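(* Let $0\le R_1<R_2\le+\infty$, $\Omega=\{x\in\mathbb{R}^2:\ R_1<|x|<R_2\}$, $\varepsilon\in\{1,-1\}$, $q>0$, $q\neq1$, $\alpha>0$, and let $M,N\in\mathbb{R}$ be such that $Mr^\alpha+Nr^{-\alpha}>0$ on $(R_1,R_2)$. Consider in $\Omega$ the equation $$\Delta u=\varepsilon|x|^{-2}\left[M|x|^\alpha+N|x|^{-\alpha}\right]^{1-q}u|u|^{q-1},\qquad (E)$$ and the ODE $$w''+\alpha^2w=\varepsilon w|w|^{q-1}.\qquad (O)$$ 1. If $\varepsilon=+1$ and $0<\alpha\le1$, then any pseudo-radial solution of (E) is radial. 2. For $\varepsilon=-1$ or $\alpha>1$, define the subset $\mathcal{A}(\varepsilon,q,\alpha)\subset\mathbb{N}$ by: $\mathcal{A}(\varepsilon,q,\alpha)=(\alpha,+\infty)\cap\mathbb{N}$ if $\varepsilon=-1$; $\mathcal{A}(\varepsilon,q,\alpha)=(0,+\infty)\cap\mathbb{N}$ if $\varepsilon=+1$, $q>1$ and $\alpha>1$; $\mathcal{A}(\varepsilon,q,\alpha)=\left(\alpha(1-q)/2,\alpha\right)\cap\mathbb{N}$ if $\varepsilon=+1$, $0<q<1$ and $\alpha>1$. Then the set of sign changing non-radial pseudo-radial solutions of (E) is parameterized by $\mathcal{A}(\varepsilon,q,\alpha)$ in the sense that it consists of the functions $$u_k(x)=\pm\left[M|x|^\alpha+N|x|^{-\alpha}\right]w_k(\theta),\qquad k\in\mathcal{A}(\varepsilon,q,\alpha),$$ where, for every $k\in\mathcal{A}(\varepsilon,q,\alpha)$,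 $w_k$ is the unique (up to sign) sign changing $\frac{2\pi}{k}$-periodic solution of (O). 3. Equation (E) admits positive non-radial pseudo-radial solutions if and only if $\varepsilon=+1$, $0<q<1$ and $\mathcal{B}(+1,q,\alpha):=\left(\alpha(1-q),\alpha\sqrt{1-q}\right)\cap\mathbb{N}\neq\emptyset$. Moreover, all these solutions are of the form $$u_k(x)=\left[M|x|^\alpha+N|x|^{-\alpha}\right]v_k(\theta),$$ where, for every $k\in\mathcal{B}(+1,q,\alpha)$, $v_k$ is the unique positive $\frac{2\pi}{k}$-periodic solution of (O). 4. If $\varepsilon=+1$, $0<q<1$ and $(1-q)\alpha\in\mathbb{N}$, then (E) admits a unique nonnegative pseudo-radial solution given by $$u(x)=\left[M|x|^\alpha+N|x|^{-\alpha}\right]v(\theta),$$ where $v$ is the unique nonnegative periodic solution of (O) (corresponding to the homoclinic-like orbit) which vanishes once in a period.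
   Context: $\Delta$ is the Euclidean Laplacian on $\mathbb{R}^2$ and $(r,\theta)$ are polar coordinates, $r=|x|$. A solution $u$ is pseudo-radial if $u(r,\theta)=h(r)w(\theta)$ for some function $h$ on $(R_1,R_2)$ and some $2\pi$-periodic function $w$; it is radial if it does not depend on $\theta$, and non-radial otherwise. Here ''$\frac{2\pi}{k}$-periodic'' means having least period $\frac{2\pi}{k}$, and uniqueness of periodic solutions of (O), and correspondingly of the solutions of (E), is understood up to translation in $\theta$. The homoclinic-like orbit of (O), for $\varepsilon=+1$ and $0<q<1$, is the orbit in the right half of the phase plane $(x,y)=(w,w')$ emanating from the origin, with equation $y^2+\alpha^2x^2=\frac{2}{1+q}|x|^{1+q}$.
   Formalization: In 2, for ε=+1, q>1, A is (0,α)∩ℕ. If ε=+1, q<1, α(1-q)≥2: 2 covers only u with no zero of vanishing gradient, 4 only u not zero on an open set. In 4 uniqueness is among non-radial nonnegative solutions that vanish somewhere, up to rotation. *)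

(* Defs.v *)
(* Vanilla Stdlib reals with Coquelicot. *)
From Stdlib Require Export Reals.
From Coquelicot Require Export Coquelicot.

Open Scope R_scope.

(* s|s|^{q-1}.  Since Stdlib's [Rpower 0 y] is the finite number 1, the factor
   [s] gives the right value 0 at s = 0, also when q < 1. *)
Definition spow (q s : R) : R := s * Rpower (Rabs s) (q - 1).

(** ** The domain and the equation (E) *)

Definition in_range (R1 : R) (R2 : Rbar) (r : R) : Prop :=
  R1 < r /\ Rbar_lt r R2.

Definition norm2 (x y : R) : R := sqrt (x ^ 2 + y ^ 2).

Definition annulus (R1 : R) (R2 : Rbar) (x y : R) : Prop :=
  in_range R1 R2 (norm2 x y).

Definition weight (alpha M N r : R) : R :=
  M * Rpower r alpha + N * Rpower r (- alpha).

Definition laplacian (u : R -> R -> R) (x y : R) : R :=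
  partial_derive 2 0 u x y + partial_derive 0 2 u x y.

(* Classical (C^2) solutions; values of [u] outside the annulus are irrelevant. *)
Definition solution_E (R1 : R) (R2 : Rbar) (eps q alpha M N : R)
    (u : R -> R -> R) : Prop :=
  forall x y, annulus R1 R2 x y ->
    ex_diff_n u 2 x y /\
    laplacian u x y =
      eps * Rpower (norm2 x y) (- 2)
          * Rpower (weight alpha M N (norm2 x y)) (1 - q) * spow q (u x y).

Definition polar_form (R1 : R) (R2 : Rbar) (u f : R -> R -> R) : Prop :=
  forall r theta, in_range R1 R2 r ->
    u (r * cos theta) (r * sin theta) = f r theta.

Definition pseudo_radial (R1 : R) (R2 : Rbar) (u : R -> R -> R) : Prop :=
  exists h w : R -> R,
    (forall theta, w (theta + 2 * PI) = w theta) /\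
    polar_form R1 R2 u (fun r theta => h r * w theta).

Definition radial (R1 : R) (R2 : Rbar) (u : R -> R -> R) : Prop :=
  forall r theta1 theta2, in_range R1 R2 r ->
    u (r * cos theta1) (r * sin theta1) = u (r * cos theta2) (r * sin theta2).

Definition sign_changing_E (R1 : R) (R2 : Rbar) (u : R -> R -> R) : Prop :=
  (exists x y, annulus R1 R2 x y /\ 0 < u x y) /\
  (exists x y, annulus R1 R2 x y /\ u x y < 0).

Definition positive_E (R1 : R) (R2 : Rbar) (u : R -> R -> R) : Prop :=
  forall x y, annulus R1 R2 x y -> 0 < u x y.

Definition nonnegative_E (R1 : R) (R2 : Rbar) (u : R -> R -> R) : Prop :=
  forall x y, annulus R1 R2 x y -> 0 <= u x y.

Definition vanishes_E (R1 : R) (R2 : Rbar) (u : R -> R -> R) : Prop :=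
  exists x y, annulus R1 R2 x y /\ u x y = 0.

(* For eps = +1 and 0 < q < 1 the Cauchy problem for (O) is not uniquely solvable
   at w = w' = 0: homoclinic loops, each run through in time
   2*PI / (alpha*(1-q)), can be glued together with arbitrary signs and with
   arbitrary rest intervals w = 0 between them.  Two or more loops fit on the
   circle exactly when [2 <= alpha * (1 - q)].  The next two conditions exclude
   such glued functions, which do not correspond to a single phase-plane orbit:
   the first one excludes passing through the origin of the phase plane, the
   second one resting there. *)
Definition no_double_zero (R1 : R) (R2 : Rbar) (u : R -> R -> R) : Prop :=
  forall x y, annulus R1 R2 x y ->
    ~ (u x y = 0 /\ Derive (fun t => u t y) x = 0 /\ Derive (fun t => u x t) y = 0).

Definition no_dead_core (R1 : R) (R2 : Rbar) (u : R -> R -> R) : Prop :=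
  forall x y, annulus R1 R2 x y -> ~ locally_2d (fun a b => u a b = 0) x y.

Definition gluing_possible (eps q alpha : R) : Prop :=
  eps = 1 /\ q < 1 /\ 2 <= alpha * (1 - q).

(** ** The ODE (O) *)

(* [ex_derive_n w 2] alone does not include differentiability of [w]. *)
Definition solution_O (eps q alpha : R) (w : R -> R) : Prop :=
  forall t, ex_derive w t /\ ex_derive_n w 2 t /\
    Derive_n w 2 t + alpha ^ 2 * w t = eps * spow q (w t).

Definition periodic (p : R) (w : R -> R) : Prop :=
  0 < p /\ forall t, w (t + p) = w t.

Definition least_period (p : R) (w : R -> R) : Prop :=
  periodic p w /\ forall p', periodic p' w -> p <= p'.

Definition sign_changing_O (w : R -> R) : Prop :=
  (exists t, 0 < w t) /\ (exists t, w t < 0).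

Definition sc_periodic_solution (eps q alpha : R) (k : nat) (w : R -> R) : Prop :=
  solution_O eps q alpha w /\ least_period (2 * PI / INR k) w /\ sign_changing_O w.

Definition pos_periodic_solution (eps q alpha : R) (k : nat) (w : R -> R) : Prop :=
  solution_O eps q alpha w /\ least_period (2 * PI / INR k) w /\
  (forall t, 0 < w t).

(* |x|^{1+q} is written x^2 |x|^{q-1}, which is also correct at x = 0. *)
Definition homoclinic_orbit (q alpha x y : R) : Prop :=
  0 <= x /\
  y ^ 2 + alpha ^ 2 * x ^ 2 = 2 / (1 + q) * (x ^ 2 * Rpower (Rabs x) (q - 1)).

Definition nonneg_once_vanishing_solution (eps q alpha : R) (w : R -> R) : Prop :=
  solution_O eps q alpha w /\ (forall t, 0 <= w t) /\
  exists p, periodic p w /\ exists! t, (0 <= t < p) /\ w t = 0.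

Definition translate_of (w w' : R -> R) : Prop :=
  exists tau, forall t, w' t = w (t + tau).

Definition translate_up_to_sign_of (w w' : R -> R) : Prop :=
  translate_of w w' \/ translate_of (fun t => - w t) w'.

(** ** The parameter sets *)

(* For eps = +1 and 1 < q the upper bound [k < alpha] is forced: there
   w'' = -(alpha^2 - |w|^{q-1}) w, so by Sturm comparison with
   z'' = - alpha^2 z every sign changing periodic solution has least period
   > 2*PI / alpha, and all periods in (2*PI / alpha, +oo) occur.  The source
   prints (0, +oo) for this interval, for which w_k would not exist when
   k >= alpha. *)
Definition setA (eps q alpha : R) (k : nat) : Prop :=
  (eps = -1 /\ alpha < INR k) \/
  (eps = 1 /\ 1 < q /\ 1 < alpha /\ 0 < INR k < alpha) \/
  (eps = 1 /\ q < 1 /\ 1 < alpha /\ alpha * (1 - q) / 2 < INR k < alpha).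

(* B(+1, q, alpha); used for 0 < q < 1 only. *)
Definition setB (q alpha : R) (k : nat) : Prop :=
  alpha * (1 - q) < INR k < alpha * sqrt (1 - q).

(* Main.v *)
(** A pseudo-radial solution that is not radial has the form [W(r) w(theta)],
    where [W] is the weight: separating variables at two radii and comparing two
    values of [|w|] shows that the profile is proportional to [W], and then [w]
    solves (O).  After scaling, [alpha = 1] and everything depends on the least
    periods of the solutions of [x'' + x = eps x|x|^(q-1)].

    Sign changing orbits are [x = a sin phi] with
    [phi' = sqrt (1 - lam rho (sin^2 phi))], [lam = eps a^(q-1)], so that the period
    is an integral increasing in [lam]; its limits are read off from
    [lam = 0], [lam -> -oo], from a logarithmic divergence (heteroclinic case) or from
    the explicit homoclinic orbit.  Positive orbits are written [x = X (h sin phi)],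
    with [X] the inverse of the signed square root of the potential; the period is
    then an integral of the even part of [X'], which increases in [h] by Chicone's
    criterion.  Solutions through the origin of the phase plane exist for
    [eps = 1], [q < 1] only, have energy zero, and are made of homoclinic loops,
    each of which is explicit. *)

Require Import Defs.
From Stdlib Require Import ZArith Lra Lia Psatz ClassicalEpsilon.
From Stdlib Require IndefiniteDescription.
Open Scope R_scope.

(** For [q < 1] the force is not Lipschitz at [x = 0], and uniqueness can fail at the origin of the
    phase plane. Where [x] vanishes with nonzero velocity, the energy identity replaces the
    Lipschitz bound. This is why solutions are split into those whose phase curve avoids the origin
    and those of zero energy that meet it.

    Solutions are produced by quadrature. In a suitable angle the time spent per unit of phase is a
    positive, continuous, periodic function, and the inverse of its primitive is the phase. Global
    existence, periodicity and a formula for the period come out together, and turning points are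
    ordinary points of the flow.

    At the ends of the parameter range the period integrals are singular. These limits are never
    taken: the integrand is compared with the derivative of an explicit primitive on inner
    intervals, or the parameter is moved slightly inside, and the intermediate value theorem fills
    the range of periods. An index [k] is admissible exactly when [2 PI alpha / k] lies in that
    range. *)

Ltac eqR := match goal with |- @eq _ ?a ?b => change (@eq R a b) end.

(* The value at [0] is [0] for every exponent. *)
Definition apow (p x : R) : R := x * spow (p - 1) x.

Lemma is_derive_comp_R (f g : R -> R) (x a b : R) :
  is_derive f (g x) a -> is_derive g x b -> is_derive (fun y => f (g y)) x (a * b).
Proof. intros H K. rewrite Rmult_comm. exact (is_derive_comp f g x a b H K). Qed.

Lemma is_derive_mult_R (f g : R -> R) (x a b : R) :
  is_derive f x a -> is_derive g x b -> is_derive (fun y => f y * g y) x (a * g x + f x * b).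
Proof. intros H K. exact (is_derive_mult f g x a b H K Rmult_comm). Qed.

Lemma is_derive_plus_R (f g : R -> R) (x a b : R) :
  is_derive f x a -> is_derive g x b -> is_derive (fun y => f y + g y) x (a + b).
Proof. intros H K. exact (is_derive_plus f g x a b H K). Qed.

Lemma is_derive_minus_R (f g : R -> R) (x a b : R) :
  is_derive f x a -> is_derive g x b -> is_derive (fun y => f y - g y) x (a - b).
Proof. intros H K. exact (is_derive_minus f g x a b H K). Qed.

Lemma is_derive_opp_R (f : R -> R) (x a : R) :
  is_derive f x a -> is_derive (fun y => - f y) x (- a).
Proof. intros H. exact (is_derive_opp f x a H). Qed.

Lemma is_derive_scal_R (f : R -> R) (k x a : R) :
  is_derive f x a -> is_derive (fun y => k * f y) x (k * a).
Proof. intros H. exact (is_derive_scal f x k a H). Qed.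

Lemma is_derive_sq_R (f : R -> R) (x a : R) :
  is_derive f x a -> is_derive (fun y => f y ^ 2) x (2 * f x * a).
Proof.
  intros H. evar_last; [exact (is_derive_pow f 2 x a H)|]. eqR. simpl. ring.
Qed.

(** * Signed and even real powers *)

Lemma Rpower_pos (x y : R) : 0 < Rpower x y.
Proof. apply exp_pos. Qed.

Lemma spow_0 (q : R) : spow q 0 = 0.
Proof. unfold spow; ring. Qed.

Lemma spow_pos (q x : R) : 0 < x -> spow q x = Rpower x q.
Proof.
  intros Hx; unfold spow. rewrite Rabs_pos_eq by lra.
  rewrite <- (Rpower_1 x) at 1 by exact Hx.
  rewrite <- Rpower_plus. f_equal; ring.
Qed.

Lemma spow_opp (q x : R) : spow q (- x) = - spow q x.
Proof. unfold spow. rewrite Rabs_Ropp; ring. Qed.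

Lemma spow_mult (q x y : R) : spow q (x * y) = spow q x * spow q y.
Proof.
  destruct (Req_dec x 0) as [->|Hx].
  { rewrite Rmult_0_l, spow_0; ring. }
  destruct (Req_dec y 0) as [->|Hy].
  { rewrite Rmult_0_r, spow_0; ring. }
  unfold spow. rewrite Rabs_mult, <- Rpower_mult_distr.
  - ring.
  - now apply Rabs_pos_lt.
  - now apply Rabs_pos_lt.
Qed.

Lemma spow_gt0 (q x : R) : 0 < x -> 0 < spow q x.
Proof. intros Hx; rewrite spow_pos by exact Hx; apply Rpower_pos. Qed.

Lemma apow_0 (p : R) : apow p 0 = 0.
Proof. unfold apow; ring. Qed.

Lemma apow_pos (p x : R) : 0 < x -> apow p x = Rpower x p.
Proof.
  intros Hx; unfold apow; rewrite spow_pos by exact Hx.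
  rewrite <- (Rpower_1 x) at 1 by exact Hx.
  rewrite <- Rpower_plus. f_equal; ring.
Qed.

Lemma apow_opp (p x : R) : apow p (- x) = apow p x.
Proof. unfold apow; rewrite spow_opp; ring. Qed.

Lemma apow_S (q x : R) : apow (1 + q) x = x * spow q x.
Proof. unfold apow; do 2 f_equal; ring. Qed.

Lemma apow_gt0 (p x : R) : x <> 0 -> 0 < apow p x.
Proof.
  intros Hx. destruct (Rlt_le_dec 0 x) as [H|H].
  - rewrite apow_pos by exact H; apply Rpower_pos.
  - rewrite <- (Ropp_involutive x), apow_opp, apow_pos by lra; apply Rpower_pos.
Qed.

Lemma apow_ge0 (p x : R) : 0 <= apow p x.
Proof.
  destruct (Req_dec x 0) as [->|H].
  - rewrite apow_0; lra.
  - now left; apply apow_gt0.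
Qed.

Lemma apow_1 (p : R) : apow p 1 = 1.
Proof. rewrite apow_pos by lra. unfold Rpower. rewrite ln_1, Rmult_0_r. apply exp_0. Qed.

Lemma spow_1 (q : R) : spow q 1 = 1.
Proof. rewrite spow_pos by lra. unfold Rpower. rewrite ln_1, Rmult_0_r. apply exp_0. Qed.

Lemma apow_sq (x : R) : apow 2 x = x ^ 2.
Proof.
  destruct (Rtotal_order x 0) as [H|[->|H]].
  - rewrite <- (Ropp_involutive x), apow_opp, apow_pos by lra.
    replace 2 with (INR 2) at 1 by (simpl; ring). rewrite Rpower_pow by lra. ring.
  - rewrite apow_0; ring.
  - rewrite apow_pos by lra.
    replace 2 with (INR 2) at 1 by (simpl; ring). now rewrite Rpower_pow by lra.
Qed.

Lemma apow_plus (p r x : R) : apow (p + r) x = apow p x * apow r x.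
Proof.
  assert (H : forall y, 0 < y -> apow (p + r) y = apow p y * apow r y).
  { intros y Hy. rewrite !apow_pos by exact Hy. apply Rpower_plus. }
  destruct (Rtotal_order x 0) as [Hx|[->|Hx]].
  - rewrite <- (Ropp_involutive x), (apow_opp (p + r)), (apow_opp p), (apow_opp r).
    apply H; lra.
  - rewrite !apow_0; ring.
  - now apply H.
Qed.

Lemma apow_apow (p r x : R) : apow p (apow r x) = apow (r * p) x.
Proof.
  assert (H : forall y, 0 < y -> apow p (apow r y) = apow (r * p) y).
  { intros y Hy. rewrite (apow_pos r), (apow_pos (r * p)) by exact Hy.
    rewrite apow_pos by apply Rpower_pos. apply Rpower_mult. }
  destruct (Rtotal_order x 0) as [Hx|[->|Hx]].
  - rewrite <- (Ropp_involutive x), (apow_opp r), (apow_opp (r * p)).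
    apply H; lra.
  - now rewrite !apow_0.
  - now apply H.
Qed.

Lemma apow_lt (p x y : R) : 0 < p -> 0 <= x < y -> apow p x < apow p y.
Proof.
  intros Hp [[Hx|<-] Hxy].
  - rewrite !apow_pos by lra. apply Rlt_Rpower_l; lra.
  - rewrite apow_0. apply apow_gt0; lra.
Qed.

Lemma apow_lt1 (p x : R) : 0 < p -> 0 <= x < 1 -> apow p x < 1.
Proof. intros Hp Hx. rewrite <- (apow_1 p). now apply apow_lt. Qed.

Lemma apow_gt1 (p x : R) : 0 < p -> 1 < x -> 1 < apow p x.
Proof. intros Hp Hx. rewrite <- (apow_1 p). apply apow_lt; lra. Qed.

Lemma apow_small (p e : R) : 0 < p -> 0 < e ->
  exists d : posreal, forall x, Rabs x < d -> apow p x < e.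
Proof.
  intros Hp He. exists (mkposreal _ (Rpower_pos e (/ p))). simpl. intros x Hx.
  replace (apow p x) with (apow p (Rabs x)).
  2:{ unfold Rabs; destruct (Rcase_abs x); trivial; apply apow_opp. }
  replace e with (apow p (Rpower e (/ p))).
  - apply apow_lt; trivial. split; trivial. apply Rabs_pos.
  - rewrite apow_pos by apply Rpower_pos. rewrite Rpower_mult.
    rewrite Rinv_l by lra. now apply Rpower_1.
Qed.

Lemma is_derive_Rpower (x y : R) : 0 < x ->
  is_derive (fun z => Rpower z y) x (y * Rpower x (y - 1)).
Proof. intros Hx. apply is_derive_Reals. now apply derivable_pt_lim_power. Qed.

Lemma is_derive_apow_pos (p x : R) : 0 < x ->
  is_derive (apow p) x (p * spow (p - 1) x).
Proof.
  intros Hx. rewrite spow_pos by exact Hx.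
  eapply is_derive_ext_loc; [| now apply is_derive_Rpower].
  exists (mkposreal x Hx). intros y Hy. simpl.
  apply Rabs_def2 in Hy. simpl in Hy. unfold minus, plus, opp in Hy. simpl in Hy.
  symmetry; apply apow_pos; lra.
Qed.

Lemma is_derive_opp_arg (f : R -> R) (x l : R) :
  is_derive f (- x) l -> is_derive (fun y => f (- y)) x (- l).
Proof.
  intros H. replace (- l) with ((-1) * l) by ring.
  apply (is_derive_comp f (fun y => - y) x l (-1)); trivial.
  auto_derive; trivial.
Qed.

Lemma is_derive_apow_neq0 (p x : R) : x <> 0 ->
  is_derive (apow p) x (p * spow (p - 1) x).
Proof.
  intros Hx. destruct (Rlt_le_dec 0 x) as [H|H].
  - now apply is_derive_apow_pos.
  - apply is_derive_ext with (fun y => apow p (- y)).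
    { intros; apply apow_opp. }
    replace (p * spow (p - 1) x) with (- (p * spow (p - 1) (- x))).
    + apply is_derive_opp_arg. apply is_derive_apow_pos. lra.
    + rewrite spow_opp; ring.
Qed.

(** The difference quotient at [h] is at most [|h|^p]. This covers the origin, where the derivative
    rule for real powers of positive numbers does not reach. *)
Lemma is_derive_at0_small (f : R -> R) (p : R) : 0 < p ->
  f 0 = 0 -> (forall x, Rabs (f x) <= Rabs x * apow p x) -> is_derive f 0 0.
Proof.
  intros Hp H0 H. apply is_derive_Reals. intros e He.
  destruct (apow_small p e Hp He) as [d Hd]. exists d. intros h Hh Hhd.
  rewrite Rplus_0_l, H0, !Rminus_0_r. unfold Rdiv. rewrite Rabs_mult, Rabs_inv.
  apply Rmult_lt_reg_r with (Rabs h); [now apply Rabs_pos_lt|].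
  rewrite Rmult_assoc, Rinv_l, Rmult_1_r by now apply Rabs_no_R0.
  apply Rle_lt_trans with (1 := H h). rewrite Rmult_comm.
  apply Rmult_lt_compat_r; [now apply Rabs_pos_lt|]. now apply Hd.
Qed.

Lemma spow_abs (q x : R) : Rabs (spow q x) = apow q x.
Proof.
  assert (H : forall y, 0 < y -> Rabs (spow q y) = apow q y).
  { intros y Hy. rewrite apow_pos, spow_pos by exact Hy. apply Rabs_pos_eq.
    left; apply Rpower_pos. }
  destruct (Rtotal_order x 0) as [Hx|[->|Hx]].
  - rewrite <- (Ropp_involutive x), spow_opp, Rabs_Ropp, apow_opp. apply H; lra.
  - rewrite apow_0, spow_0. apply Rabs_R0.
  - now apply H.
Qed.

Lemma is_derive_apow (p x : R) : 1 < p ->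
  is_derive (apow p) x (p * spow (p - 1) x).
Proof.
  intros Hp. destruct (Req_dec x 0) as [->|Hx]; [|now apply is_derive_apow_neq0].
  rewrite spow_0, Rmult_0_r. apply (is_derive_at0_small _ (p - 1)).
  - lra.
  - apply apow_0.
  - intros x. unfold apow at 1. rewrite Rabs_mult, spow_abs. lra.
Qed.

Lemma is_derive_spow_pos (q x : R) : 0 < x ->
  is_derive (spow q) x (q * apow (q - 1) x).
Proof.
  intros Hx. rewrite apow_pos by exact Hx.
  eapply is_derive_ext_loc; [| now apply is_derive_Rpower].
  exists (mkposreal x Hx). intros y Hy. simpl.
  apply Rabs_def2 in Hy. simpl in Hy. unfold minus, plus, opp in Hy. simpl in Hy.
  symmetry; apply spow_pos; lra.
Qed.

Lemma is_derive_spow_neq0 (q x : R) : x <> 0 ->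
  is_derive (spow q) x (q * apow (q - 1) x).
Proof.
  intros Hx. destruct (Rlt_le_dec 0 x) as [H|H].
  - now apply is_derive_spow_pos.
  - apply is_derive_ext with (fun y => - spow q (- y)).
    { intros; eqR; rewrite spow_opp; ring. }
    replace (q * apow (q - 1) x) with (opp (- (q * apow (q - 1) (- x)))).
    + apply (is_derive_opp (fun y => spow q (- y))).
      apply is_derive_opp_arg. apply is_derive_spow_pos. lra.
    + rewrite apow_opp. unfold opp; simpl; ring.
Qed.

Lemma is_derive_spow (q x : R) : 1 < q ->
  is_derive (spow q) x (q * apow (q - 1) x).
Proof.
  intros Hp. destruct (Req_dec x 0) as [->|Hx]; [|now apply is_derive_spow_neq0].
  rewrite apow_0, Rmult_0_r. apply (is_derive_at0_small _ (q - 1)).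
  - lra.
  - apply spow_0.
  - intros x. rewrite spow_abs. unfold apow at 1.
    rewrite <- (Rabs_pos_eq (x * _)) by apply apow_ge0. rewrite Rabs_mult, spow_abs. lra.
Qed.

Lemma continuous_of_is_derive (f : R -> R) (x l : R) : is_derive f x l -> continuous f x.
Proof. intros H. apply (ex_derive_continuous f). now exists l. Qed.

Lemma continuous_at0_small (f : R -> R) (p : R) : 0 < p ->
  f 0 = 0 -> (forall x, Rabs (f x) <= apow p x) -> continuous f 0.
Proof.
  intros Hp H0 H. apply continuity_pt_filterlim. intros e He.
  destruct (apow_small p e Hp He) as [d Hd]. exists d. split; [apply cond_pos|].
  intros x [_ Hx]. simpl in *. unfold R_dist in *. rewrite H0, Rminus_0_r in *.
  apply Rle_lt_trans with (1 := H x). now apply Hd.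
Qed.

Lemma continuous_spow (q x : R) : 0 < q -> continuous (spow q) x.
Proof.
  intros Hq. destruct (Req_dec x 0) as [->|Hx].
  - apply (continuous_at0_small _ q); trivial.
    + apply spow_0.
    + intros x. rewrite spow_abs; lra.
  - eapply continuous_of_is_derive. now apply is_derive_spow_neq0.
Qed.

Lemma continuous_apow (p x : R) : 0 < p -> continuous (apow p) x.
Proof.
  intros Hp. destruct (Req_dec x 0) as [->|Hx].
  - apply (continuous_at0_small _ p); trivial.
    + apply apow_0.
    + intros x. rewrite Rabs_pos_eq by apply apow_ge0; lra.
  - eapply continuous_of_is_derive. now apply is_derive_apow_neq0.
Qed.

Lemma spow_apow (q r x : R) : spow q (apow r x) = apow (r * q) x.
Proof.
  destruct (Req_dec x 0) as [->|Hx].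
  - now rewrite !apow_0, spow_0.
  - rewrite spow_pos by now apply apow_gt0.
    rewrite <- apow_pos by now apply apow_gt0. apply apow_apow.
Qed.

Lemma apow_mult (p x y : R) : apow p (x * y) = apow p x * apow p y.
Proof. unfold apow. rewrite spow_mult. ring. Qed.

(** * Uniqueness for the Cauchy problem *)

(** The intermediate point is strictly inside, so that derivatives and their signs are asked for on
    the open interval only; several functions below are singular or critical at an endpoint. *)
Lemma mean_value (f df : R -> R) (a b : R) : a < b ->
  (forall x, a < x < b -> is_derive f x (df x)) ->
  (forall x, a <= x <= b -> continuous f x) ->
  exists c, a < c < b /\ f b - f a = df c * (b - a).
Proof.
  intros Hab Hd Hc.
  assert (pr1 : forall c, a < c < b -> derivable_pt f c).
  { intros c Hc'. exists (df c). apply is_derive_Reals. now apply Hd. }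
  assert (pr2 : forall c, a < c < b -> derivable_pt id c).
  { intros c _. apply derivable_pt_id. }
  destruct (MVT f id a b pr1 pr2 Hab) as [c [Hc' E]].
  - intros c Hc'. apply continuity_pt_filterlim. now apply Hc.
  - intros c _. apply derivable_continuous_pt, derivable_pt_id.
  - exists c. split; trivial. unfold id in E at 1 2.
    rewrite (derive_pt_eq_0 id c 1 _ (derivable_pt_lim_id c)) in E.
    rewrite (derive_pt_eq_0 f c (df c)) in E by (apply is_derive_Reals; now apply Hd).
    lra.
Qed.

Lemma derive_le (f df : R -> R) (a b : R) : a <= b ->
  (forall x, a < x < b -> is_derive f x (df x)) ->
  (forall x, a <= x <= b -> continuous f x) ->
  (forall x, a < x < b -> 0 <= df x) -> f a <= f b.
Proof.
  intros [Hab|<-] Hd Hc H; [|lra].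
  destruct (mean_value f df a b Hab Hd Hc) as [c [Hc' E]].
  specialize (H c Hc'). nra.
Qed.

Lemma derive_lt (f df : R -> R) (a b : R) : a < b ->
  (forall x, a < x < b -> is_derive f x (df x)) ->
  (forall x, a <= x <= b -> continuous f x) ->
  (forall x, a < x < b -> 0 < df x) -> f a < f b.
Proof.
  intros Hab Hd Hc H.
  destruct (mean_value f df a b Hab Hd Hc) as [c [Hc' E]].
  specialize (H c Hc'). nra.
Qed.

Lemma derive_const (f : R -> R) (a b : R) :
  (forall x, Rmin a b <= x <= Rmax a b -> is_derive f x 0) -> f a = f b.
Proof.
  intros H. destruct (MVT_gen f a b (fun _ => 0)) as [c [_ E]].
  - intros x Hx. apply H. lra.
  - intros x Hx. apply continuity_pt_filterlim.
    eapply continuous_of_is_derive. now apply H.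
  - lra.
Qed.

(** By the bound on [dz], the function [z^2 exp (- 2 K t)] does not increase and [z^2 exp (2 K t)]
    does not decrease. Both are nonnegative and vanish at [t0]; the first settles [t >= t0], the
    second [t < t0]. *)
Lemma gronwall_zero (z dz : R -> R) (K a b t0 : R) : a < t0 < b ->
  (forall t, a < t < b -> is_derive z t (dz t)) ->
  (forall t, a < t < b -> Rabs (dz t) <= K * Rabs (z t)) ->
  z t0 = 0 -> forall t, a < t < b -> z t = 0.
Proof.
  intros H0 Hd HK Hz.
  assert (HP : forall t, a < t < b -> z t * dz t <= K * (z t * z t)).
  { intros t Ht. specialize (HK t Ht). apply Rle_trans with (1 := Rle_abs _).
    rewrite Rabs_mult. rewrite <- (Rabs_pos_eq (z t * z t)) by nra. rewrite Rabs_mult.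
    assert (J := Rabs_pos (z t)). nra. }
  assert (HN : forall t, a < t < b -> - (K * (z t * z t)) <= z t * dz t).
  { intros t Ht. specialize (HK t Ht).
    assert (J : - (z t * dz t) <= K * (z t * z t)); [|lra].
    apply Rle_trans with (1 := Rle_abs _). rewrite Rabs_Ropp.
    rewrite Rabs_mult. rewrite <- (Rabs_pos_eq (z t * z t)) by nra. rewrite Rabs_mult.
    assert (J := Rabs_pos (z t)). nra. }
  assert (HE : forall s t, a < t < b -> is_derive (fun u => (z u * z u) * exp (s * u)) t
            ((2 * (z t * dz t) + s * (z t * z t)) * exp (s * t))).
  { intros s t Ht. evar_last.
    - apply (is_derive_mult (fun u => z u * z u) (fun u => exp (s * u))).
      + apply (is_derive_mult z z); [now apply Hd|now apply Hd|]. intros; apply Rmult_comm.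
      + auto_derive; [trivial|reflexivity].
      + intros; apply Rmult_comm.
    - unfold plus, mult; simpl. ring. }
  assert (HC : forall s t, a < t < b -> continuous (fun u => (z u * z u) * exp (s * u)) t).
  { intros s t Ht. eapply continuous_of_is_derive. now apply HE. }
  intros t Ht.
  assert (Hsq : z t * z t <= 0).
  { destruct (Rle_lt_dec t0 t) as [H|H].
    - assert (J : - ((z t0 * z t0) * exp ((- (2 * K)) * t0)) <= - ((z t * z t) * exp ((- (2 * K)) * t))).
      { apply (derive_le (fun u => - ((z u * z u) * exp ((- (2 * K)) * u)))
          (fun t => - ((2 * (z t * dz t) + (- (2 * K)) * (z t * z t)) * exp ((- (2 * K)) * t)))); trivial.
        - intros u Hu. apply (is_derive_opp (fun u => z u * z u * exp (- (2 * K) * u))).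
          apply HE. lra.
        - intros u Hu. apply (continuous_opp (fun u => z u * z u * exp (- (2 * K) * u))).
          apply HC. lra.
        - intros u Hu. assert (P := HP u ltac:(lra)). assert (Q := exp_pos (- (2 * K) * u)). nra. }
      rewrite Hz in J. assert (Q := exp_pos (- (2 * K) * t)). nra.
    - assert (J : ((z t * z t) * exp (((2 * K)) * t)) <= ((z t0 * z t0) * exp (((2 * K)) * t0))).
      { apply (derive_le (fun u => ((z u * z u) * exp (((2 * K)) * u)))
          (fun t => ((2 * (z t * dz t) + ((2 * K)) * (z t * z t)) * exp (((2 * K)) * t)))); try lra.
        - intros u Hu. apply HE. lra.
        - intros u Hu. apply HC. lra.
        - intros u Hu. assert (P := HN u ltac:(lra)). assert (Q := exp_pos ((2 * K) * u)). nra. }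
      rewrite Hz in J. assert (Q := exp_pos (2 * K * t)). nra. }
  nra.
Qed.

Lemma locally_R (P : R -> Prop) (x : R) :
  locally x P <-> exists d, 0 < d /\ forall y, Rabs (y - x) < d -> P y.
Proof.
  split.
  - intros [d Hd]. exists d. split; [apply cond_pos|]. intros y Hy. now apply Hd.
  - intros [d [Hd H]]. exists (mkposreal d Hd). intros y Hy. now apply H.
Qed.

Lemma continuous_R (f : R -> R) (x e : R) : continuous f x -> 0 < e ->
  exists d, 0 < d /\ forall y, Rabs (y - x) < d -> Rabs (f y - f x) < e.
Proof.
  intros H He. apply (locally_R (fun y => Rabs (f y - f x) < e)).
  apply (H (fun y => Rabs (y - f x) < e)). exists (mkposreal e He). intros y Hy. exact Hy.
Qed.

(** By continuity the derivative stays below [|df x0| + 1] in modulus near [x0], and the mean value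
    theorem makes this a Lipschitz constant. *)
Lemma locally_lipschitz (f df : R -> R) (x0 : R) :
  locally x0 (fun x => is_derive f x (df x)) -> continuous df x0 ->
  exists d K, 0 < d /\ 0 <= K /\
    forall x y, Rabs (x - x0) < d -> Rabs (y - x0) < d ->
      Rabs (f x - f y) <= K * Rabs (x - y).
Proof.
  intros Hd Hc. apply locally_R in Hd. destruct Hd as [d1 [Hd1 H1]].
  destruct (continuous_R df x0 1 Hc Rlt_0_1) as [d2 [Hd2 H2]].
  exists (Rmin d1 d2), (Rabs (df x0) + 1). split; [now apply Rmin_glb_lt|].
  split; [assert (J := Rabs_pos (df x0)); lra|].
  intros x y Hx Hy.
  assert (HB : forall t, Rmin y x <= t <= Rmax y x -> Rabs (t - x0) < Rmin d1 d2).
  { intros t Ht. apply Rabs_def1; apply Rabs_def2 in Hx; apply Rabs_def2 in Hy;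
    unfold Rmin at 1, Rmax in Ht; destruct (Rle_dec y x); lra. }
  destruct (MVT_gen f y x df) as [c [Hc' E]].
  - intros t Ht. apply H1. eapply Rlt_le_trans; [apply HB; lra|apply Rmin_l].
  - intros t Ht. apply continuity_pt_filterlim.
    eapply continuous_of_is_derive. apply H1.
    eapply Rlt_le_trans; [now apply HB|apply Rmin_l].
  - rewrite E, Rabs_mult. apply Rmult_le_compat_r; [apply Rabs_pos|].
    assert (J := H2 c (Rlt_le_trans _ _ _ (HB c Hc') (Rmin_r _ _))).
    apply Rabs_def2 in J. unfold Rabs in *.
    destruct (Rcase_abs (df c)), (Rcase_abs (df x0)); lra.
Qed.

(** Connectedness of an interval, in the form used for uniqueness and for the proportionality of
    radial profiles: a property that is open and closed spreads from one point to the whole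
    interval. *)
Lemma interval_induction (P : R -> Prop) (a b t0 : R) : a < t0 < b -> P t0 ->
  (forall t, a < t < b -> P t -> locally t P) ->
  (forall t, a < t < b -> ~ P t -> locally t (fun s => ~ P s)) ->
  forall t, a < t < b -> P t.
Proof.
  intros H0 P0 Hop Hcl.
  assert (Hright : forall t, t0 <= t < b -> P t).
  { intros t1 Ht1. apply Classical_Prop.NNPP. intros Hn.
    (* The supremum of the [s] up to which [P] persists: closedness puts it in [P], and openness
       pushes beyond it unless it is [t1]. *)
    set (S := fun s => t0 <= s <= t1 /\ forall r, t0 <= r <= s -> P r).
    assert (HS0 : S t0).
    { split; [lra|]. intros r Hr. replace r with t0 by lra. exact P0. }
    destruct (completeness S) as [s [Hub Hlub]].
    { exists t1. intros s [Hs _]. lra. }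
    { now exists t0. }
    assert (Hs0 : t0 <= s) by now apply Hub.
    assert (Hs1 : s <= t1) by (apply Hlub; intros r [Hr _]; lra).
    assert (Hbelow : forall r, t0 <= r < s -> P r).
    { intros r Hr. apply Classical_Prop.NNPP. intros Hnr.
      assert (s <= r); [|lra]. apply Hlub. intros u [Hu1 Hu2].
      destruct (Rle_lt_dec u r) as [K|K]; trivial. exfalso. apply Hnr, Hu2. lra. }
    assert (Ps : P s).
    { apply Classical_Prop.NNPP. intros Hns.
      destruct (Rle_lt_or_eq_dec _ _ Hs0) as [K|K]; [|subst; contradiction].
      assert (L := Hcl s ltac:(lra) Hns). apply locally_R in L. destruct L as [d [Hd L]].
      set (r := Rmax t0 (s - d / 2)).
      assert (Hr1 : t0 <= r) by apply Rmax_l.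
      assert (Hr2 : s - d / 2 <= r) by apply Rmax_r.
      assert (Hr3 : r < s) by (apply Rmax_lub_lt; lra).
      apply (L r); [apply Rabs_def1; lra|]. apply Hbelow. lra. }
    destruct (Rle_lt_or_eq_dec _ _ Hs1) as [K|K]; [|subst; contradiction].
    assert (L := Hop s ltac:(lra) Ps). apply locally_R in L. destruct L as [d [Hd L]].
    set (r := Rmin t1 (s + d / 2)).
    assert (Hr1 : r <= t1) by apply Rmin_l.
    assert (Hr2 : r <= s + d / 2) by apply Rmin_r.
    assert (Hr3 : s < r) by (apply Rmin_glb_lt; lra).
    assert (S r); [|assert (r <= s) by (now apply Hub); lra].
    split; [lra|]. intros u Hu. destruct (Rlt_le_dec u s); [apply Hbelow; lra|].
    apply L. apply Rabs_def1; lra. }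
  assert (Hleft : forall t, a < t <= t0 -> P t).
  { intros t1 Ht1. apply Classical_Prop.NNPP. intros Hn.
    (* The mirror image; times are stored with the opposite sign so that an infimum is again a least
       upper bound. *)
    set (S := fun s => t1 <= - s <= t0 /\ forall r, - s <= r <= t0 -> P r).
    assert (HS0 : S (- t0)).
    { split; [lra|]. intros r Hr. replace r with t0 by lra. exact P0. }
    destruct (completeness S) as [s [Hub Hlub]].
    { exists (- t1). intros s [Hs _]. lra. }
    { now exists (- t0). }
    assert (Hs0 : - t0 <= s) by now apply Hub.
    assert (Hs1 : s <= - t1) by (apply Hlub; intros r [Hr _]; lra).
    assert (Hbelow : forall r, - s < r <= t0 -> P r).
    { intros r Hr. apply Classical_Prop.NNPP. intros Hnr.
      assert (s <= - r); [|lra]. apply Hlub. intros u [Hu1 Hu2].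
      destruct (Rle_lt_dec u (- r)) as [K|K]; trivial. exfalso. apply Hnr, Hu2. lra. }
    assert (Ps : P (- s)).
    { apply Classical_Prop.NNPP. intros Hns.
      destruct (Rle_lt_or_eq_dec _ _ Hs0) as [K|K];
        [|apply Hns; replace (- s) with t0 by lra; exact P0].
      assert (L := Hcl (- s) ltac:(lra) Hns). apply locally_R in L. destruct L as [d [Hd L]].
      set (r := Rmin t0 (- s + d / 2)).
      assert (Hr1 : r <= t0) by apply Rmin_l.
      assert (Hr2 : r <= - s + d / 2) by apply Rmin_r.
      assert (Hr3 : - s < r) by (apply Rmin_glb_lt; lra).
      apply (L r); [apply Rabs_def1; lra|]. apply Hbelow. lra. }
    destruct (Rle_lt_or_eq_dec _ _ Hs1) as [K|K];
      [|apply Hn; replace t1 with (- s) by lra; exact Ps].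
    assert (L := Hop (- s) ltac:(lra) Ps). apply locally_R in L. destruct L as [d [Hd L]].
    set (r := Rmax t1 (- s - d / 2)).
    assert (Hr1 : t1 <= r) by apply Rmax_l.
    assert (Hr2 : - s - d / 2 <= r) by apply Rmax_r.
    assert (Hr3 : r < - s) by (apply Rmax_lub_lt; lra).
    assert (S (- r)); [|assert (- r <= s) by (now apply Hub); lra].
    split; [lra|]. intros u Hu. destruct (Rlt_le_dec (- s) u); [apply Hbelow; lra|].
    apply L. apply Rabs_def1; lra. }
  intros t Ht. destruct (Rle_lt_dec t0 t); [apply Hright|apply Hleft]; lra.
Qed.

(** The case [alpha = 1] as a first order system; carrying the velocity as a function of its own
    makes the phase point available without [Derive]. *)
Definition osol (eps q : R) (x x1 : R -> R) : Prop :=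
  forall t, is_derive x t (x1 t) /\ is_derive x1 t (eps * spow q (x t) - x t).

(** Twice the Hamiltonian, normalised to vanish at the phase origin and hence on every solution
    through it. *)
Definition energy (eps q x y : R) : R := y ^ 2 + x ^ 2 - eps * (2 / (1 + q)) * apow (1 + q) x.

Lemma is_derive_apow_S (q x : R) : 0 < q -> is_derive (apow (1 + q)) x ((1 + q) * spow q x).
Proof.
  intros Hq. assert (H := is_derive_apow (1 + q) x ltac:(lra)).
  now replace (1 + q - 1) with q in H by ring.
Qed.

Lemma energy_const (eps q : R) (x x1 : R -> R) (s t : R) : 0 < q -> osol eps q x x1 ->
  energy eps q (x s) (x1 s) = energy eps q (x t) (x1 t).
Proof.
  intros Hq H. apply (derive_const (fun u => energy eps q (x u) (x1 u))).
  intros u _. destruct (H u) as [H0 H1]. unfold energy. evar_last.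
  - apply (is_derive_minus (fun u => x1 u ^ 2 + x u ^ 2)
             (fun u => eps * (2 / (1 + q)) * apow (1 + q) (x u))).
    + apply (is_derive_plus (fun u => x1 u ^ 2) (fun u => x u ^ 2)).
      * apply is_derive_pow. exact H1.
      * apply is_derive_pow. exact H0.
    + apply (is_derive_scal (fun u => apow (1 + q) (x u))).
      apply (is_derive_comp (apow (1 + q)) x); [|exact H0].
      now apply is_derive_apow_S.
  - unfold minus, plus, opp, scal; simpl. unfold mult; simpl. field. lra.
Qed.

Lemma locally_continuous_ball (x : R -> R) (t e : R) : continuous x t -> 0 < e ->
  locally t (fun s => Rabs (x s - x t) < e).
Proof. intros H He. apply locally_R. now apply continuous_R. Qed.

Lemma osol_continuous (eps q : R) (x x1 : R -> R) (t : R) : osol eps q x x1 ->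
  continuous x t /\ continuous x1 t.
Proof.
  intros H. destruct (H t) as [H0 H1]. split.
  - exact (continuous_of_is_derive _ _ _ H0).
  - exact (continuous_of_is_derive _ _ _ H1).
Qed.

Lemma osol_opp (eps q : R) (x x1 : R -> R) : osol eps q x x1 ->
  osol eps q (fun t => - x t) (fun t => - x1 t).
Proof.
  intros H t. destruct (H t) as [H0 H1]. split.
  - now apply (is_derive_opp x).
  - evar_last; [apply (is_derive_opp x1); exact H1|].
    rewrite spow_opp. unfold opp; simpl. ring.
Qed.

Lemma osol_shift (eps q : R) (x x1 : R -> R) (tau : R) : osol eps q x x1 ->
  osol eps q (fun t => x (t + tau)) (fun t => x1 (t + tau)).
Proof.
  intros H t. destruct (H (t + tau)) as [H0 H1].
  assert (Hs : is_derive (fun t => t + tau) t 1) by (auto_derive; trivial).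
  split.
  - evar_last; [apply (is_derive_comp x (fun t => t + tau)); eassumption|].
    unfold scal; simpl; unfold mult; simpl; ring.
  - evar_last; [apply (is_derive_comp x1 (fun t => t + tau)); eassumption|].
    unfold scal; simpl; unfold mult; simpl; ring.
Qed.

(** Where [x t0] is nonzero, the power is continuously differentiable and the usual Lipschitz
    argument works. Where [x t0 = 0], subtracting the two energy identities expresses
    [(x1 - y1) (x1 + y1)] through differences of [x^2] and [|x|^(1+q)], which are Lipschitz;
    dividing by [x1 + y1], nonzero near [t0], gives a first order inequality for [x - y]. *)
Lemma osol_local_unique (eps q : R) (x x1 y y1 : R -> R) (t0 : R) : 0 < q ->
  osol eps q x x1 -> osol eps q y y1 -> x t0 = y t0 -> x1 t0 = y1 t0 ->
  ~ (x t0 = 0 /\ x1 t0 = 0) -> locally t0 (fun t => x t = y t).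
Proof.
  intros Hq Hx Hy E0 E1 Hnd.
  assert (Hcx := proj1 (osol_continuous _ _ _ _ t0 Hx)).
  assert (Hcy := proj1 (osol_continuous _ _ _ _ t0 Hy)).
  assert (Hcx1 := proj2 (osol_continuous _ _ _ _ t0 Hx)).
  assert (Hcy1 := proj2 (osol_continuous _ _ _ _ t0 Hy)).
  destruct (Req_dec (x t0) 0) as [Hx0|Hx0].
  - assert (Hy0 : x1 t0 <> 0) by tauto.
    destruct (locally_lipschitz (apow (1 + q)) (fun x => (1 + q) * spow q x) 0)
      as [d [K [Hd [HK HL]]]].
    { apply filter_forall. intros z. now apply is_derive_apow_S. }
    { apply (continuous_scal_r (1 + q) (spow q)). now apply continuous_spow. }
    (* [e <= 1] bounds [|x + y|] by 2; with [r] equal to half the speed at [t0], [|x1 + y1|] stays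
       above [2 r]. *)
    set (e := Rmin d 1). assert (He : 0 < e) by (apply Rmin_glb_lt; lra).
    set (r := Rabs (x1 t0) / 2).
    assert (Hr : 0 < r) by (unfold r; apply Rabs_pos_lt in Hy0; lra).
    assert (L := filter_and _ _ (filter_and _ _ (locally_continuous_ball x t0 e Hcx He)
                   (locally_continuous_ball y t0 e Hcy He))
                   (filter_and _ _ (locally_continuous_ball x1 t0 r Hcx1 Hr)
                   (locally_continuous_ball y1 t0 r Hcy1 Hr))).
    apply locally_R in L. destruct L as [dd [Hdd L]].
    apply locally_R. exists dd. split; trivial. intros t Ht.
    apply Rminus_diag_uniq.
    apply (gronwall_zero (fun t => x t - y t) (fun t => x1 t - y1 t)
      ((2 + Rabs (eps * (2 / (1 + q))) * K) / (2 * r)) (t0 - dd) (t0 + dd) t0).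
    + lra.
    + intros s _. apply is_derive_minus_R; [apply Hx|apply Hy].
    + intros s Hs. destruct (L s) as [[Lx Ly] [Lx1 Ly1]]; [apply Rabs_def1; lra|].
      assert (He1 : e <= 1) by apply Rmin_r. assert (Hed : e <= d) by apply Rmin_l.
      rewrite <- E0, Hx0 in Ly. rewrite Hx0 in Lx. rewrite <- E1 in Ly1.
      assert (EE : energy eps q (x s) (x1 s) = energy eps q (y s) (y1 s)).
      { rewrite (energy_const eps q x x1 s t0), (energy_const eps q y y1 s t0) by trivial.
        now rewrite E0, E1. }
      unfold energy in EE.
      assert (B1 : (x1 s - y1 s) * (x1 s + y1 s) = - ((x s - y s) * (x s + y s)) +
        eps * (2 / (1 + q)) * (apow (1 + q) (x s) - apow (1 + q) (y s))) by lra.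
      assert (B2 : 2 * r <= Rabs (x1 s + y1 s)).
      { apply Rabs_def2 in Lx1. apply Rabs_def2 in Ly1. unfold r in *.
        unfold Rabs in *. destruct (Rcase_abs (x1 t0)), (Rcase_abs (x1 s + y1 s)); lra. }
      assert (B3 : Rabs (x1 s - y1 s) * Rabs (x1 s + y1 s) <=
        (2 + Rabs (eps * (2 / (1 + q))) * K) * Rabs (x s - y s)).
      { rewrite <- Rabs_mult, B1. eapply Rle_trans; [apply Rabs_triang|].
        rewrite Rabs_Ropp, !Rabs_mult. rewrite Rmult_plus_distr_r. apply Rplus_le_compat.
        - rewrite Rmult_comm. apply Rmult_le_compat_r; [apply Rabs_pos|].
          apply Rabs_def2 in Lx. apply Rabs_def2 in Ly. apply Rabs_le. lra.
        - rewrite <- Rabs_mult. rewrite (Rmult_assoc _ K). apply Rmult_le_compat_l; [apply Rabs_pos|].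
          apply HL; lra. }
      unfold Rdiv. rewrite (Rmult_comm _ (/ _)), Rmult_assoc.
      apply (Rmult_le_reg_l (2 * r)); [lra|]. rewrite <- Rmult_assoc, Rinv_r, Rmult_1_l by lra.
      eapply Rle_trans; [|exact B3]. rewrite Rmult_comm.
      apply Rmult_le_compat_l; [apply Rabs_pos|exact B2].
    + rewrite E0; ring.
    + apply Rabs_def2 in Ht; lra.
  - destruct (locally_lipschitz (spow q) (fun x => q * apow (q - 1) x) (x t0))
      as [d [K [Hd [HK HL]]]].
    { apply locally_R. exists (Rabs (x t0)). split; [now apply Rabs_pos_lt|].
      intros z Hz. apply is_derive_spow_neq0. intros ->.
      rewrite Rminus_0_l, Rabs_Ropp in Hz. lra. }
    { apply (continuous_scal_r q (apow (q - 1))).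
      eapply continuous_of_is_derive. now apply is_derive_apow_neq0. }
    assert (L := filter_and _ _ (locally_continuous_ball x t0 d Hcx Hd)
                   (locally_continuous_ball y t0 d Hcy Hd)).
    apply locally_R in L. destruct L as [dd [Hdd L]].
    apply locally_R. exists dd. split; trivial. intros t Ht.
    (* In the derivative of the squared distance the linear terms cancel. What is left is a product
       of the velocity difference and the difference of the powers, which the Lipschitz bound
       controls. *)
    assert (Z : (x t - y t) ^ 2 + (x1 t - y1 t) ^ 2 = 0).
    { apply (gronwall_zero (fun t => (x t - y t) ^ 2 + (x1 t - y1 t) ^ 2)
        (fun t => 2 * ((x t - y t) * (x1 t - y1 t)
           + (x1 t - y1 t) * (eps * (spow q (x t) - spow q (y t)) - (x t - y t))))
        (Rabs eps * K) (t0 - dd) (t0 + dd) t0).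
      - lra.
      - intros s _. destruct (Hx s) as [Hx0' Hx1]. destruct (Hy s) as [Hy0 Hy1]. evar_last.
        + apply (is_derive_plus (fun t => (x t - y t) ^ 2) (fun t => (x1 t - y1 t) ^ 2)).
          * apply is_derive_pow. apply is_derive_minus_R; eassumption.
          * apply is_derive_pow. apply is_derive_minus_R; eassumption.
        + unfold plus; simpl. ring.
      - intros s Hs. destruct (L s) as [Lx Ly]; [apply Rabs_def1; lra|]. rewrite <- E0 in Ly.
        assert (B := HL _ _ Lx Ly).
        set (u := x s - y s) in *. set (v := x1 s - y1 s) in *.
        set (D := spow q (x s) - spow q (y s)) in *.
        rewrite (Rabs_pos_eq (u ^ 2 + v ^ 2)) by nra.
        replace (2 * (u * v + v * (eps * D - u))) with (2 * v * (eps * D)) by ring.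
        rewrite !Rabs_mult, (Rabs_pos_eq 2) by lra.
        apply Rle_trans with (2 * Rabs v * (Rabs eps * (K * Rabs u))).
        + apply Rmult_le_compat_l; [assert (J := Rabs_pos v); lra|].
          apply Rmult_le_compat_l; [apply Rabs_pos|exact B].
        + replace (2 * Rabs v * (Rabs eps * (K * Rabs u)))
            with ((Rabs eps * K) * (2 * Rabs u * Rabs v)) by ring.
          apply Rmult_le_compat_l; [apply Rmult_le_pos; [apply Rabs_pos|exact HK]|].
          rewrite <- (pow2_abs u), <- (pow2_abs v).
          assert (J := pow2_ge_0 (Rabs u - Rabs v)). nra.
      - rewrite E0, E1. ring.
      - apply Rabs_def2 in Ht; lra. }
    assert (J0 := pow2_ge_0 (x t - y t)). assert (J1 := pow2_ge_0 (x1 t - y1 t)).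
    apply Rminus_diag_uniq, Rsqr_0_uniq. rewrite Rsqr_pow2. lra.
Qed.

Lemma osol_locally_derivative (eps q : R) (x x1 y y1 : R -> R) (t : R) :
  osol eps q x x1 -> osol eps q y y1 -> locally t (fun s => x s = y s) -> x1 t = y1 t.
Proof.
  intros Hx Hy L. rewrite <- (is_derive_unique x t (x1 t)) by apply Hx.
  apply is_derive_unique. apply is_derive_ext_loc with y; [|apply Hy].
  revert L; apply filter_imp. intros s Hs. now symmetry.
Qed.

(** Agreement of both phase coordinates is open by local uniqueness and closed by continuity.
    Avoidance of the phase origin is asked of [x] on the open interval, which is how the lemma
    applies inside a homoclinic loop. *)
Lemma osol_unique (eps q : R) (x x1 y y1 : R -> R) (a b t0 : R) : 0 < q ->
  osol eps q x x1 -> osol eps q y y1 -> a < t0 < b -> x t0 = y t0 -> x1 t0 = y1 t0 ->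
  (forall t, a < t < b -> ~ (x t = 0 /\ x1 t = 0)) ->
  forall t, a < t < b -> x t = y t.
Proof.
  intros Hq Hx Hy H0 E0 E1 Hnd t Ht.
  refine (proj1 (interval_induction (fun t => x t = y t /\ x1 t = y1 t) a b t0 H0
    (conj E0 E1) _ _ t Ht)).
  - intros s Hs [F0 F1].
    assert (L := osol_local_unique eps q x x1 y y1 s Hq Hx Hy F0 F1 (Hnd s Hs)).
    refine (filter_and _ _ L _).
    refine (filter_imp _ _ _ (locally_locally _ _ L)). intros r Lr.
    eapply osol_locally_derivative; eassumption.
  - intros s Hs Hn. destruct (osol_continuous _ _ _ _ s Hx) as [C1 C2].
    destruct (osol_continuous _ _ _ _ s Hy) as [C3 C4].
    assert (Z : forall u v : R -> R, continuous u s -> continuous v s -> u s <> v s ->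
              locally s (fun r => u r <> v r)).
    { intros u v Cu Cv Huv.
      assert (Hp : 0 < Rabs (u s - v s) / 2).
      { apply Rdiv_lt_0_compat; [|lra]. apply Rabs_pos_lt. lra. }
      generalize (filter_and _ _ (locally_continuous_ball u s _ Cu Hp)
                               (locally_continuous_ball v s _ Cv Hp)).
      apply filter_imp. intros r [A B] Er. rewrite Er in A.
      assert (J := Rabs_triang (u s - v r) (v r - v s)).
      replace (u s - v r + (v r - v s)) with (u s - v s) in J by ring.
      rewrite <- Rabs_Ropp in A. replace (- (v r - u s)) with (u s - v r) in A by ring. lra. }
    destruct (Req_dec (x s) (y s)) as [F0|F0].
    + assert (F1 : x1 s <> y1 s) by tauto.
      generalize (Z _ _ C2 C4 F1). apply filter_imp. tauto.
    + generalize (Z _ _ C1 C3 F0). apply filter_imp. tauto.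
Qed.

Lemma osol_unique_global (eps q : R) (x x1 y y1 : R -> R) (t0 : R) : 0 < q ->
  osol eps q x x1 -> osol eps q y y1 -> x t0 = y t0 -> x1 t0 = y1 t0 ->
  (forall t, ~ (x t = 0 /\ x1 t = 0)) -> forall t, x t = y t.
Proof.
  intros Hq Hx Hy E0 E1 Hnd t.
  apply (osol_unique eps q x x1 y y1 (Rmin t0 t - 1) (Rmax t0 t + 1) t0); trivial.
  - assert (J := Rmin_l t0 t). assert (J' := Rmax_l t0 t). lra.
  - assert (J := Rmin_r t0 t). assert (J' := Rmax_r t0 t). lra.
Qed.

(** * Flows on the circle *)

Lemma is_derive_eps (f : R -> R) (x l : R) :
  is_derive f x l <->
  forall e, 0 < e -> exists d, 0 < d /\ forall y, Rabs (y - x) < d ->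
    Rabs (f y - f x - l * (y - x)) <= e * Rabs (y - x).
Proof.
  rewrite is_derive_Reals. split.
  - intros H e He. destruct (H e He) as [d Hd]. exists d. split; [apply cond_pos|].
    intros y Hy. destruct (Req_dec (y - x) 0) as [E|E].
    + replace y with x by lra. replace (f x - f x - l * (x - x)) with 0 by ring.
      rewrite Rminus_diag, Rabs_R0; lra.
    + assert (J := Hd _ E Hy). replace (x + (y - x)) with y in J by ring.
      replace (f y - f x - l * (y - x)) with (((f y - f x) / (y - x) - l) * (y - x)) by now field.
      rewrite Rabs_mult. apply Rmult_le_compat_r; [apply Rabs_pos|lra].
  - intros H e He. destruct (H (e / 2)) as [d [Hd Hd']]; [lra|].
    exists (mkposreal d Hd). intros h Hh Hhd. simpl in Hhd.
    assert (J := Hd' (x + h)). replace (x + h - x) with h in J by ring. specialize (J Hhd).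
    replace ((f (x + h) - f x) / h - l) with ((f (x + h) - f x - l * h) / h) by now field.
    unfold Rdiv. rewrite Rabs_mult, Rabs_inv.
    assert (P := Rabs_pos_lt h Hh).
    apply Rmult_lt_reg_r with (Rabs h); trivial.
    rewrite Rmult_assoc, Rinv_l, Rmult_1_r by lra. nra.
Qed.

(** Monotonicity traps [g y] between [g y0 - r] and [g y0 + r] as soon as [y] lies between the
    images of these two points. *)
Lemma inverse_continuous (f g : R -> R) (a b c d y0 : R) :
  (forall x x', a < x -> x < x' -> x' < b -> f x < f x') -> c < y0 < d ->
  (forall y, c < y < d -> a < g y < b /\ f (g y) = y) -> continuous g y0.
Proof.
  intros Hf Hy0 Hg. apply continuity_pt_filterlim. intros e He.
  destruct (Hg y0 Hy0) as [[G1 G2] G3].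
  set (r := Rmin e (Rmin (g y0 - a) (b - g y0)) / 2).
  assert (Hr : 0 < Rmin e (Rmin (g y0 - a) (b - g y0))).
  { repeat apply Rmin_glb_lt; lra. }
  assert (Hr1 : Rmin e (Rmin (g y0 - a) (b - g y0)) <= e) by apply Rmin_l.
  assert (Hr2 : Rmin e (Rmin (g y0 - a) (b - g y0)) <= g y0 - a).
  { eapply Rle_trans; [apply Rmin_r|apply Rmin_l]. }
  assert (Hr3 : Rmin e (Rmin (g y0 - a) (b - g y0)) <= b - g y0).
  { eapply Rle_trans; [apply Rmin_r|apply Rmin_r]. }
  assert (L1 : f (g y0 - r) < y0) by (rewrite <- G3 at 2; apply Hf; unfold r; lra).
  assert (L2 : y0 < f (g y0 + r)) by (rewrite <- G3 at 1; apply Hf; unfold r; lra).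
  set (s := Rmin (Rmin (y0 - c) (d - y0)) (Rmin (y0 - f (g y0 - r)) (f (g y0 + r) - y0))).
  assert (S0 : 0 < s) by (repeat apply Rmin_glb_lt; lra).
  assert (S1 : s <= y0 - c) by (eapply Rle_trans; [apply Rmin_l|apply Rmin_l]).
  assert (S2 : s <= d - y0) by (eapply Rle_trans; [apply Rmin_l|apply Rmin_r]).
  assert (S3 : s <= y0 - f (g y0 - r)) by (eapply Rle_trans; [apply Rmin_r|apply Rmin_l]).
  assert (S4 : s <= f (g y0 + r) - y0) by (eapply Rle_trans; [apply Rmin_r|apply Rmin_r]).
  exists s. split; trivial. intros y [_ Hy]. simpl in *. unfold R_dist in *.
  apply Rabs_def2 in Hy. destruct (Hg y) as [[K1 K2] K3]; [lra|].
  apply Rabs_def1.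
  - destruct (Rlt_le_dec (g y) (g y0 + r)) as [K|K]; [unfold r in *; lra|].
    exfalso. assert (f (g y0 + r) <= f (g y)); [|lra].
    destruct K as [K|K]; [|rewrite K; lra]. left. apply Hf; unfold r in *; lra.
  - destruct (Rlt_le_dec (g y0 - r) (g y)) as [K|K]; [unfold r in *; lra|].
    exfalso. assert (f (g y) <= f (g y0 - r)); [|lra].
    destruct K as [K|K]; [|rewrite K; lra]. left. apply Hf; unfold r in *; lra.
Qed.

Lemma inverse_derive (f g : R -> R) (a b c d y0 l : R) :
  (forall x x', a < x -> x < x' -> x' < b -> f x < f x') -> c < y0 < d ->
  (forall y, c < y < d -> a < g y < b /\ f (g y) = y) ->
  is_derive f (g y0) l -> l <> 0 -> is_derive g y0 (/ l).
Proof.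
  intros Hf Hy0 Hg Hd Hl.
  assert (Hc := inverse_continuous f g a b c d y0 Hf Hy0 Hg).
  rewrite is_derive_eps in Hd. apply is_derive_eps. intros e He.
  assert (Pl := Rabs_pos_lt l Hl).
  (* The bound [|l| / 2] yields [|g y - g y0| <= 2 |y - y0| / |l|]; the other bound absorbs this 2
     and the two factors [1 / |l|] into the final error [e]. *)
  set (e' := Rmin (Rabs l / 2) (e * (Rabs l * Rabs l) / 2)).
  assert (He' : 0 < e').
  { apply Rmin_glb_lt; [lra|]. apply Rdiv_lt_0_compat; [|lra].
    apply Rmult_lt_0_compat; [trivial|nra]. }
  assert (E1 : e' <= Rabs l / 2) by apply Rmin_l.
  assert (E2 : e' <= e * (Rabs l * Rabs l) / 2) by apply Rmin_r.
  destruct (Hd e' He') as [d1 [Hd1 D1]].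
  destruct (continuous_R g y0 d1 Hc Hd1) as [d2 [Hd2 D2]].
  exists (Rmin d2 (Rmin (y0 - c) (d - y0))).
  split; [repeat apply Rmin_glb_lt; lra|]. intros y Hy.
  assert (B1 : Rabs (y - y0) < d2) by (eapply Rlt_le_trans; [exact Hy|apply Rmin_l]).
  assert (B2 : Rabs (y - y0) < y0 - c).
  { eapply Rlt_le_trans; [exact Hy|]. eapply Rle_trans; [apply Rmin_r|apply Rmin_l]. }
  assert (B3 : Rabs (y - y0) < d - y0).
  { eapply Rlt_le_trans; [exact Hy|]. eapply Rle_trans; [apply Rmin_r|apply Rmin_r]. }
  apply Rabs_def2 in B2. apply Rabs_def2 in B3.
  assert (J := D1 _ (D2 y B1)).
  destruct (Hg y) as [_ G]; [lra|]. destruct (Hg y0 Hy0) as [_ G0]. rewrite G, G0 in J.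
  set (u := g y - g y0) in *. set (v := y - y0) in *.
  assert (J1 : Rabs l * Rabs u <= Rabs v + e' * Rabs u).
  { rewrite <- Rabs_mult. replace (l * u) with (v - (v - l * u)) by ring.
    eapply Rle_trans; [apply Rabs_triang|]. rewrite Rabs_Ropp. lra. }
  assert (Pu := Rabs_pos u). assert (Pv := Rabs_pos v).
  assert (J2 : Rabs l * Rabs u <= 2 * Rabs v) by nra.
  replace (u - / l * v) with (- (/ l) * (v - l * u)) by now field.
  rewrite Rabs_mult, Rabs_Ropp, Rabs_inv.
  apply Rmult_le_reg_l with (Rabs l * Rabs l); [nra|].
  replace (Rabs l * Rabs l * (/ Rabs l * Rabs (v - l * u))) with (Rabs l * Rabs (v - l * u))
    by (field; lra).
  apply Rle_trans with (Rabs l * (e' * Rabs u)); [nra|].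
  apply Rle_trans with (e' * (2 * Rabs v)); nra.
Qed.

Lemma continuous_ex_RInt (f : R -> R) (a b : R) :
  (forall x, continuous f x) -> ex_RInt f a b.
Proof. intros H. apply (ex_RInt_continuous f). intros x _. apply H. Qed.

Lemma is_derive_primitive (f : R -> R) (a x : R) :
  (forall x, continuous f x) -> is_derive (fun y => RInt f a y) x (f x).
Proof.
  intros H. apply (is_derive_RInt f (fun y => RInt f a y) a x).
  - apply filter_forall. intros y. apply (RInt_correct f). now apply continuous_ex_RInt.
  - apply H.
Qed.

(** [K] is the time spent per unit of phase, [1 / K] the angular speed and [T] the duration of one
    turn. Starting at [PI / 2] puts a crest of [sin phi] at time 0. *)
Definition is_flow (K phi : R -> R) (T : R) : Prop :=
  0 < T /\ phi 0 = PI / 2 /\ (forall t, is_derive phi t (/ K (phi t))) /\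
  (forall t, phi (t + T) = phi t + 2 * PI).

Lemma increasing_of_derive (f df : R -> R) :
  (forall x, is_derive f x (df x)) -> (forall x, 0 < df x) ->
  forall x y, x < y -> f x < f y.
Proof.
  intros H P x y Hxy. apply (derive_lt f df x y Hxy).
  - intros z _. apply H.
  - intros z _. exact (continuous_of_is_derive _ _ _ (H z)).
  - intros z _. apply P.
Qed.

Lemma is_derive_shift (f : R -> R) (x c l : R) :
  is_derive f (x + c) l -> is_derive (fun y => f (y + c)) x l.
Proof.
  intros H. rewrite <- (Rmult_1_r l). apply (is_derive_comp_R f (fun y => y + c)); trivial.
  auto_derive; trivial.
Qed.

Lemma primitive_shift (K : R -> R) (p a x : R) : (forall x, continuous K x) ->
  (forall x, K (x + p) = K x) -> RInt K a (x + p) = RInt K a x + RInt K 0 p.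
Proof.
  intros HC Hper. assert (HD := fun y => is_derive_primitive K a y HC).
  assert (HI : RInt K a p = RInt K a 0 + RInt K 0 p).
  { rewrite <- (RInt_Chasles K a 0 p) by now apply continuous_ex_RInt.
    reflexivity. }
  set (I := fun y => RInt K a y) in *.
  assert (E : I (x + p) - I x = I (0 + p) - I 0).
  { apply (derive_const (fun y => I (y + p) - I y)). intros y _.
    replace 0 with (K (y + p) - K y) by (rewrite Hper; ring).
    apply is_derive_minus_R; [|apply HD]. now apply is_derive_shift. }
  rewrite Rplus_0_l in E. change (I p = I 0 + RInt K 0 p) in HI.
  change (I (x + p) = I x + RInt K 0 p). lra.
Qed.

(** The flow is the inverse of the elapsed time [tau], the primitive of [K] from [PI / 2]. It exists
    for all times because [tau] gains the same positive [T] on every turn and is therefore onto. *)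
Lemma ex_flow (K : R -> R) :
  (forall x, continuous K x) -> (forall x, 0 < K x) -> (forall x, K (x + 2 * PI) = K x) ->
  exists phi, is_flow K phi (RInt K 0 (2 * PI)).
Proof.
  intros HC HP Hper. pose (T := RInt K 0 (2 * PI) : R). fold T. pose (tau := (fun x => RInt K (PI / 2) x) : R -> R).
  change (exists phi, is_flow K phi T).
  assert (Dtau : forall x, is_derive tau x (K x)).
  { intros x. now apply is_derive_primitive. }
  assert (Itau := increasing_of_derive tau K Dtau HP).
  assert (Ttau : forall x, tau (x + 2 * PI) = tau x + T).
  { intros x. now apply primitive_shift. }
  assert (HT : 0 < T).
  { assert (J := Ttau 0). assert (P := PI_RGT_0). assert (J' := Itau 0 (0 + 2 * PI) ltac:(lra)). lra. }
  assert (Tn : forall n, tau (PI / 2 + INR n * (2 * PI)) = INR n * T /\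
                         tau (PI / 2 - INR n * (2 * PI)) = - (INR n * T)).
  { induction n as [|n [I1 I2]].
    - simpl. rewrite !Rmult_0_l, Rplus_0_r, Rminus_0_r. unfold tau. rewrite RInt_point.
      change (0 = 0 /\ 0 = - 0). lra.
    - rewrite S_INR. split.
      + replace (PI / 2 + (INR n + 1) * (2 * PI)) with (PI / 2 + INR n * (2 * PI) + 2 * PI) by ring.
        rewrite Ttau, I1. ring.
      + assert (E := Ttau (PI / 2 - (INR n + 1) * (2 * PI))).
        replace (PI / 2 - (INR n + 1) * (2 * PI) + 2 * PI) with (PI / 2 - INR n * (2 * PI)) in E by ring.
        rewrite I2 in E. lra. }
  assert (Surj : forall t, exists x, tau x = t).
  { intros t. destruct (INR_archimed T (Rabs t) HT) as [n Hn].
    destruct (Tn n) as [N1 N2].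
    destruct (IVT_gen tau (PI / 2 - INR n * (2 * PI)) (PI / 2 + INR n * (2 * PI)) t) as [x [_ Hx]].
    - intros x. apply continuity_pt_filterlim. exact (continuous_of_is_derive _ _ _ (Dtau x)).
    - rewrite N1, N2. assert (J := Rle_abs t). assert (J' := Rle_abs (- t)). rewrite Rabs_Ropp in J'.
      rewrite Rmin_left, Rmax_right by lra. lra.
    - now exists x. }
  destruct (IndefiniteDescription.functional_choice _ Surj) as [phi Hphi].
  assert (Inj : forall x y, tau x = tau y -> x = y).
  { intros x y E. destruct (Rtotal_order x y) as [H|[H|H]]; trivial; apply Itau in H; lra. }
  exists phi. split; [exact HT|split; [|split]].
  - apply Inj. rewrite Hphi. unfold tau. rewrite RInt_point. reflexivity.
  (* The inverse function rule is local: the window from [- N] to [N] contains [t] in its interior,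
     and the preimages of its ends bound the phases. *)
  - intros t. set (N := Rabs t + 1).
    assert (J := Rle_abs t). assert (J' := Rle_abs (- t)). rewrite Rabs_Ropp in J'.
    destruct (Surj (- N)) as [x1 X1]. destruct (Surj N) as [x2 X2].
    apply (inverse_derive tau phi x1 x2 (- N) N).
    + intros x x' _ H _. now apply Itau.
    + unfold N; lra.
    + intros y Hy. split; [|apply Hphi].
      split; apply Rnot_le_lt; intros [Hle|Hle].
      * apply Itau in Hle. rewrite Hphi in Hle. lra.
      * rewrite <- Hle, Hphi in X1. lra.
      * apply Itau in Hle. rewrite Hphi in Hle. lra.
      * rewrite Hle, Hphi in X2. lra.
    + apply Dtau.
    + assert (P := HP (phi t)). lra.
  - intros t. apply Inj. rewrite Ttau, !Hphi. reflexivity.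
Qed.

(** [1 - sin x] is twice the square of the sine of [(x - PI / 2) / 2], an angle strictly between 0
    and [PI]. *)
Lemma sin_lt_1 (x : R) : PI / 2 < x < PI / 2 + 2 * PI -> sin x < 1.
Proof.
  intros H. assert (S := sin_gt_0 ((x - PI / 2) / 2) ltac:(lra) ltac:(lra)).
  rewrite <- (cos_shift x).
  replace (PI / 2 - x) with (- (2 * ((x - PI / 2) / 2))) by field.
  rewrite cos_neg, cos_2a_sin. nra.
Qed.

(** The remainder [p - n T] lies in [(0, T]], not in [[0, T)]: a period that is a multiple of [T]
    leaves the remainder [T], and the multiple [S n] is positive. *)
Lemma ex_nat_step (T p : R) : 0 < T -> 0 < p -> exists n, INR n * T < p <= INR (S n) * T.
Proof.
  intros HT Hp. destruct (INR_archimed T p HT) as [n Hn].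
  induction n as [|n IH].
  - simpl in Hn. lra.
  - destruct (Rlt_le_dec (INR n * T) p) as [H|H].
    + exists n. lra.
    + destruct (Rlt_le_dec p (INR n * T)) as [K|K]; [now apply IH|].
      assert (E : p = INR n * T) by lra. destruct n as [|n].
      * simpl in E. lra.
      * exists n. rewrite E. split; [|lra]. apply Rmult_lt_compat_r; trivial.
        apply lt_INR; lia.
Qed.

Lemma periodic_mult (p : R) (x : R -> R) (n : nat) :
  (forall t, x (t + p) = x t) -> forall t, x (t + INR n * p) = x t.
Proof.
  intros H. induction n as [|n IH]; intros t.
  - simpl. f_equal; ring.
  - rewrite S_INR. replace (t + (INR n + 1) * p) with (t + INR n * p + p) by ring.
    now rewrite H.
Qed.

(** The maximum [P 1] is attained only at the crests, where [phi] is [PI / 2] modulo [2 PI]. They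
    recur exactly after time [T], and a period carries the crest at time 0 to another crest. *)
Lemma wave_periods (K phi P : R -> R) (T : R) : is_flow K phi T -> (forall x, 0 < K x) ->
  (forall s, -1 <= s < 1 -> P s < P 1) ->
  least_period T (fun t => P (sin (phi t))) /\
  forall p, periodic p (fun t => P (sin (phi t))) -> exists n, p = INR (S n) * T.
Proof.
  intros [HT [H0 [Hd Hp]]] HK HP.
  assert (Inc : forall x y, x < y -> phi x < phi y).
  { apply (increasing_of_derive phi (fun t => / K (phi t))); trivial.
    intros x. now apply Rinv_0_lt_compat. }
  assert (PT : forall t, P (sin (phi (t + T))) = P (sin (phi t))).
  { intros t. rewrite Hp. f_equal.
    rewrite sin_plus, sin_2PI, cos_2PI. ring. }
  assert (Q : forall p, periodic p (fun t => P (sin (phi t))) -> exists n, p = INR (S n) * T).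
  { intros p [P0 P1]. destruct (ex_nat_step T p HT P0) as [n Hn]. exists n.
    set (r := p - INR n * T). rewrite S_INR in Hn.
    assert (E : P (sin (phi r)) = P (sin (phi 0))).
    { rewrite <- (P1 0). rewrite <- (periodic_mult T (fun t => P (sin (phi t))) n PT r).
      simpl. do 3 f_equal. unfold r; ring. }
    rewrite H0, sin_PI2 in E.
    assert (Er : r = T).
    { apply Rle_antisym; [unfold r; lra|]. apply Rnot_lt_le. intros Hlt.
      assert (I1 := Inc 0 r ltac:(unfold r; lra)). assert (I2 := Inc r (0 + T) ltac:(lra)).
      rewrite Hp, H0 in I2. rewrite H0 in I1.
      assert (S := sin_lt_1 (phi r) ltac:(lra)).
      assert (S' := SIN_bound (phi r)).
      assert (J := HP (sin (phi r)) ltac:(lra)). lra. }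
    rewrite S_INR. unfold r in Er. lra. }
  split; trivial. split; [now split|].
  intros p Hper. destruct (Q p Hper) as [n ->]. rewrite S_INR.
  assert (N := pos_INR n). nra.
Qed.

Lemma continuous_comp_lin (f : R -> R) (u v : R) : (forall x, continuous f x) ->
  forall x, continuous (fun y => f (u * y + v)) x.
Proof.
  intros H x. apply (continuous_comp (fun y => u * y + v) f); [|apply H].
  apply (ex_derive_continuous (fun y => u * y + v)). now auto_derive.
Qed.

Lemma RInt_reflect (f : R -> R) (u v a b : R) : (forall x, continuous f x) ->
  u = 1 \/ u = -1 ->
  RInt f (u * a + v) (u * b + v) = u * RInt (fun y => f (u * y + v)) a b.
Proof.
  intros H Hu. rewrite <- (RInt_comp_lin f u v a b) by now apply continuous_ex_RInt.
  apply (RInt_scal (fun y => f (u * y + v)) a b u).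
  apply continuous_ex_RInt. now apply continuous_comp_lin.
Qed.

(** A turn consists of four quarters, two with positive and two with negative sine, related by
    reflections. The period therefore sees only the even part of [k], which makes asymmetric wells
    tractable. *)
Lemma RInt_sin_quarter (k : R -> R) : (forall x, continuous (fun y => k (sin y)) x) ->
  RInt (fun y => k (sin y)) 0 (2 * PI) =
  2 * RInt (fun y => k (sin y) + k (- sin y)) 0 (PI / 2).
Proof.
  intros H. set (f := fun y => k (sin y)).
  assert (Hm : forall x, continuous (fun y => k (- sin y)) x).
  { intros x. apply continuous_ext with (fun y => f ((-1) * y + 0)).
    - intros y. unfold f. rewrite <- sin_neg. do 2 f_equal; ring.
    - now apply continuous_comp_lin. }
  assert (E : forall a b, ex_RInt f a b) by (intros; now apply continuous_ex_RInt).
  rewrite <- (RInt_Chasles f 0 (PI / 2)), <- (RInt_Chasles f (PI / 2) PI),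
    <- (RInt_Chasles f PI (PI + PI / 2)) by trivial.
  assert (E1 : RInt f (PI / 2) PI = RInt f 0 (PI / 2)).
  { replace (PI / 2) with ((-1) * (PI / 2) + PI) at 1 by field.
    replace PI with ((-1) * 0 + PI) at 3 by ring.
    rewrite RInt_reflect by (trivial; now right).
    rewrite <- (opp_RInt_swap _ 0 (PI / 2)).
    2:{ apply continuous_ex_RInt. now apply continuous_comp_lin. }
    unfold opp; simpl. rewrite (RInt_ext (fun y => f (-1 * y + PI)) f).
    - ring.
    - intros x _. unfold f. f_equal. rewrite <- sin_PI_x. f_equal. ring. }
  assert (E2 : RInt f PI (PI + PI / 2) = RInt (fun y => k (- sin y)) 0 (PI / 2)).
  { replace PI with (1 * 0 + PI) at 1 by ring.
    replace (PI + PI / 2) with (1 * (PI / 2) + PI) by ring.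
    rewrite RInt_reflect by (trivial; now left).
    rewrite Rmult_1_l. apply RInt_ext. intros x _. unfold f. f_equal.
    rewrite Rmult_1_l. apply neg_sin. }
  assert (E3 : RInt f (PI + PI / 2) (2 * PI) = RInt (fun y => k (- sin y)) 0 (PI / 2)).
  { replace (PI + PI / 2) with ((-1) * (PI / 2) + 2 * PI) by field.
    replace (2 * PI) with ((-1) * 0 + 2 * PI) at 2 by ring.
    rewrite RInt_reflect by (trivial; now right).
    rewrite <- (opp_RInt_swap _ 0 (PI / 2)).
    2:{ apply continuous_ex_RInt. now apply continuous_comp_lin. }
    unfold opp; simpl. rewrite (RInt_ext (fun y => f (-1 * y + 2 * PI)) (fun y => k (- sin y))).
    - ring.
    - intros x _. unfold f. f_equal. rewrite sin_plus, sin_2PI, cos_2PI, <- sin_neg.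
      rewrite Rmult_0_r, Rplus_0_r, Rmult_1_r. f_equal. ring. }
  rewrite E1, E2, E3.
  rewrite (RInt_plus f (fun y => k (- sin y))) by (trivial; now apply continuous_ex_RInt).
  unfold plus; simpl. lra.
Qed.

Lemma RInt_param_continuous (f : R -> R -> R) (a b x0 : R) : a <= b ->
  locally x0 (fun x => ex_RInt (f x) a b) ->
  (forall t, a <= t <= b -> continuity_2d_pt f x0 t) ->
  continuous (fun x => RInt (f x) a b) x0.
Proof.
  intros Hab Hex Hc. apply continuity_pt_filterlim. intros e He.
  (* The added 1 keeps the quotient meaningful when [a = b]. *)
  assert (He' : 0 < e / (2 * (b - a + 1))) by (apply Rdiv_lt_0_compat; lra).
  destruct (uniform_continuity_2d_1d (fun t x => f x t) a b x0) with (mkposreal _ He') as [d Hd].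
  { intros t Ht e0. destruct (Hc t Ht e0) as [d Hd]. exists d. intros u v Hu Hv. now apply Hd. }
  apply locally_R in Hex. destruct Hex as [d1 [Hd1 D1]].
  exists (Rmin (d / 2) d1). split; [apply Rmin_glb_lt; [assert (J := cond_pos d); lra|trivial]|].
  intros x [_ Hx]. simpl in *. unfold R_dist in *.
  assert (B1 : Rabs (x - x0) < d / 2) by (eapply Rlt_le_trans; [exact Hx|apply Rmin_l]).
  assert (B2 : Rabs (x - x0) < d1) by (eapply Rlt_le_trans; [exact Hx|apply Rmin_r]).
  assert (X1 := D1 x B2). assert (X0 : ex_RInt (f x0) a b).
  { apply D1. rewrite Rminus_diag, Rabs_R0; lra. }
  change (Rabs (minus (RInt (f x) a b) (RInt (f x0) a b)) < e).
  rewrite <- RInt_minus by trivial.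
  apply Rle_lt_trans with ((b - a) * (e / (2 * (b - a + 1)))).
  - apply abs_RInt_le_const; trivial.
    + now apply (ex_RInt_minus (f x) (f x0)).
    + intros t Ht. left. apply Rabs_def2 in B1. assert (J := cond_pos d).
      apply (Hd t x0 t x); try lra.
      rewrite Rminus_diag, Rabs_R0; trivial.
  - replace ((b - a) * (e / (2 * (b - a + 1)))) with (e * ((b - a) / (2 * (b - a + 1)))) by (field; lra).
    rewrite <- (Rmult_1_r e) at 2. apply Rmult_lt_compat_l; trivial.
    apply Rmult_lt_reg_r with (2 * (b - a + 1)); [lra|].
    unfold Rdiv. rewrite Rmult_assoc, Rinv_l by lra. lra.
Qed.

Lemma intermediate_value (f : R -> R) (a b y : R) : a < b ->
  (forall x, a <= x <= b -> continuous f x) ->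
  f a <= y <= f b -> exists x, a <= x <= b /\ f x = y.
Proof.
  intros Hab Hc Hy. destruct (Ranalysis5.f_interv_is_interv f a b y Hab Hy) as [x Hx].
  - intros x Hx. apply continuity_pt_filterlim. now apply Hc.
  - now exists x.
Qed.

(** * Sign changing periodic solutions *)

(** With [x = a s] and maximal value [a], conservation of energy reads
    [x1^2 = a^2 (1 - s^2) (1 - lam rho (s^2))]: [rho] is what remains of the difference of powers
    once the turning point factor [1 - s^2] is taken out, continued by its limit 1 at [p = 1]. *)
Definition rho (q p : R) : R :=
  if Req_EM_T p 1 then 1 else 2 / (1 + q) * (1 - apow ((1 + q) / 2) p) / (1 - p).

Lemma rho_spec (q p : R) : 0 < q ->
  (1 - p) * rho q p = 2 / (1 + q) * (1 - apow ((1 + q) / 2) p).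
Proof.
  intros Hq. unfold rho. destruct (Req_EM_T p 1) as [->|H].
  - rewrite apow_1. field. lra.
  - field. split; lra.
Qed.

Lemma rho_1 (q : R) : rho q 1 = 1.
Proof. unfold rho. destruct (Req_EM_T 1 1); trivial. lra. Qed.

Lemma continuous_rho (q p : R) : 0 < q -> continuous (rho q) p.
Proof.
  intros Hq. destruct (Req_dec p 1) as [->|Hp].
  - apply continuity_pt_filterlim. intros e He.
    assert (D := is_derive_apow_pos ((1 + q) / 2) 1 Rlt_0_1).
    rewrite spow_1, is_derive_eps in D.
    destruct (D (e * ((1 + q) / 4))) as [d [Hd D1]].
    { apply Rmult_lt_0_compat; lra. }
    exists d. split; trivial. intros x [[_ Hx1] Hx]. simpl in *. unfold R_dist in *.
    rewrite rho_1. specialize (D1 x Hx). rewrite apow_1 in D1.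
    assert (P : 0 < Rabs (x - 1)) by (apply Rabs_pos_lt; lra).
    replace (rho q x - 1) with
      (2 / (1 + q) * ((apow ((1 + q) / 2) x - 1 - (1 + q) / 2 * 1 * (x - 1)) / (x - 1))).
    + unfold Rdiv at 2. rewrite !Rabs_mult, Rabs_inv.
      rewrite (Rabs_pos_eq (2 / (1 + q))) by (apply Rlt_le, Rdiv_lt_0_compat; lra).
      apply Rle_lt_trans with (2 / (1 + q) * (e * ((1 + q) / 4))).
      * apply Rmult_le_compat_l; [apply Rlt_le, Rdiv_lt_0_compat; lra|].
        apply Rmult_le_reg_r with (Rabs (x - 1)); trivial.
        rewrite Rmult_assoc, Rinv_l, Rmult_1_r by lra. exact D1.
      * replace (2 / (1 + q) * (e * ((1 + q) / 4))) with (e / 2) by (field; lra). lra.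
    + unfold rho. destruct (Req_EM_T x 1) as [E|_]; [lra|]. field. split; lra.
  - apply continuous_ext_loc with
      (fun p => 2 / (1 + q) * (1 - apow ((1 + q) / 2) p) * / (1 - p)).
    + apply locally_R. exists (Rabs (1 - p)). split; [apply Rabs_pos_lt; lra|].
      intros y Hy. unfold rho. destruct (Req_EM_T y 1) as [->|_]; [lra|reflexivity].
    + apply (continuous_mult (fun p => 2 / (1 + q) * (1 - apow ((1 + q) / 2) p))).
      * apply (continuous_scal_r (2 / (1 + q)) (fun p => 1 - apow ((1 + q) / 2) p)).
        apply (continuous_minus (fun _ => 1)); [apply continuous_const|].
        apply continuous_apow; lra.
      * apply (ex_derive_continuous (fun p => / (1 - p))). auto_derive. lra.
Qed.

Lemma rho_mean (q p : R) : 0 < q -> 0 <= p < 1 ->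
  exists c, p < c < 1 /\ rho q p = Rpower c ((1 + q) / 2 - 1).
Proof.
  intros Hq Hp.
  destruct (mean_value (apow ((1 + q) / 2)) (fun x => (1 + q) / 2 * spow ((1 + q) / 2 - 1) x) p 1)
    as [c [Hc E]]; [lra| | |].
  - intros x Hx. apply is_derive_apow_neq0; lra.
  - intros x Hx. apply continuous_apow; lra.
  - exists c. split; trivial. rewrite <- spow_pos by lra. rewrite apow_1 in E.
    apply Rmult_eq_reg_l with (1 - p); [|lra]. rewrite rho_spec by trivial. rewrite E.
    field. lra.
Qed.

Lemma Rpower_lt1 (c y : R) : 0 < c < 1 -> 0 < y -> Rpower c y < 1.
Proof.
  intros Hc Hy. rewrite <- apow_pos by lra. apply apow_lt1; lra.
Qed.

Lemma Rpower_gt1 (c y : R) : 0 < c < 1 -> y < 0 -> 1 < Rpower c y.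
Proof.
  intros Hc Hy. replace y with (- (- y)) by ring. rewrite Rpower_Ropp.
  rewrite <- Rinv_1. apply Rinv_lt_contravar.
  - rewrite Rmult_1_r. apply Rpower_pos.
  - apply Rpower_lt1; lra.
Qed.

(** The extreme values are those at the ends, 1 at [p = 1] and [2 / (1 + q)] at [p = 0], in an order
    that depends on the sign of [q - 1]. The first bound comes from the mean value form with
    [c < 1], the second from comparing [p^((1+q)/2)] with [p]. *)
Lemma rho_bounds (q p : R) : 0 < q -> 0 <= p <= 1 ->
  Rmin 1 (2 / (1 + q)) <= rho q p <= Rmax 1 (2 / (1 + q)).
Proof.
  intros Hq Hp. destruct (Req_dec p 1) as [->|Hp1].
  { rewrite rho_1. split; [apply Rmin_l|apply Rmax_l]. }
  destruct (rho_mean q p Hq) as [c [Hc E]]; [lra|].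
  assert (Hk : 0 < 2 / (1 + q)) by (apply Rdiv_lt_0_compat; lra).
  assert (Ha := rho_spec q p Hq).
  assert (Hs : apow 1 p = p).
  { destruct (Req_dec p 0) as [->|Hp0]; [apply apow_0|].
    rewrite apow_pos by lra. apply Rpower_1; lra. }
  assert (Hpp : apow ((1 + q) / 2) p = p * apow ((q - 1) / 2) p).
  { rewrite <- Hs at 2. rewrite <- apow_plus. f_equal; field. }
  destruct (Rtotal_order q 1) as [H|[->|H]].
  - assert (P : p <= apow ((1 + q) / 2) p).
    { destruct (Req_dec p 0) as [->|Hp0]; [rewrite apow_0; lra|].
      rewrite Hpp, apow_pos by lra.
      assert (J := Rpower_gt1 p ((q - 1) / 2) ltac:(lra) ltac:(lra)). nra. }
    assert (J := Rpower_gt1 c ((1 + q) / 2 - 1) ltac:(lra) ltac:(lra)). split.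
    + eapply Rle_trans; [apply Rmin_l|lra].
    + eapply Rle_trans; [|apply Rmax_r].
      apply Rmult_le_reg_l with (1 - p); [lra|]. rewrite Ha, Rmult_comm.
      apply Rmult_le_compat_r; lra.
  - rewrite E. replace ((1 + 1) / 2 - 1) with 0 by field. rewrite Rpower_O by lra.
    split; [apply Rmin_l|apply Rmax_l].
  - assert (P : apow ((1 + q) / 2) p <= p).
    { destruct (Req_dec p 0) as [->|Hp0]; [rewrite apow_0; lra|].
      rewrite Hpp, apow_pos by lra.
      assert (J := Rpower_lt1 p ((q - 1) / 2) ltac:(lra) ltac:(lra)). nra. }
    assert (J := Rpower_lt1 c ((1 + q) / 2 - 1) ltac:(lra) ltac:(lra)). split.
    + eapply Rle_trans; [apply Rmin_r|].
      apply Rmult_le_reg_l with (1 - p); [lra|]. rewrite Ha, Rmult_comm.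
      apply Rmult_le_compat_l; lra.
    + eapply Rle_trans; [|apply Rmax_l]. lra.
Qed.

Lemma rho_gt0 (q p : R) : 0 < q -> 0 <= p <= 1 -> 0 < rho q p.
Proof.
  intros Hq Hp. eapply Rlt_le_trans; [|apply (rho_bounds q p Hq Hp)].
  apply Rmin_glb_lt; [lra|]. apply Rdiv_lt_0_compat; lra.
Qed.

Lemma sin_sq_bounds (y : R) : 0 <= sin y ^ 2 <= 1.
Proof. assert (H := SIN_bound y). nra. Qed.

(** The two thresholds are the reciprocals of the extreme values of [rho]. At [lam = 1] the
    amplitude would be an equilibrium; at [lam = (1 + q) / 2] the energy would vanish, as on the
    homoclinic orbit. *)
Lemma rho_admissible (q lam p : R) : 0 < q -> lam < Rmin 1 ((1 + q) / 2) -> 0 <= p <= 1 ->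
  0 < 1 - lam * rho q p.
Proof.
  intros Hq Hl Hp. assert (B := rho_bounds q p Hq Hp). assert (P := rho_gt0 q p Hq Hp).
  assert (L1 : lam < 1) by (eapply Rlt_le_trans; [exact Hl|apply Rmin_l]).
  assert (L2 : lam < (1 + q) / 2) by (eapply Rlt_le_trans; [exact Hl|apply Rmin_r]).
  destruct (Rle_lt_dec lam 0) as [H|H]; [nra|].
  destruct B as [_ B]. unfold Rmax in B. destruct (Rle_dec 1 (2 / (1 + q))) as [K|K]; [|nra].
  assert (J : lam * rho q p <= lam * (2 / (1 + q))) by (apply Rmult_le_compat_l; lra).
  assert (J' : lam * (2 / (1 + q)) < (1 + q) / 2 * (2 / (1 + q))).
  { apply Rmult_lt_compat_r; [apply Rdiv_lt_0_compat; lra|trivial]. }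
  replace ((1 + q) / 2 * (2 / (1 + q))) with 1 in J' by (field; lra). lra.
Qed.

(** Reciprocal of the angular speed in the representation [a sin phi]; by homogeneity it depends on
    the amplitude only through [lam]. *)
Definition slowness (q lam y : R) : R := / sqrt (1 - lam * rho q (sin y ^ 2)).

(* The period of a sign changing solution of amplitude [a], where
   [lam = eps * a^(q-1)]. *)
Definition sc_period (q lam : R) : R := RInt (slowness q lam) 0 (2 * PI).

Lemma continuous_rho_sin (q y : R) : 0 < q -> continuous (fun y => rho q (sin y ^ 2)) y.
Proof.
  intros Hq. apply (continuous_comp (fun y => sin y ^ 2) (rho q)).
  - apply (ex_derive_continuous (fun y => sin y ^ 2)). now auto_derive.
  - now apply continuous_rho.
Qed.

Lemma continuous_inv_sqrt (x : R) : 0 < x -> continuous (fun x => / sqrt x) x.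
Proof.
  intros H. apply (ex_derive_continuous (fun x => / sqrt x)). auto_derive.
  split; trivial. split; trivial. apply Rgt_not_eq. now apply sqrt_lt_R0.
Qed.

Lemma continuous_speed (q lam y : R) : 0 < q ->
  continuous (fun y => sqrt (1 - lam * rho q (sin y ^ 2))) y.
Proof.
  intros Hq. apply (continuous_comp (fun y => 1 - lam * rho q (sin y ^ 2)) sqrt).
  - apply (continuous_minus (fun _ => 1)); [apply continuous_const|].
    apply (continuous_scal_r lam (fun y => rho q (sin y ^ 2))). now apply continuous_rho_sin.
  - apply continuous_sqrt.
Qed.

Lemma continuous_slowness (q lam y : R) : 0 < q -> 0 < 1 - lam * rho q (sin y ^ 2) ->
  continuous (slowness q lam) y.
Proof.
  intros Hq H. apply (continuous_comp (fun y => 1 - lam * rho q (sin y ^ 2)) (fun x => / sqrt x)).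
  - apply (continuous_minus (fun _ => 1)); [apply continuous_const|].
    apply (continuous_scal_r lam (fun y => rho q (sin y ^ 2))). now apply continuous_rho_sin.
  - now apply continuous_inv_sqrt.
Qed.

Lemma slowness_gt0 (q lam y : R) : 0 < 1 - lam * rho q (sin y ^ 2) -> 0 < slowness q lam y.
Proof. intros H. apply Rinv_0_lt_compat. now apply sqrt_lt_R0. Qed.

Lemma slowness_lt (q lam mu y : R) : 0 < q -> lam < mu -> 0 < 1 - mu * rho q (sin y ^ 2) ->
  slowness q lam y < slowness q mu y.
Proof.
  intros Hq H K. assert (P := rho_gt0 q (sin y ^ 2) Hq (sin_sq_bounds y)).
  assert (L : 1 - mu * rho q (sin y ^ 2) < 1 - lam * rho q (sin y ^ 2)) by nra.
  apply Rinv_lt_contravar.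
  - apply Rmult_lt_0_compat; apply sqrt_lt_R0; lra.
  - apply sqrt_lt_1_alt. lra.
Qed.

Lemma sc_period_lt (q lam mu : R) : 0 < q -> lam < mu -> mu < Rmin 1 ((1 + q) / 2) ->
  sc_period q lam < sc_period q mu.
Proof.
  intros Hq H Hmu. assert (P := PI_RGT_0). apply RInt_lt; [lra| | |]; intros y _.
  - apply continuous_slowness; trivial. apply rho_admissible; trivial. apply sin_sq_bounds.
  - apply continuous_slowness; trivial. apply rho_admissible; trivial; [lra|apply sin_sq_bounds].
  - apply slowness_lt; trivial. apply rho_admissible; trivial. apply sin_sq_bounds.
Qed.

Lemma sc_period_0 (q : R) : sc_period q 0 = 2 * PI.
Proof.
  unfold sc_period. rewrite (RInt_ext _ (fun _ => 1)).
  - rewrite RInt_const. unfold scal; simpl; unfold mult; simpl. ring.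
  - intros y _. unfold slowness. rewrite Rmult_0_l, Rminus_0_r, sqrt_1. apply Rinv_1.
Qed.

Lemma continuous_sc_period (q lam : R) : 0 < q -> lam < Rmin 1 ((1 + q) / 2) ->
  continuous (sc_period q) lam.
Proof.
  intros Hq Hl. assert (P := PI_RGT_0). apply (RInt_param_continuous (slowness q)); [lra| |].
  - apply locally_R. exists (Rmin 1 ((1 + q) / 2) - lam). split; [lra|].
    intros mu Hmu. apply Rabs_def2 in Hmu. apply continuous_ex_RInt. intros y.
    apply continuous_slowness; trivial. apply rho_admissible; trivial; [lra|apply sin_sq_bounds].
  - intros y _. unfold slowness.
    apply (continuity_1d_2d_pt_comp (fun x => / sqrt x)
             (fun lam y => 1 - lam * rho q (sin y ^ 2)) lam y).
    + apply continuity_pt_filterlim, continuous_inv_sqrt.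
      apply rho_admissible; trivial. apply sin_sq_bounds.
    + apply (continuity_2d_pt_minus (fun _ _ => 1) (fun lam y => lam * rho q (sin y ^ 2))).
      * apply continuity_2d_pt_const.
      * apply (continuity_2d_pt_mult (fun lam _ => lam) (fun _ y => rho q (sin y ^ 2))).
        -- apply continuity_2d_pt_id1.
        -- apply (continuity_1d_2d_pt_comp (fun y => rho q (sin y ^ 2)) (fun _ y => y)).
           ++ apply continuity_pt_filterlim. now apply continuous_rho_sin.
           ++ apply continuity_2d_pt_id2.
Qed.

(** At a zero of [u] the product rule holds with [f] merely continuous. It serves at turning points
    and at the bottom of the well, where the second factor is a square root known only to be
    continuous. *)
Lemma is_derive_mult_zero (u f : R -> R) (x l : R) :
  is_derive u x l -> u x = 0 -> continuous f x -> is_derive (fun y => u y * f y) x (l * f x).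
Proof.
  intros Hu H0 Hf. rewrite is_derive_eps in Hu. apply is_derive_eps. intros e He.
  assert (Pf := Rabs_pos (f x)). assert (Pl := Rabs_pos l).
  set (e1 := e / (2 * (Rabs (f x) + 1))). set (e2 := Rmin 1 (e / (2 * (Rabs l + 1)))).
  assert (He1 : 0 < e1) by (apply Rdiv_lt_0_compat; lra).
  assert (He2 : 0 < e2) by (apply Rmin_glb_lt; [lra|apply Rdiv_lt_0_compat; lra]).
  destruct (Hu e1 He1) as [d1 [Hd1 D1]]. destruct (continuous_R f x e2 Hf He2) as [d2 [Hd2 D2]].
  exists (Rmin d1 d2). split; [now apply Rmin_glb_lt|]. intros y Hy.
  specialize (D1 y (Rlt_le_trans _ _ _ Hy (Rmin_l _ _))).
  specialize (D2 y (Rlt_le_trans _ _ _ Hy (Rmin_r _ _))).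
  rewrite H0 in *. rewrite Rminus_0_r in D1.
  assert (D2a : Rabs (f y - f x) < 1) by (eapply Rlt_le_trans; [exact D2|apply Rmin_l]).
  assert (D2b : Rabs (f y - f x) < e / (2 * (Rabs l + 1))).
  { eapply Rlt_le_trans; [exact D2|apply Rmin_r]. }
  replace (u y * f y - 0 * f x - l * f x * (y - x)) with
    (f y * (u y - l * (y - x)) + l * (f y - f x) * (y - x)) by ring.
  eapply Rle_trans; [apply Rabs_triang|]. rewrite !Rabs_mult.
  assert (Py := Rabs_pos (y - x)).
  assert (B1 : Rabs (f y) <= Rabs (f x) + 1).
  { replace (f y) with (f x + (f y - f x)) by ring.
    eapply Rle_trans; [apply Rabs_triang|]. lra. }
  assert (B2 : Rabs (f y) * Rabs (u y - l * (y - x)) <= e / 2 * Rabs (y - x)).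
  { apply Rle_trans with ((Rabs (f x) + 1) * (e1 * Rabs (y - x))).
    - apply Rmult_le_compat; try apply Rabs_pos; trivial.
    - unfold e1. right. field. lra. }
  assert (B3 : Rabs l * Rabs (f y - f x) <= e / 2).
  { apply Rle_trans with ((Rabs l + 1) * (e / (2 * (Rabs l + 1)))).
    - apply Rmult_le_compat; try apply Rabs_pos; lra.
    - right. field. lra. }
  nra.
Qed.

(** The difference of squares is divided by the sum [y t + y x], which is continuous and nonzero
    near [x]. *)
Lemma is_derive_of_square (y : R -> R) (x l : R) : continuous y x -> y x <> 0 ->
  is_derive (fun t => y t ^ 2) x l -> is_derive y x (l / (2 * y x)).
Proof.
  intros Hc H0 Hd.
  assert (D : is_derive (fun t => (y t ^ 2 - y x ^ 2) * / (y t + y x)) x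
                (l * / (y x + y x))).
  { apply (is_derive_mult_zero (fun t => y t ^ 2 - y x ^ 2) (fun t => / (y t + y x))).
    - evar_last; [apply (is_derive_minus_R (fun t => y t ^ 2) (fun _ => y x ^ 2)); [exact Hd|apply (is_derive_const (y x ^ 2))]|].
      unfold zero; simpl. ring.
    - ring.
    - apply (continuous_comp y (fun z => / (z + y x))); trivial.
      apply (ex_derive_continuous (fun z => / (z + y x))). auto_derive. lra. }
  replace (l / (2 * y x)) with (l * / (y x + y x) + 0) by (field; lra).
  apply is_derive_ext_loc with (fun t => (y t ^ 2 - y x ^ 2) * / (y t + y x) + y x).
  - assert (Hp : 0 < Rabs (y x)) by now apply Rabs_pos_lt.
    generalize (locally_continuous_ball y x _ Hc Hp). apply filter_imp. intros t Ht. eqR.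
    field. apply Rabs_def2 in Ht. unfold Rabs in Ht. destruct (Rcase_abs (y x)); lra.
  - apply (is_derive_plus_R _ (fun _ => y x)); trivial. apply (is_derive_const (y x)).
Qed.

(** Away from the turning points the squared velocity is, by [rho_spec], explicit in [sin y], and
    differentiating it avoids a derivative of [rho]. At [cos y = 0], where [rho] is defined by
    continuation, the product rule at a zero takes over. *)
Lemma is_derive_cos_speed (q lam y : R) : 0 < q -> 0 < 1 - lam * rho q (sin y ^ 2) ->
  is_derive (fun y => cos y * sqrt (1 - lam * rho q (sin y ^ 2))) y
    ((- sin y + lam * spow q (sin y)) * slowness q lam y).
Proof.
  intros Hq Hadm. unfold slowness. set (f := fun y => sqrt (1 - lam * rho q (sin y ^ 2))).
  change (is_derive (fun y => cos y * f y) y ((- sin y + lam * spow q (sin y)) * / f y)).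
  assert (Hf : 0 < f y) by now apply sqrt_lt_R0.
  assert (Hf2 : f y * f y = 1 - lam * rho q (sin y ^ 2)) by (apply sqrt_sqrt; lra).
  assert (Hcf : continuous f y) by now apply continuous_speed.
  assert (Hdc : is_derive cos y (- sin y)) by (auto_derive; trivial; ring).
  assert (Hds : is_derive sin y (cos y)) by (auto_derive; trivial; ring).
  assert (Hsc := sin2_cos2 y). unfold Rsqr in Hsc.
  destruct (Req_dec (cos y) 0) as [Hc|Hc].
  - evar_last; [apply is_derive_mult_zero; eassumption|]. eqR.
    assert (S1 : sin y ^ 2 = 1) by (rewrite Hc in Hsc; nra).
    rewrite S1, rho_1 in Hf2.
    assert (S2 : spow q (sin y) = sin y).
    { assert (E : (sin y - 1) * (sin y + 1) = 0) by nra.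
      apply Rmult_integral in E. destruct E as [E|E].
      - replace (sin y) with 1 by lra. apply spow_1.
      - replace (sin y) with (- (1)) by lra. now rewrite spow_opp, spow_1. }
    rewrite S2. apply Rmult_eq_reg_r with (f y); [|lra].
    rewrite !Rmult_assoc, Hf2, Rinv_l by lra. ring.
  - assert (Hy : continuous (fun y => cos y * f y) y).
    { apply (continuous_mult cos f); trivial. now apply (continuous_of_is_derive _ _ _ Hdc). }
    assert (Hn : cos y * f y <> 0) by (apply Rmult_integral_contrapositive; split; lra).
    evar_last.
    + apply (is_derive_of_square (fun y => cos y * f y)); trivial.
      apply is_derive_ext_loc with
        (fun y => 1 - sin y ^ 2 - lam * (2 / (1 + q)) * (1 - apow (1 + q) (sin y))).
      * assert (L : locally y (fun z => Rabs ((1 - lam * rho q (sin z ^ 2)) - (1 - lam * rho q (sin y ^ 2)))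
                     < 1 - lam * rho q (sin y ^ 2))).
        { apply (locally_continuous_ball (fun z => 1 - lam * rho q (sin z ^ 2))); trivial.
          apply (continuous_minus (fun _ => 1)); [apply continuous_const|].
          apply (continuous_scal_r lam (fun y => rho q (sin y ^ 2))). now apply continuous_rho_sin. }
        revert L. apply filter_imp. intros z Hz. eqR. apply Rabs_def2 in Hz.
        assert (F : f z * f z = 1 - lam * rho q (sin z ^ 2)) by (apply sqrt_sqrt; lra).
        replace ((cos z * f z) ^ 2) with (cos z * cos z * (f z * f z)) by ring. rewrite F.
        assert (C := sin2_cos2 z). unfold Rsqr in C.
        replace (cos z * cos z) with (1 - sin z ^ 2) by lra.
        assert (R := rho_spec q (sin z ^ 2) Hq).
        rewrite <- (apow_sq (sin z)) in R at 3. rewrite apow_apow in R.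
        replace (2 * ((1 + q) / 2)) with (1 + q) in R by field.
        rewrite (Rmult_assoc lam), <- R. ring.
      * apply is_derive_minus_R.
        -- apply is_derive_minus_R; [apply (is_derive_const 1)|]. apply is_derive_sq_R. exact Hds.
        -- apply is_derive_scal_R. apply is_derive_minus_R; [apply (is_derive_const 1)|].
           apply is_derive_comp_R; [now apply is_derive_apow_S|exact Hds].
    + eqR. unfold zero; simpl. field. repeat split; lra.
Qed.

(** The velocity of [a sin phi] is [a cos phi] times the angular speed. The phase origin is avoided
    because the speed is positive and sine and cosine have no common zero. *)
Lemma ex_sc_wave (eps q a lam : R) : 0 < q -> 0 < a -> lam = eps * apow (q - 1) a ->
  lam < Rmin 1 ((1 + q) / 2) ->
  exists x x1, osol eps q x x1 /\ x 0 = a /\ x1 0 = 0 /\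
    (forall t, ~ (x t = 0 /\ x1 t = 0)) /\ least_period (sc_period q lam) x /\
    sign_changing_O x /\
    (forall p, periodic p x -> exists n, p = INR (S n) * sc_period q lam).
Proof.
  intros Hq Ha El Hl.
  assert (Adm : forall y, 0 < 1 - lam * rho q (sin y ^ 2)).
  { intros y. apply rho_admissible; trivial. apply sin_sq_bounds. }
  destruct (ex_flow (slowness q lam)) as [phi Hphi].
  { intros y. now apply continuous_slowness. }
  { intros y. now apply slowness_gt0. }
  { intros y. unfold slowness. now rewrite sin_plus, sin_2PI, cos_2PI, Rmult_0_r, Rplus_0_r, Rmult_1_r. }
  fold (sc_period q lam) in Hphi. set (T := sc_period q lam) in *.
  set (f := fun y => sqrt (1 - lam * rho q (sin y ^ 2))).
  assert (Hf : forall y, 0 < f y) by (intros y; now apply sqrt_lt_R0).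
  destruct (wave_periods (slowness q lam) phi (fun s => a * s) T Hphi) as [W1 W2].
  { intros y. now apply slowness_gt0. }
  { intros s Hs. nra. }
  destruct Hphi as [HT [H0 [Hd Hp]]].
  exists (fun t => a * sin (phi t)), (fun t => a * (cos (phi t) * f (phi t))).
  assert (Hd' : forall t, is_derive phi t (f (phi t))).
  { intros t. evar_last; [apply Hd|]. unfold slowness. apply Rinv_inv. }
  refine (conj _ (conj _ (conj _ (conj _ (conj W1 (conj _ W2)))))).
  - intros t. split.
    + apply is_derive_scal_R. apply is_derive_comp_R; [|apply Hd'].
      auto_derive; trivial; ring.
    + evar_last.
      * apply is_derive_scal_R.
        apply (is_derive_comp_R (fun y => cos y * f y) phi); [|apply Hd'].
        apply is_derive_cos_speed; trivial.
      * eqR. unfold slowness. fold (f (phi t)). rewrite spow_mult.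
        replace (spow q a) with (a * apow (q - 1) a).
        2:{ rewrite apow_pos, spow_pos by trivial. rewrite <- (Rpower_1 a) at 1 by trivial.
            rewrite <- Rpower_plus. f_equal; ring. }
        rewrite El. field. specialize (Hf (phi t)). lra.
  - rewrite H0, sin_PI2. ring.
  - rewrite H0, cos_PI2. ring.
  - intros t [E1 E2]. assert (S := sin2_cos2 (phi t)). unfold Rsqr in S.
    specialize (Hf (phi t)).
    assert (Z1 : sin (phi t) = 0) by nra.
    assert (Z2 : cos (phi t) = 0).
    { apply Rmult_eq_reg_r with (f (phi t)); [|lra].
      apply Rmult_eq_reg_l with a; lra. }
    rewrite Z1, Z2 in S. lra.
  - split.
    { exists 0. rewrite H0, sin_PI2. lra. }
    (* The trough [3 PI / 2] is passed during the first turn, which runs from [PI / 2] to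
       [PI / 2 + 2 PI]. *)
    destruct (intermediate_value phi 0 T (3 * (PI / 2))) as [t [_ Ht]].
    + exact HT.
    + intros t _. exact (continuous_of_is_derive _ _ _ (Hd t)).
    + assert (E := Hp 0). rewrite Rplus_0_l, H0 in E. rewrite E, H0.
      assert (P := PI_RGT_0). lra.
    + exists t. rewrite Ht, sin_3PI2. lra.
Qed.

(** Comparison with an explicit primitive: [g] may be singular at the endpoints while [G] extends
    continuously, so that no improper integral appears. *)
Lemma RInt_between (K G g : R -> R) (a b : R) : a <= b -> (forall y, continuous K y) ->
  (forall y, a < y < b -> is_derive G y (g y)) -> (forall y, a <= y <= b -> continuous G y) ->
  (forall y, a < y < b -> K y <= g y) -> RInt K a b <= G b - G a.
Proof.
  intros Hab HK HG HC H.
  assert (J : G a - RInt K a a <= G b - RInt K a b).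
  { apply (derive_le (fun y => G y - RInt K a y) (fun y => g y - K y)); trivial.
    - intros y Hy. apply is_derive_minus_R; [now apply HG|now apply is_derive_primitive].
    - intros y Hy. apply (continuous_minus G (fun y => RInt K a y)); [now apply HC|].
      exact (continuous_of_is_derive _ _ _ (is_derive_primitive K a y HK)).
    - intros y Hy. specialize (H y Hy). lra. }
  rewrite RInt_point in J. unfold zero in J; simpl in J. lra.
Qed.

Lemma RInt_between_ge (K G g : R -> R) (a b : R) : a <= b -> (forall y, continuous K y) ->
  (forall y, a < y < b -> is_derive G y (g y)) -> (forall y, a <= y <= b -> continuous G y) ->
  (forall y, a < y < b -> g y <= K y) -> G b - G a <= RInt K a b.
Proof.
  intros Hab HK HG HC H.
  assert (J : RInt K a a - G a <= RInt K a b - G b).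
  { apply (derive_le (fun y => RInt K a y - G y) (fun y => K y - g y)); trivial.
    - intros y Hy. apply is_derive_minus_R; [now apply is_derive_primitive|now apply HG].
    - intros y Hy. apply (continuous_minus (fun y => RInt K a y) G); [|now apply HC].
      exact (continuous_of_is_derive _ _ _ (is_derive_primitive K a y HK)).
    - intros y Hy. specialize (H y Hy). lra. }
  rewrite RInt_point in J. unfold zero in J; simpl in J. lra.
Qed.

Lemma RInt_subinterval (K : R -> R) (a a' b' b : R) : a <= a' -> a' <= b' -> b' <= b ->
  (forall y, continuous K y) -> (forall y, 0 <= K y) -> RInt K a' b' <= RInt K a b.
Proof.
  intros H1 H2 H3 HK HP.
  assert (E : forall x y, ex_RInt K x y) by (intros; now apply continuous_ex_RInt).
  rewrite <- (RInt_Chasles K a a' b), <- (RInt_Chasles K a' b' b) by trivial.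
  assert (P1 := RInt_ge_0 K a a' H1 (E _ _) (fun y _ => HP y)).
  assert (P2 := RInt_ge_0 K b' b H3 (E _ _) (fun y _ => HP y)).
  unfold plus; simpl. lra.
Qed.

(** Continuity of the primitive carries a bound from all inner intervals to the whole one. It is
    applied when the function compared with [K] is under control only in the interior. *)
Lemma RInt_interior_le (K : R -> R) (x y c : R) : x < y -> (forall z, continuous K z) ->
  (forall a b, x < a -> a < b -> b < y -> RInt K a b <= c) -> RInt K x y <= c.
Proof.
  intros Hxy HK H. apply Rnot_lt_le. intros Hlt.
  pose (F := (fun z => RInt K x z) : R -> R).
  assert (HF : forall z, continuous F z).
  { intros z. exact (continuous_of_is_derive _ _ _ (is_derive_primitive K x z HK)). }
  set (e := (RInt K x y - c) / 2). assert (He : 0 < e) by (unfold e; lra).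
  destruct (continuous_R F x e (HF x) He) as [d1 [Hd1 D1]].
  destruct (continuous_R F y e (HF y) He) as [d2 [Hd2 D2]].
  set (d := Rmin (Rmin d1 d2) (y - x) / 3).
  assert (B : 0 < Rmin (Rmin d1 d2) (y - x)) by (repeat apply Rmin_glb_lt; lra).
  assert (B1 : Rmin (Rmin d1 d2) (y - x) <= d1) by (eapply Rle_trans; [apply Rmin_l|apply Rmin_l]).
  assert (B2 : Rmin (Rmin d1 d2) (y - x) <= d2) by (eapply Rle_trans; [apply Rmin_l|apply Rmin_r]).
  assert (B3 : Rmin (Rmin d1 d2) (y - x) <= y - x) by apply Rmin_r.
  assert (C1 := D1 (x + d) ltac:(apply Rabs_def1; unfold d; lra)).
  assert (C2 := D2 (y - d) ltac:(apply Rabs_def1; unfold d; lra)).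
  assert (C3 := H (x + d) (y - d) ltac:(unfold d; lra) ltac:(unfold d; lra) ltac:(unfold d; lra)).
  assert (C4 : F (y - d) = F (x + d) + RInt K (x + d) (y - d)).
  { symmetry. apply (RInt_Chasles K x (x + d) (y - d)); now apply continuous_ex_RInt. }
  assert (C5 : F x = 0) by exact (RInt_point x K).
  assert (C6 : F y = RInt K x y) by reflexivity.
  apply Rabs_def2 in C1. apply Rabs_def2 in C2. unfold e in *. lra.
Qed.

(** * The range of the periods of sign changing solutions *)

Lemma sc_period_quarter (q lam : R) : 0 < q -> lam < Rmin 1 ((1 + q) / 2) ->
  sc_period q lam = 4 * RInt (slowness q lam) 0 (PI / 2).
Proof.
  intros Hq Hl. set (k := fun s => / sqrt (1 - lam * rho q (s ^ 2))).
  assert (HC : forall y, continuous (slowness q lam) y).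
  { intros y. apply continuous_slowness; trivial. apply rho_admissible; trivial.
    apply sin_sq_bounds. }
  unfold sc_period. change (slowness q lam) with (fun y => k (sin y)).
  rewrite RInt_sin_quarter by exact HC.
  rewrite (RInt_ext (fun y => k (sin y) + k (- sin y)) (fun y => 2 * k (sin y))).
  - assert (E := RInt_scal (fun y => k (sin y)) 0 (PI / 2) 2
      (continuous_ex_RInt _ _ _ HC)).
    replace 4 with (2 * 2) by ring. rewrite Rmult_assoc. f_equal. exact E.
  - intros y _. eqR. unfold k. replace ((- sin y) ^ 2) with (sin y ^ 2) by ring. ring.
Qed.

Lemma sc_period_attained (q lam0 lam1 T : R) : 0 < q -> lam0 < lam1 ->
  lam1 < Rmin 1 ((1 + q) / 2) -> sc_period q lam0 <= T <= sc_period q lam1 ->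
  exists lam, lam0 <= lam <= lam1 /\ sc_period q lam = T.
Proof.
  intros Hq H Hl HT. apply intermediate_value; trivial.
  intros x Hx. apply continuous_sc_period; trivial. lra.
Qed.

Lemma sc_period_gt0 (q lam : R) : 0 < q -> lam < Rmin 1 ((1 + q) / 2) -> 0 < sc_period q lam.
Proof.
  intros Hq Hl. assert (P := PI_RGT_0). apply RInt_gt_0; [lra| |]; intros y _.
  - apply slowness_gt0. apply rho_admissible; trivial. apply sin_sq_bounds.
  - apply continuous_slowness; trivial. apply rho_admissible; trivial. apply sin_sq_bounds.
Qed.

Lemma sc_param_bound_gt0 (q : R) : 0 < q -> 0 < Rmin 1 ((1 + q) / 2).
Proof. intros Hq. apply Rmin_glb_lt; lra. Qed.

(** At [lam = - B] the angular speed is at least [sqrt (1 + B mu)], with [mu] the lower bound of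
    [rho], so large [B] gives short periods; [lam = 0] gives [2 PI], and continuity fills the
    gap. *)
Lemma sc_period_neg (q T : R) : 0 < q -> 0 < T < 2 * PI ->
  exists lam, lam < 0 /\ sc_period q lam = T.
Proof.
  intros Hq HT. assert (HP := PI_RGT_0). assert (Hb := sc_param_bound_gt0 q Hq).
  set (mu := Rmin 1 (2 / (1 + q))).
  assert (Hmu : 0 < mu) by (apply Rmin_glb_lt; [lra|apply Rdiv_lt_0_compat; lra]).
  set (r := 2 * PI / T). assert (Hr : 0 < r) by (apply Rdiv_lt_0_compat; lra).
  (* Then [B mu = r^2], and the angular speed is at least [r = 2 PI / T]. *)
  set (B := r ^ 2 / mu). assert (HB : 0 < B) by (apply Rdiv_lt_0_compat; [nra|trivial]).
  assert (Adm : forall y, 0 < 1 - (- B) * rho q (sin y ^ 2)).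
  { intros y. apply rho_admissible; trivial; [lra|apply sin_sq_bounds]. }
  destruct (sc_period_attained q (- B) 0 T) as [lam [Hl El]]; trivial; [lra| |].
  - rewrite sc_period_0. split; [|lra].
    replace T with (RInt (fun _ => / r) 0 (2 * PI)).
    + apply RInt_le; [lra| | |].
      * apply continuous_ex_RInt. intros y. now apply continuous_slowness.
      * apply ex_RInt_const.
      * intros y _. unfold slowness. apply Rinv_le_contravar; trivial.
        rewrite <- (sqrt_pow2 r) by lra. apply sqrt_le_1_alt.
        assert (J := proj1 (rho_bounds q _ Hq (sin_sq_bounds y))). fold mu in J.
        assert (E : B * mu = r ^ 2) by (unfold B; field; lra). nra.
    + rewrite RInt_const. change ((2 * PI - 0) * / r = T). unfold r. field. lra.
  - exists lam. split; trivial. destruct (Req_dec lam 0) as [->|E]; [|lra].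
    rewrite sc_period_0 in El. lra.
Qed.

Lemma pow_bernoulli (c : R) (n : nat) : 0 <= c <= 1 -> 1 - INR n * (1 - c) <= c ^ n.
Proof.
  intros Hc. induction n as [|n IH]; [simpl; lra|].
  rewrite S_INR. simpl.
  assert (P : 0 <= c ^ n <= 1).
  { split; [apply pow_le; lra|]. rewrite <- (pow1 n). apply pow_incr; lra. }
  nra.
Qed.

(** The mean value form [c^((q-1)/2)] is at least [c^n] for an integer [n] above the exponent, and
    Bernoulli's inequality applies to the latter. So [rho] reaches 1 at least at a linear rate,
    which makes the period diverge logarithmically at [lam = 1]. *)
Lemma rho_lower (q p : R) (n : nat) : 1 < q -> (1 + q) / 2 - 1 < INR n -> 0 <= p <= 1 ->
  1 - rho q p <= INR n * (1 - p).
Proof.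
  intros Hq Hn Hp. destruct (Req_dec p 1) as [->|Hp1].
  { rewrite rho_1; lra. }
  destruct (rho_mean q p ltac:(lra)) as [c [Hc E]]; [lra|].
  assert (B := pow_bernoulli c n ltac:(lra)). rewrite <- Rpower_pow in B by lra.
  replace (INR n) with (((1 + q) / 2 - 1) + (INR n - ((1 + q) / 2 - 1))) in B at 2 by ring.
  rewrite Rpower_plus in B.
  assert (J := Rpower_lt1 c (INR n - ((1 + q) / 2 - 1)) ltac:(lra) ltac:(lra)).
  assert (J' := Rpower_pos c ((1 + q) / 2 - 1)). nra.
Qed.

(** At [lam = 1 - e^2] the squared speed is at most [e^2 + n (PI/2 - y)^2], hence the speed at most
    [e + c (PI/2 - y)] with [c = sqrt n]. The reciprocal integrates to a logarithm that is unbounded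
    as [e] tends to 0. *)
Lemma sc_period_super (q T : R) : 1 < q -> 2 * PI < T ->
  exists lam, 0 < lam < 1 /\ sc_period q lam = T.
Proof.
  intros Hq HT. assert (HP := PI_RGT_0).
  assert (Eb : Rmin 1 ((1 + q) / 2) = 1) by (apply Rmin_left; lra).
  destruct (INR_archimed 1 ((1 + q) / 2 - 1) ltac:(lra)) as [n Hn]. rewrite Rmult_1_r in Hn.
  assert (Hn0 : 0 < INR n) by lra.
  set (c := sqrt (INR n)). assert (Hc : 0 < c) by now apply sqrt_lt_R0.
  assert (Hc2 : c * c = INR n) by (apply sqrt_sqrt; lra).
  set (B := exp (c * T)). assert (HB : 0 < B) by apply exp_pos.
  (* [e <= 1/2] keeps [lam] positive; the second bound gives [c (PI/2) / e >= exp (c T)], so that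
     the logarithm reaches [c T]. *)
  set (e := Rmin (1 / 2) (c * (PI / 2) / B)).
  assert (He : 0 < e).
  { apply Rmin_glb_lt; [lra|]. apply Rdiv_lt_0_compat; [nra|trivial]. }
  assert (He1 : e <= 1 / 2) by apply Rmin_l.
  assert (He2 : e * B <= c * (PI / 2)).
  { apply Rle_trans with (c * (PI / 2) / B * B).
    - apply Rmult_le_compat_r; [lra|apply Rmin_r].
    - right. field. lra. }
  set (lam := 1 - e ^ 2). assert (Hl : 0 < lam < 1) by (unfold lam; nra).
  assert (Adm : forall y, 0 < 1 - lam * rho q (sin y ^ 2)).
  { intros y. apply rho_admissible; [lra|rewrite Eb; lra|apply sin_sq_bounds]. }
  assert (L : T <= sc_period q lam).
  { rewrite sc_period_quarter by (rewrite ?Eb; lra).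
    set (G := fun y => - / c * ln (e + c * (PI / 2 - y))).
    assert (I : G (PI / 2) - G 0 <= RInt (slowness q lam) 0 (PI / 2)).
    { assert (Dg : forall y, y <= PI / 2 -> is_derive G y (/ (e + c * (PI / 2 - y)))).
      { intros y Hy. unfold G. assert (0 < e + c * (PI / 2 - y)) by nra. auto_derive; [trivial|].
        field. split; lra. }
      apply (RInt_between_ge _ G (fun y => / (e + c * (PI / 2 - y)))); [lra| | | |].
      - intros y. apply continuous_slowness; [lra|trivial].
      - intros y Hy. apply Dg; lra.
      - intros y Hy. exact (continuous_of_is_derive _ _ _ (Dg y (proj2 Hy))).
      - intros y Hy. unfold slowness. apply Rinv_le_contravar; [now apply sqrt_lt_R0|].
        assert (P0 : 0 < e + c * (PI / 2 - y)) by nra.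
        rewrite <- (sqrt_pow2 (e + c * (PI / 2 - y))) by lra. apply sqrt_le_1_alt.
        assert (R1 := rho_lower q _ n Hq Hn (sin_sq_bounds y)).
        assert (R2 := proj2 (rho_bounds q _ ltac:(lra) (sin_sq_bounds y))).
        rewrite Rmax_left in R2.
        2:{ apply Rmult_le_reg_r with (1 + q); [lra|]. unfold Rdiv.
            rewrite Rmult_assoc, Rinv_l; lra. }
        assert (R3 : 1 - sin y ^ 2 <= (PI / 2 - y) ^ 2).
        { assert (S := sin2_cos2 y). unfold Rsqr in S. rewrite <- sin_shift in S.
          assert (S1 := sin_lt_x (PI / 2 - y) ltac:(lra)).
          assert (S2 := sin_ge_0 (PI / 2 - y) ltac:(lra) ltac:(lra)). nra. }
        assert (R4 : lam * (1 - rho q (sin y ^ 2)) <= INR n * (PI / 2 - y) ^ 2).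
        { apply Rle_trans with (1 - rho q (sin y ^ 2)); [nra|].
          eapply Rle_trans; [exact R1|]. apply Rmult_le_compat_l; lra. }
        assert (P1 : 0 < e * (c * (PI / 2 - y))) by (apply Rmult_lt_0_compat; nra).
        unfold lam in *. nra. }
    assert (I2 : c * T <= ln (e + c * (PI / 2)) - ln e).
    { rewrite <- (ln_exp (c * T)). fold B. rewrite <- ln_div by (try nra).
      apply Rcomplements.ln_le; trivial.
      apply Rmult_le_reg_r with e; trivial.
      replace ((e + c * (PI / 2)) / e * e) with (e + c * (PI / 2)) by (field; lra). nra. }
    unfold G in I. replace (PI / 2 - PI / 2) with 0 in I by ring.
    rewrite Rmult_0_r, Rplus_0_r, Rminus_0_r in I.
    assert (I3 : T <= / c * (ln (e + c * (PI / 2)) - ln e)).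
    { apply Rmult_le_reg_l with c; trivial.
      rewrite <- Rmult_assoc, Rinv_r, Rmult_1_l by lra. exact I2. }
    lra. }
  destruct (sc_period_attained q 0 lam T) as [mu [Hmu Emu]]; [lra|lra|rewrite Eb; lra| |].
  - rewrite sc_period_0. lra.
  - exists mu. split; trivial. destruct (Req_dec mu 0) as [->|E]; [|lra].
    rewrite sc_period_0 in Emu. lra.
Qed.

Lemma is_derive_asin (x : R) : -1 < x < 1 -> is_derive asin x (/ sqrt (1 - x ^ 2)).
Proof.
  intros Hx. apply is_derive_Reals. rewrite <- Rsqr_pow2.
  replace (/ sqrt (1 - Rsqr x)) with (derive_pt asin x (derivable_pt_asin x Hx)).
  - apply derive_pt_eq_1 with (derivable_pt_asin x Hx). reflexivity.
  - rewrite derive_pt_asin. unfold Rdiv. ring.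
Qed.

(* The time needed by the homoclinic orbit to rise from [0] to [s] times its maximal height. *)
Definition rise_time (q s : R) : R := 2 / (1 - q) * asin (apow ((1 - q) / 2) s).

Lemma apow_sub_sq_gt0 (q s : R) : 0 < q < 1 -> 0 < s < 1 -> 0 < apow (1 + q) s - s ^ 2.
Proof.
  intros Hq Hs. rewrite <- apow_sq. replace 2 with (1 + q + (1 - q)) by ring.
  rewrite (apow_plus (1 + q)). assert (P := apow_gt0 (1 + q) s ltac:(lra)).
  assert (J := apow_lt1 (1 - q) s ltac:(lra) ltac:(lra)). nra.
Qed.

(** On the homoclinic orbit the relative height satisfies [s'^2 = s^(1+q) - s^2]. The substitution
    [z = s^((1-q)/2)] turns the separated equation into that of the arcsine. *)
Lemma is_derive_rise_time (q s : R) : 0 < q < 1 -> 0 < s < 1 ->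
  is_derive (rise_time q) s (/ sqrt (apow (1 + q) s - s ^ 2)).
Proof.
  intros Hq Hs. set (w := (1 - q) / 2). set (z := apow w s). set (r := spow (w - 1) s).
  set (v := apow (1 + q) s - s ^ 2).
  assert (Hz : 0 < z < 1).
  { split; [apply apow_gt0; lra|]. apply apow_lt1; unfold w; lra. }
  assert (Hr : 0 < r) by now apply spow_gt0.
  assert (Ez : z = s * r) by reflexivity.
  assert (Er : r * r * apow (1 + q) s = 1).
  { unfold r. rewrite spow_pos, apow_pos by lra. rewrite <- !Rpower_plus.
    replace (w - 1 + (w - 1) + (1 + q)) with 0 by (unfold w; field). apply Rpower_O; lra. }
  assert (E : r * r * v = 1 - z ^ 2).
  { unfold v. rewrite Rmult_minus_distr_l, Er, Ez. ring. }
  assert (Hv : 0 < v) by now apply apow_sub_sq_gt0.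
  unfold rise_time. evar_last.
  - apply is_derive_scal_R. apply (is_derive_comp_R asin (apow w)).
    + apply is_derive_asin. fold z. lra.
    + apply is_derive_apow_neq0. lra.
  - eqR. fold z. fold r.
    assert (Es : sqrt (1 - z ^ 2) = r * sqrt v).
    { rewrite <- E. rewrite sqrt_mult by nra. rewrite sqrt_square by lra. reflexivity. }
    assert (Hsv : 0 < sqrt v) by now apply sqrt_lt_R0.
    rewrite Es. unfold w. field. repeat split; lra.
Qed.

Lemma rise_time_bounds (q s : R) : 0 < q < 1 -> 0 < s < 1 ->
  0 <= rise_time q s <= PI / (1 - q).
Proof.
  intros Hq Hs. unfold rise_time.
  assert (Hz : 0 < apow ((1 - q) / 2) s < 1).
  { split; [apply apow_gt0; lra|]. apply apow_lt1; lra. }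
  assert (A := asin_bound (apow ((1 - q) / 2) s)).
  assert (A0 : 0 <= asin (apow ((1 - q) / 2) s)).
  { rewrite asin_atan by lra. rewrite <- atan_0.
    apply Rlt_le, atan_increasing. apply Rdiv_lt_0_compat; [lra|]. apply sqrt_lt_R0.
    unfold Rsqr; nra. }
  assert (H2 : 0 < 2 / (1 - q)) by (apply Rdiv_lt_0_compat; lra).
  split; [nra|]. replace (PI / (1 - q)) with (2 / (1 - q) * (PI / 2)) by (field; lra).
  apply Rmult_le_compat_l; lra.
Qed.

Lemma sin_quarter (y : R) : 0 < y < PI / 2 -> 0 < sin y < 1 /\ 0 < cos y.
Proof.
  intros Hy. assert (S := sin2_cos2 y). unfold Rsqr in S.
  assert (S1 := sin_gt_0 y ltac:(lra) ltac:(lra)).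
  assert (C1 := cos_gt_0 y ltac:(lra) ltac:(lra)). repeat split; trivial. nra.
Qed.

Lemma rise_time_surj (q t : R) : 0 < q < 1 -> 0 < t < PI / (1 - q) ->
  exists s, 0 < s < 1 /\ rise_time q s = t.
Proof.
  intros Hq Ht. set (w := (1 - q) / 2). assert (Hw : 0 < w) by (unfold w; lra).
  assert (Hwt : 0 < w * t < PI / 2).
  { split; [nra|]. apply Rmult_lt_reg_l with (/ w); [now apply Rinv_0_lt_compat|].
    rewrite <- Rmult_assoc, Rinv_l, Rmult_1_l by lra.
    replace (/ w * (PI / 2)) with (PI / (1 - q)) by (unfold w; field; lra). lra. }
  destruct (sin_quarter _ Hwt) as [S C].
  assert (Hw' : 0 < / w) by now apply Rinv_0_lt_compat.
  exists (apow (/ w) (sin (w * t))). split.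
  - split; [apply apow_gt0; lra|]. apply apow_lt1; lra.
  - unfold rise_time. rewrite apow_apow. fold w. rewrite Rinv_l by lra.
    rewrite apow_pos by lra. rewrite Rpower_1 by lra. rewrite asin_sin by lra.
    unfold w. field. lra.
Qed.

Lemma asin_quarter (s : R) : 0 < s < 1 -> 0 < asin s < PI / 2.
Proof.
  intros Hs. assert (B := asin_bound_lt s ltac:(lra)).
  assert (Ss : sin (asin s) = s) by (apply sin_asin; lra).
  split; [|lra]. apply Rnot_le_lt. intros Hle.
  assert (0 <= sin (- asin s)); [|rewrite sin_neg in *; lra].
  apply sin_ge_0; lra.
Qed.

(** The same time in the angle with [s = sin y], a primitive of the slowness at the critical value
    [lam = (1 + q) / 2], which is singular at [y = 0]. *)
Definition homoclinic_time (q y : R) : R := rise_time q (sin y).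

(** At the critical parameter the constants cancel in [cos^2 y (1 - lam rho (sin^2 y))], which
    becomes [s^(1+q) - s^2] with [s = sin y]. *)
Lemma is_derive_homoclinic_time (q y : R) : 0 < q < 1 -> 0 < y < PI / 2 ->
  0 < 1 - (1 + q) / 2 * rho q (sin y ^ 2) /\
  is_derive (homoclinic_time q) y (slowness q ((1 + q) / 2) y).
Proof.
  intros Hq Hy. destruct (sin_quarter y Hy) as [[S0 S1] C0].
  assert (SC := sin2_cos2 y). unfold Rsqr in SC.
  set (v := 1 - (1 + q) / 2 * rho q (sin y ^ 2)).
  assert (Ev : cos y * cos y * v = apow (1 + q) (sin y) - sin y ^ 2).
  { replace (cos y * cos y) with (1 - sin y ^ 2) by lra. unfold v.
    assert (R := rho_spec q (sin y ^ 2) ltac:(lra)).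
    rewrite <- (apow_sq (sin y)) in R at 3. rewrite apow_apow in R.
    replace (2 * ((1 + q) / 2)) with (1 + q) in R by field.
    replace ((1 - sin y ^ 2) * (1 - (1 + q) / 2 * rho q (sin y ^ 2))) with
      ((1 - sin y ^ 2) - (1 + q) / 2 * ((1 - sin y ^ 2) * rho q (sin y ^ 2))) by ring.
    rewrite R. field. lra. }
  assert (Hn := apow_sub_sq_gt0 q (sin y) Hq ltac:(lra)).
  assert (Hv : 0 < v).
  { apply Rmult_lt_reg_l with (cos y * cos y); [nra|]. lra. }
  split; trivial. unfold homoclinic_time. evar_last.
  - apply (is_derive_comp_R (rise_time q) sin).
    + apply is_derive_rise_time; trivial; lra.
    + auto_derive; trivial.
  - eqR. unfold slowness. fold v. rewrite <- Ev.
    rewrite sqrt_mult by nra. rewrite sqrt_square by lra.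
    assert (Hsv : 0 < sqrt v) by now apply sqrt_lt_R0. field. split; lra.
Qed.

Lemma homoclinic_time_bounds (q y : R) : 0 < q < 1 -> 0 < y < PI / 2 ->
  0 <= homoclinic_time q y <= PI / (1 - q).
Proof. intros Hq Hy. apply rise_time_bounds; trivial. apply (sin_quarter y Hy). Qed.

Lemma homoclinic_time_surj (q t : R) : 0 < q < 1 -> 0 < t < PI / (1 - q) ->
  exists y, 0 < y < PI / 2 /\ homoclinic_time q y = t.
Proof.
  intros Hq Ht. destruct (rise_time_surj q t Hq Ht) as [s [Hs E]].
  exists (asin s). split; [now apply asin_quarter|].
  unfold homoclinic_time. rewrite sin_asin; lra.
Qed.

Lemma homoclinic_time_lt (q y1 y2 : R) : 0 < q < 1 -> 0 < y1 < PI / 2 -> 0 < y2 < PI / 2 ->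
  homoclinic_time q y1 < homoclinic_time q y2 -> y1 < y2.
Proof.
  intros Hq H1 H2 H. apply Rnot_le_lt. intros Hle. apply Rlt_not_le in H. apply H.
  apply (derive_le (homoclinic_time q) (slowness q ((1 + q) / 2)) y2 y1); trivial.
  - intros x Hx. apply is_derive_homoclinic_time; lra.
  - intros x Hx.
    exact (continuous_of_is_derive _ _ _ (proj2 (is_derive_homoclinic_time q x Hq ltac:(lra)))).
  - intros x Hx. apply Rlt_le, slowness_gt0. apply is_derive_homoclinic_time; lra.
Qed.

(** Comparison with the homoclinic slowness on inner intervals bounds the quarter period by
    [PI / (1 - q)], without strictness. A parameter halfway to the critical one, together with
    strict monotonicity, makes the bound strict. *)
Lemma sc_period_sub_lt (q lam : R) : 0 < q < 1 -> lam < (1 + q) / 2 ->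
  sc_period q lam < 4 * PI / (1 - q).
Proof.
  intros Hq Hl. assert (HP := PI_RGT_0).
  assert (Eb : Rmin 1 ((1 + q) / 2) = (1 + q) / 2) by (apply Rmin_right; lra).
  assert (L : forall mu, mu < (1 + q) / 2 -> sc_period q mu <= 4 * PI / (1 - q)).
  { intros mu Hmu. rewrite sc_period_quarter by (rewrite ?Eb; lra).
    replace (4 * PI / (1 - q)) with (4 * (PI / (1 - q))) by (field; lra).
    apply Rmult_le_compat_l; [lra|].
    assert (HC : forall y, continuous (slowness q mu) y).
    { intros y. apply continuous_slowness; [lra|]. apply rho_admissible; rewrite ?Eb; try lra.
      apply sin_sq_bounds. }
    apply RInt_interior_le; trivial; [lra|]. intros a b Ha Hab Hb.
    apply Rle_trans with (homoclinic_time q b - homoclinic_time q a).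
    - apply (RInt_between _ _ (slowness q ((1 + q) / 2))); trivial; [lra| | |].
      + intros y Hy. apply is_derive_homoclinic_time; lra.
      + intros y Hy. exact (continuous_of_is_derive _ _ _
          (proj2 (is_derive_homoclinic_time q y Hq ltac:(lra)))).
      + intros y Hy. apply Rlt_le, slowness_lt; [lra|lra|].
        apply is_derive_homoclinic_time; lra.
    - assert (Ba := homoclinic_time_bounds q a Hq ltac:(lra)).
      assert (Bb := homoclinic_time_bounds q b Hq ltac:(lra)). lra. }
  apply Rlt_le_trans with (sc_period q ((lam + (1 + q) / 2) / 2)).
  - apply sc_period_lt; rewrite ?Eb; lra.
  - apply L. lra.
Qed.

(** A compact part [[y1, y2]] of the quarter turn carries all but [2 d] of the homoclinic time.
    There the critical speed is bounded away from 0, so for [lam] close to critical the time spent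
    is nearly the same. *)
Lemma sc_period_sub (q T : R) : 0 < q < 1 -> 2 * PI < T < 4 * PI / (1 - q) ->
  exists lam, 0 < lam < (1 + q) / 2 /\ sc_period q lam = T.
Proof.
  intros Hq HT. assert (HP := PI_RGT_0).
  assert (Eb : Rmin 1 ((1 + q) / 2) = (1 + q) / 2) by (apply Rmin_right; lra).
  set (L := PI / (1 - q)). assert (EL : 4 * PI / (1 - q) = 4 * L) by (unfold L; field; lra).
  (* With this [d], [4 (L - 2 d) - T = 8 d > 0]: cutting off a time [d] at both ends leaves more
     than [T / 4]. *)
  rewrite EL in HT. set (d := (4 * L - T) / 16).
  destruct (homoclinic_time_surj q d Hq) as [y1 [Y1 E1]]; [fold L; unfold d; lra|].
  destruct (homoclinic_time_surj q (L - d) Hq) as [y2 [Y2 E2]]; [fold L; unfold d; lra|].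
  assert (Y12 : y1 < y2).
  { apply (homoclinic_time_lt q); trivial. rewrite E1, E2. unfold d; lra. }
  set (v := fun y => 1 - (1 + q) / 2 * rho q (sin y ^ 2)).
  destruct (continuity_ab_min v y1 y2 (Rlt_le _ _ Y12)) as [y0 [V0 Hy0]].
  { intros y _. apply continuity_pt_filterlim.
    apply (continuous_minus (fun _ => 1)); [apply continuous_const|].
    apply (continuous_scal_r ((1 + q) / 2) (fun y => rho q (sin y ^ 2))).
    apply continuous_rho_sin; lra. }
  assert (Hv0 : 0 < v y0) by (apply is_derive_homoclinic_time; lra).
  (* The relative slack: [4 (L - 2 d) / (1 + e) = T]. *)
  set (e := 4 * (L - 2 * d) / T - 1).
  assert (He : 0 < e).
  { unfold e. assert (1 < 4 * (L - 2 * d) / T); [|lra].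
    apply Rmult_lt_reg_r with T; [lra|].
    replace (4 * (L - 2 * d) / T * T) with (4 * (L - 2 * d)) by (field; lra). unfold d; lra. }
  set (k := 2 / (1 + q)). assert (Hk : 1 < k).
  { unfold k. apply Rmult_lt_reg_r with (1 + q); [lra|].
    replace (2 / (1 + q) * (1 + q)) with 2 by (field; lra). lra. }
  (* Since [rho <= k] and [v y0] is the minimum of [v] on [[y1, y2]], this decrease of the parameter
     raises the squared speed [v] at most to [(1 + e) v], and so the speed at most by the factor
     [1 + e]. *)
  set (lam := (1 + q) / 2 - e * v y0 / k).
  assert (Hl : lam < (1 + q) / 2).
  { unfold lam. assert (0 < e * v y0 / k); [|lra]. apply Rdiv_lt_0_compat; [nra|lra]. }
  assert (Adm : forall y, 0 < 1 - lam * rho q (sin y ^ 2)).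
  { intros y. apply rho_admissible; rewrite ?Eb; try lra. apply sin_sq_bounds. }
  assert (HC : forall y, continuous (slowness q lam) y).
  { intros y. apply continuous_slowness; [lra|trivial]. }
  assert (HL : T <= sc_period q lam).
  { rewrite sc_period_quarter by (rewrite ?Eb; lra).
    assert (I1 : RInt (slowness q lam) y1 y2 <= RInt (slowness q lam) 0 (PI / 2)).
    { apply RInt_subinterval; trivial; try lra. intros y. now apply Rlt_le, slowness_gt0. }
    assert (I2 : / (1 + e) * homoclinic_time q y2 - / (1 + e) * homoclinic_time q y1
                  <= RInt (slowness q lam) y1 y2).
    { assert (Dt : forall y, y1 <= y <= y2 -> is_derive (fun y => / (1 + e) * homoclinic_time q y) y
                     (/ (1 + e) * slowness q ((1 + q) / 2) y)).
      { intros y Hy. apply is_derive_scal_R. apply is_derive_homoclinic_time; lra. }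
      apply (RInt_between_ge _ (fun y => / (1 + e) * homoclinic_time q y)
               (fun y => / (1 + e) * slowness q ((1 + q) / 2) y)); trivial; [lra| | |].
      - intros y Hy. apply Dt; lra.
      - intros y Hy. exact (continuous_of_is_derive _ _ _ (Dt y Hy)).
      - intros y Hy. assert (Vy := V0 y ltac:(lra)).
        assert (R2 := proj2 (rho_bounds q _ ltac:(lra) (sin_sq_bounds y))). fold k in R2.
        rewrite Rmax_right in R2 by lra.
        unfold slowness. fold (v y). rewrite <- Rinv_mult.
        assert (Hsv : 0 < sqrt (v y)) by (apply sqrt_lt_R0; lra).
        apply Rinv_le_contravar; [now apply sqrt_lt_R0|].
        apply Rle_trans with (sqrt ((1 + e) ^ 2 * v y)).
        + apply sqrt_le_1_alt.
          assert (J : 1 - lam * rho q (sin y ^ 2) = v y + e * v y0 / k * rho q (sin y ^ 2)).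
          { unfold lam, v. ring. }
          rewrite J.
          assert (J2 : e * v y0 / k * rho q (sin y ^ 2) <= e * v y0 / k * k).
          { apply Rmult_le_compat_l; trivial. apply Rlt_le, Rdiv_lt_0_compat; [nra|lra]. }
          replace (e * v y0 / k * k) with (e * v y0) in J2 by (field; lra).
          assert (J3 : e * v y0 <= e * v y) by (apply Rmult_le_compat_l; lra).
          assert (J4 : 0 <= e ^ 2 * v y) by (apply Rmult_le_pos; nra). nra.
        + rewrite sqrt_mult by nra. rewrite sqrt_pow2 by lra. lra. }
    rewrite E1, E2 in I2.
    assert (I3 : T = 4 * (/ (1 + e) * (L - d) - / (1 + e) * d)).
    { unfold e. field. split; [lra|]. unfold d; lra. }
    lra. }
  assert (Hl0 : 0 < lam).
  { apply Rnot_le_lt. intros [H|H].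
    - assert (J := sc_period_lt q lam 0 ltac:(lra) H ltac:(rewrite Eb; lra)).
      rewrite sc_period_0 in J. lra.
    - rewrite H, sc_period_0 in HL. lra. }
  destruct (sc_period_attained q 0 lam T) as [mu [Hmu Emu]]; [lra|lra|rewrite Eb; lra| |].
  - rewrite sc_period_0. lra.
  - exists mu. split; trivial. destruct (Req_dec mu 0) as [->|E]; [|lra].
    rewrite sc_period_0 in Emu. lra.
Qed.

(** * Extrema of periodic functions and the normal form of sign changing solutions *)

Lemma periodic_multZ (p : R) (x : R -> R) (n : Z) :
  (forall t, x (t + p) = x t) -> forall t, x (t + IZR n * p) = x t.
Proof.
  intros H t. destruct (Z_le_gt_dec 0 n) as [Hn|Hn].
  - rewrite <- (Z2Nat.id n Hn), <- INR_IZR_INZ. now apply periodic_mult.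
  - set (m := Z.to_nat (- n)).
    assert (E : IZR n = - INR m).
    { unfold m. rewrite INR_IZR_INZ, Z2Nat.id by lia. rewrite opp_IZR. ring. }
    rewrite E. rewrite <- (periodic_mult p x m H (t + - INR m * p)). f_equal; ring.
Qed.

Lemma periodic_reduce (p : R) (x : R -> R) (t : R) : 0 < p ->
  (forall t, x (t + p) = x t) -> exists t', 0 <= t' < p /\ x t' = x t /\ exists n, t' = t + IZR n * p.
Proof.
  intros Hp H. destruct (base_Int_part (t / p)) as [B1 B2].
  set (n := Int_part (t / p)) in *.
  assert (E : t = t / p * p) by (field; lra).
  exists (t + IZR (- n) * p). split; [|split; [now apply periodic_multZ|now exists (- n)%Z]].
  rewrite opp_IZR. split; [nra|].
  assert (t / p < IZR n + 1) by lra. nra.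
Qed.

Lemma periodic_max (p : R) (f : R -> R) : 0 < p -> (forall t, f (t + p) = f t) ->
  (forall t, continuous f t) -> exists t0, forall t, f t <= f t0.
Proof.
  intros Hp H HC. destruct (continuity_ab_maj f 0 p (Rlt_le _ _ Hp)) as [t0 [M _]].
  { intros t _. apply continuity_pt_filterlim, HC. }
  exists t0. intros t. destruct (periodic_reduce p f t Hp H) as [t' [Ht' [E _]]].
  rewrite <- E. apply M; lra.
Qed.

Lemma max_derive_0 (f : R -> R) (t0 l : R) : is_derive f t0 l ->
  (forall t, f t <= f t0) -> l = 0.
Proof.
  intros Hd H. rewrite is_derive_eps in Hd. apply Rminus_diag_uniq. rewrite Rminus_0_r.
  destruct (Req_dec l 0) as [E|E]; trivial. exfalso.
  assert (Pl := Rabs_pos_lt l E).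
  destruct (Hd (Rabs l / 2)) as [d [Hd0 D]]; [lra|].
  assert (Sg : exists s, Rabs s = 1 /\ l * s = Rabs l).
  { unfold Rabs at 2. destruct (Rcase_abs l).
    - exists (-1). split; [rewrite Rabs_left; lra|ring].
    - exists 1. split; [apply Rabs_R1|ring]. }
  destruct Sg as [s [S1 S2]].
  specialize (D (t0 + s * (d / 2))). specialize (H (t0 + s * (d / 2))).
  replace (t0 + s * (d / 2) - t0) with (s * (d / 2)) in D by ring.
  rewrite Rabs_mult, S1, (Rabs_pos_eq (d / 2)) in D by lra. specialize (D ltac:(lra)).
  replace (l * (s * (d / 2))) with (Rabs l * (d / 2)) in D by (rewrite <- S2; ring).
  assert (J := Rle_abs (- (f (t0 + s * (d / 2)) - f t0 - Rabs l * (d / 2)))).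
  rewrite Rabs_Ropp in J. nra.
Qed.

(** A positive second derivative at a critical point would make [f] increase to its right. *)
Lemma max_second_derive (f f1 : R -> R) (t0 l : R) : (forall t, is_derive f t (f1 t)) ->
  is_derive f1 t0 l -> (forall t, f t <= f t0) -> l <= 0.
Proof.
  intros Hd Hl H. assert (E := max_derive_0 f t0 _ (Hd t0) H).
  apply Rnot_lt_le. intros Hp. rewrite is_derive_eps in Hl.
  destruct (Hl (l / 2)) as [d [Hd0 D]]; [lra|].
  assert (L : f t0 < f (t0 + d / 2)).
  { apply (derive_lt f f1); [lra| | |].
    - intros x _. apply Hd.
    - intros x _. exact (continuous_of_is_derive _ _ _ (Hd x)).
    - intros x Hx. specialize (D x). rewrite E, Rminus_0_r in D.
      rewrite (Rabs_pos_eq (x - t0)) in D by lra. specialize (D ltac:(lra)).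
      assert (J := Rle_abs (- (f1 x - l * (x - t0)))). rewrite Rabs_Ropp in J. nra. }
  specialize (H (t0 + d / 2)). lra.
Qed.

Lemma spow_eq_mul_apow (q a : R) : 0 < a -> spow q a = a * apow (q - 1) a.
Proof.
  intros Ha. rewrite apow_pos, spow_pos by trivial. rewrite <- (Rpower_1 a) at 2 by trivial.
  rewrite <- Rpower_plus. f_equal; ring.
Qed.

Lemma osol_const (eps q a : R) : eps * spow q a - a = 0 -> osol eps q (fun _ => a) (fun _ => 0).
Proof.
  intros H t. rewrite H. split; [apply (is_derive_const a)|apply (is_derive_const 0)].
Qed.

Lemma continuous_Rabs_comp (f : R -> R) (t : R) :
  continuous f t -> continuous (fun t => Rabs (f t)) t.
Proof. intros H. apply (continuous_comp f Rabs); trivial. apply continuous_Rabs. Qed.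

(** The crest is a maximum of [|x|], turned upward by [s]. The second derivative there gives
    [lam <= 1], and equality would force the constant solution by uniqueness. The energy is positive
    at a zero crossed with nonzero speed; read at the crest, this is [lam < (1 + q) / 2]. *)
Lemma sc_crest (eps q p : R) (x x1 : R -> R) : 0 < q -> osol eps q x x1 -> periodic p x ->
  sign_changing_O x -> (forall t, ~ (x t = 0 /\ x1 t = 0)) ->
  exists t0 s a, (s = 1 \/ s = -1) /\ 0 < a /\ s * x t0 = a /\ s * x1 t0 = 0 /\
    eps * apow (q - 1) a < Rmin 1 ((1 + q) / 2).
Proof.
  intros Hq Hx [Hp Hper] [[tp Htp] [tn Htn]] Hnd.
  assert (Cx := fun t => proj1 (osol_continuous _ _ _ _ t Hx)).
  destruct (periodic_max p (fun t => Rabs (x t)) Hp) as [t0 M].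
  { intros t. now rewrite Hper. }
  { intros t. apply continuous_Rabs_comp, Cx. }
  simpl in M.
  assert (Sg : exists s, (s = 1 \/ s = -1) /\ s * x t0 = Rabs (x t0)).
  { unfold Rabs. destruct (Rcase_abs (x t0)).
    - exists (-1). split; [now right|ring].
    - exists 1. split; [now left|ring]. }
  destruct Sg as [s [Hs Es]]. set (a := Rabs (x t0)) in *.
  assert (Ha : 0 < a).
  { apply Rlt_le_trans with (Rabs (x tp)); [apply Rabs_pos_lt; lra|apply M]. }
  assert (Hy : osol eps q (fun t => s * x t) (fun t => s * x1 t)).
  { intros t. destruct (Hx t) as [H0 H1]. split; [now apply is_derive_scal_R|].
    evar_last; [apply is_derive_scal_R; exact H1|]. eqR.
    destruct Hs as [-> | ->]; [rewrite !Rmult_1_l; ring|].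
    replace (-1 * x t) with (- x t) by ring. rewrite spow_opp. ring. }
  assert (My : forall t, s * x t <= s * x t0).
  { intros t. rewrite Es. apply Rle_trans with (Rabs (x t)); [|apply M]. eapply Rle_trans; [apply Rle_abs|].
    rewrite Rabs_mult. replace (Rabs s) with 1; [lra|].
    destruct Hs as [-> | ->]; unfold Rabs; destruct (Rcase_abs _); lra. }
  assert (E1 := max_derive_0 _ t0 _ (proj1 (Hy t0)) My).
  assert (E2 := max_second_derive _ _ t0 _ (fun t => proj1 (Hy t)) (proj2 (Hy t0)) My).
  simpl in E1, E2. rewrite Es in E2.
  exists t0, s, a. repeat split; trivial.
  set (lam := eps * apow (q - 1) a).
  assert (El : eps * spow q a = a * lam).
  { unfold lam. rewrite spow_eq_mul_apow by trivial. ring. }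
  rewrite El in E2. apply Rmin_glb_lt.
  - destruct (Rlt_le_dec lam 1) as [H|H]; trivial. exfalso.
    assert (H1 : lam = 1) by nra.
    assert (U := osol_unique_global eps q _ _ _ _ t0 Hq Hy
      (osol_const eps q a ltac:(rewrite El, H1; ring)) Es E1).
    assert (Hnd' : forall t, ~ (s * x t = 0 /\ s * x1 t = 0)).
    { intros t [Z1 Z2]. apply (Hnd t). destruct Hs as [-> | ->]; split; lra. }
    specialize (U Hnd'). assert (U1 := U tp). assert (U2 := U tn). simpl in U1, U2.
    destruct Hs as [-> | ->]; lra.
  - assert (Z : exists tz, x tz = 0).
    { destruct (IVT_gen x tp tn 0) as [tz [_ Htz]].
      - intros t. apply continuity_pt_filterlim, Cx.
      - rewrite Rmin_right, Rmax_left by lra. lra.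
      - now exists tz. }
    destruct Z as [tz Htz].
    assert (Hz1 : x1 tz <> 0) by (intros E; now apply (Hnd tz)).
    assert (EE := energy_const eps q _ _ tz t0 Hq Hy). unfold energy in EE. simpl in EE.
    rewrite Htz, Es, E1, Rmult_0_r, apow_0, apow_S in EE.
    assert (Z2 : 0 < (s * x1 tz) * (s * x1 tz)).
    { destruct Hs as [-> | ->]; nra. }
    assert (K : 0 < a * a * (1 - 2 / (1 + q) * lam)).
    { replace (a * a * (1 - 2 / (1 + q) * lam)) with (a * a - 2 / (1 + q) * (a * (a * lam))) by ring.
      rewrite <- El. nra. }
    assert (K2 : 0 < 1 - 2 / (1 + q) * lam) by nra.
    apply Rmult_lt_reg_l with (2 / (1 + q)); [apply Rdiv_lt_0_compat; lra|].
    replace (2 / (1 + q) * ((1 + q) / 2)) with 1 by (field; lra). lra.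
Qed.

Lemma least_period_ext (T : R) (x y : R -> R) : (forall t, x t = y t) ->
  least_period T x -> least_period T y.
Proof.
  intros E [[H0 H1] H2]. split; [split; trivial|].
  - intros t. now rewrite <- !E.
  - intros p [P0 P1]. apply H2. split; trivial. intros t. now rewrite !E.
Qed.

Lemma periodic_shift_sign (p tau s : R) (x : R -> R) : s <> 0 ->
  periodic p (fun t => s * x (t + tau)) <-> periodic p x.
Proof.
  intros Hs. split; intros [H0 H1]; split; trivial; intros t.
  - specialize (H1 (t - tau)). replace (t - tau + tau) with t in H1 by ring.
    replace (t - tau + p + tau) with (t + p) in H1 by ring.
    now apply Rmult_eq_reg_l in H1.
  - rewrite <- (H1 (t + tau)). do 2 f_equal; ring.
Qed.

Lemma least_period_shift_sign (T tau s : R) (x : R -> R) : s <> 0 ->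
  least_period T x -> least_period T (fun t => s * x (t + tau)).
Proof.
  intros Hs [H0 H1]. split; [now apply periodic_shift_sign|].
  intros p Hp. apply H1. now apply (periodic_shift_sign p tau s).
Qed.

Lemma least_period_unique (T T' : R) (x : R -> R) :
  least_period T x -> least_period T' x -> T = T'.
Proof. intros [H0 H1] [H2 H3]. apply Rle_antisym; auto. Qed.

(** [2 PI] is the period of the linear oscillator, [4 PI / (1 - q)] the duration of two homoclinic
    loops, one of each sign. *)
Definition sc_range (eps q T : R) : Prop :=
  (eps = -1 /\ 0 < T < 2 * PI) \/ (eps = 1 /\ 1 < q /\ 2 * PI < T) \/
  (eps = 1 /\ q < 1 /\ 2 * PI < T < 4 * PI / (1 - q)).

Lemma sc_period_range (eps q a : R) : 0 < q -> q <> 1 -> eps = 1 \/ eps = -1 -> 0 < a ->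
  eps * apow (q - 1) a < Rmin 1 ((1 + q) / 2) ->
  sc_range eps q (sc_period q (eps * apow (q - 1) a)).
Proof.
  intros Hq Hq1 Heps Ha Hl. assert (P := apow_gt0 (q - 1) a ltac:(lra)).
  assert (Hb := sc_param_bound_gt0 q Hq). assert (T0 := sc_period_gt0 q _ Hq Hl).
  set (lam := eps * apow (q - 1) a) in *. destruct Heps as [E|E].
  - assert (Hl0 : 0 < lam) by (unfold lam; rewrite E; lra).
    assert (L := sc_period_lt q 0 lam Hq Hl0 Hl). rewrite sc_period_0 in L.
    destruct (Rlt_le_dec q 1) as [K|K].
    + right; right. repeat split; trivial. apply sc_period_sub_lt; [lra|].
      eapply Rlt_le_trans; [exact Hl|apply Rmin_r].
    + right; left. repeat split; trivial. lra.
  - left. assert (Hl0 : lam < 0) by (unfold lam; rewrite E; lra).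
    assert (L := sc_period_lt q lam 0 Hq Hl0 Hb). rewrite sc_period_0 in L.
    repeat split; trivial.
Qed.

(** The wave is left universally quantified, so that one crest can be compared both with a wave
    built from its own amplitude and with a wave of prescribed period. *)
Lemma sc_normal_form (eps q p : R) (x x1 : R -> R) : 0 < q -> osol eps q x x1 -> periodic p x ->
  sign_changing_O x -> (forall t, ~ (x t = 0 /\ x1 t = 0)) ->
  exists a, 0 < a /\ eps * apow (q - 1) a < Rmin 1 ((1 + q) / 2) /\
    forall w w1, osol eps q w w1 -> w 0 = a -> w1 0 = 0 ->
      exists s tau, (s = 1 \/ s = -1) /\ forall t, x t = s * w (t + tau).
Proof.
  intros Hq Hx Hp Hsc Hnd.
  destruct (sc_crest eps q p x x1 Hq Hx Hp Hsc Hnd) as [t0 [s [a [Hs [Ha [E0 [E1 Hl]]]]]]].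
  exists a. split; [trivial|split; [trivial|]]. intros w w1 Hw W0 W1. exists s, (- t0).
  split; trivial.
  assert (Hss : s * s = 1) by (destruct Hs as [-> | ->]; ring).
  assert (Hw' : osol eps q (fun t => s * w (t + - t0)) (fun t => s * w1 (t + - t0))).
  { assert (S := osol_shift eps q w w1 (- t0) Hw). intros t. destruct (S t) as [S0 S1].
    split; [now apply is_derive_scal_R|]. evar_last; [apply is_derive_scal_R; exact S1|]. eqR.
    destruct Hs as [-> | ->]; [rewrite !Rmult_1_l; ring|].
    replace (-1 * w (t + - t0)) with (- w (t + - t0)) by ring. rewrite spow_opp. ring. }
  apply (osol_unique_global eps q x x1 _ _ t0 Hq Hx Hw'); trivial.
  - rewrite Rplus_opp_r, W0, <- E0, <- Rmult_assoc, Hss. ring.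
  - rewrite Rplus_opp_r, W1, <- E1, <- Rmult_assoc, Hss. ring.
Qed.

Lemma sc_periods (eps q p : R) (x x1 : R -> R) : 0 < q -> q <> 1 -> eps = 1 \/ eps = -1 ->
  osol eps q x x1 -> periodic p x -> sign_changing_O x ->
  (forall t, ~ (x t = 0 /\ x1 t = 0)) ->
  exists n T, p = INR (S n) * T /\ least_period T x /\ sc_range eps q T.
Proof.
  intros Hq Hq1 Heps Hx Hp Hsc Hnd.
  destruct (sc_normal_form eps q p x x1 Hq Hx Hp Hsc Hnd) as [a [Ha [Hl N]]].
  destruct (ex_sc_wave eps q a _ Hq Ha eq_refl Hl) as [w [w1 [Hw [W0 [W1 [_ [Wl [_ Wp]]]]]]]].
  destruct (N w w1 Hw W0 W1) as [s [tau [Hs E]]].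
  assert (Hs0 : s <> 0) by (destruct Hs as [-> | ->]; lra).
  destruct (Wp p) as [n En].
  { apply (periodic_shift_sign p tau s); trivial. destruct Hp as [P0 P1]. split; trivial.
    intros t. now rewrite <- !E. }
  exists n, (sc_period q (eps * apow (q - 1) a)). split; [trivial|split].
  - apply (least_period_ext _ (fun t => s * w (t + tau))); [now intros t|].
    now apply least_period_shift_sign.
  - now apply sc_period_range.
Qed.

Lemma apow_inverse (r a : R) : r <> 0 -> 0 < a -> apow (/ r) (apow r a) = a.
Proof.
  intros Hr Ha. rewrite apow_apow, Rinv_r, apow_pos by trivial. now apply Rpower_1.
Qed.

Lemma sc_period_inj (q lam mu : R) : 0 < q -> lam < Rmin 1 ((1 + q) / 2) ->
  mu < Rmin 1 ((1 + q) / 2) -> sc_period q lam = sc_period q mu -> lam = mu.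
Proof.
  intros Hq Hl Hm E. destruct (Rtotal_order lam mu) as [H|[H|H]]; trivial.
  - assert (J := sc_period_lt q lam mu Hq H Hm). lra.
  - assert (J := sc_period_lt q mu lam Hq H Hl). lra.
Qed.

(** The period determines [lam] by strict monotonicity, and [lam = eps a^(q-1)] determines the
    amplitude because [q] is not 1. Here [eps lam] is [|lam|], whose power with exponent
    [1 / (q - 1)] is [a]. *)
Lemma sc_family (eps q T : R) : 0 < q -> q <> 1 -> sc_range eps q T ->
  exists w w1, osol eps q w w1 /\ least_period T w /\ sign_changing_O w /\
    (forall t, ~ (w t = 0 /\ w1 t = 0)) /\
    forall x x1, osol eps q x x1 -> least_period T x -> sign_changing_O x ->
      (forall t, ~ (x t = 0 /\ x1 t = 0)) ->
      exists s tau, (s = 1 \/ s = -1) /\ forall t, x t = s * w (t + tau).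
Proof.
  intros Hq Hq1 HT.
  assert (L : exists lam, lam < Rmin 1 ((1 + q) / 2) /\ 0 < eps * lam /\ eps * eps = 1 /\
             sc_period q lam = T).
  { destruct HT as [[-> H]|[[-> [H1 H]]|[-> [H1 H]]]].
    - destruct (sc_period_neg q T Hq H) as [lam [Hl E]]. exists lam.
      assert (Hb := sc_param_bound_gt0 q Hq). repeat split; trivial; lra.
    - destruct (sc_period_super q T H1 H) as [lam [Hl E]]. exists lam.
      rewrite Rmin_left by lra. repeat split; trivial; lra.
    - destruct (sc_period_sub q T ltac:(lra) H) as [lam [Hl E]]. exists lam.
      rewrite Rmin_right by lra. repeat split; trivial; lra. }
  destruct L as [lam [Hl [Hp [He ET]]]].
  set (a := apow (/ (q - 1)) (eps * lam)).
  assert (Ha : 0 < a) by (apply apow_gt0; lra).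
  assert (Ea : eps * apow (q - 1) a = lam).
  { unfold a. replace (q - 1) with (/ / (q - 1)) at 1 by (apply Rinv_inv).
    rewrite apow_inverse; [|apply Rinv_neq_0_compat; lra|trivial].
    rewrite <- Rmult_assoc, He. ring. }
  destruct (ex_sc_wave eps q a lam Hq Ha (eq_sym Ea) Hl) as [w [w1 [Hw [W0 [W1 [Wn [Wl [Ws _]]]]]]]].
  exists w, w1. rewrite <- ET. repeat (split; [trivial|]).
  intros x x1 Hx Xl Xs Xn.
  destruct (sc_normal_form eps q (sc_period q lam) x x1 Hq Hx (proj1 Xl) Xs Xn) as [b [Hb [Hlb N]]].
  assert (Eb : b = a).
  { destruct (ex_sc_wave eps q b _ Hq Hb eq_refl Hlb) as [v [v1 [Hv [V0 [V1 [_ [Vl _]]]]]]].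
    destruct (N v v1 Hv V0 V1) as [s [tau [Hs E]]].
    assert (Hs0 : s <> 0) by (destruct Hs as [-> | ->]; lra).
    assert (Xl' : least_period (sc_period q (eps * apow (q - 1) b)) x).
    { apply (least_period_ext _ (fun t => s * v (t + tau))); [now intros t|].
      now apply least_period_shift_sign. }
    assert (EE := sc_period_inj q _ _ Hq Hlb Hl (least_period_unique _ _ _ Xl' Xl)).
    rewrite <- Ea in EE.
    assert (E2 : apow (q - 1) b = apow (q - 1) a).
    { apply Rmult_eq_reg_l with eps; [trivial|]. intros Z. rewrite Z in He. lra. }
    rewrite <- (apow_inverse (q - 1) b), <- (apow_inverse (q - 1) a), E2; trivial; lra. }
  subst b. now apply (N w w1).
Qed.

(** * Positive periodic solutions *)

Definition force (q x : R) : R := x - spow q x.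

(** The constant makes the value at the equilibrium [x = 1] equal to 0. For [eps = 1] the sum of
    [x1^2 / 2] and the potential is constant along solutions. *)
Definition potential (q x : R) : R :=
  x ^ 2 / 2 - apow (1 + q) x / (1 + q) + (1 - q) / (2 * (1 + q)).

Lemma is_derive_potential (q x : R) : 0 < q -> is_derive (potential q) x (force q x).
Proof.
  intros Hq. unfold potential. evar_last.
  - apply is_derive_plus_R; [|apply (is_derive_const ((1 - q) / (2 * (1 + q))))].
    apply is_derive_minus_R.
    + apply is_derive_ext with (fun x => / 2 * x ^ 2); [intros; eqR; field|].
      apply is_derive_scal_R. apply (is_derive_sq_R (fun x => x)). apply (is_derive_id (K := R_AbsRing)).
    + apply is_derive_ext with (fun x => / (1 + q) * apow (1 + q) x); [intros; eqR; field; lra|].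
      apply is_derive_scal_R. now apply is_derive_apow_S.
  - eqR. unfold force, one, zero; simpl. field. lra.
Qed.

Lemma continuous_potential (q x : R) : 0 < q -> continuous (potential q) x.
Proof. intros Hq. exact (continuous_of_is_derive _ _ _ (is_derive_potential q x Hq)). Qed.

Lemma force_factor (q x : R) : 0 < x -> force q x = spow q x * (apow (1 - q) x - 1).
Proof.
  intros Hx. unfold force. rewrite spow_pos, apow_pos by trivial.
  rewrite Rmult_minus_distr_l, <- Rpower_plus.
  replace (q + (1 - q)) with 1 by ring. rewrite Rpower_1 by trivial. ring.
Qed.

Lemma force_gt0 (q x : R) : q < 1 -> 1 < x -> 0 < force q x.
Proof.
  intros Hq Hx. rewrite force_factor by lra.
  apply Rmult_lt_0_compat; [apply spow_gt0; lra|].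
  assert (J := apow_gt1 (1 - q) x ltac:(lra) Hx). lra.
Qed.

Lemma force_lt0 (q x : R) : q < 1 -> 0 < x < 1 -> force q x < 0.
Proof.
  intros Hq Hx. rewrite force_factor by lra.
  assert (P := spow_gt0 q x ltac:(lra)).
  assert (J := apow_lt1 (1 - q) x ltac:(lra) ltac:(lra)). nra.
Qed.

Lemma force_1 (q : R) : force q 1 = 0.
Proof. unfold force. rewrite spow_1. ring. Qed.

Lemma potential_1 (q : R) : 0 < q -> potential q 1 = 0.
Proof. intros Hq. unfold potential. rewrite apow_1. field. lra. Qed.

Lemma potential_0 (q : R) : potential q 0 = (1 - q) / (2 * (1 + q)).
Proof. unfold potential. rewrite apow_0. unfold Rdiv. ring. Qed.

Lemma potential_inc (q x y : R) : 0 < q < 1 -> 1 <= x -> x < y -> potential q x < potential q y.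
Proof.
  intros Hq Hx Hy. apply (derive_lt _ (force q)); trivial.
  - intros z _. apply is_derive_potential; lra.
  - intros z _. apply continuous_potential; lra.
  - intros z Hz. apply force_gt0; lra.
Qed.

Lemma potential_dec (q x y : R) : 0 < q < 1 -> 0 <= x -> x < y -> y <= 1 ->
  potential q y < potential q x.
Proof.
  intros Hq Hx Hy H1. apply Ropp_lt_cancel.
  apply (derive_lt (fun z => - potential q z) (fun z => - force q z)); trivial.
  - intros z _. apply is_derive_opp_R, is_derive_potential; lra.
  - intros z _. apply (continuous_opp (potential q)), continuous_potential; lra.
  - intros z Hz. assert (J := force_lt0 q z ltac:(lra) ltac:(lra)). lra.
Qed.

Lemma potential_gt0 (q x : R) : 0 < q < 1 -> 0 <= x -> x <> 1 -> 0 < potential q x.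
Proof.
  intros Hq Hx H1. rewrite <- (potential_1 q) by lra. destruct (Rlt_le_dec x 1) as [H|H].
  - apply potential_dec; lra.
  - apply potential_inc; lra.
Qed.

(* The maximal height of the homoclinic orbit. *)
Definition top (q : R) : R := apow (/ (1 - q)) (2 / (1 + q)).

Lemma apow_top (q : R) : 0 < q < 1 -> apow (1 - q) (top q) = 2 / (1 + q).
Proof.
  intros Hq. unfold top. rewrite apow_apow, Rinv_l by lra.
  assert (H : 0 < 2 / (1 + q)) by (apply Rdiv_lt_0_compat; lra).
  rewrite apow_pos by trivial. now apply Rpower_1.
Qed.

Lemma top_gt1 (q : R) : 0 < q < 1 -> 1 < top q.
Proof.
  intros Hq. unfold top. apply apow_gt1; [apply Rinv_0_lt_compat; lra|].
  apply Rmult_lt_reg_r with (1 + q); [lra|].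
  replace (2 / (1 + q) * (1 + q)) with 2 by (field; lra). lra.
Qed.

Lemma potential_top (q : R) : 0 < q < 1 -> potential q (top q) = (1 - q) / (2 * (1 + q)).
Proof.
  intros Hq. unfold potential. rewrite <- apow_sq.
  replace 2 with (1 + q + (1 - q)) at 1 by ring. rewrite (apow_plus (1 + q)), apow_top by trivial.
  field. lra.
Qed.

(* Chicone's criterion for a monotone period, in the integrated form
   [force^2 + q/(3(1-q)) force^3 > 2 potential force']; the constant makes both
   sides agree to fourth order at the centre [x = 1]. *)
Lemma force_potential_ineq (q x : R) : 0 < q < 1 -> 0 < x -> x <> 1 ->
  0 < force q x ^ 2 + q / (3 * (1 - q)) * force q x ^ 3
      - 2 * potential q x * (1 - q * apow (q - 1) x).
Proof.
  intros Hq Hx Hx1.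
  (* Once every power is a rational expression in [z] and [E z = z^q], [field] can verify the
     derivatives below. *)
  set (E := fun z => exp (q * ln z)).
  assert (HE : forall z, 0 < z -> spow q z = E z /\ apow (1 + q) z = z * E z /\
                apow (q - 1) z = E z / z /\ apow (1 - q) z = z / E z /\ 0 < E z).
  { intros z Hz. assert (ES : spow q z = E z) by now apply spow_pos.
    assert (PE : 0 < E z) by apply exp_pos.
    split; [trivial|]. split; [now rewrite apow_S, ES|].
    assert (E1 : apow (q - 1) z = E z / z).
    { assert (J := spow_eq_mul_apow q z Hz). rewrite ES in J.
      rewrite J. field. lra. }
    split; [trivial|split; [|trivial]].
    rewrite apow_pos by trivial. replace (1 - q) with (- (q - 1)) by ring.
    rewrite Rpower_Ropp, <- apow_pos by trivial. rewrite E1. field. lra. }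
  set (k := q / (3 * (1 - q))).
  set (P := fun z => z ^ 2 / 2 - z * E z / (1 + q) + (1 - q) / (2 * (1 + q))).
  set (Rf := fun z => (z - E z) ^ 2 + k * (z - E z) ^ 3 - 2 * P z * (1 - q * (E z / z))).
  assert (HP : forall z, 0 < z -> potential q z = P z).
  { intros z Hz. unfold potential, P. now destruct (HE z Hz) as [_ [-> _]]. }
  enough (0 < Rf x).
  { unfold force. rewrite HP by trivial. destruct (HE x Hx) as [-> [_ [-> _]]]. exact H. }
  (* [S] is the derivative of [Rf] divided by the positive factor [q (1-q) E z / z^2]. This leaves
     [P] with the constant coefficient [-2], so that one more differentiation removes it. *)
  set (S := fun z => (z - E z) ^ 2 * (z * z / E z - q * z) / (1 - q) ^ 2 - 2 * P z).
  assert (DS : forall z, 0 < z -> is_derive S z ((z - E z) *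
    ((E z * ((4 - q) * (z / E z) ^ 2 - (4 * q + 2) * (z / E z) + q * (2 * q + 1))) / (1 - q) ^ 2 - 2))).
  { intros z Hz. destruct (HE z Hz) as [_ [_ [_ [_ PE]]]]. unfold S, P, E. auto_derive.
    - repeat split; trivial; try lra. apply Rgt_not_eq, exp_pos.
    - change (exp (q * ln z)) with (E z). field. repeat split; lra. }
  assert (DR : forall z, 0 < z -> is_derive Rf z (q * (1 - q) * (E z / (z * z)) * S z)).
  { intros z Hz. destruct (HE z Hz) as [_ [_ [_ [_ PE]]]]. unfold Rf, S, P, k, E. auto_derive.
    - repeat split; trivial; lra.
    - change (exp (q * ln z)) with (E z). field. repeat split; lra. }
  assert (CR : forall z, 0 < z -> continuous Rf z).
  { intros z Hz. exact (continuous_of_is_derive _ _ _ (DR z Hz)). }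
  assert (CS : forall z, 0 < z -> continuous S z).
  { intros z Hz. exact (continuous_of_is_derive _ _ _ (DS z Hz)). }
  assert (E1 : E 1 = 1) by (unfold E; rewrite ln_1, Rmult_0_r; apply exp_0).
  assert (P1 : P 1 = 0) by (rewrite <- HP by lra; apply potential_1; lra).
  assert (S1 : S 1 = 0) by (unfold S; rewrite P1, E1; field; lra).
  assert (R1 : Rf 1 = 0) by (unfold Rf; rewrite P1, E1; field).
  assert (K0 : 0 < k) by (apply Rdiv_lt_0_compat; lra).
  (* In [v = z / E z = z^(1-q)] the quadratic is [2 (1-q)^2 + (v-1) g] with [g] increasing and equal
     to [(2+q) (1-q)] at [v = q]. As [v - 1], [E z - 1] and [z - E z] have the same sign, [S]
     increases wherever [v > q]. *)
  assert (Sd : forall z, 0 < z -> z <> 1 -> q < z / E z -> 0 < (z - E z) *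
    ((E z * ((4 - q) * (z / E z) ^ 2 - (4 * q + 2) * (z / E z) + q * (2 * q + 1))) / (1 - q) ^ 2 - 2)).
  { intros z Hz Hz1 Hv. destruct (HE z Hz) as [ES [_ [_ [EV PE]]]]. set (v := z / E z) in *.
    replace (z - E z) with (E z * (v - 1)) by (unfold v; field; lra).
    assert (F : (4 - q) * v ^ 2 - (4 * q + 2) * v + q * (2 * q + 1)
                = 2 * (1 - q) ^ 2 + (v - 1) * ((4 - q) * v + 2 - 5 * q)) by ring.
    rewrite F. assert (G : 0 < (4 - q) * v + 2 - 5 * q) by nra.
    set (g := (4 - q) * v + 2 - 5 * q) in *.
    replace (E z * (2 * (1 - q) ^ 2 + (v - 1) * g) / (1 - q) ^ 2 - 2) with
      (2 * (E z - 1) + E z * ((v - 1) * g) / (1 - q) ^ 2) by (field; lra).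
    assert (Hq2 : 0 < (1 - q) ^ 2) by nra.
    rewrite Rmult_assoc. apply Rmult_lt_0_compat; trivial.
    replace ((v - 1) * (2 * (E z - 1) + E z * ((v - 1) * g) / (1 - q) ^ 2)) with
      (2 * ((v - 1) * (E z - 1)) + E z * g / (1 - q) ^ 2 * ((v - 1) * (v - 1))) by (field; lra).
    assert (Hc : 0 < E z * g / (1 - q) ^ 2).
    { apply Rdiv_lt_0_compat; trivial. now apply Rmult_lt_0_compat. }
    assert (Hv1 : 0 < (v - 1) * (E z - 1) /\ v <> 1).
    { rewrite <- EV, <- ES. destruct (Rlt_le_dec z 1) as [H|H].
      - assert (J := apow_lt1 (1 - q) z ltac:(lra) ltac:(lra)).
        assert (J' := apow_lt1 q z ltac:(lra) ltac:(lra)).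
        rewrite spow_pos, <- apow_pos by trivial. split; [nra|lra].
      - assert (J := apow_gt1 (1 - q) z ltac:(lra) ltac:(lra)).
        assert (J' := apow_gt1 q z ltac:(lra) ltac:(lra)).
        rewrite spow_pos, <- apow_pos by trivial. split; [nra|lra]. }
    assert (0 < (v - 1) * (v - 1)).
    { destruct (Rtotal_order v 1) as [H|[H|H]]; [nra|tauto|nra]. }
    nra. }
  assert (Vmono : forall y z, 0 < y -> y <= z -> y / E y <= z / E z).
  { intros y z Hy [Hyz| <-]; [|lra].
    destruct (HE y Hy) as [_ [_ [_ [<- _]]]]. destruct (HE z ltac:(lra)) as [_ [_ [_ [<- _]]]].
    apply Rlt_le, apow_lt; lra. }
  assert (Cf : forall z, 0 < z -> 0 < q * (1 - q) * (E z / (z * z))).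
  { intros z Hz. destruct (HE z Hz) as [_ [_ [_ [_ PE]]]].
    apply Rmult_lt_0_compat; [nra|]. apply Rdiv_lt_0_compat; nra. }
  (* Where [v > q], [S] has the sign of [z - 1], so [Rf] decreases to its value 0 at 1 and increases
     afterwards. *)
  destruct (Rlt_le_dec 1 x) as [Hgt|Hle].
  - rewrite <- R1. apply (derive_lt Rf (fun z => q * (1 - q) * (E z / (z * z)) * S z)); trivial.
    + intros z Hz. apply DR; lra.
    + intros z Hz. apply CR; lra.
    + intros z Hz. apply Rmult_lt_0_compat; [apply Cf; lra|].
      rewrite <- S1. apply (derive_lt S _ 1 z (proj1 Hz) (fun y Hy => DS y ltac:(lra))).
      * intros y Hy. apply CS; lra.
      * intros y Hy. apply Sd; try lra.
        assert (J := Vmono 1 y ltac:(lra) ltac:(lra)). rewrite E1 in J. lra.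
  - assert (Hlt : x < 1) by lra.
    destruct (HE x Hx) as [ES [_ [_ [EV PE]]]].
    destruct (Rlt_le_dec q (x / E x)) as [Hv|Hv].
    + apply Ropp_lt_cancel. rewrite Ropp_0.
      assert (J : - Rf x < - Rf 1); [|lra].
      apply (derive_lt (fun z => - Rf z) (fun z => - (q * (1 - q) * (E z / (z * z)) * S z))); trivial.
      * intros z Hz. apply is_derive_opp_R, DR; lra.
      * intros z Hz. apply (continuous_opp Rf), CR; lra.
      * intros z Hz. assert (C := Cf z ltac:(lra)).
        assert (Sz : S z < S 1).
        { apply (derive_lt S _ z 1 (proj2 Hz) (fun y Hy => DS y ltac:(lra))).
          - intros y Hy. apply CS; lra.
          - intros y Hy. apply Sd; try lra.
            assert (J := Vmono x y ltac:(lra) ltac:(lra)). lra. }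
        rewrite S1 in Sz. nra.
    (* Where [v <= q] the force has nonpositive derivative, so the potential term helps. The tangent
       of [E] at 1 bounds the force below by [-(1-q)], and [k (1-q) = q/3] lets its square outweigh
       the cubic term. *)
    + assert (Pp : 0 < P x) by (rewrite <- HP by trivial; apply potential_gt0; lra).
      assert (D1 : 1 - q * (E x / x) <= 0).
      { assert (0 < E x / x) by now apply Rdiv_lt_0_compat.
        assert (E2 : x / E x * (E x / x) = 1) by (field; lra).
        assert (x / E x * (E x / x) <= q * (E x / x)) by (apply Rmult_le_compat_r; lra). lra. }
      assert (G0 : - (1 - q) <= x - E x).
      { assert (J : E x <= 1 + q * (x - 1)).
        { assert (J : - (1 + q * (x - 1) - E x) <= - (1 + q * (1 - 1) - E 1)).
          { apply (derive_le (fun z => - (1 + q * (z - 1) - E z)) (fun z => - (q - q * (E z / z)))); trivial.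
            - intros z Hz. unfold E. auto_derive; [lra|]. field. lra.
            - intros z Hz. apply (ex_derive_continuous (fun z => - (1 + q * (z - 1) - E z))).
              unfold E. auto_derive. lra.
            - intros z Hz. destruct (HE z ltac:(lra)) as [_ [_ [_ [EVz PEz]]]].
              assert (J := apow_lt1 (1 - q) z ltac:(lra) ltac:(lra)). rewrite EVz in J.
              assert (1 < E z / z); [|nra].
              apply Rmult_lt_reg_l with (z / E z); [apply Rdiv_lt_0_compat; lra|].
              replace (z / E z * (E z / z)) with 1 by (field; lra). lra. }
          rewrite E1 in J. lra. }
        nra. }
      assert (Gn : x - E x < 0).
      { assert (J := force_lt0 q x ltac:(lra) ltac:(lra)). unfold force in J. now rewrite ES in J. }
      unfold Rf. assert (K1 : k * (1 - q) = q / 3) by (unfold k; field; lra).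
      assert (K2 : 0 < 1 + k * (x - E x)) by nra.
      set (g := x - E x) in *.
      assert (0 < g ^ 2 * (1 + k * g)) by (apply Rmult_lt_0_compat; nra). nra.
Qed.

(** * The well coordinate and its inverse *)

Lemma continuous_slope (f : R -> R) (x0 l : R) : is_derive f x0 l ->
  continuous (fun x => if Req_EM_T x x0 then l else (f x - f x0) / (x - x0)) x0.
Proof.
  intros Hd. apply continuity_pt_filterlim. intros e He.
  rewrite is_derive_eps in Hd. destruct (Hd (e / 2)) as [d [Hd0 D]]; [lra|].
  exists d. split; trivial. intros x [[_ Hx1] Hx]. simpl in *. unfold R_dist in *.
  destruct (Req_EM_T x0 x0) as [_|E]; [|now destruct E].
  destruct (Req_EM_T x x0) as [E|E]; [now destruct Hx1|].
  specialize (D x Hx). assert (P : 0 < Rabs (x - x0)) by (apply Rabs_pos_lt; lra).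
  replace ((f x - f x0) / (x - x0) - l) with ((f x - f x0 - l * (x - x0)) / (x - x0)) by (field; lra).
  unfold Rdiv. rewrite Rabs_mult, Rabs_inv.
  apply Rmult_lt_reg_r with (Rabs (x - x0)); trivial.
  rewrite Rmult_assoc, Rinv_l, Rmult_1_r by lra. nra.
Qed.

Lemma continuous_if_neq (f : R -> R) (x0 l x : R) : x <> x0 -> continuous f x ->
  continuous (fun x => if Req_EM_T x x0 then l else f x) x.
Proof.
  intros H Hf. apply continuous_ext_loc with f; trivial.
  apply locally_R. exists (Rabs (x - x0)). split; [apply Rabs_pos_lt; lra|].
  intros y Hy. destruct (Req_EM_T y x0) as [->|_]; [|reflexivity].
  rewrite <- Rabs_Ropp, Ropp_minus_distr in Hy. lra.
Qed.

(** The factor [x - 1] is split off from the force, and its square from the potential, so that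
    ratios of the two make sense at the centre of the well. *)
Definition force_slope (q x : R) : R :=
  if Req_EM_T x 1 then 1 - q else (force q x - force q 1) / (x - 1).

Definition potential_quot (q x : R) : R :=
  if Req_EM_T x 1 then (1 - q) / 2 else potential q x / (x - 1) ^ 2.

Lemma is_derive_force (q x : R) : x <> 0 -> is_derive (force q) x (1 - q * apow (q - 1) x).
Proof.
  intros Hx. apply is_derive_minus_R; [apply (is_derive_id (K := R_AbsRing))|].
  now apply is_derive_spow_neq0.
Qed.

Lemma continuous_force (q x : R) : 0 < q -> continuous (force q) x.
Proof.
  intros Hq. apply (continuous_minus (fun x : R => x) (spow q)); [apply continuous_id|].
  now apply continuous_spow.
Qed.

Lemma continuous_force_slope (q x : R) : 0 < q -> continuous (force_slope q) x.
Proof.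
  intros Hq. destruct (Req_dec x 1) as [->|H].
  - apply continuous_slope. assert (J := is_derive_force q 1 ltac:(lra)).
    now rewrite apow_1, Rmult_1_r in J.
  - apply (continuous_if_neq (fun x => (force q x - force q 1) / (x - 1))); trivial.
    apply (continuous_mult (fun x => force q x - force q 1) (fun x => / (x - 1))).
    + apply (continuous_minus (force q)); [now apply continuous_force|apply continuous_const].
    + apply (ex_derive_continuous (fun x => / (x - 1))). auto_derive. lra.
Qed.

Lemma force_slope_spec (q x : R) : (x - 1) * force_slope q x = force q x.
Proof.
  unfold force_slope. destruct (Req_EM_T x 1) as [->|H]; rewrite force_1; [ring|]. field. lra.
Qed.

Lemma force_slope_gt0 (q x : R) : 0 < q < 1 -> 0 < x -> 0 < force_slope q x.
Proof.
  intros Hq Hx. assert (S := force_slope_spec q x). destruct (Rtotal_order x 1) as [H|[->|H]].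
  - assert (J := force_lt0 q x ltac:(lra) ltac:(lra)). nra.
  - unfold force_slope. destruct (Req_EM_T 1 1); lra.
  - assert (J := force_gt0 q x ltac:(lra) H). nra.
Qed.

(** At the centre the mean value theorem is applied to the potential minus its quadratic part, whose
    derivative is the linearisation error of the force. *)
Lemma continuous_potential_quot (q x : R) : 0 < q < 1 -> continuous (potential_quot q) x.
Proof.
  intros Hq. destruct (Req_dec x 1) as [->|H].
  - apply continuity_pt_filterlim. intros e He.
    assert (D := is_derive_force q 1 ltac:(lra)). rewrite apow_1, Rmult_1_r in D.
    rewrite is_derive_eps in D. destruct (D (e / 2)) as [d [Hd D1]]; [lra|].
    exists d. split; trivial. intros x [[_ Hx1] Hx]. simpl in *. unfold R_dist in *.
    unfold potential_quot. destruct (Req_EM_T 1 1) as [_|K]; [|now destruct K].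
    destruct (Req_EM_T x 1) as [K|K]; [now destruct Hx1|].
    destruct (MVT_gen (fun z => potential q z - (1 - q) / 2 * (z - 1) ^ 2) 1 x
      (fun z => force q z - (1 - q) * (z - 1))) as [c [Hc E]].
    + intros z _. apply (is_derive_minus_R (potential q) (fun z => (1 - q) / 2 * (z - 1) ^ 2)).
      * apply is_derive_potential; lra.
      * auto_derive; trivial; field.
    + intros z _. apply continuity_pt_filterlim.
      apply (continuous_minus (potential q) (fun z => (1 - q) / 2 * (z - 1) ^ 2)).
      { apply continuous_potential; lra. }
      apply (ex_derive_continuous (fun z => (1 - q) / 2 * (z - 1) ^ 2)). now auto_derive.
    + rewrite potential_1 in E by lra.
      assert (Hcx : Rabs (c - 1) <= Rabs (x - 1)).
      { unfold Rmin, Rmax in Hc. unfold Rabs.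
        destruct (Rle_dec 1 x), (Rcase_abs (c - 1)), (Rcase_abs (x - 1)); lra. }
      specialize (D1 c ltac:(lra)). rewrite force_1, Rminus_0_r in D1.
      assert (P : 0 < Rabs (x - 1)) by (apply Rabs_pos_lt; lra).
      replace (potential q x / (x - 1) ^ 2 - (1 - q) / 2) with
        ((force q c - (1 - q) * (c - 1)) / (x - 1)).
      2:{ replace (potential q x) with
            ((force q c - (1 - q) * (c - 1)) * (x - 1) + (1 - q) / 2 * (x - 1) ^ 2) by lra.
          field. lra. }
      unfold Rdiv. rewrite Rabs_mult, Rabs_inv.
      apply Rmult_lt_reg_r with (Rabs (x - 1)); trivial.
      rewrite Rmult_assoc, Rinv_l, Rmult_1_r by lra. nra.
  - apply (continuous_if_neq (fun x => potential q x / (x - 1) ^ 2)); trivial.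
    apply (continuous_mult (potential q) (fun x => / (x - 1) ^ 2)).
    + apply continuous_potential; lra.
    + apply (ex_derive_continuous (fun x => / (x - 1) ^ 2)). auto_derive. nra.
Qed.

Lemma potential_quot_spec (q x : R) : 0 < q -> (x - 1) ^ 2 * potential_quot q x = potential q x.
Proof.
  intros Hq. unfold potential_quot. destruct (Req_EM_T x 1) as [->|H].
  - rewrite potential_1 by trivial. ring.
  - field. lra.
Qed.

Lemma potential_quot_gt0 (q x : R) : 0 < q < 1 -> 0 <= x -> 0 < potential_quot q x.
Proof.
  intros Hq Hx. unfold potential_quot. destruct (Req_EM_T x 1) as [->|H]; [lra|].
  apply Rdiv_lt_0_compat; [apply potential_gt0; lra|]. nra.
Qed.

(* The signed square root of the potential. *)
Definition well (q x : R) : R := (x - 1) * sqrt (potential_quot q x).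

(** Since [well^2] is the potential, the inverse of [well] has derivative [2 well / force]; here the
    common factor [x - 1] is cancelled. *)
Definition inv_well_slope (q x : R) : R := 2 * sqrt (potential_quot q x) / force_slope q x.

Lemma well_sq (q x : R) : 0 < q < 1 -> 0 <= x -> well q x ^ 2 = potential q x.
Proof.
  intros Hq Hx. unfold well. rewrite <- potential_quot_spec by lra.
  rewrite Rpow_mult_distr, pow2_sqrt; trivial.
  assert (J := potential_quot_gt0 q x Hq Hx). lra.
Qed.

Lemma continuous_sqrt_potential_quot (q x : R) : 0 < q < 1 ->
  continuous (fun x => sqrt (potential_quot q x)) x.
Proof.
  intros Hq. apply (continuous_comp (potential_quot q) sqrt).
  - now apply continuous_potential_quot.
  - apply continuous_sqrt.
Qed.

Lemma continuous_well (q x : R) : 0 < q < 1 -> continuous (well q) x.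
Proof.
  intros Hq. apply (continuous_mult (fun x => x - 1)).
  - apply (ex_derive_continuous (fun x => x - 1)). now auto_derive.
  - now apply continuous_sqrt_potential_quot.
Qed.

Lemma inv_well_slope_gt0 (q x : R) : 0 < q < 1 -> 0 < x -> 0 < inv_well_slope q x.
Proof.
  intros Hq Hx. apply Rdiv_lt_0_compat; [|now apply force_slope_gt0].
  apply Rmult_lt_0_compat; [lra|]. apply sqrt_lt_R0. apply potential_quot_gt0; lra.
Qed.

Lemma continuous_inv_well_slope (q x : R) : 0 < q < 1 -> 0 < x ->
  continuous (inv_well_slope q) x.
Proof.
  intros Hq Hx. apply (continuous_mult (fun x => 2 * sqrt (potential_quot q x))).
  - apply (continuous_scal_r 2 (fun x => sqrt (potential_quot q x))).
    now apply continuous_sqrt_potential_quot.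
  - apply (continuous_comp (force_slope q) (fun z => / z)).
    + apply continuous_force_slope; lra.
    + apply (ex_derive_continuous (fun z => / z)). auto_derive.
      assert (J := force_slope_gt0 q x Hq Hx). lra.
Qed.

Lemma inv_well_slope_spec (q x : R) : 0 < q < 1 -> 0 < x ->
  inv_well_slope q x * force q x = 2 * well q x.
Proof.
  intros Hq Hx. unfold inv_well_slope, well. rewrite <- force_slope_spec.
  assert (J := force_slope_gt0 q x Hq Hx). field. lra.
Qed.

Lemma is_derive_well (q x : R) : 0 < q < 1 -> 0 < x -> is_derive (well q) x (/ inv_well_slope q x).
Proof.
  intros Hq Hx. assert (Js := sqrt_lt_R0 _ (potential_quot_gt0 q x Hq ltac:(lra))).
  assert (Jf := force_slope_gt0 q x Hq Hx).
  destruct (Req_dec x 1) as [->|H].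
  - evar_last.
    + apply (is_derive_mult_zero (fun x => x - 1) (fun x => sqrt (potential_quot q x))).
      * auto_derive; [trivial|reflexivity].
      * ring.
      * now apply continuous_sqrt_potential_quot.
    + eqR. unfold inv_well_slope.
      assert (E : force_slope q 1 = 2 * (sqrt (potential_quot q 1) * sqrt (potential_quot q 1))).
      { rewrite sqrt_sqrt by (apply Rlt_le, potential_quot_gt0; lra).
        unfold force_slope, potential_quot. destruct (Req_EM_T 1 1) as [_|K]; [field|now destruct K]. }
      rewrite E. field. lra.
  - assert (W := inv_well_slope_spec q x Hq Hx).
    assert (Wn : well q x <> 0).
    { apply Rmult_integral_contrapositive. split; lra. }
    assert (In := inv_well_slope_gt0 q x Hq Hx).
    evar_last.
    + apply is_derive_of_square; trivial.
      * now apply continuous_well.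
      * apply is_derive_ext_loc with (potential q); [|apply is_derive_potential; lra].
        apply locally_R. exists x. split; trivial. intros y Hy. apply Rabs_def2 in Hy.
        symmetry. apply well_sq; lra.
    + eqR. apply Rmult_eq_reg_l with (inv_well_slope q x); [|lra].
      rewrite Rinv_r by lra.
      replace (inv_well_slope q x * (force q x / (2 * well q x))) with
        ((inv_well_slope q x * force q x) / (2 * well q x)) by (field; trivial).
      rewrite W. field. trivial.
Qed.

Lemma well_inc (q x y : R) : 0 < q < 1 -> 0 <= x -> x < y -> well q x < well q y.
Proof.
  intros Hq Hx Hy. apply (derive_lt (well q) (fun x => / inv_well_slope q x)); trivial.
  - intros z Hz. apply is_derive_well; lra.
  - intros z _. now apply continuous_well.
  - intros z Hz. apply Rinv_0_lt_compat. apply inv_well_slope_gt0; lra.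
Qed.

(* The well is [depth q ^ 2] deep, with rims at [x = 0] and [x = top q]. *)
Definition depth (q : R) : R := sqrt ((1 - q) / (2 * (1 + q))).

Lemma depth_gt0 (q : R) : 0 < q < 1 -> 0 < depth q.
Proof. intros Hq. apply sqrt_lt_R0. apply Rdiv_lt_0_compat; lra. Qed.

Lemma depth_sq (q : R) : 0 < q < 1 -> depth q ^ 2 = (1 - q) / (2 * (1 + q)).
Proof. intros Hq. apply pow2_sqrt. apply Rlt_le, Rdiv_lt_0_compat; lra. Qed.

Lemma well_0 (q : R) : 0 < q < 1 -> well q 0 = - depth q.
Proof.
  intros Hq. unfold well, potential_quot. destruct (Req_EM_T 0 1) as [E|_]; [lra|].
  rewrite potential_0. replace ((0 - 1) ^ 2) with 1 by ring. rewrite Rdiv_1_r.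
  unfold depth. ring.
Qed.

Lemma well_1 (q : R) : well q 1 = 0.
Proof. unfold well. ring. Qed.

Lemma well_top (q : R) : 0 < q < 1 -> well q (top q) = depth q.
Proof.
  intros Hq. assert (T := top_gt1 q Hq).
  assert (S := well_sq q (top q) Hq ltac:(lra)). rewrite potential_top, <- depth_sq in S by trivial.
  assert (D := depth_gt0 q Hq).
  assert (W := well_inc q 1 (top q) Hq ltac:(lra) T). rewrite well_1 in W. nra.
Qed.

(** Chosen by [epsilon]; the value is meaningful only for [h] strictly between [- depth q] and
    [depth q]. *)
Definition inv_well (q h : R) : R :=
  epsilon (inhabits 0) (fun x => 0 < x < top q /\ well q x = h).

Lemma inv_well_spec (q h : R) : 0 < q < 1 -> - depth q < h < depth q ->
  0 < inv_well q h < top q /\ well q (inv_well q h) = h.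
Proof.
  intros Hq Hh. apply (epsilon_spec (inhabits 0) (fun x => 0 < x < top q /\ well q x = h)).
  assert (T := top_gt1 q Hq).
  destruct (intermediate_value (well q) 0 (top q) h) as [x [Hx E]].
  - lra.
  - intros x _. now apply continuous_well.
  - rewrite well_0, well_top by trivial. lra.
  - exists x. split; trivial. split.
    + destruct (Req_dec x 0) as [->|]; [|lra]. rewrite well_0 in E by trivial. lra.
    + destruct (Req_dec x (top q)) as [->|]; [|lra]. rewrite well_top in E by trivial. lra.
Qed.

Lemma well_inj (q x y : R) : 0 < q < 1 -> 0 <= x -> 0 <= y -> well q x = well q y -> x = y.
Proof.
  intros Hq Hx Hy E. destruct (Rtotal_order x y) as [H|[H|H]]; trivial.
  - assert (J := well_inc q x y Hq Hx H). lra.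
  - assert (J := well_inc q y x Hq Hy H). lra.
Qed.

Lemma well_range (q x : R) : 0 < q < 1 -> 0 < x < top q -> - depth q < well q x < depth q.
Proof.
  intros Hq Hx. rewrite <- well_0, <- well_top by trivial. split; apply well_inc; lra.
Qed.

Lemma inv_well_well (q x : R) : 0 < q < 1 -> 0 < x < top q -> inv_well q (well q x) = x.
Proof.
  intros Hq Hx. destruct (inv_well_spec q (well q x) Hq (well_range q x Hq Hx)) as [H E].
  apply (well_inj q); trivial; lra.
Qed.

Lemma inv_well_0 (q : R) : 0 < q < 1 -> inv_well q 0 = 1.
Proof.
  intros Hq. rewrite <- (well_1 q). apply inv_well_well; trivial.
  assert (T := top_gt1 q Hq). lra.
Qed.

Lemma is_derive_inv_well (q h : R) : 0 < q < 1 -> - depth q < h < depth q ->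
  is_derive (inv_well q) h (inv_well_slope q (inv_well q h)).
Proof.
  intros Hq Hh. destruct (inv_well_spec q h Hq Hh) as [Hx E].
  assert (P := inv_well_slope_gt0 q (inv_well q h) Hq ltac:(lra)).
  rewrite <- (Rinv_inv (inv_well_slope q (inv_well q h))).
  apply (inverse_derive (well q) (inv_well q) 0 (top q) (- depth q) (depth q)); trivial.
  - intros x x' H0 H1 _. apply well_inc; lra.
  - intros y Hy. now apply inv_well_spec.
  - apply is_derive_well; trivial; lra.
  - apply Rinv_neq_0_compat. lra.
Qed.

Definition well_speed (q h : R) : R := inv_well_slope q (inv_well q h).

Lemma well_speed_gt0 (q h : R) : 0 < q < 1 -> - depth q < h < depth q -> 0 < well_speed q h.
Proof.
  intros Hq Hh. apply inv_well_slope_gt0; trivial. now apply inv_well_spec.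
Qed.

Lemma continuous_well_speed (q h : R) : 0 < q < 1 -> - depth q < h < depth q ->
  continuous (well_speed q) h.
Proof.
  intros Hq Hh. apply (continuous_comp (inv_well q) (inv_well_slope q)).
  - exact (continuous_of_is_derive _ _ _ (is_derive_inv_well q h Hq Hh)).
  - apply continuous_inv_well_slope; trivial. now apply inv_well_spec.
Qed.

Lemma inv_well_neq1 (q h : R) : 0 < q < 1 -> - depth q < h < depth q -> h <> 0 ->
  inv_well q h <> 1.
Proof.
  intros Hq Hh H0 E. destruct (inv_well_spec q h Hq Hh) as [_ W]. rewrite E, well_1 in W. lra.
Qed.

(** Off the centre [well_speed] is [2 h / force] along the inverse, and the potential is [h^2]
    there. The numerator that results is the quantity in [force_potential_ineq] without its cubic
    term. *)
Lemma is_derive_well_speed (q h : R) : 0 < q < 1 -> - depth q < h < depth q -> h <> 0 ->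
  let x := inv_well q h in
  is_derive (well_speed q) h
    (2 * (force q x ^ 2 - 2 * potential q x * (1 - q * apow (q - 1) x)) / force q x ^ 3).
Proof.
  intros Hq Hh H0 x. destruct (inv_well_spec q h Hq Hh) as [Hx E]. fold x in Hx, E.
  assert (Hx1 : x <> 1) by now apply inv_well_neq1.
  assert (Hf : force q x <> 0).
  { destruct (Rlt_le_dec x 1) as [H|H].
    - assert (J := force_lt0 q x ltac:(lra) ltac:(lra)). lra.
    - assert (J := force_gt0 q x ltac:(lra) ltac:(lra)). lra. }
  assert (HV : potential q x = h ^ 2) by (rewrite <- E; symmetry; apply well_sq; lra).
  assert (S := inv_well_slope_spec q x Hq ltac:(lra)). rewrite E in S.
  evar_last.
  - apply is_derive_ext_loc with (fun h => 2 * h * / force q (inv_well q h)).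
    + apply locally_R. exists (Rmin (Rabs h) (Rmin (h + depth q) (depth q - h))).
      split; [repeat apply Rmin_glb_lt; try lra; now apply Rabs_pos_lt|].
      intros k Hk. eqR.
      assert (B1 : Rabs (k - h) < Rabs h) by (eapply Rlt_le_trans; [exact Hk|apply Rmin_l]).
      assert (B2 : Rabs (k - h) < h + depth q).
      { eapply Rlt_le_trans; [exact Hk|]. eapply Rle_trans; [apply Rmin_r|apply Rmin_l]. }
      assert (B3 : Rabs (k - h) < depth q - h).
      { eapply Rlt_le_trans; [exact Hk|]. eapply Rle_trans; [apply Rmin_r|apply Rmin_r]. }
      apply Rabs_def2 in B2. apply Rabs_def2 in B3.
      assert (Hk0 : k <> 0).
      { intros ->. rewrite Rminus_0_l, Rabs_Ropp in B1. lra. }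
      destruct (inv_well_spec q k Hq ltac:(lra)) as [Hy Ey].
      assert (Sy := inv_well_slope_spec q (inv_well q k) Hq ltac:(lra)). rewrite Ey in Sy.
      unfold well_speed. rewrite <- Sy. field. intros Z. rewrite Z in Sy. lra.
    + apply is_derive_mult_R.
      * apply is_derive_scal_R. apply (is_derive_id (K := R_AbsRing)).
      * apply (is_derive_comp_R (fun z => / z)).
        -- auto_derive; [|reflexivity]. exact Hf.
        -- apply (is_derive_comp_R (force q)).
           ++ apply is_derive_force. fold x. lra.
           ++ now apply is_derive_inv_well.
  - eqR. fold x. rewrite HV. unfold one; simpl.
    replace (inv_well_slope q x) with (2 * h / force q x) by (rewrite <- S; now field).
    change (inv_well q h) with x. now field.
Qed.

(** The derivative of the even part is [D h - D (- h)]. By the inequality with the cubic term, [D]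
    exceeds [- 2 c] on the right of the centre and lies below [- 2 c] on the left, so the constant
    drops out of the difference. *)
Lemma even_speed_inc (q h k : R) : 0 < q < 1 -> 0 <= h -> h < k -> k < depth q ->
  well_speed q h + well_speed q (- h) < well_speed q k + well_speed q (- k).
Proof.
  intros Hq Hh Hhk Hk.
  set (D := fun h => let x := inv_well q h in
    2 * (force q x ^ 2 - 2 * potential q x * (1 - q * apow (q - 1) x)) / force q x ^ 3).
  apply (derive_lt (fun h => well_speed q h + well_speed q (- h)) (fun h => D h + - D (- h))); trivial.
  - intros z Hz. apply is_derive_plus_R.
    + apply is_derive_well_speed; lra.
    + apply is_derive_opp_arg. apply is_derive_well_speed; lra.
  - intros z Hz. apply (continuous_plus (well_speed q) (fun h => well_speed q (- h))).
    + apply continuous_well_speed; lra.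
    + apply (continuous_comp (fun h => - h) (well_speed q)).
      * apply (ex_derive_continuous (fun h => - h)). now auto_derive.
      * apply continuous_well_speed; lra.
  - intros z Hz. set (c := q / (3 * (1 - q))).
    destruct (inv_well_spec q z Hq ltac:(lra)) as [Hx Ex].
    destruct (inv_well_spec q (- z) Hq ltac:(lra)) as [Hy Ey].
    unfold D. set (x := inv_well q z) in *. set (y := inv_well q (- z)) in *. simpl.
    assert (X1 : 1 < x).
    { apply Rnot_le_lt. intros Hle. assert (well q x <= 0); [|lra].
      rewrite <- (well_1 q). destruct Hle as [Hle| ->]; [|lra]. apply Rlt_le, well_inc; lra. }
    assert (Y1 : y < 1).
    { apply Rnot_le_lt. intros Hle. assert (0 <= well q y); [|lra].
      rewrite <- (well_1 q). destruct Hle as [Hle|<-]; [|lra]. apply Rlt_le, well_inc; lra. }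
    assert (Rx := force_potential_ineq q x Hq ltac:(lra) ltac:(lra)). fold c in Rx.
    assert (Ry := force_potential_ineq q y Hq ltac:(lra) ltac:(lra)). fold c in Ry.
    assert (Fx := force_gt0 q x ltac:(lra) X1).
    assert (Fy := force_lt0 q y ltac:(lra) ltac:(lra)).
    set (nx := force q x ^ 2 - 2 * potential q x * (1 - q * apow (q - 1) x)).
    set (ny := force q y ^ 2 - 2 * potential q y * (1 - q * apow (q - 1) y)).
    change (0 < 2 * nx / force q x ^ 3 + - (2 * ny / force q y ^ 3)).
    assert (Fx3 : 0 < force q x ^ 3) by now apply pow_lt.
    assert (Fy3 : force q y ^ 3 < 0).
    { replace (force q y ^ 3) with (- (- force q y) ^ 3) by ring.
      assert (0 < (- force q y) ^ 3) by (apply pow_lt; lra). lra. }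
    assert (A : - c < nx / force q x ^ 3).
    { apply Rmult_lt_reg_r with (force q x ^ 3); trivial.
      replace (nx / force q x ^ 3 * force q x ^ 3) with nx by (field; lra). unfold nx. lra. }
    assert (B : ny / force q y ^ 3 < - c).
    { apply Rmult_lt_reg_r with (- force q y ^ 3); [lra|].
      replace (ny / force q y ^ 3 * - force q y ^ 3) with (- ny) by (field; lra). unfold ny. lra. }
    unfold Rdiv in *. lra.
Qed.

(** For [x = X (h sin phi)] with [X] the inverse of [well], conservation of energy gives
    [phi' = sqrt 2 / X']. *)
Definition pos_slowness (q h y : R) : R := well_speed q (h * sin y) / sqrt 2.

(* The period of the positive solution of height [inv_well q h]. *)
Definition pos_period (q h : R) : R := RInt (pos_slowness q h) 0 (2 * PI).

Lemma Rabs_mult_sin_lt (h y d : R) : Rabs h < d -> - d < h * sin y < d.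
Proof.
  intros H. assert (B : Rabs (h * sin y) < d); [|apply Rabs_def2 in B; lra].
  rewrite Rabs_mult. assert (S := SIN_bound y).
  assert (Rabs (sin y) <= 1) by (apply Rabs_le; lra).
  assert (P := Rabs_pos h). assert (P' := Rabs_pos (sin y)). nra.
Qed.

Lemma sqrt2_gt0 : 0 < sqrt 2.
Proof. apply sqrt_lt_R0; lra. Qed.

Lemma continuous_pos_slowness (q h y : R) : 0 < q < 1 -> - depth q < h * sin y < depth q ->
  continuous (pos_slowness q h) y.
Proof.
  intros Hq H. apply (continuous_mult (fun y => well_speed q (h * sin y)) (fun _ => / sqrt 2)).
  - apply (continuous_comp (fun y => h * sin y) (well_speed q)).
    + apply (ex_derive_continuous (fun y => h * sin y)). now auto_derive.
    + now apply continuous_well_speed.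
  - apply continuous_const.
Qed.

Lemma pos_slowness_gt0 (q h y : R) : 0 < q < 1 -> - depth q < h * sin y < depth q ->
  0 < pos_slowness q h y.
Proof.
  intros Hq H. apply Rdiv_lt_0_compat; [now apply well_speed_gt0|apply sqrt2_gt0].
Qed.

Definition even_slowness (q h y : R) : R :=
  (well_speed q (h * sin y) + well_speed q (- (h * sin y))) / sqrt 2.

Lemma continuous_even_slowness (q h y : R) : 0 < q < 1 -> - depth q < h * sin y < depth q ->
  continuous (even_slowness q h) y.
Proof.
  intros Hq H.
  apply (continuous_mult (fun y => well_speed q (h * sin y) + well_speed q (- (h * sin y))) (fun _ => / sqrt 2)).
  - apply (continuous_plus (fun y => well_speed q (h * sin y)) (fun y => well_speed q (- (h * sin y)))).
    + apply (continuous_comp (fun y => h * sin y) (well_speed q)).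
      * apply (ex_derive_continuous (fun y => h * sin y)). now auto_derive.
      * now apply continuous_well_speed.
    + apply (continuous_comp (fun y => - (h * sin y)) (well_speed q)).
      * apply (ex_derive_continuous (fun y => - (h * sin y))). now auto_derive.
      * apply continuous_well_speed; lra.
  - apply continuous_const.
Qed.

Lemma pos_period_even (q h : R) : 0 < q < 1 -> Rabs h < depth q ->
  pos_period q h = 2 * RInt (even_slowness q h) 0 (PI / 2).
Proof.
  intros Hq Hh.
  assert (HC : forall y, continuous (pos_slowness q h) y).
  { intros y. apply continuous_pos_slowness; trivial. now apply Rabs_mult_sin_lt. }
  transitivity (2 * RInt (fun y => well_speed q (h * sin y) / sqrt 2
                                   + well_speed q (h * - sin y) / sqrt 2) 0 (PI / 2)).
  - exact (RInt_sin_quarter (fun s => well_speed q (h * s) / sqrt 2) HC).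
  - f_equal. apply RInt_ext. intros y _. eqR. unfold even_slowness.
    replace (h * - sin y) with (- (h * sin y)) by ring. unfold Rdiv. ring.
Qed.

Lemma even_slowness_lt (q h k y : R) : 0 < q < 1 -> 0 <= h < k -> k * sin y < depth q ->
  0 < sin y -> even_slowness q h y < even_slowness q k y.
Proof.
  intros Hq Hh Hk Hy. apply Rmult_lt_compat_r; [apply Rinv_0_lt_compat, sqrt2_gt0|].
  apply even_speed_inc; trivial; nra.
Qed.

Lemma pos_period_lt (q h k : R) : 0 < q < 1 -> 0 <= h -> h < k -> k < depth q ->
  pos_period q h < pos_period q k.
Proof.
  intros Hq Hh Hhk Hk. assert (P := PI_RGT_0).
  rewrite !pos_period_even by (trivial; rewrite Rabs_pos_eq; lra).
  apply Rmult_lt_compat_l; [lra|]. apply RInt_lt; [lra| | |].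
  - intros y _. apply continuous_even_slowness; trivial. apply Rabs_mult_sin_lt.
    rewrite Rabs_pos_eq; lra.
  - intros y _. apply continuous_even_slowness; trivial. apply Rabs_mult_sin_lt.
    rewrite Rabs_pos_eq; lra.
  - intros y Hy. destruct (sin_quarter y Hy) as [S _].
    apply even_slowness_lt; trivial; try lra.
    assert (J := Rabs_mult_sin_lt k y (depth q) ltac:(rewrite Rabs_pos_eq; lra)). lra.
Qed.

(** The limit of small oscillations: [sqrt (1 - q)] is the frequency of the linearisation at the
    equilibrium. *)
Lemma pos_period_0 (q : R) : 0 < q < 1 -> pos_period q 0 = 2 * PI / sqrt (1 - q).
Proof.
  intros Hq. unfold pos_period. assert (S1 : 0 < sqrt (1 - q)) by (apply sqrt_lt_R0; lra).
  rewrite (RInt_ext _ (fun _ => / sqrt (1 - q))).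
  - rewrite RInt_const. change ((2 * PI - 0) * / sqrt (1 - q) = 2 * PI / sqrt (1 - q)).
    field. lra.
  - intros y _. eqR. unfold pos_slowness, well_speed. rewrite Rmult_0_l, inv_well_0 by trivial.
    unfold inv_well_slope, potential_quot, force_slope.
    destruct (Req_EM_T 1 1) as [_|K]; [|now destruct K].
    rewrite sqrt_div by lra. assert (S2 := sqrt2_gt0).
    assert (E2 : sqrt 2 * sqrt 2 = 2) by (apply sqrt_sqrt; lra).
    assert (E1 : sqrt (1 - q) * sqrt (1 - q) = 1 - q) by (apply sqrt_sqrt; lra).
    apply Rmult_eq_reg_l with (sqrt (1 - q)); [|lra]. rewrite Rinv_r by lra.
    replace (sqrt (1 - q) * (2 * (sqrt (1 - q) / sqrt 2) / (1 - q) / sqrt 2)) with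
      (2 / (sqrt 2 * sqrt 2) * (sqrt (1 - q) * sqrt (1 - q) / (1 - q))) by (field; lra).
    rewrite E1, E2. field. lra.
Qed.

Lemma continuity_2d_pos_slowness (q h y : R) : 0 < q < 1 -> - depth q < h * sin y < depth q ->
  continuity_2d_pt (pos_slowness q) h y.
Proof.
  intros Hq H. unfold pos_slowness, Rdiv.
  apply (continuity_2d_pt_mult (fun h y => well_speed q (h * sin y)) (fun _ _ => / sqrt 2)).
  - apply (continuity_1d_2d_pt_comp (well_speed q) (fun h y => h * sin y)).
    + apply continuity_pt_filterlim. now apply continuous_well_speed.
    + apply (continuity_2d_pt_mult (fun h _ => h) (fun _ y => sin y)).
      * apply continuity_2d_pt_id1.
      * apply (continuity_1d_2d_pt_comp sin (fun _ y => y)).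
        -- apply continuity_pt_filterlim, continuous_sin.
        -- apply continuity_2d_pt_id2.
  - apply continuity_2d_pt_const.
Qed.

(* Stated up to [h = depth q], where the integrand is singular at [-PI/2] only. *)
Lemma continuous_pos_partial (q h s a b : R) : 0 < q < 1 -> 0 < s -> a <= b ->
  (forall y, a <= y <= b -> Rabs (sin y) <= s) -> Rabs h * s < depth q ->
  continuous (fun h => RInt (pos_slowness q h) a b) h.
Proof.
  intros Hq Hs Hab Hsin Hh.
  assert (B : forall k y, Rabs k * s < depth q -> a <= y <= b -> - depth q < k * sin y < depth q).
  { intros k y Hk Hy. assert (J : Rabs (k * sin y) < depth q); [|apply Rabs_def2 in J; lra].
    rewrite Rabs_mult. specialize (Hsin y Hy). assert (P := Rabs_pos k). nra. }
  apply RInt_param_continuous; trivial.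
  - apply locally_R. exists ((depth q - Rabs h * s) / s).
    split; [apply Rdiv_lt_0_compat; lra|]. intros k Hk.
    apply (ex_RInt_continuous (pos_slowness q k)). intros y Hy.
    rewrite Rmin_left, Rmax_right in Hy by trivial. apply continuous_pos_slowness; trivial.
    apply B; trivial.
    assert (T : Rabs k <= Rabs h + Rabs (k - h)).
    { replace k with (h + (k - h)) at 1 by ring. apply Rabs_triang. }
    assert (T2 : Rabs (k - h) * s < depth q - Rabs h * s).
    { apply Rmult_lt_reg_r with (/ s); [now apply Rinv_0_lt_compat|].
      rewrite Rmult_assoc, Rinv_r, Rmult_1_r by lra. exact Hk. }
    nra.
  - intros y Hy. apply continuity_2d_pos_slowness; trivial. now apply B.
Qed.

Lemma continuous_pos_period (q h : R) : 0 < q < 1 -> Rabs h < depth q ->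
  continuous (pos_period q) h.
Proof.
  intros Hq Hh. assert (P := PI_RGT_0).
  apply (continuous_pos_partial q h 1 0 (2 * PI)); trivial; try lra.
  intros y _. assert (S := SIN_bound y). apply Rabs_le; lra.
Qed.

(** The homoclinic orbit is the case [h = depth q]. This is the time it takes to rise from 0 to the
    point with angle [y], and it serves as an explicit primitive of the critical slowness. *)
Definition ascent_time (q y : R) : R := rise_time q (inv_well q (depth q * sin y) / top q).

Lemma sin_half (y : R) : - (PI / 2) < y < PI / 2 -> -1 < sin y < 1 /\ 0 < cos y.
Proof.
  intros Hy. assert (C := cos_gt_0 y ltac:(lra) ltac:(lra)).
  assert (S := sin2_cos2 y). unfold Rsqr in S. repeat split; trivial; nra.
Qed.

Lemma depth_sin_bounds (q y : R) : 0 < q < 1 -> - (PI / 2) < y < PI / 2 ->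
  - depth q < depth q * sin y < depth q.
Proof.
  intros Hq Hy. destruct (sin_half y Hy) as [S _]. assert (D := depth_gt0 q Hq). split; nra.
Qed.

Lemma inv_well_div_top (q h : R) : 0 < q < 1 -> - depth q < h < depth q ->
  0 < inv_well q h / top q < 1.
Proof.
  intros Hq Hh. destruct (inv_well_spec q h Hq Hh) as [Hx _].
  split; [apply Rdiv_lt_0_compat; lra|].
  apply Rmult_lt_reg_r with (top q); [lra|].
  replace (inv_well q h / top q * top q) with (inv_well q h) by (field; lra). lra.
Qed.

Lemma is_derive_ascent_time (q y : R) : 0 < q < 1 -> - (PI / 2) < y < PI / 2 ->
  is_derive (ascent_time q) y (pos_slowness q (depth q) y).
Proof.
  intros Hq Hy. destruct (sin_half y Hy) as [S C]. assert (D := depth_gt0 q Hq).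
  assert (B := depth_sin_bounds q y Hq Hy).
  destruct (inv_well_spec q _ Hq B) as [Hx Ex]. set (x := inv_well q (depth q * sin y)) in *.
  assert (Bs := inv_well_div_top q _ Hq B). fold x in Bs. set (s := x / top q) in *.
  assert (Ht : 0 < top q) by (assert (J := top_gt1 q Hq); lra).
  assert (Hn := apow_sub_sq_gt0 q s Hq Bs).
  (* At zero energy [s^(1+q) - s^2] equals [2 (depth cos y)^2 / top^2], because the potential at [x]
     is [depth^2 sin^2 y]. *)
  assert (E : sqrt (apow (1 + q) s - s ^ 2) = sqrt 2 * (depth q * cos y) / top q).
  { rewrite <- (sqrt_pow2 (depth q * cos y)) by nra. rewrite <- sqrt_mult by nra.
    rewrite <- (sqrt_pow2 (top q)) at 1 by lra. rewrite <- sqrt_div by nra. f_equal.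
    apply Rmult_eq_reg_r with (top q ^ 2); [|nra].
    replace (2 * (depth q * cos y) ^ 2 / top q ^ 2 * top q ^ 2) with (2 * (depth q * cos y) ^ 2)
      by (field; lra).
    assert (Es : x = s * top q) by (unfold s; field; lra).
    assert (Ea : apow (1 + q) s * top q ^ 2 = 2 / (1 + q) * apow (1 + q) x).
    { rewrite Es at 1. rewrite apow_mult. rewrite <- apow_sq.
      replace 2 with (1 + q + (1 - q)) at 1 by ring. rewrite (apow_plus (1 + q)), apow_top by trivial.
      ring. }
    assert (Ev : potential q x = depth q ^ 2 * sin y ^ 2).
    { rewrite <- well_sq by lra. rewrite Ex. ring. }
    assert (SC := sin2_cos2 y). unfold Rsqr in SC.
    assert (Ec : cos y ^ 2 = 1 - sin y ^ 2) by lra.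
    replace ((apow (1 + q) s - s ^ 2) * top q ^ 2) with
      (apow (1 + q) s * top q ^ 2 - (s * top q) ^ 2) by ring.
    rewrite Ea, <- Es.
    replace (2 * (depth q * cos y) ^ 2) with (2 * depth q ^ 2 - 2 * (depth q ^ 2 * sin y ^ 2))
      by (rewrite Rpow_mult_distr, Ec; ring).
    rewrite <- Ev, depth_sq by trivial. unfold potential. field. lra. }
  unfold ascent_time. evar_last.
  - apply (is_derive_comp_R (rise_time q) (fun y => inv_well q (depth q * sin y) / top q)).
    + apply is_derive_rise_time; trivial.
    + apply is_derive_ext with (fun y => / top q * inv_well q (depth q * sin y)).
      { intros; eqR; unfold Rdiv; ring. }
      apply is_derive_scal_R.
      apply (is_derive_comp_R (inv_well q) (fun y => depth q * sin y)).
      * now apply is_derive_inv_well.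
      * auto_derive; [trivial|reflexivity].
  - eqR. change (inv_well q (depth q * sin y) / top q) with s. rewrite E.
    unfold pos_slowness, well_speed. assert (S2 := sqrt2_gt0). field. repeat split; lra.
Qed.

Lemma ascent_time_surj (q t : R) : 0 < q < 1 -> 0 < t < PI / (1 - q) ->
  exists y, - (PI / 2) < y < PI / 2 /\ ascent_time q y = t.
Proof.
  intros Hq Ht. destruct (rise_time_surj q t Hq Ht) as [s [Hs E]].
  assert (T := top_gt1 q Hq). assert (D := depth_gt0 q Hq).
  assert (Bx : 0 < s * top q < top q) by (split; nra).
  assert (W := well_range q _ Hq Bx).
  assert (Bz : -1 < well q (s * top q) / depth q < 1).
  { split; apply Rmult_lt_reg_r with (depth q); trivial;
      unfold Rdiv; rewrite Rmult_assoc, Rinv_l; lra. }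
  exists (asin (well q (s * top q) / depth q)). split; [now apply asin_bound_lt|].
  unfold ascent_time. rewrite sin_asin by lra.
  replace (depth q * (well q (s * top q) / depth q)) with (well q (s * top q)) by (field; lra).
  rewrite inv_well_well by trivial. rewrite <- E. f_equal. field. lra.
Qed.

Lemma ascent_time_mono (q y z : R) : 0 < q < 1 -> - (PI / 2) < y -> y <= z -> z < PI / 2 ->
  ascent_time q y <= ascent_time q z.
Proof.
  intros Hq Hy Hyz Hz. apply (derive_le (ascent_time q) (pos_slowness q (depth q))); trivial.
  - intros x Hx. apply is_derive_ascent_time; lra.
  - intros x Hx. exact (continuous_of_is_derive _ _ _ (is_derive_ascent_time q x Hq ltac:(lra))).
  - intros x Hx. apply Rlt_le, pos_slowness_gt0; trivial. apply depth_sin_bounds; lra.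
Qed.

Lemma ascent_time_bounds (q y : R) : 0 < q < 1 -> - (PI / 2) < y < PI / 2 ->
  0 <= ascent_time q y <= PI / (1 - q).
Proof.
  intros Hq Hy. apply rise_time_bounds; trivial. apply inv_well_div_top; trivial.
  now apply depth_sin_bounds.
Qed.

(** The even slowness at the critical height is the derivative of
    [ascent_time q y - ascent_time q (- y)], whose increment over an inner interval is at most the
    whole ascent time [PI / (1 - q)]. A height halfway to the critical one makes the bound
    strict. *)
Lemma pos_period_lt_sup (q h : R) : 0 < q < 1 -> 0 <= h < depth q ->
  pos_period q h < 2 * PI / (1 - q).
Proof.
  intros Hq Hh. assert (P := PI_RGT_0).
  assert (L : forall k, 0 <= k < depth q -> pos_period q k <= 2 * PI / (1 - q)).
  { intros k Hk. rewrite pos_period_even by (trivial; rewrite Rabs_pos_eq; lra).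
    replace (2 * PI / (1 - q)) with (2 * (PI / (1 - q))) by (field; lra).
    apply Rmult_le_compat_l; [lra|].
    assert (HC : forall y, continuous (even_slowness q k) y).
    { intros y. apply continuous_even_slowness; trivial. apply Rabs_mult_sin_lt.
      rewrite Rabs_pos_eq; lra. }
    apply RInt_interior_le; trivial; [lra|]. intros a b Ha Hab Hb.
    assert (Dg : forall y, a <= y <= b ->
      is_derive (fun y => ascent_time q y - ascent_time q (- y)) y (even_slowness q (depth q) y)).
    { intros y Hy. evar_last.
      - apply is_derive_minus_R.
        + apply is_derive_ascent_time; lra.
        + apply is_derive_opp_arg. apply is_derive_ascent_time; lra.
      - eqR. unfold pos_slowness, even_slowness. rewrite sin_neg.
        replace (depth q * - sin y) with (- (depth q * sin y)) by ring. unfold Rdiv. ring. }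
    apply Rle_trans with ((ascent_time q b - ascent_time q (- b)) -
                          (ascent_time q a - ascent_time q (- a))).
    - apply (RInt_between _ (fun y => ascent_time q y - ascent_time q (- y))
               (even_slowness q (depth q))); trivial; [lra| | |].
      + intros y Hy. apply Dg; lra.
      + intros y Hy. exact (continuous_of_is_derive _ _ _ (Dg y Hy)).
      + intros y Hy. destruct (sin_quarter y ltac:(lra)) as [S _].
        apply Rlt_le, even_slowness_lt; trivial; try lra.
        apply depth_sin_bounds; lra.
    - assert (M := ascent_time_mono q (- a) a Hq ltac:(lra) ltac:(lra) ltac:(lra)).
      assert (B1 := ascent_time_bounds q b Hq ltac:(lra)).
      assert (B2 := ascent_time_bounds q (- b) Hq ltac:(lra)). lra. }
  apply Rlt_le_trans with (pos_period q ((h + depth q) / 2)).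
  - apply pos_period_lt; lra.
  - apply L. lra.
Qed.

Lemma RInt_sin_half (k : R -> R) : (forall x, continuous (fun y => k (sin y)) x) ->
  RInt (fun y => k (sin y)) 0 (2 * PI) = 2 * RInt (fun y => k (sin y)) (- (PI / 2)) (PI / 2).
Proof.
  intros H. rewrite RInt_sin_quarter by trivial. f_equal.
  assert (Hm : forall x, continuous (fun y => k (- sin y)) x).
  { intros x. apply continuous_ext with (fun y => (fun y => k (sin y)) ((-1) * y + 0)).
    - intros y. rewrite <- sin_neg. do 2 f_equal; ring.
    - now apply (continuous_comp_lin (fun y => k (sin y))). }
  rewrite (RInt_plus (fun y => k (sin y)) (fun y => k (- sin y))) by now apply continuous_ex_RInt.
  rewrite <- (RInt_Chasles (fun y => k (sin y)) (- (PI / 2)) 0 (PI / 2)) by now apply continuous_ex_RInt.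
  assert (E : RInt (fun y => k (sin y)) (- (PI / 2)) 0 = RInt (fun y => k (- sin y)) 0 (PI / 2)).
  { replace (- (PI / 2)) with ((-1) * (PI / 2) + 0) by ring.
    replace 0 with ((-1) * 0 + 0) at 2 by ring.
    rewrite RInt_reflect by (trivial; now right).
    rewrite <- (opp_RInt_swap _ 0 (PI / 2)).
    2:{ apply continuous_ex_RInt. now apply (continuous_comp_lin (fun y => k (sin y))). }
    unfold opp; simpl. rewrite (RInt_ext (fun y => k (sin (-1 * y + 0))) (fun y => k (- sin y))).
    - lra.
    - intros x _. rewrite <- sin_neg. do 2 f_equal. ring. }
  rewrite E. unfold plus; simpl. lra.
Qed.

(** At the critical height the passage from [y1] to [y2] lasts [L - 2 d]. By continuity it lasts
    more than [L - 3 d] at a height slightly below, and a full period contains it twice. *)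
Lemma pos_period_attained (q T : R) : 0 < q < 1 ->
  2 * PI / sqrt (1 - q) < T < 2 * PI / (1 - q) -> exists h, 0 < h < depth q /\ pos_period q h = T.
Proof.
  intros Hq HT. assert (P := PI_RGT_0). assert (D := depth_gt0 q Hq).
  set (L := PI / (1 - q)). assert (EL : 2 * PI / (1 - q) = 2 * L) by (unfold L; field; lra).
  assert (T0 : 0 < T).
  { eapply Rlt_trans; [|apply HT]. apply Rdiv_lt_0_compat; [lra|]. apply sqrt_lt_R0; lra. }
  (* Here [2 L - T = 8 d], hence [2 (L - 3 d) = T + 2 d]. *)
  rewrite EL in HT. set (d := (2 * L - T) / 8).
  destruct (ascent_time_surj q d Hq) as [y1 [Y1 E1]]; [fold L; unfold d; lra|].
  destruct (ascent_time_surj q (L - d) Hq) as [y2 [Y2 E2]]; [fold L; unfold d; lra|].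
  assert (Y12 : y1 < y2).
  { apply Rnot_le_lt. intros Hle.
    assert (M := ascent_time_mono q y2 y1 Hq ltac:(lra) Hle ltac:(lra)).
    rewrite E1, E2 in M. unfold d in M; lra. }
  (* A bound for [|sin|] on [[y1, y2]]: the entry [1/2] makes it positive, and [s < 1] keeps
     [depth q * s] inside the domain of [inv_well]. *)
  set (s := Rmax (Rabs (sin y1)) (Rmax (Rabs (sin y2)) (1 / 2))).
  assert (Hs : 1 / 2 <= s < 1).
  { split; [eapply Rle_trans; [apply Rmax_r|apply Rmax_r]|].
    apply Rmax_lub_lt; [|apply Rmax_lub_lt; [|lra]]; apply Rabs_def1; apply sin_half; trivial. }
  assert (Hsin : forall y, y1 <= y <= y2 -> Rabs (sin y) <= s).
  { intros y Hy. apply Rabs_le.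
    assert (A1 : sin y1 <= sin y) by (apply sin_incr_1; lra).
    assert (A2 : sin y <= sin y2) by (apply sin_incr_1; lra).
    assert (A3 : Rabs (sin y1) <= s) by apply Rmax_l.
    assert (A4 : Rabs (sin y2) <= s) by (eapply Rle_trans; [apply Rmax_l|apply Rmax_r]).
    apply Rabs_le_between in A3. apply Rabs_le_between in A4. lra. }
  assert (C := continuous_pos_partial q (depth q) s y1 y2 Hq ltac:(lra) ltac:(lra) Hsin
    ltac:(rewrite Rabs_pos_eq by lra; nra)).
  assert (EF : RInt (pos_slowness q (depth q)) y1 y2 = L - d - d).
  { rewrite <- E1 at 2. rewrite <- E2. apply is_RInt_unique.
    apply (is_RInt_derive (ascent_time q) (pos_slowness q (depth q))).
    - intros y Hy. rewrite Rmin_left, Rmax_right in Hy by lra. apply is_derive_ascent_time; lra.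
    - intros y Hy. rewrite Rmin_left, Rmax_right in Hy by lra.
      apply continuous_pos_slowness; trivial. apply depth_sin_bounds; lra. }
  destruct (continuous_R _ _ d C) as [e [He B]]; [unfold d; lra|].
  set (h := depth q - Rmin (e / 2) (depth q / 2)).
  assert (M0 : 0 < Rmin (e / 2) (depth q / 2)) by (apply Rmin_glb_lt; lra).
  assert (M1 : Rmin (e / 2) (depth q / 2) <= e / 2) by apply Rmin_l.
  assert (M2 : Rmin (e / 2) (depth q / 2) <= depth q / 2) by apply Rmin_r.
  assert (Hh : 0 < h < depth q) by (unfold h; lra).
  assert (Bh := B h ltac:(apply Rabs_def1; unfold h; lra)). simpl in Bh. rewrite EF in Bh.
  apply Rabs_def2 in Bh.
  assert (HC : forall y, - depth q < h * sin y < depth q).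
  { intros y. apply Rabs_mult_sin_lt. rewrite Rabs_pos_eq; lra. }
  assert (HL : T <= pos_period q h).
  { unfold pos_period.
    assert (Eh : RInt (pos_slowness q h) 0 (2 * PI)
                 = 2 * RInt (pos_slowness q h) (- (PI / 2)) (PI / 2)).
    { exact (RInt_sin_half (fun s => well_speed q (h * s) / sqrt 2)
        (fun y => continuous_pos_slowness q h y Hq (HC y))). }
    rewrite Eh.
    assert (I := RInt_subinterval (pos_slowness q h) (- (PI / 2)) y1 y2 (PI / 2)
      ltac:(lra) ltac:(lra) ltac:(lra) (fun y => continuous_pos_slowness q h y Hq (HC y))
      (fun y => Rlt_le _ _ (pos_slowness_gt0 q h y Hq (HC y)))).
    unfold d in *. lra. }
  destruct (intermediate_value (pos_period q) 0 h T) as [k [Hk Ek]]; [lra| | |].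
  - intros x Hx. apply continuous_pos_period; trivial. rewrite Rabs_pos_eq; lra.
  - rewrite pos_period_0 by trivial. lra.
  - exists k. split; trivial. split; [|lra].
    destruct (Req_dec k 0) as [->|]; [|lra]. rewrite pos_period_0 in Ek by trivial. lra.
Qed.

Lemma ex_pos_wave (q h : R) : 0 < q < 1 -> 0 < h < depth q ->
  exists x x1, osol 1 q x x1 /\ x 0 = inv_well q h /\ x1 0 = 0 /\ (forall t, 0 < x t) /\
    least_period (pos_period q h) x /\
    (forall p, periodic p x -> exists n, p = INR (S n) * pos_period q h).
Proof.
  intros Hq Hh.
  assert (HC : forall y, - depth q < h * sin y < depth q).
  { intros y. apply Rabs_mult_sin_lt. rewrite Rabs_pos_eq; lra. }
  destruct (ex_flow (pos_slowness q h)) as [phi Hphi].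
  { intros y. now apply continuous_pos_slowness. }
  { intros y. now apply pos_slowness_gt0. }
  { intros y. unfold pos_slowness. now rewrite sin_plus, sin_2PI, cos_2PI, Rmult_0_r, Rplus_0_r, Rmult_1_r. }
  fold (pos_period q h) in Hphi.
  destruct (wave_periods (pos_slowness q h) phi (fun s => inv_well q (h * s)) _ Hphi) as [W1 W2].
  { intros y. now apply pos_slowness_gt0. }
  { intros s Hs. apply Rnot_le_lt. intros Hle.
    assert (B1 : - depth q < h * 1 < depth q) by lra.
    assert (B2 : - depth q < h * s < depth q) by (split; nra).
    destruct (inv_well_spec q _ Hq B1) as [X1 V1]. destruct (inv_well_spec q _ Hq B2) as [X2 V2].
    destruct Hle as [Hle|Hle].
    - assert (J := well_inc q _ _ Hq (Rlt_le _ _ (proj1 X1)) Hle). rewrite V1, V2 in J. nra.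
    - rewrite Hle, V2 in V1. nra. }
  destruct Hphi as [HT [H0 [Hd Hp]]].
  exists (fun t => inv_well q (h * sin (phi t))), (fun t => sqrt 2 * h * cos (phi t)).
  assert (S2 := sqrt2_gt0). assert (E2 : sqrt 2 * sqrt 2 = 2) by (apply sqrt_sqrt; lra).
  refine (conj _ (conj _ (conj _ (conj _ (conj W1 W2))))).
  - intros t. destruct (inv_well_spec q _ Hq (HC (phi t))) as [Hx Ex].
    assert (Sp := inv_well_slope_spec q _ Hq (proj1 Hx)). rewrite Ex in Sp.
    assert (In := inv_well_slope_gt0 q _ Hq (proj1 Hx)).
    split.
    + evar_last.
      * apply (is_derive_comp_R (inv_well q) (fun t => h * sin (phi t))).
        -- now apply is_derive_inv_well.
        -- apply is_derive_scal_R. apply (is_derive_comp_R sin phi); [|apply Hd].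
           auto_derive; [trivial|reflexivity].
      * eqR. unfold pos_slowness, well_speed. field. split; lra.
    + evar_last.
      * apply is_derive_scal_R. apply (is_derive_comp_R cos phi); [|apply Hd].
        auto_derive; [trivial|reflexivity].
      * eqR. unfold pos_slowness, well_speed. rewrite Rmult_1_l.
        set (x := inv_well q (h * sin (phi t))) in *.
        replace (1 * spow q x - x) with (- force q x) by (unfold force; ring).
        apply Rmult_eq_reg_l with (inv_well_slope q x); [|lra].
        replace (inv_well_slope q x * - force q x) with (- (inv_well_slope q x * force q x)) by ring.
        rewrite Sp. replace (- (2 * (h * sin (phi t)))) with (- (sqrt 2 * sqrt 2 * (h * sin (phi t))))
          by (rewrite E2; ring).
        field. split; lra.
  - now rewrite H0, sin_PI2, Rmult_1_r.
  - rewrite H0, cos_PI2. ring.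
  - intros t. now apply (inv_well_spec q _ Hq (HC (phi t))).
Qed.

(** The acceleration is nonpositive at the maximum [a] and nonnegative at the minimum [b]. This
    excludes [eps = -1], and for [eps = 1] it gives [a^(q-1) <= 1 <= b^(q-1)], which excludes
    [q > 1]. For [q < 1] uniqueness excludes [a = 1], and equal potentials at [a] and [b > 0] put
    [a] below the rim [top q]. *)
Lemma positive_nonconstant_case (eps q p : R) (x x1 : R -> R) : 0 < q -> q <> 1 ->
  eps = 1 \/ eps = -1 -> osol eps q x x1 -> periodic p x -> (forall t, 0 < x t) ->
  ~ (forall s t, x s = x t) -> eps = 1 /\ q < 1 /\ exists t0, x1 t0 = 0 /\ 1 < x t0 < top q.
Proof.
  intros Hq Hq1 Heps Hx [Hp Hper] Hpos Hnc.
  assert (Cx := fun t => proj1 (osol_continuous _ _ _ _ t Hx)).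
  destruct (periodic_max p x Hp Hper Cx) as [t0 M0].
  destruct (periodic_max p (fun t => - x t) Hp) as [t1 M1].
  { intros t. now rewrite Hper. }
  { intros t. apply (continuous_opp x), Cx. }
  assert (A0 := max_derive_0 x t0 _ (proj1 (Hx t0)) M0).
  assert (A2 := max_second_derive x x1 t0 _ (fun t => proj1 (Hx t)) (proj2 (Hx t0)) M0).
  assert (Ho := osol_opp _ _ _ _ Hx).
  assert (B0 := max_derive_0 _ t1 _ (proj1 (Ho t1)) M1).
  assert (B2 := max_second_derive _ _ t1 _ (fun t => proj1 (Ho t)) (proj2 (Ho t1)) M1).
  simpl in M1, B0, B2. rewrite spow_opp in B2.
  assert (Hlt : x t1 < x t0).
  { apply Rnot_le_lt. intros Hle. apply Hnc.
    assert (Hc : forall t, x t = x t0).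
    { intros t. specialize (M0 t). specialize (M1 t). lra. }
    intros s t. now rewrite !Hc. }
  set (a := x t0) in *. set (b := x t1) in *.
  assert (Ha : 0 < a) by apply Hpos. assert (Hb : 0 < b) by apply Hpos.
  rewrite (spow_eq_mul_apow q a Ha) in A2. rewrite (spow_eq_mul_apow q b Hb) in B2.
  assert (Pa := apow_gt0 (q - 1) a ltac:(lra)). assert (Pb := apow_gt0 (q - 1) b ltac:(lra)).
  destruct Heps as [-> | ->]; [|nra].
  assert (A3 : apow (q - 1) a <= 1) by nra. assert (B3 : 1 <= apow (q - 1) b) by nra.
  destruct (Rlt_le_dec q 1) as [Hlt1|Hgt1].
  - split; [trivial|split; [trivial|]]. exists t0. fold a.
    assert (Hq' : 0 < q < 1) by lra.
    assert (Ea : apow (1 - q) a * apow (q - 1) a = 1).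
    { rewrite <- apow_plus. replace (1 - q + (q - 1)) with 0 by ring.
      rewrite apow_pos by trivial. now apply Rpower_O. }
    assert (Eb : apow (1 - q) b * apow (q - 1) b = 1).
    { rewrite <- apow_plus. replace (1 - q + (q - 1)) with 0 by ring.
      rewrite apow_pos by trivial. now apply Rpower_O. }
    assert (Pa' := apow_gt0 (1 - q) a ltac:(lra)). assert (Pb' := apow_gt0 (1 - q) b ltac:(lra)).
    assert (Hb1 : b <= 1).
    { apply Rnot_lt_le. intros H. assert (J := apow_gt1 (1 - q) b ltac:(lra) H). nra. }
    assert (Ha1 : 1 <= a).
    { apply Rnot_lt_le. intros H. assert (J := apow_lt1 (1 - q) a ltac:(lra) ltac:(lra)). nra. }
    assert (Ha2 : a <> 1).
    { intros E.
      assert (U := osol_unique_global 1 q x x1 _ _ t0 Hq Hx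
        (osol_const 1 q 1 ltac:(rewrite spow_1; ring)) E A0).
      assert (U' : forall t, x t = 1).
      { apply U. intros t [Z _]. specialize (Hpos t). lra. }
      apply Hnc. intros s t. now rewrite !U'. }
    assert (EV : potential q a = potential q b).
    { assert (EE := energy_const 1 q x x1 t0 t1 Hq Hx). unfold energy in EE.
      assert (B0' : x1 t1 = 0) by lra. rewrite A0, B0' in EE. fold a b in EE.
      unfold potential. unfold Rdiv in *. lra. }
    repeat split; trivial; [lra|].
    apply Rnot_le_lt. intros Hle.
    assert (J1 : potential q (top q) <= potential q a).
    { destruct Hle as [Hle| ->]; [|lra]. apply Rlt_le, potential_inc; trivial.
      apply Rlt_le, top_gt1; trivial. }
    assert (J2 := potential_dec q 0 b Hq' ltac:(lra) Hb Hb1).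
    rewrite potential_top in J1 by trivial. rewrite potential_0 in J2. lra.
  - exfalso.
    assert (J := apow_lt (q - 1) b a ltac:(lra) ltac:(lra)). lra.
Qed.

Definition pos_range (q T : R) : Prop := 2 * PI / sqrt (1 - q) < T < 2 * PI / (1 - q).

Lemma pos_normal_form (q p : R) (x x1 : R -> R) : 0 < q < 1 ->
  osol 1 q x x1 -> periodic p x -> (forall t, 0 < x t) -> ~ (forall s t, x s = x t) ->
  exists h, 0 < h < depth q /\
    forall w w1, osol 1 q w w1 -> w 0 = inv_well q h -> w1 0 = 0 ->
      exists tau, forall t, x t = w (t + tau).
Proof.
  intros Hq Hx Hp Hpos Hnc.
  destruct (positive_nonconstant_case 1 q p x x1 ltac:(lra) ltac:(lra) ltac:(now left) Hx Hp Hpos Hnc)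
    as [_ [_ [t0 [E1 Ha]]]].
  exists (well q (x t0)). split.
  - split; [|now apply well_range; lra]. rewrite <- (well_1 q). apply well_inc; lra.
  - intros w w1 Hw W0 W1. rewrite inv_well_well in W0 by lra. exists (- t0).
    apply (osol_unique_global 1 q x x1 _ _ t0 ltac:(lra) Hx (osol_shift _ _ _ _ (- t0) Hw)).
    + now rewrite Rplus_opp_r, W0.
    + now rewrite Rplus_opp_r, W1.
    + intros t [Z _]. specialize (Hpos t). lra.
Qed.

Lemma least_period_shift (T tau : R) (x : R -> R) :
  least_period T x -> least_period T (fun t => x (t + tau)).
Proof.
  intros H. apply (least_period_ext _ (fun t => 1 * x (t + tau))); [intros; ring|].
  apply least_period_shift_sign; [lra|trivial].
Qed.

Lemma periodic_shift (p tau : R) (x : R -> R) : periodic p (fun t => x (t + tau)) -> periodic p x.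
Proof.
  intros [H0 H1]. apply (periodic_shift_sign p tau 1); [lra|]. split; trivial.
  intros t. rewrite H1. reflexivity.
Qed.

Lemma pos_period_range (q h : R) : 0 < q < 1 -> 0 < h < depth q -> pos_range q (pos_period q h).
Proof.
  intros Hq Hh. split.
  - rewrite <- pos_period_0 by trivial. apply pos_period_lt; lra.
  - apply pos_period_lt_sup; lra.
Qed.

Lemma pos_periods (q p : R) (x x1 : R -> R) : 0 < q < 1 ->
  osol 1 q x x1 -> periodic p x -> (forall t, 0 < x t) -> ~ (forall s t, x s = x t) ->
  exists n T, p = INR (S n) * T /\ least_period T x /\ pos_range q T.
Proof.
  intros Hq Hx Hp Hpos Hnc.
  destruct (pos_normal_form q p x x1 Hq Hx Hp Hpos Hnc) as [h [Hh N]].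
  destruct (ex_pos_wave q h Hq Hh) as [w [w1 [Hw [W0 [W1 [_ [Wl Wp]]]]]]].
  destruct (N w w1 Hw W0 W1) as [tau E].
  destruct (Wp p) as [n En].
  { apply (periodic_shift p tau). destruct Hp as [P0 P1]. split; trivial.
    intros t. now rewrite <- !E. }
  exists n, (pos_period q h). split; [trivial|split].
  - apply (least_period_ext _ (fun t => w (t + tau))); [now intros t|].
    now apply least_period_shift.
  - now apply pos_period_range.
Qed.

Lemma pos_period_inj (q h k : R) : 0 < q < 1 -> 0 <= h < depth q -> 0 <= k < depth q ->
  pos_period q h = pos_period q k -> h = k.
Proof.
  intros Hq Hh Hk E. destruct (Rtotal_order h k) as [H|[H|H]]; trivial.
  - assert (J := pos_period_lt q h k Hq ltac:(lra) H ltac:(lra)). lra.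
  - assert (J := pos_period_lt q k h Hq ltac:(lra) H ltac:(lra)). lra.
Qed.

Lemma least_period_nonconstant (T : R) (x : R -> R) :
  least_period T x -> ~ (forall s t, x s = x t).
Proof.
  intros [[H0 _] H] Hc. assert (J : T <= T / 2); [|lra]. apply H. split; [lra|].
  intros t. apply Hc.
Qed.

Lemma pos_family (q T : R) : 0 < q < 1 -> pos_range q T ->
  exists w w1, osol 1 q w w1 /\ least_period T w /\ (forall t, 0 < w t) /\
    forall x x1, osol 1 q x x1 -> least_period T x -> (forall t, 0 < x t) ->
      exists tau, forall t, x t = w (t + tau).
Proof.
  intros Hq HT. destruct (pos_period_attained q T Hq HT) as [h [Hh Eh]].
  destruct (ex_pos_wave q h Hq Hh) as [w [w1 [Hw [W0 [W1 [Wp [Wl _]]]]]]].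
  rewrite Eh in Wl. exists w, w1. repeat (split; [trivial|]). intros x x1 Hx Xl Xp.
  destruct (pos_normal_form q T x x1 Hq Hx (proj1 Xl) Xp (least_period_nonconstant T x Xl))
    as [k [Hk N]].
  assert (E : k = h).
  { destruct (ex_pos_wave q k Hq Hk) as [v [v1 [Hv [V0 [V1 [_ [Vl _]]]]]]].
    destruct (N v v1 Hv V0 V1) as [tau E].
    apply (pos_period_inj q); trivial; try lra. rewrite Eh.
    apply (least_period_unique _ _ x); trivial.
    apply (least_period_ext _ (fun t => v (t + tau))); [now intros t|].
    now apply least_period_shift. }
  subst k. now apply (N w w1).
Qed.

(** * Solutions through the origin of the phase plane *)

(* The homoclinic orbit, repeated with period [loop q]. *)
Definition bump (q t : R) : R := top q * apow (2 / (1 - q)) (sin ((1 - q) / 2 * t)).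

Definition bump' (q t : R) : R :=
  top q * (spow (2 / (1 - q) - 1) (sin ((1 - q) / 2 * t)) * cos ((1 - q) / 2 * t)).

Definition loop (q : R) : R := 2 * PI / (1 - q).

Lemma loop_gt (q : R) : 0 < q < 1 -> 2 * PI < loop q.
Proof.
  intros Hq. assert (P := PI_RGT_0). unfold loop.
  apply Rmult_lt_reg_r with (1 - q); [lra|].
  replace (2 * PI / (1 - q) * (1 - q)) with (2 * PI) by (field; lra). nra.
Qed.

Lemma top_gt0 (q : R) : 0 < q < 1 -> 0 < top q.
Proof. intros Hq. assert (J := top_gt1 q Hq). lra. Qed.

Lemma bump_exponent (q : R) : 0 < q < 1 -> 2 < 2 / (1 - q).
Proof.
  intros Hq. apply Rmult_lt_reg_r with (1 - q); [lra|].
  replace (2 / (1 - q) * (1 - q)) with 2 by (field; lra). lra.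
Qed.

(** The exponent [b = 2 / (1 - q)] exceeds 2, which gives two derivatives at the zeros of the sine.
    The identity [b q = b - 2] matches the powers in the equation, and the choice of [top q] matches
    the coefficients. *)
Lemma osol_bump (q : R) : 0 < q < 1 -> osol 1 q (bump q) (bump' q).
Proof.
  intros Hq t. assert (Hb := bump_exponent q Hq). assert (Ht := top_gt0 q Hq).
  set (b := 2 / (1 - q)) in *. set (w := (1 - q) / 2).
  assert (Hbw : b * w = 1) by (unfold b, w; field; lra).
  assert (Ds : is_derive (fun t => sin (w * t)) t (w * cos (w * t))).
  { auto_derive; [trivial|ring]. }
  assert (Dc : is_derive (fun t => cos (w * t)) t (- (w * sin (w * t)))).
  { auto_derive; [trivial|ring]. }
  split.
  - unfold bump. fold b w. evar_last.
    + apply is_derive_scal_R. apply (is_derive_comp_R (apow b) (fun t => sin (w * t))).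
      * apply is_derive_apow; lra.
      * exact Ds.
    + eqR. unfold bump'. fold b w.
      replace (b * spow (b - 1) (sin (w * t)) * (w * cos (w * t))) with
        ((b * w) * (spow (b - 1) (sin (w * t)) * cos (w * t))) by ring.
      rewrite Hbw. ring.
  - unfold bump'. fold b w. evar_last.
    + apply is_derive_scal_R. apply is_derive_mult_R; [|exact Dc].
      apply (is_derive_comp_R (spow (b - 1)) (fun t => sin (w * t))); [|exact Ds].
      apply is_derive_spow; lra.
    + eqR. unfold bump. fold b w. set (s := sin (w * t)). set (c := cos (w * t)).
      assert (SC := sin2_cos2 (w * t)). unfold Rsqr in SC. fold s c in SC.
      rewrite spow_mult, spow_apow.
      assert (Eb : b * q = b - 1 - 1) by (unfold b; field; lra). rewrite Eb.
      assert (E1 : s * spow (b - 1) s = apow b s) by reflexivity.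
      assert (E2 : apow b s = s ^ 2 * apow (b - 1 - 1) s).
      { rewrite <- apow_sq, <- apow_plus. f_equal; ring. }
      assert (Et : spow q (top q) = (1 + q) / 2 * top q).
      { rewrite spow_pos, <- apow_pos by trivial.
        assert (J : apow (1 - q) (top q) * apow q (top q) = top q).
        { rewrite <- apow_plus, apow_pos by trivial. replace (1 - q + q) with 1 by ring.
          now apply Rpower_1. }
        rewrite apow_top in J by trivial. rewrite <- J at 2. field. lra. }
      rewrite Et.
      replace (top q * ((b - 1) * apow (b - 1 - 1) s * (w * c) * c + spow (b - 1) s * - (w * s)))
        with (top q * (w * ((b - 1) * ((c * c) * apow (b - 1 - 1) s) - s * spow (b - 1) s))) by ring.
      rewrite E1, E2. replace (c * c) with (1 - s ^ 2) by lra.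
      set (a := apow (b - 1 - 1) s).
      replace (top q * (w * ((b - 1) * ((1 - s ^ 2) * a) - s ^ 2 * a))) with
        (top q * (a * ((b * w - w) - (b * w) * s ^ 2))) by ring.
      rewrite Hbw. unfold w. field.
Qed.

Lemma bump_ge0 (q t : R) : 0 < q < 1 -> 0 <= bump q t.
Proof.
  intros Hq. apply Rmult_le_pos; [apply Rlt_le, top_gt0; trivial|apply apow_ge0].
Qed.

Lemma bump_gt0 (q t : R) : 0 < q < 1 -> 0 < t < loop q -> 0 < bump q t.
Proof.
  intros Hq Ht. apply Rmult_lt_0_compat; [apply top_gt0; trivial|]. apply apow_gt0.
  assert (0 < sin ((1 - q) / 2 * t)); [|lra]. apply sin_gt_0; [nra|].
  replace PI with ((1 - q) / 2 * loop q) by (unfold loop; field; lra). nra.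
Qed.

Lemma bump_0 (q : R) : bump q 0 = 0.
Proof. unfold bump. rewrite Rmult_0_r, sin_0, apow_0. ring. Qed.

Lemma bump_periodic (q t : R) : 0 < q < 1 -> bump q (t + loop q) = bump q t.
Proof.
  intros Hq. unfold bump.
  replace ((1 - q) / 2 * (t + loop q)) with ((1 - q) / 2 * t + PI) by (unfold loop; field; lra).
  now rewrite neg_sin, apow_opp.
Qed.

Lemma bump_loop (q : R) : 0 < q < 1 -> bump q (loop q) = 0.
Proof. intros Hq. rewrite <- (Rplus_0_l (loop q)), bump_periodic by trivial. apply bump_0. Qed.

Lemma energy_bump (q t : R) : 0 < q < 1 -> energy 1 q (bump q t) (bump' q t) = 0.
Proof.
  intros Hq. rewrite (energy_const 1 q _ _ t 0 ltac:(lra) (osol_bump q Hq)).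
  unfold energy. rewrite bump_0. unfold bump'. rewrite Rmult_0_r, sin_0, spow_0, apow_0. ring.
Qed.

(** With [s = (x / top)^((1-q)/2)] and [c] the normalised velocity, zero energy becomes
    [s^2 + c^2 = 1]. The angle [acos c] then lies in [(0, PI)] and has sine [s]. *)
Lemma bump_phase (q x y : R) : 0 < q < 1 -> 0 < x -> energy 1 q x y = 0 ->
  exists t, 0 < t < loop q /\ bump q t = x /\ bump' q t = y.
Proof.
  intros Hq Hx E. assert (Ht := top_gt0 q Hq). assert (Hb := bump_exponent q Hq).
  set (b := 2 / (1 - q)) in *. set (w := (1 - q) / 2). assert (Hw : 0 < w) by (unfold w; lra).
  assert (Hbw : w * b = 1) by (unfold b, w; field; lra).
  set (s := apow w (x / top q)).
  assert (Hxt : 0 < x / top q) by now apply Rdiv_lt_0_compat.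
  assert (Hs : 0 < s) by (apply apow_gt0; lra).
  assert (Ex : x = top q * apow b s).
  { unfold s. rewrite apow_apow, Hbw, apow_pos, Rpower_1 by trivial. field. lra. }
  set (r := spow (b - 1) s). assert (Hr : 0 < r) by now apply spow_gt0.
  assert (Er : apow b s = s * r) by reflexivity.
  set (c := y / (top q * r)).
  assert (Ey : y = top q * r * c) by (unfold c; field; lra).
  assert (SC : s ^ 2 + c ^ 2 = 1).
  { unfold energy in E.
    assert (E1 : 1 * (2 / (1 + q)) * apow (1 + q) x = top q ^ 2 * r ^ 2).
    { rewrite Ex, apow_mult, apow_apow.
      assert (E2 : top q ^ 2 = apow (1 + q) (top q) * (2 / (1 + q))).
      { rewrite <- apow_top, <- apow_plus, <- apow_sq by trivial. f_equal; ring. }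
      rewrite E2. replace (b * (1 + q)) with (b - 1 + (b - 1)) by (unfold b; field; lra).
      rewrite (apow_plus (b - 1)). clear E2. unfold r. rewrite !apow_pos, spow_pos by trivial. ring. }
    rewrite E1, Ey in E. rewrite Ex, Er in E.
    assert (E2 : (top q * r) ^ 2 * (s ^ 2 + c ^ 2 - 1) = 0) by (rewrite <- E; ring).
    apply Rmult_integral in E2. destruct E2 as [E2|E2]; [|lra].
    assert (0 < (top q * r) ^ 2) by (apply pow_lt; nra). lra. }
  assert (Hc : -1 < c < 1) by (split; nra).
  assert (B := acos_bound_lt c Hc).
  assert (Sn : sin (acos c) = s).
  { rewrite sin_acos by lra. rewrite Rsqr_pow2. replace (1 - c ^ 2) with (s ^ 2) by lra.
    apply sqrt_pow2; lra. }
  assert (Cs : cos (acos c) = c) by (apply cos_acos; lra).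
  exists (acos c / w).
  assert (Ew : w * (acos c / w) = acos c) by (field; lra).
  split; [split|split].
  - apply Rdiv_lt_0_compat; lra.
  - replace (loop q) with (PI / w) by (unfold loop, w; field; lra).
    apply Rmult_lt_compat_r; [now apply Rinv_0_lt_compat|lra].
  - unfold bump. fold b w. rewrite Ew, Sn. now symmetry.
  - unfold bump'. fold b w. rewrite Ew, Sn, Cs. fold r. rewrite Ey. ring.
Qed.

Lemma continuous_eq_endpoint (f g : R -> R) (a b t : R) : a < b -> a <= t <= b ->
  continuous f t -> continuous g t -> (forall s, a < s < b -> f s = g s) -> f t = g t.
Proof.
  intros Hab Ht Hf Hg H. apply Rminus_diag_uniq.
  destruct (Req_dec (f t - g t) 0) as [E|E]; trivial. exfalso.
  assert (C : continuous (fun s => f s - g s) t) by now apply (continuous_minus f g).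
  destruct (continuous_R _ t _ C (Rabs_pos_lt _ E)) as [d [Hd D]].
  set (m := Rmin d (b - a) / 3).
  assert (M0 : 0 < Rmin d (b - a)) by (apply Rmin_glb_lt; lra).
  assert (M1 : Rmin d (b - a) <= d) by apply Rmin_l.
  assert (M2 : Rmin d (b - a) <= b - a) by apply Rmin_r.
  assert (Z : exists s, a < s < b /\ Rabs (s - t) < d).
  { destruct (Rlt_le_dec (t + m) b) as [K|K].
    - exists (t + m). split; [unfold m in *; lra|]. apply Rabs_def1; unfold m; lra.
    - exists (t - m). split; [unfold m in *; lra|]. apply Rabs_def1; unfold m; lra. }
  destruct Z as [s [Hs Ds]]. specialize (D s Ds). rewrite H in D by trivial.
  rewrite Rminus_diag, Rminus_0_l, Rabs_Ropp in D. lra.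
Qed.

(** Uniqueness is applied in the open loop, where the translated [bump] is positive; continuity adds
    the two ends, where uniqueness is lost. *)
Lemma degenerate_loop (q : R) (x x1 : R -> R) (t : R) : 0 < q < 1 -> osol 1 q x x1 ->
  energy 1 q (x t) (x1 t) = 0 -> 0 < x t ->
  exists l, l < t < l + loop q /\ forall s, l <= s <= l + loop q -> x s = bump q (s - l).
Proof.
  intros Hq Hx He Hp. destruct (bump_phase q _ _ Hq Hp He) as [u [Hu [E0 E1]]].
  exists (t - u). split; [lra|].
  assert (Hs := osol_shift 1 q _ _ (- (t - u)) (osol_bump q Hq)).
  assert (U : forall s, t - u < s < t - u + loop q -> bump q (s + - (t - u)) = x s).
  { apply (osol_unique 1 q _ _ x x1 _ _ t ltac:(lra) Hs Hx).
    - lra.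
    - replace (t + - (t - u)) with u by ring. exact E0.
    - replace (t + - (t - u)) with u by ring. exact E1.
    - intros s Hs' [Z _]. assert (J := bump_gt0 q (s + - (t - u)) Hq ltac:(lra)). lra. }
  intros s Hs'.
  apply (continuous_eq_endpoint x (fun s => bump q (s + - (t - u))) (t - u) (t - u + loop q)).
  - lra.
  - exact Hs'.
  - exact (proj1 (osol_continuous _ _ _ _ s Hx)).
  - exact (proj1 (osol_continuous _ _ _ _ s Hs)).
  - intros r Hr. symmetry. now apply U.
Qed.

Lemma degenerate_loop_pos (q : R) (x x1 : R -> R) (t : R) : 0 < q < 1 -> osol 1 q x x1 ->
  energy 1 q (x t) (x1 t) = 0 -> 0 < x t ->
  exists l, l < t < l + loop q /\ x l = 0 /\ x (l + loop q) = 0 /\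
    forall s, l < s < l + loop q -> 0 < x s.
Proof.
  intros Hq Hx He Hp. assert (P := PI_RGT_0). assert (Hl := loop_gt q Hq).
  destruct (degenerate_loop q x x1 t Hq Hx He Hp) as [l [Hlt E]].
  exists l. split; [trivial|]. split; [|split].
  - rewrite E by lra. rewrite Rminus_diag. apply bump_0.
  - rewrite E by lra. replace (l + loop q - l) with (loop q) by ring. now apply bump_loop.
  - intros s Hs. rewrite E by lra. apply bump_gt0; trivial. lra.
Qed.

Lemma energy_opp (eps q x y : R) : energy eps q (- x) (- y) = energy eps q x y.
Proof. unfold energy. rewrite apow_opp. ring. Qed.

Lemma degenerate_loop_neg (q : R) (x x1 : R -> R) (t : R) : 0 < q < 1 -> osol 1 q x x1 ->
  energy 1 q (x t) (x1 t) = 0 -> x t < 0 ->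
  exists l, l < t < l + loop q /\ x l = 0 /\ x (l + loop q) = 0 /\
    forall s, l < s < l + loop q -> x s < 0.
Proof.
  intros Hq Hx He Hn.
  destruct (degenerate_loop_pos q _ _ t Hq (osol_opp _ _ _ _ Hx)) as [l [Hl [E0 [E1 H]]]].
  - now rewrite energy_opp.
  - lra.
  - exists l. split; [trivial|]. split; [lra|]. split; [lra|]. intros s Hs.
    specialize (H s Hs). lra.
Qed.

Lemma energy_0 (eps q : R) : energy eps q 0 0 = 0.
Proof. unfold energy. rewrite apow_0. ring. Qed.

Lemma degenerate_energy (eps q : R) (x x1 : R -> R) (t0 : R) : 0 < q -> osol eps q x x1 ->
  x t0 = 0 -> x1 t0 = 0 -> forall t, energy eps q (x t) (x1 t) = 0.
Proof.
  intros Hq Hx E0 E1 t. rewrite (energy_const eps q x x1 t t0 Hq Hx), E0, E1. apply energy_0.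
Qed.

(** The energy is zero. For [eps = -1] it is a sum of nonnegative terms. For [eps = 1] and [q > 1],
    with [x] bounded by periodicity, it bounds [|x1|] by a multiple of [|x|], and the Gronwall
    estimate starts from [t0]. Both leave only the zero solution. *)
Lemma degenerate_case (eps q p : R) (x x1 : R -> R) (t0 : R) : 0 < q -> q <> 1 ->
  eps = 1 \/ eps = -1 -> osol eps q x x1 -> periodic p x -> x t0 = 0 -> x1 t0 = 0 ->
  ~ (forall s t, x s = x t) -> eps = 1 /\ q < 1.
Proof.
  intros Hq Hq1 Heps Hx [Hp Hper] E0 E1 Hnc.
  assert (En := degenerate_energy eps q x x1 t0 Hq Hx E0 E1).
  assert (Hk : 0 < 2 / (1 + q)) by (apply Rdiv_lt_0_compat; lra).
  assert (Z : (forall t, x t = 0) -> False).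
  { intros Z. apply Hnc. intros s t. now rewrite !Z. }
  destruct Heps as [-> | ->].
  - split; trivial. destruct (Rlt_le_dec q 1) as [H|H]; trivial. exfalso. apply Z.
    assert (Cx := fun t => proj1 (osol_continuous _ _ _ _ t Hx)).
    destruct (periodic_max p (fun t => Rabs (x t)) Hp) as [tm M].
    { intros t. now rewrite Hper. }
    { intros t. apply continuous_Rabs_comp, Cx. }
    simpl in M. set (B := Rabs (x tm)) in *. set (K := 2 / (1 + q) * apow (q - 1) B).
    assert (HB : forall t, x1 t ^ 2 <= K * x t ^ 2).
    { intros t. specialize (En t). unfold energy in En.
      replace (1 + q) with (q - 1 + 2) in En at 2 by ring. rewrite apow_plus, apow_sq in En.
      assert (Ha : apow (q - 1) (x t) <= apow (q - 1) B).
      { replace (apow (q - 1) (x t)) with (apow (q - 1) (Rabs (x t))).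
        2:{ unfold Rabs. destruct (Rcase_abs (x t)); trivial. apply apow_opp. }
        destruct (M t) as [Hlt| ->]; [|lra]. apply Rlt_le, apow_lt; [lra|].
        split; trivial. apply Rabs_pos. }
      assert (Hx2 := pow2_ge_0 (x t)).
      assert (Ha' : 2 / (1 + q) * apow (q - 1) (x t) <= K) by (apply Rmult_le_compat_l; lra).
      assert (2 / (1 + q) * apow (q - 1) (x t) * x t ^ 2 <= K * x t ^ 2)
        by (apply Rmult_le_compat_r; lra). lra. }
    assert (HK : 0 <= K) by (apply Rmult_le_pos; [lra|apply apow_ge0]).
    intros t. apply (gronwall_zero x x1 (sqrt K) (Rmin t t0 - 1) (Rmax t t0 + 1) t0).
    + assert (J := Rmin_r t t0). assert (J' := Rmax_r t t0). lra.
    + intros s _. apply Hx.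
    + intros s _. apply Rsqr_incr_0_var.
      * unfold Rsqr. replace (sqrt K * Rabs (x s) * (sqrt K * Rabs (x s))) with
          ((sqrt K * sqrt K) * (Rabs (x s) ^ 2)) by ring.
        rewrite sqrt_sqrt, pow2_abs by trivial.
        replace (Rabs (x1 s) * Rabs (x1 s)) with (Rabs (x1 s) ^ 2) by ring. rewrite pow2_abs.
        apply HB.
      * apply Rmult_le_pos; [apply sqrt_pos|apply Rabs_pos].
    + trivial.
    + assert (J := Rmin_l t t0). assert (J' := Rmax_l t t0). lra.
  - exfalso. apply Z. intros t. specialize (En t). unfold energy in En.
    assert (J := apow_ge0 (1 + q) (x t)).
    assert (0 <= 2 / (1 + q) * apow (1 + q) (x t)) by (apply Rmult_le_pos; lra).
    assert (J1 := pow2_ge_0 (x1 t)). assert (J0 := pow2_ge_0 (x t)).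
    apply Rsqr_0_uniq. rewrite Rsqr_pow2. lra.
Qed.

(** A shorter period would move the left end of a loop, where [x] vanishes, into its interior. *)
Lemma degenerate_period (q p : R) (x x1 : R -> R) (t0 : R) : 0 < q < 1 -> osol 1 q x x1 ->
  periodic p x -> x t0 = 0 -> x1 t0 = 0 -> ~ (forall s t, x s = x t) -> loop q <= p.
Proof.
  intros Hq Hx [Hp Hper] E0 E1 Hnc. assert (P := PI_RGT_0). assert (HL := loop_gt q Hq).
  assert (En := degenerate_energy 1 q x x1 t0 ltac:(lra) Hx E0 E1).
  assert (Z : exists t, x t <> 0).
  { apply Classical_Prop.NNPP. intros Z. apply Hnc.
    assert (Z0 : forall t, x t = 0).
    { intros t. apply Classical_Prop.NNPP. intros K. apply Z. now exists t. }
    intros s t. now rewrite !Z0. }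
  destruct Z as [t Ht]. apply Rnot_lt_le. intros Hlt.
  destruct (Rlt_le_dec 0 (x t)) as [H|H].
  - destruct (degenerate_loop_pos q x x1 t Hq Hx (En t) H) as [l [_ [El [_ Hl]]]].
    specialize (Hl (l + p) ltac:(lra)). rewrite Hper in Hl. lra.
  - destruct (degenerate_loop_neg q x x1 t Hq Hx (En t) ltac:(lra)) as [l [_ [El [_ Hl]]]].
    specialize (Hl (l + p) ltac:(lra)). rewrite Hper in Hl. lra.
Qed.

(** A positive loop and a negative one, the latter moved by periods into the window that starts with
    the former, occupy disjoint intervals of length [loop q] within one period. *)
Lemma degenerate_sc_period (q p : R) (x x1 : R -> R) (t0 : R) : 0 < q < 1 -> osol 1 q x x1 ->
  periodic p x -> x t0 = 0 -> x1 t0 = 0 -> sign_changing_O x -> 2 * loop q <= p.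
Proof.
  intros Hq Hx [Hp Hper] E0 E1 [[tp Htp] [tn Htn]].
  assert (P := PI_RGT_0). assert (HL := loop_gt q Hq).
  assert (En := degenerate_energy 1 q x x1 t0 ltac:(lra) Hx E0 E1).
  destruct (degenerate_loop_pos q x x1 tp Hq Hx (En tp) Htp) as [l [_ [El [_ Hl]]]].
  set (y := fun t => x (t + l)).
  assert (Hy : forall t, y (t + p) = y t).
  { intros t. unfold y. replace (t + p + l) with (t + l + p) by ring. apply Hper. }
  destruct (degenerate_loop_neg q x x1 tn Hq Hx (En tn) Htn) as [l' [_ [El' [_ Hl']]]].
  destruct (periodic_reduce p y (l' - l) Hp Hy) as [m [Hm [_ [n En']]]].
  set (m' := m + l). assert (Em : m' = l' + IZR n * p) by (unfold m'; lra).
  assert (Xm : x m' = 0) by (rewrite Em, (periodic_multZ p x n Hper); exact El').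
  assert (Hm' : forall s, m' < s < m' + loop q -> x s < 0).
  { intros s Hs. rewrite <- (periodic_multZ p x (- n) Hper). apply Hl'. rewrite opp_IZR. lra. }
  (* A zero end of one loop cannot lie inside the other; coinciding left ends are excluded by the
     signs at the midpoint. *)
  assert (M1 : l + loop q <= m').
  { apply Rnot_lt_le. intros K. destruct (Req_dec m' l) as [E|E].
    - assert (J1 := Hl (l + loop q / 2) ltac:(lra)). assert (J2 := Hm' (l + loop q / 2) ltac:(lra)). lra.
    - assert (J := Hl m' ltac:(unfold m' in *; lra)). lra. }
  assert (M2 : m' + loop q <= l + p).
  { apply Rnot_lt_le. intros K. assert (J := Hm' (l + p) ltac:(unfold m' in *; lra)).
    rewrite Hper in J. lra. }
  lra.
Qed.

Lemma min_derive_0 (f : R -> R) (t0 l : R) : is_derive f t0 l ->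
  (forall t, f t0 <= f t) -> l = 0.
Proof.
  intros Hd H. assert (E := max_derive_0 (fun t => - f t) t0 (- l) (is_derive_opp_R _ _ _ Hd)).
  assert (- l = 0); [|lra]. apply E. intros t. specialize (H t). lra.
Qed.

Lemma nonneg_zero_derive (eps q : R) (x x1 : R -> R) (t0 : R) : osol eps q x x1 ->
  (forall t, 0 <= x t) -> x t0 = 0 -> x1 t0 = 0.
Proof.
  intros Hx Hp E. apply (min_derive_0 x t0); [apply Hx|]. intros t. rewrite E. apply Hp.
Qed.

(** Both ends of a loop are zeros, hence congruent to the single zero modulo [p], so [loop q] is a
    positive multiple of [p]. It is also at most [p], since the left end cannot be moved into the
    interior; thus [p = loop q] and one loop fills the period. *)
Lemma once_vanishing_bump (q p : R) (x x1 : R -> R) : 0 < q < 1 -> osol 1 q x x1 ->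
  (forall t, 0 <= x t) -> periodic p x -> (exists! t, (0 <= t < p) /\ x t = 0) ->
  exists tau, forall t, x t = bump q (t + tau).
Proof.
  intros Hq Hx Hnn [Hp Hper] [t0 [[Ht0 E0] Hun]].
  assert (P := PI_RGT_0). assert (HL := loop_gt q Hq).
  assert (E1 := nonneg_zero_derive 1 q x x1 t0 Hx Hnn E0).
  assert (En := degenerate_energy 1 q x x1 t0 ltac:(lra) Hx E0 E1).
  assert (Z : exists s, 0 < x s).
  { assert (Zs : exists s, 0 <= s < p /\ s <> t0).
    { destruct (Req_dec t0 0) as [->|H]; [exists (p / 2); lra|exists 0; lra]. }
    destruct Zs as [s [Hs Hs0]]. exists s. destruct (Hnn s) as [H|H]; trivial.
    destruct Hs0. symmetry. now apply Hun. }
  destruct Z as [s Hs].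
  destruct (degenerate_loop q x x1 s Hq Hx (En s) Hs) as [l [Hl El]].
  assert (Xl : x l = 0) by (rewrite El by lra; rewrite Rminus_diag; apply bump_0).
  assert (Xl' : x (l + loop q) = 0).
  { rewrite El by lra. replace (l + loop q - l) with (loop q) by ring. now apply bump_loop. }
  assert (Hpl : loop q <= p).
  { apply Rnot_lt_le. intros K. assert (J := El (l + p) ltac:(lra)). rewrite Hper, Xl in J.
    assert (J' := bump_gt0 q (l + p - l) Hq ltac:(lra)). lra. }
  destruct (periodic_reduce p x l Hp Hper) as [a [Ha [Ea [na Na]]]].
  destruct (periodic_reduce p x (l + loop q) Hp Hper) as [b [Hb [Eb [nb Nb]]]].
  assert (A : t0 = a) by (apply Hun; split; [trivial|lra]).
  assert (B : t0 = b) by (apply Hun; split; [trivial|lra]).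
  assert (Elp : loop q = IZR (na - nb) * p) by (rewrite minus_IZR; lra).
  assert (Hn : (na - nb = 1)%Z).
  { assert (G0 : 0 < IZR (na - nb)) by nra. assert (G1 : IZR (na - nb) <= 1) by nra.
    apply lt_IZR in G0. apply le_IZR in G1. lia. }
  rewrite Hn, Rmult_1_l in Elp.
  exists (- l). intros t.
  destruct (periodic_reduce p (fun t => x (t + l)) (t - l) Hp) as [r [Hr [Er [n En']]]].
  { intros u. replace (u + p + l) with (u + l + p) by ring. apply Hper. }
  simpl in Er. replace (t - l + l) with t in Er by ring. rewrite <- Er.
  rewrite El by lra. replace (r + l - l) with (t + - l + IZR n * p) by lra.
  apply periodic_multZ. intros u. rewrite <- Elp. now apply bump_periodic.
Qed.

(** A period has the length of exactly [n] loops. For [n = 1] one loop fills it; otherwise density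
    of the positive set excludes rest intervals, so each loop starts where the previous one ends. *)
Lemma full_loops_bump (q : R) (n : nat) (x x1 : R -> R) (t0 : R) : 0 < q < 1 -> osol 1 q x x1 ->
  (forall t, 0 <= x t) -> (0 < n)%nat -> (forall t, x (t + INR n * loop q) = x t) ->
  x t0 = 0 -> ~ (forall s t, x s = x t) ->
  ((1 < n)%nat -> forall a b, a < b -> exists t, a < t < b /\ 0 < x t) ->
  exists tau, forall t, x t = bump q (t + tau).
Proof.
  intros Hq Hx Hnn Hn Hper E0 Hnc Hdense.
  assert (P := PI_RGT_0). assert (HL := loop_gt q Hq).
  assert (E1 := nonneg_zero_derive 1 q x x1 t0 Hx Hnn E0).
  assert (En := degenerate_energy 1 q x x1 t0 ltac:(lra) Hx E0 E1).
  assert (Z : exists s, 0 < x s).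
  { apply Classical_Prop.NNPP. intros Z. apply Hnc.
    assert (Z0 : forall t, x t = 0).
    { intros t. apply Rle_antisym; [|apply Hnn]. apply Rnot_lt_le. intros K. apply Z. now exists t. }
    intros s t. now rewrite !Z0. }
  destruct Z as [s Hs].
  destruct (degenerate_loop q x x1 s Hq Hx (En s) Hs) as [l [Hl El]].
  (* From any zero a loop starts at once: a gap before the next loop would contain a point of yet
     another loop, whose interior would cover [t1] or [l1], both zeros. *)
  assert (Step : (1 < n)%nat -> forall t1, x t1 = 0 ->
            forall t, t1 <= t <= t1 + loop q -> x t = bump q (t - t1)).
  { intros H1 t1 Z1. specialize (Hdense H1).
    destruct (Hdense t1 (t1 + loop q) ltac:(lra)) as [s1 [Hs1 Ps1]].
    destruct (degenerate_loop q x x1 s1 Hq Hx (En s1) Ps1) as [l1 [Hl1 El1]].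
    assert (L1 : t1 <= l1).
    { apply Rnot_lt_le. intros K. assert (J := El1 t1 ltac:(lra)). rewrite Z1 in J.
      assert (J' := bump_gt0 q (t1 - l1) Hq ltac:(lra)). lra. }
    assert (E : l1 = t1).
    { apply Rle_antisym; trivial. apply Rnot_lt_le. intros K.
      destruct (Hdense t1 l1 K) as [s2 [Hs2 Ps2]].
      destruct (degenerate_loop q x x1 s2 Hq Hx (En s2) Ps2) as [l2 [Hl2 El2]].
      assert (L2 : t1 <= l2).
      { apply Rnot_lt_le. intros K2. assert (J := El2 t1 ltac:(lra)). rewrite Z1 in J.
        assert (J' := bump_gt0 q (t1 - l2) Hq ltac:(lra)). lra. }
      assert (Zl : x l1 = 0) by (rewrite El1 by lra; rewrite Rminus_diag; apply bump_0).
      assert (J := El2 l1 ltac:(lra)). rewrite Zl in J.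
      assert (J' := bump_gt0 q (l1 - l2) Hq ltac:(lra)). lra. }
    now rewrite E in El1. }
  assert (All : forall j, (j < n)%nat -> forall t,
            l + INR j * loop q <= t <= l + INR (S j) * loop q -> x t = bump q (t - l)).
  { induction j as [|j IH]; intros Hj t Ht.
    - simpl in Ht. apply El. lra.
    - assert (H1 : (1 < n)%nat) by lia.
      assert (Z1 : x (l + INR (S j) * loop q) = 0).
      { rewrite IH; [|lia|rewrite S_INR; lra].
        replace (l + INR (S j) * loop q - l) with (0 + INR (S j) * loop q) by ring.
        rewrite (periodic_mult (loop q) (bump q)); [apply bump_0|].
        intros u. now apply bump_periodic. }
      rewrite (Step H1 _ Z1) by (rewrite (S_INR (S j)) in Ht; lra).
      rewrite <- (periodic_mult (loop q) (bump q) (S j) (fun u => bump_periodic q u Hq)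
                    (t - (l + INR (S j) * loop q))).
      f_equal; ring. }
  exists (- l). intros t.
  assert (Hp : 0 < INR n * loop q).
  { apply Rmult_lt_0_compat; [apply lt_0_INR; lia|lra]. }
  destruct (periodic_reduce _ (fun t => x (t + l)) (t - l) Hp) as [r [Hr [Er [m Em]]]].
  { intros u. replace (u + INR n * loop q + l) with (u + l + INR n * loop q) by ring. apply Hper. }
  simpl in Er. replace (t - l + l) with t in Er by ring. rewrite <- Er.
  assert (Hj : exists j, (j < n)%nat /\ INR j * loop q <= r <= INR (S j) * loop q).
  { destruct (Req_dec r 0) as [->|Hr0].
    - exists 0%nat. split; [trivial|]. simpl. lra.
    - destruct (ex_nat_step (loop q) r ltac:(lra) ltac:(lra)) as [j Hj]. exists j. split; [|lra].
      apply INR_lt. nra. }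
  destruct Hj as [j [Hj Hjr]].
  rewrite (All j Hj) by lra. replace (r + l - l) with (t + - l + IZR m * (INR n * loop q)) by lra.
  apply periodic_multZ. intros u. apply periodic_mult. intros v. now apply bump_periodic.
Qed.

(** * Polar coordinates *)

(** Continuous differentiability of order [n] on [D], with the partial derivatives as witnesses;
    sums, products and compositions then follow by induction on [n], and [ex_diff_n] is recovered
    when [D] is open. *)
Fixpoint smooth (D : R -> R -> Prop) (n : nat) (f : R -> R -> R) : Prop :=
  (forall x y, D x y -> continuity_2d_pt f x y) /\
  match n with
  | O => True
  | S n => exists fx fy, (forall x y, D x y ->
      is_derive (fun z => f z y) x (fx x y) /\ is_derive (fun z => f x z) y (fy x y)) /\
      smooth D n fx /\ smooth D n fy
  end.

Fixpoint smooth1 (I : R -> Prop) (n : nat) (g : R -> R) : Prop :=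
  (forall x, I x -> continuous g x) /\
  match n with
  | O => True
  | S n => exists g', (forall x, I x -> is_derive g x (g' x)) /\ smooth1 I n g'
  end.

Lemma smooth_ex_diff_n (D : R -> R -> Prop) (n : nat) (f : R -> R -> R) :
  (forall x y, D x y -> locally_2d D x y) -> smooth D n f ->
  forall x y, D x y -> ex_diff_n f n x y.
Proof.
  intros HD. revert f. induction n as [|n IH]; intros f [Hc Hn] x y Hxy.
  - simpl. split; [now apply Hc|trivial].
  - destruct Hn as [fx [fy [Hd [Hx Hy]]]]. simpl. split; [now apply Hc|].
    split; [|split; [|split]].
    + exists (fx x y). now apply Hd.
    + exists (fy x y). now apply Hd.
    + apply ex_diff_n_ext_loc with fx; [|now apply IH].
      apply locally_2d_impl with (2 := HD x y Hxy). apply locally_2d_forall.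
      intros u v Huv. symmetry. apply is_derive_unique. now apply Hd.
    + apply ex_diff_n_ext_loc with fy; [|now apply IH].
      apply locally_2d_impl with (2 := HD x y Hxy). apply locally_2d_forall.
      intros u v Huv. symmetry. apply is_derive_unique. now apply Hd.
Qed.

Lemma smooth_pred (D : R -> R -> Prop) (n : nat) (f : R -> R -> R) :
  smooth D (S n) f -> smooth D n f.
Proof.
  revert f. induction n as [|n IH]; intros f [Hc [fx [fy [Hd [Hx Hy]]]]].
  - split; trivial.
  - split; trivial. exists fx, fy. split; [trivial|]. split; now apply IH.
Qed.

Lemma smooth_const (D : R -> R -> Prop) (n : nat) (c : R) : smooth D n (fun _ _ => c).
Proof.
  revert c. induction n as [|n IH]; intros c; (split; [intros; apply continuity_2d_pt_const|]); trivial.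
  exists (fun _ _ => 0), (fun _ _ => 0). split; [|split; apply IH].
  intros x y _. split; apply (is_derive_const c).
Qed.

Lemma smooth_fst (D : R -> R -> Prop) (n : nat) : smooth D n (fun x _ => x).
Proof.
  destruct n as [|n]; (split; [intros; apply continuity_2d_pt_id1|]); trivial.
  exists (fun _ _ => 1), (fun _ _ => 0). split; [|split; apply smooth_const].
  intros x y _. split; [apply (is_derive_id (K := R_AbsRing))|apply (is_derive_const x)].
Qed.

Lemma smooth_snd (D : R -> R -> Prop) (n : nat) : smooth D n (fun _ y => y).
Proof.
  destruct n as [|n]; (split; [intros; apply continuity_2d_pt_id2|]); trivial.
  exists (fun _ _ => 0), (fun _ _ => 1). split; [|split; apply smooth_const].
  intros x y _. split; [apply (is_derive_const y)|apply (is_derive_id (K := R_AbsRing))].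
Qed.

Lemma smooth_plus (D : R -> R -> Prop) (n : nat) (f g : R -> R -> R) :
  smooth D n f -> smooth D n g -> smooth D n (fun x y => f x y + g x y).
Proof.
  revert f g. induction n as [|n IH]; intros f g [Fc Fn] [Gc Gn];
    (split; [intros; apply continuity_2d_pt_plus; auto|]); trivial.
  destruct Fn as [fx [fy [Fd [Fx Fy]]]]. destruct Gn as [gx [gy [Gd [Gx Gy]]]].
  exists (fun x y => fx x y + gx x y), (fun x y => fy x y + gy x y).
  split; [|split; now apply IH]. intros x y H.
  split; apply is_derive_plus_R; (apply Fd || apply Gd); trivial.
Qed.

Lemma smooth_mult (D : R -> R -> Prop) (n : nat) (f g : R -> R -> R) :
  smooth D n f -> smooth D n g -> smooth D n (fun x y => f x y * g x y).
Proof.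
  revert f g. induction n as [|n IH]; intros f g Hf Hg;
    (split; [intros; apply continuity_2d_pt_mult; [apply Hf|apply Hg]; trivial|]); trivial.
  assert (Hf' := smooth_pred _ _ _ Hf). assert (Hg' := smooth_pred _ _ _ Hg).
  destruct Hf as [_ [fx [fy [Fd [Fx Fy]]]]]. destruct Hg as [_ [gx [gy [Gd [Gx Gy]]]]].
  exists (fun x y => fx x y * g x y + f x y * gx x y), (fun x y => fy x y * g x y + f x y * gy x y).
  split; [|split; apply smooth_plus; now apply IH]. intros x y H.
  destruct (Fd x y H) as [F1 F2]. destruct (Gd x y H) as [G1 G2]. split.
  - now apply (is_derive_mult_R (fun z => f z y) (fun z => g z y)).
  - now apply (is_derive_mult_R (fun z => f x z) (fun z => g x z)).
Qed.

Lemma smooth_comp (D : R -> R -> Prop) (I : R -> Prop) (n : nat) (g : R -> R) (f : R -> R -> R) :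
  smooth1 I n g -> smooth D n f -> (forall x y, D x y -> I (f x y)) ->
  smooth D n (fun x y => g (f x y)).
Proof.
  revert g f. induction n as [|n IH]; intros g f Hg Hf HI;
    (split; [intros x y H; apply (continuity_1d_2d_pt_comp g f);
       [apply continuity_pt_filterlim; apply Hg; auto|apply Hf; trivial]|]); trivial.
  assert (Hf' := smooth_pred _ _ _ Hf).
  destruct Hf as [_ [fx [fy [Fd [Fx Fy]]]]]. destruct Hg as [_ [g' [Gd Gn]]].
  exists (fun x y => g' (f x y) * fx x y), (fun x y => g' (f x y) * fy x y).
  split; [|split; apply smooth_mult; trivial; now apply IH].
  intros x y H. destruct (Fd x y H) as [F1 F2]. split.
  - apply (is_derive_comp_R g (fun z => f z y)); trivial. now apply Gd, HI.
  - apply (is_derive_comp_R g (fun z => f x z)); trivial. now apply Gd, HI.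
Qed.

Lemma smooth1_two (I : R -> Prop) (g g1 g2 : R -> R) :
  (forall x, I x -> is_derive g x (g1 x)) -> (forall x, I x -> is_derive g1 x (g2 x)) ->
  (forall x, I x -> continuous g2 x) -> smooth1 I 2 g.
Proof.
  intros H1 H2 H3. split.
  { intros x Hx. exact (continuous_of_is_derive _ _ _ (H1 x Hx)). }
  exists g1. split; trivial. split.
  { intros x Hx. exact (continuous_of_is_derive _ _ _ (H2 x Hx)). }
  exists g2. split; trivial. split; trivial.
Qed.

Lemma chain_2d (g : R -> R -> R) (X Y : R -> R) (t X' Y' : R) :
  locally_2d (fun x y => ex_diff_n g 1 x y) (X t) (Y t) ->
  is_derive X t X' -> is_derive Y t Y' ->
  is_derive (fun t => g (X t) (Y t)) t
    (Derive (fun z => g z (Y t)) (X t) * X' + Derive (fun z => g (X t) z) (Y t) * Y').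
Proof.
  intros L HX HY. apply is_derive_Reals.
  apply (derivable_pt_lim_comp_2d g X Y); [|now apply is_derive_Reals|now apply is_derive_Reals].
  apply filterdiff_differentiable_pt_lim.
  apply (is_derive_filterdiff g (X t) (Y t) (fun x y => Derive (fun z => g z y) x)).
  - apply locally_2d_locally in L. revert L. apply filter_imp. intros [u v] H.
    apply Derive_correct. apply H.
  - apply locally_2d_singleton in L. apply Derive_correct. apply L.
  - apply locally_2d_singleton in L. destruct L as [_ [_ [_ [[H _] _]]]].
    now apply continuity_2d_pt_filterlim in H.
Qed.

Lemma norm2_polar (r t : R) : 0 <= r -> norm2 (r * cos t) (r * sin t) = r.
Proof.
  intros Hr. unfold norm2. rewrite <- (sqrt_pow2 r) at 3 by trivial. f_equal.
  assert (S := sin2_cos2 t). unfold Rsqr in S.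
  replace ((r * cos t) ^ 2 + (r * sin t) ^ 2) with (r ^ 2 * (sin t * sin t + cos t * cos t)) by ring.
  rewrite S. ring.
Qed.

Lemma in_range_pos (R1 : R) (R2 : Rbar) (r : R) : 0 <= R1 -> in_range R1 R2 r -> 0 < r.
Proof. intros H [H1 _]. lra. Qed.

Lemma annulus_polar (R1 : R) (R2 : Rbar) (r t : R) : 0 <= R1 -> in_range R1 R2 r ->
  annulus R1 R2 (r * cos t) (r * sin t).
Proof.
  intros H Hr. unfold annulus. rewrite norm2_polar; trivial.
  apply Rlt_le. now apply (in_range_pos R1 R2).
Qed.

Lemma locally_in_range (R1 : R) (R2 : Rbar) (r : R) : in_range R1 R2 r ->
  locally r (in_range R1 R2).
Proof.
  intros [H1 H2]. apply filter_and.
  - apply locally_R. exists (r - R1). split; [lra|]. intros y Hy. apply Rabs_def2 in Hy. lra.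
  - now apply (open_Rbar_lt R2).
Qed.

Lemma continuity_2d_norm2 (x y : R) : continuity_2d_pt norm2 x y.
Proof.
  apply (continuity_1d_2d_pt_comp sqrt (fun x y => x ^ 2 + y ^ 2)).
  - apply continuity_pt_filterlim, continuous_sqrt.
  - apply (continuity_2d_pt_ext (fun x y => x * x + y * y)); [intros; ring|].
    apply continuity_2d_pt_plus; apply continuity_2d_pt_mult;
      (apply continuity_2d_pt_id1 || apply continuity_2d_pt_id2).
Qed.

Lemma locally_2d_of_continuity (f : R -> R -> R) (P : R -> Prop) (x y : R) :
  continuity_2d_pt f x y -> locally (f x y) P -> locally_2d (fun u v => P (f u v)) x y.
Proof.
  intros Hc HP. apply locally_R in HP. destruct HP as [d [Hd H]].
  destruct (Hc (mkposreal d Hd)) as [e He]. exists e. intros u v Hu Hv. now apply H, He.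
Qed.

Lemma locally_2d_annulus (R1 : R) (R2 : Rbar) (x y : R) : annulus R1 R2 x y ->
  locally_2d (annulus R1 R2) x y.
Proof.
  intros H. apply (locally_2d_of_continuity norm2 (in_range R1 R2)).
  - apply continuity_2d_norm2.
  - now apply locally_in_range.
Qed.

(** The chain rule is applied to [u] and to its first partials; in the polar sum the mixed terms
    cancel. The derivatives are returned as functions so that each can later be identified with its
    product form. *)
Lemma polar_laplacian (R1 : R) (R2 : Rbar) (u : R -> R -> R) : 0 <= R1 ->
  (forall x y, annulus R1 R2 x y -> ex_diff_n u 2 x y) ->
  exists ur ut urr utt : R -> R -> R, forall r t, in_range R1 R2 r ->
    is_derive (fun r => u (r * cos t) (r * sin t)) r (ur r t) /\
    is_derive (fun r => ur r t) r (urr r t) /\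
    is_derive (fun t => u (r * cos t) (r * sin t)) t (ut r t) /\
    is_derive (fun t => ut r t) t (utt r t) /\
    laplacian u (r * cos t) (r * sin t) = urr r t + ur r t / r + utt r t / r ^ 2.
Proof.
  intros HR1 Hu.
  set (ux := fun x y => Derive (fun z => u z y) x). set (uy := fun x y => Derive (fun z => u x z) y).
  set (uxx := fun x y => Derive (fun z => ux z y) x). set (uxy := fun x y => Derive (fun z => ux x z) y).
  set (uyx := fun x y => Derive (fun z => uy z y) x). set (uyy := fun x y => Derive (fun z => uy x z) y).
  exists (fun r t => ux (r * cos t) (r * sin t) * cos t + uy (r * cos t) (r * sin t) * sin t),
    (fun r t => ux (r * cos t) (r * sin t) * (- (r * sin t)) + uy (r * cos t) (r * sin t) * (r * cos t)),
    (fun r t => (uxx (r * cos t) (r * sin t) * cos t + uxy (r * cos t) (r * sin t) * sin t) * cos t +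
                (uyx (r * cos t) (r * sin t) * cos t + uyy (r * cos t) (r * sin t) * sin t) * sin t),
    (fun r t => (uxx (r * cos t) (r * sin t) * (- (r * sin t)) + uxy (r * cos t) (r * sin t) * (r * cos t)) * (- (r * sin t))
                + ux (r * cos t) (r * sin t) * (- (r * cos t)) +
                ((uyx (r * cos t) (r * sin t) * (- (r * sin t)) + uyy (r * cos t) (r * sin t) * (r * cos t)) * (r * cos t)
                + uy (r * cos t) (r * sin t) * (- (r * sin t)))).
  intros r t Hr. assert (Ha := annulus_polar R1 R2 r t HR1 Hr). assert (r0 := in_range_pos _ _ _ HR1 Hr).
  set (x := r * cos t) in *. set (y := r * sin t) in *.
  assert (L := locally_2d_annulus R1 R2 x y Ha).
  assert (Lu : locally_2d (fun x y => ex_diff_n u 1 x y) x y).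
  { apply locally_2d_impl with (2 := L). apply locally_2d_forall. intros a b H.
    apply (ex_diff_n_m 2 1); [lia|now apply Hu]. }
  assert (Lx : locally_2d (fun x y => ex_diff_n ux 1 x y) x y).
  { apply locally_2d_impl with (2 := L). apply locally_2d_forall. intros a b H.
    exact (proj1 (proj2 (proj2 (proj2 (Hu a b H))))). }
  assert (Ly : locally_2d (fun x y => ex_diff_n uy 1 x y) x y).
  { apply locally_2d_impl with (2 := L). apply locally_2d_forall. intros a b H.
    exact (proj2 (proj2 (proj2 (proj2 (Hu a b H))))). }
  assert (DXr : is_derive (fun r => r * cos t) r (cos t)) by (auto_derive; [trivial|ring]).
  assert (DYr : is_derive (fun r => r * sin t) r (sin t)) by (auto_derive; [trivial|ring]).
  assert (DXt : is_derive (fun t => r * cos t) t (- (r * sin t))) by (auto_derive; [trivial|ring]).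
  assert (DYt : is_derive (fun t => r * sin t) t (r * cos t)) by (auto_derive; [trivial|ring]).
  split; [|split; [|split; [|split]]].
  - exact (chain_2d u (fun r => r * cos t) (fun r => r * sin t) r _ _ Lu DXr DYr).
  - apply (is_derive_plus_R (fun r => ux (r * cos t) (r * sin t) * cos t)
             (fun r => uy (r * cos t) (r * sin t) * sin t)).
    + evar_last.
      * apply (is_derive_mult_R (fun r => ux (r * cos t) (r * sin t)) (fun _ => cos t)).
        -- exact (chain_2d ux (fun r => r * cos t) (fun r => r * sin t) r _ _ Lx DXr DYr).
        -- apply (is_derive_const (cos t)).
      * eqR. unfold zero; simpl. unfold uxx, uxy, x, y. ring.
    + evar_last.
      * apply (is_derive_mult_R (fun r => uy (r * cos t) (r * sin t)) (fun _ => sin t)).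
        -- exact (chain_2d uy (fun r => r * cos t) (fun r => r * sin t) r _ _ Ly DXr DYr).
        -- apply (is_derive_const (sin t)).
      * eqR. unfold zero; simpl. unfold uyx, uyy, x, y. ring.
  - exact (chain_2d u (fun t => r * cos t) (fun t => r * sin t) t _ _ Lu DXt DYt).
  - apply (is_derive_plus_R (fun t => ux (r * cos t) (r * sin t) * (- (r * sin t)))
             (fun t => uy (r * cos t) (r * sin t) * (r * cos t))).
    + apply (is_derive_mult_R (fun t => ux (r * cos t) (r * sin t)) (fun t => - (r * sin t))).
      * exact (chain_2d ux (fun t => r * cos t) (fun t => r * sin t) t _ _ Lx DXt DYt).
      * auto_derive; [trivial|unfold x; ring].
    + apply (is_derive_mult_R (fun t => uy (r * cos t) (r * sin t)) (fun t => r * cos t)).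
      * exact (chain_2d uy (fun t => r * cos t) (fun t => r * sin t) t _ _ Ly DXt DYt).
      * auto_derive; [trivial|unfold y; ring].
  - assert (EL : laplacian u x y = uxx x y + uyy x y) by reflexivity.
    rewrite EL. assert (S := sin2_cos2 t). unfold Rsqr in S.
    set (A := uxx x y). set (B := uxy x y). set (C := uyx x y). set (E := uyy x y).
    set (F := ux x y). set (G := uy x y).
    assert (S2 : A + E = (A + E) * (sin t * sin t + cos t * cos t)) by (rewrite S; ring).
    rewrite S2. unfold y, x. field. lra.
Qed.

Lemma is_derive_loc_unique (f g : R -> R) (x a b : R) :
  is_derive f x a -> is_derive g x b -> locally x (fun y => f y = g y) -> a = b.
Proof.
  intros Hf Hg L. rewrite <- (is_derive_unique f x a Hf).
  apply is_derive_unique. apply is_derive_ext_loc with g; trivial.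
  revert L. apply filter_imp. intros y E. now symmetry.
Qed.

Definition weight' (alpha M N r : R) : R :=
  alpha / r * (M * Rpower r alpha - N * Rpower r (- alpha)).

Lemma is_derive_weight (alpha M N r : R) : 0 < r ->
  is_derive (weight alpha M N) r (weight' alpha M N r).
Proof.
  intros Hr. unfold weight, weight', Rpower. auto_derive; [lra|]. field. lra.
Qed.

(** Euler's equation [r^2 W'' + r W' = alpha^2 W], solved for the second derivative. *)
Lemma is_derive_weight' (alpha M N r : R) : 0 < r ->
  is_derive (weight' alpha M N) r
    ((alpha ^ 2 * weight alpha M N r - r * weight' alpha M N r) / r ^ 2).
Proof.
  intros Hr. unfold weight, weight', Rpower. auto_derive; [lra|]. field. lra.
Qed.

Lemma Rpower_minus2 (r : R) : 0 < r -> Rpower r (- 2) = / r ^ 2.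
Proof.
  intros Hr. replace (- 2) with (- INR 2) by (simpl; ring).
  rewrite Rpower_Ropp. now rewrite Rpower_pow.
Qed.

(** The homogeneity by which the factor [W^(1-q)] in the equation cancels the radial part of the
    nonlinearity up to one factor [W]. *)
Lemma Rpower_spow_scale (q a x : R) : 0 < a ->
  Rpower a (1 - q) * spow q (a * x) = a * spow q x.
Proof.
  intros Ha. rewrite spow_mult, (spow_pos q a) by trivial. rewrite <- Rmult_assoc, <- Rpower_plus.
  replace (1 - q + q) with 1 by ring. now rewrite Rpower_1.
Qed.

Lemma polar_exists (x y : R) : exists t, x = norm2 x y * cos t /\ y = norm2 x y * sin t.
Proof.
  set (r := norm2 x y). assert (Hr : 0 <= r) by apply sqrt_pos.
  assert (Er : r ^ 2 = x ^ 2 + y ^ 2) by (apply pow2_sqrt; nra).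
  destruct Hr as [Hr|Hr].
  - assert (Hc : (x / r) ^ 2 + (y / r) ^ 2 = 1).
    { replace ((x / r) ^ 2 + (y / r) ^ 2) with ((x ^ 2 + y ^ 2) / r ^ 2) by (field; lra).
      rewrite <- Er. field. lra. }
    assert (Hb : -1 <= x / r <= 1) by (split; nra).
    assert (Sn : sin (acos (x / r)) = Rabs (y / r)).
    { rewrite sin_acos by trivial. rewrite Rsqr_pow2.
      replace (1 - (x / r) ^ 2) with ((y / r) ^ 2) by lra. rewrite <- Rsqr_pow2. apply sqrt_Rsqr_abs. }
    destruct (Rle_lt_dec 0 (y / r)) as [H|H].
    + exists (acos (x / r)). rewrite cos_acos, Sn, Rabs_pos_eq by trivial. split; field; lra.
    + exists (- acos (x / r)). rewrite cos_neg, sin_neg, cos_acos, Sn by trivial.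
      rewrite Rabs_left by trivial. split; field; lra.
  - exists 0. rewrite <- Hr in *. assert (x = 0) by nra. assert (y = 0) by nra. split; lra.
Qed.

Lemma norm2_sq (x y : R) : norm2 x y ^ 2 = x ^ 2 + y ^ 2.
Proof. apply pow2_sqrt. nra. Qed.

(** In the half plane around a base point the angle is the base angle plus the arctangent of cross
    product over dot product. Unlike an angle chosen pointwise, this one is smooth. *)
Lemma local_angle (x0 y0 t0 x y : R) : x0 = norm2 x0 y0 * cos t0 -> y0 = norm2 x0 y0 * sin t0 ->
  0 < x0 * x + y0 * y ->
  let t := t0 + atan ((x0 * y - y0 * x) * / (x0 * x + y0 * y)) in
  x = norm2 x y * cos t /\ y = norm2 x y * sin t.
Proof.
  intros Ex Ey Hd t. set (d := x0 * x + y0 * y) in *. set (e := x0 * y - y0 * x) in *.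
  set (r0 := norm2 x0 y0) in *. set (r := norm2 x y).
  assert (Hr0 : 0 <= r0) by apply sqrt_pos. assert (Hr : 0 <= r) by apply sqrt_pos.
  assert (E0 : r0 ^ 2 = x0 ^ 2 + y0 ^ 2) by apply norm2_sq.
  assert (E1 : r ^ 2 = x ^ 2 + y ^ 2) by apply norm2_sq.
  assert (E2 : d ^ 2 + e ^ 2 = (r0 * r) ^ 2) by (rewrite Rpow_mult_distr, E0, E1; unfold d, e; ring).
  assert (P0 : r0 <> 0).
  { intros Z. rewrite Z in *. assert (x0 = 0) by lra. assert (y0 = 0) by lra. unfold d in Hd. nra. }
  assert (P1 : r <> 0).
  { intros Z. rewrite Z in E1. assert (x = 0) by nra. assert (y = 0) by nra. unfold d in Hd. nra. }
  assert (Es : sqrt (1 + Rsqr (e * / d)) = r0 * r / d).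
  { rewrite <- (sqrt_pow2 (r0 * r / d)) by (apply Rlt_le, Rdiv_lt_0_compat; nra). f_equal.
    rewrite Rsqr_pow2. replace ((r0 * r / d) ^ 2) with ((r0 * r) ^ 2 / d ^ 2) by (field; lra).
    rewrite <- E2. field. lra. }
  assert (Ec : cos (atan (e * / d)) = d / (r0 * r)).
  { rewrite cos_atan, Es. field. repeat split; lra. }
  assert (En : sin (atan (e * / d)) = e / (r0 * r)).
  { rewrite sin_atan, Es. field. repeat split; lra. }
  unfold t. rewrite cos_plus, sin_plus, Ec, En.
  assert (C0 : cos t0 = x0 / r0) by (rewrite Ex; field; trivial).
  assert (S0 : sin t0 = y0 / r0) by (rewrite Ey; field; trivial).
  rewrite C0, S0. split.
  - replace (r * (x0 / r0 * (d / (r0 * r)) - y0 / r0 * (e / (r0 * r)))) with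
      ((x0 * d - y0 * e) / r0 ^ 2) by (field; split; trivial).
    replace (x0 * d - y0 * e) with ((x0 ^ 2 + y0 ^ 2) * x) by (unfold d, e; ring).
    rewrite <- E0. field. trivial.
  - replace (r * (y0 / r0 * (d / (r0 * r)) + x0 / r0 * (e / (r0 * r)))) with
      ((y0 * d + x0 * e) / r0 ^ 2) by (field; split; trivial).
    replace (y0 * d + x0 * e) with ((x0 ^ 2 + y0 ^ 2) * y) by (unfold d, e; ring).
    rewrite <- E0. field. trivial.
Qed.

Lemma locally_2d_half_plane (x0 y0 x y : R) : 0 < x0 * x + y0 * y ->
  locally_2d (fun x y => 0 < x0 * x + y0 * y) x y.
Proof.
  intros H. apply (locally_2d_of_continuity (fun x y => x0 * x + y0 * y) (fun z => 0 < z)).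
  - apply continuity_2d_pt_plus; apply continuity_2d_pt_mult;
      (apply continuity_2d_pt_const || apply continuity_2d_pt_id1 || apply continuity_2d_pt_id2).
  - apply locally_R. exists (x0 * x + y0 * y). split; trivial.
    intros z Hz. apply Rabs_def2 in Hz. lra.
Qed.

(** As a function of [r^2] the weight can be differentiated in Cartesian coordinates without a
    square root. *)
Lemma weight_of_square (alpha M N r : R) : 0 < r -> weight alpha M N r =
  M * exp (alpha / 2 * ln (r ^ 2)) + N * exp (- (alpha / 2) * ln (r ^ 2)).
Proof.
  intros Hr. unfold weight, Rpower. replace (r ^ 2) with (r * r) by ring.
  rewrite ln_mult by trivial. f_equal; do 2 f_equal; field.
Qed.

Definition alpha_osol (eps q alpha : R) (w w1 : R -> R) : Prop :=
  forall t, is_derive w t (w1 t) /\ is_derive w1 t (eps * spow q (w t) - alpha ^ 2 * w t).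

Lemma smooth_linear (D : R -> R -> Prop) (n : nat) (a b : R) :
  smooth D n (fun x y => a * x + b * y).
Proof.
  apply smooth_plus; apply smooth_mult;
    (apply smooth_const || apply smooth_fst || apply smooth_snd).
Qed.

Lemma smooth_angle (x0 y0 t0 : R) : smooth (fun x y => 0 < x0 * x + y0 * y) 2
  (fun x y => t0 + atan ((x0 * y + - y0 * x) * / (x0 * x + y0 * y))).
Proof.
  set (D := fun x y => 0 < x0 * x + y0 * y).
  apply smooth_plus; [apply smooth_const|].
  apply (smooth_comp D (fun _ => True) 2 atan).
  - apply (smooth1_two _ atan (fun z => / (1 + z ^ 2)) (fun z => - (2 * z) / (1 + z ^ 2) ^ 2)).
    + intros z _. evar_last; [apply is_derive_Reals, derivable_pt_lim_atan|].
      reflexivity.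
    + intros z _. auto_derive; [nra|]. field. nra.
    + intros z _. apply (ex_derive_continuous (fun z => - (2 * z) / (1 + z ^ 2) ^ 2)).
      auto_derive. nra.
  - apply smooth_mult.
    + apply (smooth_plus D 2 (fun _ y => x0 * y) (fun x _ => - y0 * x));
        apply smooth_mult; (apply smooth_const || apply smooth_fst || apply smooth_snd).
    + apply (smooth_comp D (fun z => 0 < z) 2 (fun z => / z)).
      * apply (smooth1_two _ (fun z => / z) (fun z => - / z ^ 2) (fun z => 2 / z ^ 3)).
        -- intros z Hz. auto_derive; [lra|]. field. lra.
        -- intros z Hz. auto_derive; [nra|]. field. lra.
        -- intros z Hz. apply (ex_derive_continuous (fun z => 2 / z ^ 3)).
           auto_derive. apply (pow_nonzero z 3). lra.
      * apply smooth_linear.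
      * trivial.
  - trivial.
Qed.

(** Near each point [u] is a smooth function of [x^2 + y^2] times [w] of the local angle; [w] has a
    continuous second derivative because the equation expresses it through [w]. *)
Lemma polar_form_smooth (R1 : R) (R2 : Rbar) (eps q alpha M N : R) (u : R -> R -> R)
  (w w1 : R -> R) : 0 <= R1 -> 0 < q -> alpha_osol eps q alpha w w1 ->
  polar_form R1 R2 u (fun r t => weight alpha M N r * w t) ->
  forall x y, annulus R1 R2 x y -> ex_diff_n u 2 x y.
Proof.
  intros HR1 Hq Hw Hp x0 y0 H0. destruct (polar_exists x0 y0) as [t0 [Ex Ey]].
  assert (Hr0 := in_range_pos _ _ _ HR1 H0).
  assert (E0 := norm2_sq x0 y0).
  set (V := fun p => M * exp (alpha / 2 * ln p) + N * exp (- (alpha / 2) * ln p)).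
  set (D := fun x y => 0 < x0 * x + y0 * y).
  assert (D0 : D x0 y0) by (unfold D; nra).
  apply ex_diff_n_ext_loc with
    (fun x y => V (x * x + y * y) * w (t0 + atan ((x0 * y + - y0 * x) * / (x0 * x + y0 * y)))).
  - assert (LA := locally_2d_annulus R1 R2 x0 y0 H0).
    assert (LD := locally_2d_half_plane x0 y0 x0 y0 D0).
    assert (L := locally_2d_and _ _ _ _ LA LD). apply locally_2d_impl with (2 := L).
    apply locally_2d_forall. intros x y [Ha Hd].
    destruct (local_angle x0 y0 t0 x y Ex Ey Hd) as [Px Py].
    replace (x0 * y + - y0 * x) with (x0 * y - y0 * x) by ring.
    set (t := t0 + atan ((x0 * y - y0 * x) * / (x0 * x + y0 * y))) in *.
    assert (Hr := in_range_pos _ _ _ HR1 Ha).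
    assert (Eu : u x y = u (norm2 x y * cos t) (norm2 x y * sin t)) by now rewrite <- Px, <- Py.
    rewrite Eu, Hp by exact Ha.
    f_equal. rewrite weight_of_square by trivial. rewrite norm2_sq.
    unfold V. now replace (x * x + y * y) with (x ^ 2 + y ^ 2) by ring.
  - apply (smooth_ex_diff_n D).
    + intros x y Hd. now apply locally_2d_half_plane.
    + apply smooth_mult.
      * apply (smooth_comp D (fun p => 0 < p) 2 V).
        -- apply (smooth1_two _ V
             (fun p => alpha / 2 / p * (M * exp (alpha / 2 * ln p) - N * exp (- (alpha / 2) * ln p)))
             (fun p => (alpha / 2 * (alpha / 2) * V p -
                alpha / 2 * (M * exp (alpha / 2 * ln p) - N * exp (- (alpha / 2) * ln p))) / (p * p))).
           ++ intros p Hpp. unfold V. auto_derive; [lra|]. field. lra.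
           ++ intros p Hpp. unfold V. auto_derive; [lra|]. field. lra.
           ++ intros p Hpp. unfold V.
              match goal with |- continuous ?f p => apply (ex_derive_continuous f) end.
              auto_derive. repeat split; trivial; nra.
        -- apply smooth_plus; apply smooth_mult; (apply smooth_fst || apply smooth_snd).
        -- intros x y Hd. unfold D in Hd.
           destruct (Req_dec x 0) as [->|]; [destruct (Req_dec y 0) as [->|]; [lra|nra]|nra].
      * apply (smooth_comp D (fun _ => True) 2 w).
        -- apply (smooth1_two _ w w1 (fun t => eps * spow q (w t) - alpha ^ 2 * w t)).
           ++ intros t _. apply Hw.
           ++ intros t _. apply Hw.
           ++ intros t _. assert (Cw := continuous_of_is_derive _ _ _ (proj1 (Hw t))).
              apply (continuous_minus (fun t => eps * spow q (w t)) (fun t => alpha ^ 2 * w t)).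
              ** apply (continuous_scal_r eps (fun t => spow q (w t))).
                 apply (continuous_comp w (spow q)); trivial. now apply continuous_spow.
              ** now apply (continuous_scal_r (alpha ^ 2) w).
        -- exact (smooth_angle x0 y0 t0).
        -- trivial.
    + exact D0.
Qed.

Lemma polar_form_solution (R1 : R) (R2 : Rbar) (eps q alpha M N : R) (u : R -> R -> R)
  (w w1 : R -> R) : 0 <= R1 -> 0 < q ->
  (forall r, in_range R1 R2 r -> 0 < weight alpha M N r) -> alpha_osol eps q alpha w w1 ->
  polar_form R1 R2 u (fun r t => weight alpha M N r * w t) ->
  solution_E R1 R2 eps q alpha M N u.
Proof.
  intros HR1 Hq HW Hw Hp.
  assert (HC := polar_form_smooth R1 R2 eps q alpha M N u w w1 HR1 Hq Hw Hp).
  intros x y Ha. split; [now apply HC|].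
  destruct (polar_exists x y) as [t [Ex Ey]].
  assert (Hr0 := in_range_pos _ _ _ HR1 Ha). set (r := norm2 x y) in *.
  assert (Hr : in_range R1 R2 r) by exact Ha.
  destruct (polar_laplacian R1 R2 u HR1 HC) as [ur [ut [urr [utt H]]]].
  destruct (H r t Hr) as [_ [Hrr [_ [Htt HL]]]].
  assert (Er : forall r, in_range R1 R2 r -> ur r t = weight' alpha M N r * w t).
  { intros s Hs. destruct (H s t Hs) as [Hd _].
    apply (is_derive_loc_unique _ (fun s => weight alpha M N s * w t) s _ _ Hd).
    - evar_last; [apply (is_derive_mult_R (weight alpha M N) (fun _ => w t));
        [apply is_derive_weight; now apply (in_range_pos R1 R2)|apply (is_derive_const (w t))]|].
      unfold zero; simpl; ring.
    - generalize (locally_in_range R1 R2 s Hs). apply filter_imp. intros z Hz. now apply Hp. }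
  assert (Et : forall t, ut r t = weight alpha M N r * w1 t).
  { intros s. destruct (H r s Hr) as [_ [_ [Hd _]]].
    apply (is_derive_loc_unique _ (fun s => weight alpha M N r * w s) s _ _ Hd).
    - apply is_derive_scal_R. apply Hw.
    - apply filter_forall. intros z. now apply Hp. }
  assert (Err : urr r t = (alpha ^ 2 * weight alpha M N r - r * weight' alpha M N r) / r ^ 2 * w t).
  { apply (is_derive_loc_unique _ (fun s => weight' alpha M N s * w t) r _ _ Hrr).
    - evar_last; [apply (is_derive_mult_R (weight' alpha M N) (fun _ => w t));
        [now apply is_derive_weight'|apply (is_derive_const (w t))]|].
      unfold zero; simpl; ring.
    - generalize (locally_in_range R1 R2 r Hr). apply filter_imp. intros z Hz. now apply Er. }
  assert (Ett : utt r t = weight alpha M N r * (eps * spow q (w t) - alpha ^ 2 * w t)).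
  { apply (is_derive_loc_unique _ (fun s => weight alpha M N r * w1 s) t _ _ Htt).
    - apply is_derive_scal_R. apply Hw.
    - apply filter_forall. intros z. apply Et. }
  rewrite Ex, Ey, HL, Err, Ett, Er, Hp by trivial.
  rewrite Rpower_minus2 by trivial.
  replace (eps * / r ^ 2 * Rpower (weight alpha M N r) (1 - q) * spow q (weight alpha M N r * w t))
    with (eps * / r ^ 2 * (Rpower (weight alpha M N r) (1 - q) * spow q (weight alpha M N r * w t))) by ring.
  rewrite Rpower_spow_scale by now apply HW. field. lra.
Qed.

(** * Separation of variables *)

(** Each factor inherits its derivatives from [u] by freezing the other variable where the other
    factor is nonzero, at [t1] or at [r0]. *)
Lemma product_form_derivatives (R1 : R) (R2 : Rbar) (u : R -> R -> R) (h w : R -> R) (r0 t1 : R) :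
  0 <= R1 -> (forall x y, annulus R1 R2 x y -> ex_diff_n u 2 x y) ->
  polar_form R1 R2 u (fun r t => h r * w t) -> in_range R1 R2 r0 -> h r0 <> 0 -> w t1 <> 0 ->
  exists h1 h2 w1 w2 : R -> R,
    (forall r, in_range R1 R2 r -> is_derive h r (h1 r) /\ is_derive h1 r (h2 r)) /\
    (forall t, is_derive w t (w1 t) /\ is_derive w1 t (w2 t)) /\
    forall r t, in_range R1 R2 r ->
      laplacian u (r * cos t) (r * sin t) = h2 r * w t + h1 r * w t / r + h r * w2 t / r ^ 2.
Proof.
  intros HR1 HC Hp Hr0 H0 W0.
  destruct (polar_laplacian R1 R2 u HR1 HC) as [ur [ut [urr [utt H]]]].
  exists (fun r => ur r t1 / w t1), (fun r => urr r t1 / w t1),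
    (fun t => ut r0 t / h r0), (fun t => utt r0 t / h r0).
  assert (Dh : forall r, in_range R1 R2 r -> is_derive h r (ur r t1 / w t1)).
  { intros r Hr. destruct (H r t1 Hr) as [Hd _].
    apply is_derive_ext_loc with (fun r => / w t1 * u (r * cos t1) (r * sin t1)).
    - generalize (locally_in_range R1 R2 r Hr). apply filter_imp. intros s Hs. eqR.
      rewrite Hp by trivial. field. trivial.
    - evar_last; [apply is_derive_scal_R; exact Hd|]. eqR. unfold Rdiv. ring. }
  assert (Dw : forall t, is_derive w t (ut r0 t / h r0)).
  { intros t. destruct (H r0 t Hr0) as [_ [_ [Hd _]]].
    apply is_derive_ext with (fun t => / h r0 * u (r0 * cos t) (r0 * sin t)).
    - intros s. eqR. rewrite Hp by trivial. field. trivial.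
    - evar_last; [apply is_derive_scal_R; exact Hd|]. eqR. unfold Rdiv. ring. }
  assert (Dh2 : forall r, in_range R1 R2 r -> is_derive (fun r => ur r t1 / w t1) r (urr r t1 / w t1)).
  { intros r Hr. destruct (H r t1 Hr) as [_ [Hd _]].
    apply is_derive_ext with (fun r => / w t1 * ur r t1).
    - intros s. eqR. unfold Rdiv. ring.
    - evar_last; [apply is_derive_scal_R; exact Hd|]. eqR. unfold Rdiv. ring. }
  assert (Dw2 : forall t, is_derive (fun t => ut r0 t / h r0) t (utt r0 t / h r0)).
  { intros t. destruct (H r0 t Hr0) as [_ [_ [_ [Hd _]]]].
    apply is_derive_ext with (fun t => / h r0 * ut r0 t).
    - intros s. eqR. unfold Rdiv. ring.
    - evar_last; [apply is_derive_scal_R; exact Hd|]. eqR. unfold Rdiv. ring. }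
  split; [|split].
  - intros r Hr. split; [now apply Dh|now apply Dh2].
  - intros t. split; [apply Dw|apply Dw2].
  - intros r t Hr. destruct (H r t Hr) as [Hd1 [Hd2 [Hd3 [Hd4 HL]]]]. rewrite HL.
    assert (E1 : forall s, in_range R1 R2 s -> ur s t = ur s t1 / w t1 * w t).
    { intros s Hs. destruct (H s t Hs) as [Hd _].
      apply (is_derive_loc_unique _ (fun s => h s * w t) s _ _ Hd).
      - evar_last; [apply (is_derive_mult_R h (fun _ => w t)); [now apply Dh|apply (is_derive_const (w t))]|].
        unfold zero; simpl; ring.
      - generalize (locally_in_range R1 R2 s Hs). apply filter_imp. intros z Hz. now apply Hp. }
    assert (E2 : urr r t = urr r t1 / w t1 * w t).
    { apply (is_derive_loc_unique _ (fun s => ur s t1 / w t1 * w t) r _ _ Hd2).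
      - evar_last; [apply (is_derive_mult_R (fun s => ur s t1 / w t1) (fun _ => w t)); [now apply Dh2|apply (is_derive_const (w t))]|].
        unfold zero; simpl; ring.
      - generalize (locally_in_range R1 R2 r Hr). apply filter_imp. intros z Hz. now apply E1. }
    assert (E3 : forall s, ut r s = h r * (ut r0 s / h r0)).
    { intros s. destruct (H r s Hr) as [_ [_ [Hd _]]].
      apply (is_derive_loc_unique _ (fun s => h r * w s) s _ _ Hd).
      - apply is_derive_scal_R. apply Dw.
      - apply filter_forall. intros z. now apply Hp. }
    assert (E4 : utt r t = h r * (utt r0 t / h r0)).
    { apply (is_derive_loc_unique _ (fun s => h r * (ut r0 s / h r0)) t _ _ Hd4).
      - apply is_derive_scal_R. apply Dw2.
      - apply filter_forall. intros z. apply E3. }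
    rewrite (E1 r Hr), E2, E4. reflexivity.
Qed.

(** If the two values are opposite, or one of them is zero, the intermediate value theorem supplies
    half of a nonzero one. *)
Lemma two_moduli (w : R -> R) (s t : R) : (forall t, continuous w t) -> w s <> w t ->
  exists a b, 0 < Rabs (w a) /\ 0 < Rabs (w b) /\ Rabs (w a) <> Rabs (w b).
Proof.
  intros Hc Hst.
  assert (Z : forall a b, w b <> 0 -> (w a = 0 \/ w a = - w b) ->
            exists c, w c = w b / 2).
  { intros a b Hb Ha. destruct (IVT_gen w a b (w b / 2)) as [c [_ E]].
    - intros x. apply continuity_pt_filterlim, Hc.
    - unfold Rmin, Rmax. destruct (Rle_dec (w a) (w b)); destruct Ha; lra.
    - now exists c. }
  assert (F : forall a b, w b <> 0 -> (w a = 0 \/ w a = - w b) ->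
    exists c d, 0 < Rabs (w c) /\ 0 < Rabs (w d) /\ Rabs (w c) <> Rabs (w d)).
  { intros a b Hb Ha. destruct (Z a b Hb Ha) as [c Ec]. exists c, b.
    assert (P := Rabs_pos_lt _ Hb). rewrite Ec. unfold Rdiv. rewrite Rabs_mult.
    rewrite (Rabs_pos_eq (/ 2)) by lra. repeat split; lra. }
  destruct (Req_dec (w s) 0) as [S0|S0].
  - apply (F s t); [lra|now left].
  - destruct (Req_dec (w t) 0) as [T0|T0].
    + apply (F t s); [lra|now left].
    + destruct (Req_dec (Rabs (w s)) (Rabs (w t))) as [E|E].
      * apply (F s t); trivial. right. unfold Rabs in E.
        destruct (Rcase_abs (w s)), (Rcase_abs (w t)); lra.
      * exists s, t. repeat split; trivial; now apply Rabs_pos_lt.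
Qed.

Lemma apow_Rabs (p x : R) : apow p (Rabs x) = apow p x.
Proof. unfold Rabs. destruct (Rcase_abs x); trivial. apply apow_opp. Qed.

Lemma spow_mul_apow (q x : R) : spow q x = x * apow (q - 1) x.
Proof.
  destruct (Rtotal_order x 0) as [H|[->|H]].
  - rewrite <- (Ropp_involutive x) at 1. rewrite spow_opp, spow_eq_mul_apow by lra.
    rewrite apow_opp. ring.
  - rewrite spow_0. ring.
  - now apply spow_eq_mul_apow.
Qed.

(* The separated equation at two radii makes [(h/W)^(q-1)] independent of the radius. *)
Lemma separation_ratio (q eps h h' W W' a a' wa wb wa2 wb2 : R) :
  q <> 1 -> eps * eps = 1 -> h <> 0 -> h' <> 0 -> 0 < W -> 0 < W' ->
  0 < Rabs wa -> 0 < Rabs wb -> Rabs wa <> Rabs wb ->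
  (forall w w2, (w = wa /\ w2 = wa2) \/ (w = wb /\ w2 = wb2) ->
     a * w + h * w2 = eps * Rpower W (1 - q) * spow q (h * w) /\
     a' * w + h' * w2 = eps * Rpower W' (1 - q) * spow q (h' * w)) ->
  Rabs h / W = Rabs h' / W'.
Proof.
  intros Hq1 He Hh Hh' HW HW' Pa Pb Hab H.
  set (b := apow (q - 1) (Rabs h / W)). set (b' := apow (q - 1) (Rabs h' / W')).
  assert (Hb : forall h W, h <> 0 -> 0 < W -> forall w,
             Rpower W (1 - q) * spow q (h * w) = h * (apow (q - 1) (Rabs h / W) * (w * apow (q - 1) w))).
  { intros k V Hk HV w. rewrite spow_mult, (spow_mul_apow q k), (spow_mul_apow q w).
    assert (E : apow (q - 1) (Rabs k) = apow (q - 1) (Rabs k / V) * apow (q - 1) V).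
    { rewrite <- apow_mult. f_equal. field. lra. }
    rewrite apow_Rabs in E. rewrite E, (apow_pos _ V) by trivial.
    assert (E1 : Rpower V (1 - q) * Rpower V (q - 1) = 1).
    { rewrite <- Rpower_plus. replace (1 - q + (q - 1)) with 0 by ring. now apply Rpower_O. }
    replace (Rpower V (1 - q) * (k * (apow (q - 1) (Rabs k / V) * Rpower V (q - 1)) * (w * apow (q - 1) w)))
      with ((Rpower V (1 - q) * Rpower V (q - 1)) * (k * (apow (q - 1) (Rabs k / V) * (w * apow (q - 1) w)))) by ring.
    rewrite E1. ring. }
  (* Dividing each equation by its profile and subtracting eliminates [w2]. What remains is a
     multiple of [|w|^(q-1)], and its being the same for two different moduli forces the multiple to
     vanish. *)
  assert (K : forall w w2, w <> 0 -> (w = wa /\ w2 = wa2) \/ (w = wb /\ w2 = wb2) ->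
            a / h - a' / h' = eps * (b - b') * apow (q - 1) w).
  { intros w w2 Hw Hc. destruct (H w w2 Hc) as [E1 E2].
    rewrite !Rmult_assoc, Hb in E1, E2 by trivial. fold b in E1. fold b' in E2.
    apply Rmult_eq_reg_r with w; trivial.
    assert (F1 : a / h * w + w2 = eps * (b * (w * apow (q - 1) w))).
    { apply Rmult_eq_reg_l with h; trivial.
      replace (h * (a / h * w + w2)) with (a * w + h * w2) by (field; trivial). rewrite E1. ring. }
    assert (F2 : a' / h' * w + w2 = eps * (b' * (w * apow (q - 1) w))).
    { apply Rmult_eq_reg_l with h'; trivial.
      replace (h' * (a' / h' * w + w2)) with (a' * w + h' * w2) by (field; trivial). rewrite E2. ring. }
    lra. }
  assert (Ka := K wa wa2 ltac:(intros Z; rewrite Z, Rabs_R0 in Pa; lra) ltac:(left; split; reflexivity)).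
  assert (Kb := K wb wb2 ltac:(intros Z; rewrite Z, Rabs_R0 in Pb; lra) ltac:(right; split; reflexivity)).
  assert (Eb : b = b').
  { rewrite Ka in Kb.
    assert (Z : eps * (b - b') * (apow (q - 1) wa - apow (q - 1) wb) = 0) by lra.
    apply Rmult_integral in Z. destruct Z as [Z|Z].
    - apply Rmult_integral in Z. destruct Z as [Z|Z]; [rewrite Z in He; lra|lra].
    - exfalso. apply Hab. rewrite <- (apow_Rabs _ wa), <- (apow_Rabs _ wb) in Z.
      rewrite <- (apow_inverse (q - 1) (Rabs wa)), <- (apow_inverse (q - 1) (Rabs wb)) by (trivial; lra).
      f_equal. lra. }
  assert (P1 : 0 < Rabs h / W) by (apply Rdiv_lt_0_compat; trivial; now apply Rabs_pos_lt).
  assert (P2 : 0 < Rabs h' / W') by (apply Rdiv_lt_0_compat; trivial; now apply Rabs_pos_lt).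
  rewrite <- (apow_inverse (q - 1) (Rabs h / W)), <- (apow_inverse (q - 1) (Rabs h' / W')) by (trivial; lra).
  f_equal. exact Eb.
Qed.

(** Provides the finite right end that interval induction asks for, as [R2] may be infinite. *)
Lemma in_range_above (R1 : R) (R2 : Rbar) (r s : R) : in_range R1 R2 r -> in_range R1 R2 s ->
  exists b, r < b /\ s < b /\ forall z, R1 < z < b -> in_range R1 R2 z.
Proof.
  intros Hr Hs. set (m := Rmax r s).
  assert (Hm : in_range R1 R2 m) by (unfold m, Rmax; destruct (Rle_dec r s); trivial).
  destruct (proj1 (locally_R _ _) (locally_in_range R1 R2 m Hm)) as [d [Hd H]].
  exists (m + d / 2). assert (J1 : r <= m) by apply Rmax_l. assert (J2 : s <= m) by apply Rmax_r.
  split; [lra|split; [lra|]]. intros z [Hz1 Hz2]. split; trivial.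
  destruct (H (m + d / 2) ltac:(apply Rabs_def1; lra)) as [_ Hb].
  destruct R2 as [b| |]; simpl in *; trivial. lra.
Qed.

(** Where [h] is nonzero it equals [c W] or [- c W]. The set where it equals [c W] is closed by
    continuity and open because the sign of [h] persists, so zeros and changes of sign are excluded
    together. *)
Lemma profile_proportional (R1 : R) (R2 : Rbar) (h W : R -> R) (r0 : R) :
  in_range R1 R2 r0 -> h r0 <> 0 -> (forall r, in_range R1 R2 r -> 0 < W r) ->
  (forall r, in_range R1 R2 r -> continuous h r) -> (forall r, in_range R1 R2 r -> continuous W r) ->
  (forall r, in_range R1 R2 r -> h r <> 0 -> Rabs (h r) / W r = Rabs (h r0) / W r0) ->
  forall r, in_range R1 R2 r -> h r = h r0 / W r0 * W r.
Proof.
  intros Hr0 H0 HW Ch CW HE r Hr. set (c := h r0 / W r0). assert (W0 := HW r0 Hr0).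
  assert (Hc : c <> 0).
  { unfold c, Rdiv. apply Rmult_integral_contrapositive. split; trivial.
    apply Rinv_neq_0_compat. lra. }
  assert (Trich : forall s, in_range R1 R2 s -> h s = 0 \/ h s = c * W s \/ h s = - (c * W s)).
  { intros s Hs. destruct (Req_dec (h s) 0) as [Z|Z]; [now left|right].
    assert (E := HE s Hs Z). assert (Ws := HW s Hs).
    assert (E2 : Rabs (h s) = Rabs (c * W s)).
    { unfold c. rewrite Rabs_mult. unfold Rdiv. rewrite Rabs_mult, Rabs_inv.
      rewrite (Rabs_pos_eq (W r0)), (Rabs_pos_eq (W s)) by lra.
      unfold Rdiv in E. rewrite <- E. field. lra. }
    unfold Rabs in E2. destruct (Rcase_abs (h s)), (Rcase_abs (c * W s)); lra. }
  destruct (in_range_above R1 R2 r0 r Hr0 Hr) as [b [B1 [B2 Hb]]].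
  apply (interval_induction (fun s => h s = c * W s) R1 b r0).
  - destruct Hr0. lra.
  - unfold c. field. lra.
  - intros s Hs Es. assert (Is := Hb s Hs). assert (Ws := HW s Is).
    assert (P : 0 < Rabs (h s)).
    { apply Rabs_pos_lt. rewrite Es. apply Rmult_integral_contrapositive. split; [trivial|lra]. }
    generalize (filter_and _ _ (locally_continuous_ball h s _ (Ch s Is) P) (locally_in_range R1 R2 s Is)).
    apply filter_imp. intros z [Hz Iz]. assert (Wz := HW z Iz).
    apply Rabs_def2 in Hz.
    assert (c2 : 0 < c * c) by nra.
    assert (Sg : 0 < c * h z).
    { destruct (Rtotal_order c 0) as [K|[K|K]]; [|contradiction|].
      - rewrite (Rabs_left (h s)) in Hz by (rewrite Es; nra). nra.
      - rewrite (Rabs_pos_eq (h s)) in Hz by (rewrite Es; nra). nra. }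
    destruct (Trich z Iz) as [Z|[Z|Z]]; trivial.
    + rewrite Z in Sg. lra.
    + rewrite Z in Sg. nra.
  - intros s Hs Ns. assert (Is := Hb s Hs).
    assert (C : continuous (fun s => h s - c * W s) s).
    { apply (continuous_minus h (fun s => c * W s)); [now apply Ch|].
      apply (continuous_scal_r c W). now apply CW. }
    assert (P : 0 < Rabs (h s - c * W s)) by (apply Rabs_pos_lt; lra).
    generalize (locally_continuous_ball _ s _ C P). apply filter_imp. intros z Hz Ez.
    rewrite Ez in Hz. replace (c * W z - c * W z - (h s - c * W s)) with (- (h s - c * W s)) in Hz by ring.
    rewrite Rabs_Ropp in Hz. lra.
  - destruct Hr. lra.
Qed.

(** Non-radiality supplies a radius with [h] nonzero and two different values of [w]. Once [h] is a
    multiple [c] of the weight, [c] is moved into the angular factor, and the equation at the single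
    radius [r0] yields the ODE. *)
Lemma reduction (R1 : R) (R2 : Rbar) (eps q alpha M N : R) (u : R -> R -> R) :
  0 <= R1 -> eps = 1 \/ eps = -1 -> 0 < q -> q <> 1 ->
  (forall r, in_range R1 R2 r -> 0 < weight alpha M N r) ->
  solution_E R1 R2 eps q alpha M N u -> pseudo_radial R1 R2 u -> ~ radial R1 R2 u ->
  exists w w1, (forall t, w (t + 2 * PI) = w t) /\ alpha_osol eps q alpha w w1 /\
    ~ (forall s t, w s = w t) /\ polar_form R1 R2 u (fun r t => weight alpha M N r * w t).
Proof.
  intros HR1 Heps Hq Hq1 HW Hs [h [w [Hper Hp]]] Hnr.
  assert (HC : forall x y, annulus R1 R2 x y -> ex_diff_n u 2 x y) by (intros x y H; now apply Hs).
  assert (NR : exists r0 s t, in_range R1 R2 r0 /\ h r0 <> 0 /\ w s <> w t).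
  { apply Classical_Prop.NNPP. intros K. apply Hnr. intros r s t Hr. rewrite !Hp by trivial.
    destruct (Req_dec (h r) 0) as [Z|Z]; [rewrite Z; ring|].
    destruct (Req_dec (w s) (w t)) as [E|E]; [now rewrite E|].
    exfalso. apply K. now exists r, s, t. }
  destruct NR as [r0 [s0 [t0 [Hr0 [H0 Hst]]]]].
  assert (W1 : exists t1, w t1 <> 0).
  { destruct (Req_dec (w s0) 0) as [Z|Z]; [exists t0; lra|now exists s0]. }
  destruct W1 as [t1 Ht1].
  destruct (product_form_derivatives R1 R2 u h w r0 t1 HR1 HC Hp Hr0 H0 Ht1)
    as [h1 [h2 [w1 [w2 [Dh [Dw HL]]]]]].
  assert (Cw : forall t, continuous w t).
  { intros t. exact (continuous_of_is_derive _ _ _ (proj1 (Dw t))). }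
  destruct (two_moduli w s0 t0 Cw Hst) as [a [b [Pa [Pb Hab]]]].
  set (W := weight alpha M N) in *.
  assert (Eq : forall r t, in_range R1 R2 r ->
    (r ^ 2 * h2 r + r * h1 r) * w t + h r * w2 t = eps * Rpower (W r) (1 - q) * spow q (h r * w t)).
  { intros r t Hr. assert (r1 := in_range_pos _ _ _ HR1 Hr).
    destruct (Hs _ _ (annulus_polar R1 R2 r t HR1 Hr)) as [_ E].
    rewrite norm2_polar in E by lra. rewrite HL, Hp, Rpower_minus2 in E by trivial. fold W in E.
    replace ((r ^ 2 * h2 r + r * h1 r) * w t + h r * w2 t) with
      (r ^ 2 * (h2 r * w t + h1 r * w t / r + h r * w2 t / r ^ 2)) by (field; lra).
    rewrite E. field. lra. }
  assert (He : eps * eps = 1) by (destruct Heps as [-> | ->]; ring).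
  assert (Hprop : forall r, in_range R1 R2 r -> h r = h r0 / W r0 * W r).
  { apply profile_proportional; trivial.
    - intros r Hr. exact (continuous_of_is_derive _ _ _ (proj1 (Dh r Hr))).
    - intros r Hr. exact (continuous_of_is_derive _ _ _
        (is_derive_weight alpha M N r (in_range_pos _ _ _ HR1 Hr))).
    - intros r Hr Hh.
      apply (separation_ratio q eps (h r) (h r0) (W r) (W r0)
        (r ^ 2 * h2 r + r * h1 r) (r0 ^ 2 * h2 r0 + r0 * h1 r0) (w a) (w b) (w2 a) (w2 b)); trivial.
      + now apply HW.
      + now apply HW.
      + intros z z2 [[-> ->]|[-> ->]]; split; now apply Eq. }
  set (c := h r0 / W r0) in *. assert (W0 := HW r0 Hr0).
  assert (r0p := in_range_pos _ _ _ HR1 Hr0).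
  assert (Hc : c <> 0).
  { unfold c, Rdiv. apply Rmult_integral_contrapositive. split; trivial.
    apply Rinv_neq_0_compat. lra. }
  exists (fun t => c * w t), (fun t => c * w1 t). split; [|split; [|split]].
  - intros t. now rewrite Hper.
  - intros t. destruct (Dw t) as [D1 D2]. split; [now apply is_derive_scal_R|].
    evar_last; [apply is_derive_scal_R; exact D2|]. eqR.
    assert (E1 : forall r, in_range R1 R2 r -> h1 r = c * weight' alpha M N r).
    { intros r Hr. destruct (Dh r Hr) as [D _].
      apply (is_derive_loc_unique h (fun r => c * W r) r _ _ D).
      - apply is_derive_scal_R. apply is_derive_weight. now apply (in_range_pos R1 R2).
      - generalize (locally_in_range R1 R2 r Hr). apply filter_imp. exact Hprop. }
    assert (E2 : h2 r0 = c * ((alpha ^ 2 * W r0 - r0 * weight' alpha M N r0) / r0 ^ 2)).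
    { destruct (Dh r0 Hr0) as [_ D].
      apply (is_derive_loc_unique h1 (fun r => c * weight' alpha M N r) r0 _ _ D).
      - apply is_derive_scal_R. now apply is_derive_weight'.
      - generalize (locally_in_range R1 R2 r0 Hr0). apply filter_imp. exact E1. }
    assert (E := Eq r0 t Hr0). rewrite E2, (E1 r0 Hr0), (Hprop r0 Hr0) in E.
    replace (c * W r0 * w t) with (W r0 * (c * w t)) in E by ring.
    rewrite (Rmult_assoc eps), Rpower_spow_scale in E by trivial.
    apply Rmult_eq_reg_l with (W r0); [|lra].
    replace (W r0 * (eps * spow q (c * w t) - alpha ^ 2 * (c * w t))) with
      (eps * (W r0 * spow q (c * w t)) - alpha ^ 2 * W r0 * (c * w t)) by ring.
    rewrite <- E. field. lra.
  - intros K. apply Hst. apply (Rmult_eq_reg_l c); [exact (K s0 t0)|exact Hc].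
  - intros r t Hr. rewrite Hp, (Hprop r Hr) by trivial. ring.
Qed.

(** * Scaling and sorting by the least period *)

Lemma solution_O_iff (eps q alpha : R) (w : R -> R) :
  solution_O eps q alpha w <-> exists w1, alpha_osol eps q alpha w w1.
Proof.
  split.
  - intros H. exists (Derive w). intros t. destruct (H t) as [H1 [H2 H3]]. split.
    + now apply Derive_correct.
    + replace (eps * spow q (w t) - alpha ^ 2 * w t) with (Derive_n w 2 t) by lra.
      exact (Derive_correct _ _ H2).
  - intros [w1 H] t. destruct (H t) as [H1 H2].
    assert (E : forall s, Derive w s = w1 s) by (intros s; apply is_derive_unique, H).
    assert (D2 : is_derive (Derive w) t (eps * spow q (w t) - alpha ^ 2 * w t)).
    { apply is_derive_ext with w1; trivial. intros s. now symmetry. }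
    split; [now exists (w1 t)|split].
    + now exists (eps * spow q (w t) - alpha ^ 2 * w t).
    + replace (Derive_n w 2 t) with (eps * spow q (w t) - alpha ^ 2 * w t); [ring|].
      symmetry. exact (is_derive_unique _ _ _ D2).
Qed.

(* [w t = unit_amp * x (alpha * t)] turns the equation with [alpha = 1] into the general one. *)
Definition unit_amp (q alpha : R) : R := apow (/ (q - 1)) (alpha ^ 2).

Lemma unit_amp_gt0 (q alpha : R) : 0 < alpha -> 0 < unit_amp q alpha.
Proof. intros H. apply apow_gt0. nra. Qed.

Lemma apow_unit_amp (q alpha : R) : q <> 1 -> 0 < alpha ->
  apow (q - 1) (unit_amp q alpha) = alpha ^ 2.
Proof.
  intros Hq Ha. unfold unit_amp. rewrite apow_apow, Rinv_l by lra.
  rewrite apow_pos by nra. apply Rpower_1. nra.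
Qed.

Lemma osol_scale (eps q alpha : R) (x x1 : R -> R) : q <> 1 -> 0 < alpha -> osol eps q x x1 ->
  alpha_osol eps q alpha (fun t => unit_amp q alpha * x (alpha * t))
    (fun t => unit_amp q alpha * alpha * x1 (alpha * t)).
Proof.
  intros Hq Ha Hx t. destruct (Hx (alpha * t)) as [H0 H1].
  assert (Dl : is_derive (fun t => alpha * t) t alpha) by (auto_derive; [trivial|ring]).
  split.
  - evar_last; [apply is_derive_scal_R, (is_derive_comp_R x (fun t => alpha * t)); eassumption|].
    eqR. ring.
  - evar_last; [apply is_derive_scal_R, (is_derive_comp_R x1 (fun t => alpha * t)); eassumption|].
    eqR. rewrite spow_mult, (spow_mul_apow q (unit_amp q alpha)), apow_unit_amp by trivial. ring.
Qed.

Lemma osol_unscale (eps q alpha : R) (w w1 : R -> R) : q <> 1 -> 0 < alpha ->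
  alpha_osol eps q alpha w w1 ->
  exists x x1, osol eps q x x1 /\ (forall t, w t = unit_amp q alpha * x (alpha * t)) /\
    (forall t, w1 t = unit_amp q alpha * alpha * x1 (alpha * t)).
Proof.
  intros Hq Ha Hw. set (A := unit_amp q alpha). assert (HA : 0 < A) by now apply unit_amp_gt0.
  exists (fun t => / A * w (/ alpha * t)), (fun t => / (A * alpha) * w1 (/ alpha * t)).
  split; [|split].
  - intros t. destruct (Hw (/ alpha * t)) as [H0 H1].
    assert (Dl : is_derive (fun t => / alpha * t) t (/ alpha)) by (auto_derive; [trivial|ring]).
    split.
    + evar_last; [apply is_derive_scal_R, (is_derive_comp_R w (fun t => / alpha * t)); eassumption|].
      eqR. field. split; lra.
    + evar_last; [apply is_derive_scal_R, (is_derive_comp_R w1 (fun t => / alpha * t)); eassumption|].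
      eqR. set (y := w (/ alpha * t)).
      assert (E : spow q y = A * alpha ^ 2 * spow q (/ A * y)).
      { replace y with (A * (/ A * y)) at 1 by (field; lra).
        rewrite spow_mult, (spow_mul_apow q A). unfold A at 2. now rewrite apow_unit_amp. }
      rewrite E. field. split; lra.
  - intros t. replace (/ alpha * (alpha * t)) with t by (field; lra). field. lra.
  - intros t. replace (/ alpha * (alpha * t)) with t by (field; lra). field. lra.
Qed.

Definition rescaled (a c : R) (w x : R -> R) : Prop := forall t, w t = a * x (c * t).

Lemma periodic_rescaled (a c p : R) (w x : R -> R) : 0 < a -> 0 < c -> rescaled a c w x ->
  periodic p w <-> periodic (c * p) x.
Proof.
  intros Ha Hc H. split; intros [P0 P1]; split.
  - now apply Rmult_lt_0_compat.
  - intros t. assert (E := P1 (t / c)). rewrite !H in E.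
    replace (c * (t / c + p)) with (t + c * p) in E by (field; lra).
    replace (c * (t / c)) with t in E by (field; lra).
    apply Rmult_eq_reg_l in E; trivial. lra.
  - apply Rmult_lt_reg_l with c; trivial. lra.
  - intros t. rewrite !H. replace (c * (t + p)) with (c * t + c * p) by ring. now rewrite P1.
Qed.

Lemma least_period_rescaled (a c p : R) (w x : R -> R) : 0 < a -> 0 < c -> rescaled a c w x ->
  least_period p w <-> least_period (c * p) x.
Proof.
  intros Ha Hc H. split; intros [P0 P1]; split.
  - now apply (periodic_rescaled a c p w x).
  - intros p' Hp'. replace p' with (c * (p' / c)) in Hp' |- * by (field; lra).
    apply Rmult_le_compat_l; [lra|]. apply P1. now apply (periodic_rescaled a c _ w x).
  - now apply (periodic_rescaled a c p w x) in P0.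
  - intros p' Hp'. apply Rmult_le_reg_l with c; trivial. apply P1.
    now apply (periodic_rescaled a c _ w x).
Qed.

Lemma rescaled_inv (a c t : R) (w x : R -> R) : 0 < a -> 0 < c -> rescaled a c w x ->
  x t = / a * w (t / c).
Proof.
  intros Ha Hc H. rewrite H. replace (c * (t / c)) with t by (field; lra). field. lra.
Qed.

Lemma sign_changing_rescaled (a c : R) (w x : R -> R) : 0 < a -> 0 < c -> rescaled a c w x ->
  sign_changing_O w <-> sign_changing_O x.
Proof.
  intros Ha Hc H. assert (Ha' : 0 < / a) by now apply Rinv_0_lt_compat.
  split; intros [[s Hs] [t Ht]]; split.
  - exists (c * s). rewrite H in Hs. nra.
  - exists (c * t). rewrite H in Ht. nra.
  - exists (s / c). rewrite (rescaled_inv a c s w x Ha Hc H) in Hs. nra.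
  - exists (t / c). rewrite (rescaled_inv a c t w x Ha Hc H) in Ht. nra.
Qed.

Lemma nonconstant_rescaled (a c : R) (w x : R -> R) : rescaled a c w x ->
  ~ (forall s t, w s = w t) -> ~ (forall s t, x s = x t).
Proof. intros H Hw Hx. apply Hw. intros s t. rewrite !H. f_equal. apply Hx. Qed.

Lemma two_pi_periodic (w : R -> R) : (forall t, w (t + 2 * PI) = w t) -> periodic (2 * PI) w.
Proof. intros H. split; trivial. assert (P := PI_RGT_0). lra. Qed.

(** The period attached to [k] after rescaling to [alpha = 1] is [2 PI alpha / k]; [Lt] and [Gt]
    clear denominators. In the converse, [alpha > 1] follows from [k < alpha] and [k >= 1]. *)
Lemma setA_iff (eps q alpha : R) (k : nat) : 0 < q -> q <> 1 -> 0 < alpha ->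
  setA eps q alpha k <-> 0 < INR k /\ sc_range eps q (alpha * (2 * PI / INR k)).
Proof.
  intros Hq Hq1 Ha. assert (P := PI_RGT_0).
  assert (Lt : forall c d, 0 < INR k -> c * INR k < d * alpha <-> 2 * PI * c < d * (alpha * (2 * PI / INR k))).
  { intros c d Hk. replace (d * (alpha * (2 * PI / INR k))) with (2 * PI * (d * alpha / INR k)) by (field; lra).
    split; intros H.
    - apply Rmult_lt_compat_l; [lra|]. apply Rmult_lt_reg_r with (INR k); trivial.
      replace (d * alpha / INR k * INR k) with (d * alpha) by (field; lra). lra.
    - apply Rmult_lt_reg_l in H; [|lra]. apply (Rmult_lt_compat_r (INR k)) in H; trivial.
      replace (d * alpha / INR k * INR k) with (d * alpha) in H by (field; lra). lra. }
  assert (Gt : forall c d, 0 < INR k -> d * alpha < c * INR k <-> d * (alpha * (2 * PI / INR k)) < 2 * PI * c).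
  { intros c d Hk. assert (L := Lt (- c) (- d) Hk). split; intros H.
    - assert (K : - c * INR k < - d * alpha) by lra. apply L in K. lra.
    - assert (K : 2 * PI * - c < - d * (alpha * (2 * PI / INR k))) by lra. apply L in K. lra. }
  assert (Pos : 0 < INR k -> 0 < alpha * (2 * PI / INR k)).
  { intros Hk. apply Rmult_lt_0_compat; trivial. apply Rdiv_lt_0_compat; lra. }
  assert (K1 : 0 < INR k -> 1 <= INR k).
  { intros Hk. apply (le_INR 1). apply INR_lt. simpl in *. destruct k; simpl in Hk; [lra|]. 
    rewrite S_INR. assert (J := pos_INR k). lra. }
  assert (Eq : q < 1 -> 4 * PI / (1 - q) = 2 * PI * (2 / (1 - q))) by (intros H; field; lra).
  split.
  - intros [[He H]|[[He [H1 [H2 [H3 H4]]]]|[He [H1 [H2 [H3 H4]]]]]].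
    + assert (Hk : 0 < INR k) by lra. split; trivial. left. split; trivial. split; [now apply Pos|].
      assert (G := proj1 (Gt 1 1 Hk)). lra.
    + split; trivial. right; left. split; trivial. split; trivial.
      assert (L := proj1 (Lt 1 1 H3)). lra.
    + assert (Hk : 0 < INR k) by nra. split; trivial. right; right. split; trivial. split; trivial.
      rewrite Eq by trivial. split.
      * assert (L := proj1 (Lt 1 1 Hk)). lra.
      * assert (G := proj1 (Gt (2 / (1 - q)) 1 Hk)).
        assert (K : 1 * alpha < 2 / (1 - q) * INR k).
        { apply Rmult_lt_reg_l with ((1 - q) / 2); [lra|].
          replace ((1 - q) / 2 * (2 / (1 - q) * INR k)) with (INR k) by (field; lra). lra. }
        specialize (G K). lra.
  - intros [Hk [[He H]|[[He [H1 H2]]|[He [H1 H2]]]]].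
    + left. split; trivial. assert (G := proj2 (Gt 1 1 Hk)). lra.
    + right; left. assert (L := proj2 (Lt 1 1 Hk)). specialize (K1 Hk). repeat split; trivial; lra.
    + right; right. rewrite Eq in H2 by trivial.
      assert (L := proj2 (Lt 1 1 Hk)). assert (G := proj2 (Gt (2 / (1 - q)) 1 Hk)).
      specialize (K1 Hk). specialize (G ltac:(lra)).
      apply (Rmult_lt_compat_l ((1 - q) / 2)) in G; [|lra].
      replace ((1 - q) / 2 * (2 / (1 - q) * INR k)) with (INR k) in G by (field; lra).
      repeat split; trivial; lra.
Qed.

(** Long periods belong to small [k]: the homoclinic bound becomes the lower end of the set, the
    small oscillation bound its upper end. *)
Lemma setB_iff (q alpha : R) (k : nat) : 0 < q < 1 -> 0 < alpha ->
  setB q alpha k <-> 0 < INR k /\ pos_range q (alpha * (2 * PI / INR k)).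
Proof.
  intros Hq Ha. assert (P := PI_RGT_0). set (s := sqrt (1 - q)).
  assert (Hs : 0 < s) by (apply sqrt_lt_R0; lra).
  unfold setB, pos_range. fold s. split.
  - intros [H1 H2]. assert (Hk : 0 < INR k) by nra. split; trivial. split.
    + apply Rmult_lt_reg_r with (s * INR k); [nra|].
      replace (2 * PI / s * (s * INR k)) with (2 * PI * INR k) by (field; lra).
      replace (alpha * (2 * PI / INR k) * (s * INR k)) with (2 * PI * (alpha * s)) by (field; lra). nra.
    + apply Rmult_lt_reg_r with ((1 - q) * INR k); [nra|].
      replace (2 * PI / (1 - q) * ((1 - q) * INR k)) with (2 * PI * INR k) by (field; lra).
      replace (alpha * (2 * PI / INR k) * ((1 - q) * INR k)) with (2 * PI * (alpha * (1 - q))) by (field; lra). nra.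
  - intros [Hk [H1 H2]]. split.
    + apply (Rmult_lt_compat_r ((1 - q) * INR k)) in H2; [|nra].
      replace (2 * PI / (1 - q) * ((1 - q) * INR k)) with (2 * PI * INR k) in H2 by (field; lra).
      replace (alpha * (2 * PI / INR k) * ((1 - q) * INR k)) with (2 * PI * (alpha * (1 - q))) in H2 by (field; lra). nra.
    + apply (Rmult_lt_compat_r (s * INR k)) in H1; [|nra].
      replace (2 * PI / s * (s * INR k)) with (2 * PI * INR k) in H1 by (field; lra).
      replace (alpha * (2 * PI / INR k) * (s * INR k)) with (2 * PI * (alpha * s)) in H1 by (field; lra). nra.
Qed.

(** The phase curve avoids the origin, the only point where uniqueness can fail. *)
Definition regular (w w1 : R -> R) : Prop := forall t, ~ (w t = 0 /\ w1 t = 0).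

Lemma regular_rescaled (a b c : R) (w w1 x x1 : R -> R) : 0 < a -> 0 < b -> 0 < c ->
  rescaled a c w x -> rescaled b c w1 x1 -> regular w w1 <-> regular x x1.
Proof.
  intros Ha Hb Hc H H1. split; intros K t [Z0 Z1].
  - apply (K (t / c)). rewrite H, H1.
    replace (c * (t / c)) with t by (field; lra). rewrite Z0, Z1. split; ring.
  - apply (K (c * t)). rewrite H in Z0. rewrite H1 in Z1. split.
    + apply Rmult_eq_reg_l with a; lra.
    + apply Rmult_eq_reg_l with b; lra.
Qed.

(** The period [2 PI] is a positive multiple of the least period, and this multiple is the index
    [k]. *)
Lemma alpha_sc_periods (eps q alpha : R) (w w1 : R -> R) : 0 < q -> q <> 1 ->
  eps = 1 \/ eps = -1 -> 0 < alpha -> alpha_osol eps q alpha w w1 ->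
  (forall t, w (t + 2 * PI) = w t) -> sign_changing_O w -> regular w w1 ->
  exists k, setA eps q alpha k /\ least_period (2 * PI / INR k) w.
Proof.
  intros Hq Hq1 Heps Ha Hw Hper Hsc Hnd.
  destruct (osol_unscale eps q alpha w w1 Hq1 Ha Hw) as [x [x1 [Hx [E E1]]]].
  assert (HA := unit_amp_gt0 q alpha Ha). set (A := unit_amp q alpha) in *.
  destruct (sc_periods eps q (alpha * (2 * PI)) x x1 Hq Hq1 Heps Hx) as [n [T [ET [HT HR]]]].
  - now apply (periodic_rescaled A alpha _ w x), two_pi_periodic.
  - now apply (sign_changing_rescaled A alpha w x).
  - apply (regular_rescaled A (A * alpha) alpha w w1 x x1); trivial. now apply Rmult_lt_0_compat.
  - exists (S n). assert (Hn : 0 < INR (S n)) by (apply lt_0_INR; lia).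
    assert (EE : alpha * (2 * PI / INR (S n)) = T).
    { replace (alpha * (2 * PI / INR (S n))) with (alpha * (2 * PI) / INR (S n)) by (field; lra).
      rewrite ET. field. lra. }
    split.
    + apply setA_iff; trivial. rewrite EE. now split.
    + apply (least_period_rescaled A alpha _ w x); trivial. now rewrite EE.
Qed.

Lemma alpha_sc_family (eps q alpha : R) (k : nat) : 0 < q -> q <> 1 -> 0 < alpha ->
  setA eps q alpha k ->
  exists w w1, alpha_osol eps q alpha w w1 /\ least_period (2 * PI / INR k) w /\
    sign_changing_O w /\ regular w w1 /\
    forall v v1, alpha_osol eps q alpha v v1 -> least_period (2 * PI / INR k) v ->
      sign_changing_O v -> regular v v1 ->
      exists s tau, (s = 1 \/ s = -1) /\ forall t, v t = s * w (t + tau).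
Proof.
  intros Hq Hq1 Ha Hk. apply setA_iff in Hk; trivial. destruct Hk as [Hk HT].
  assert (HA := unit_amp_gt0 q alpha Ha). set (A := unit_amp q alpha) in *.
  assert (HAa : 0 < A * alpha) by now apply Rmult_lt_0_compat.
  destruct (sc_family eps q _ Hq Hq1 HT) as [x [x1 [Hx [Xl [Xs [Xn Xu]]]]]].
  exists (fun t => A * x (alpha * t)), (fun t => A * alpha * x1 (alpha * t)).
  split; [now apply osol_scale|]. split; [|split; [|split]].
  - now apply (least_period_rescaled A alpha _ _ x).
  - now apply (sign_changing_rescaled A alpha _ x).
  - now apply (regular_rescaled A (A * alpha) alpha _ _ x x1).
  - intros v v1 Hv Vl Vs Vn.
    destruct (osol_unscale eps q alpha v v1 Hq1 Ha Hv) as [y [y1 [Hy [E E1]]]]. fold A in E, E1.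
    destruct (Xu y y1 Hy) as [s [tau [Hs Es]]].
    + now apply (least_period_rescaled A alpha _ v y).
    + now apply (sign_changing_rescaled A alpha v y).
    + now apply (regular_rescaled A (A * alpha) alpha v v1 y y1).
    + exists s, (tau / alpha). split; trivial. intros t. rewrite E, Es.
      replace (alpha * (t + tau / alpha)) with (alpha * t + tau) by (field; lra). ring.
Qed.

Lemma alpha_pos_family (q alpha : R) (k : nat) : 0 < q < 1 -> 0 < alpha -> setB q alpha k ->
  exists w w1, alpha_osol 1 q alpha w w1 /\ least_period (2 * PI / INR k) w /\
    (forall t, 0 < w t) /\
    forall v v1, alpha_osol 1 q alpha v v1 -> least_period (2 * PI / INR k) v ->
      (forall t, 0 < v t) -> exists tau, forall t, v t = w (t + tau).
Proof.
  intros Hq Ha Hk. apply setB_iff in Hk; trivial. destruct Hk as [Hk HT].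
  assert (Hq1 : q <> 1) by lra.
  assert (HA := unit_amp_gt0 q alpha Ha). set (A := unit_amp q alpha) in *.
  destruct (pos_family q _ Hq HT) as [x [x1 [Hx [Xl [Xp Xu]]]]].
  exists (fun t => A * x (alpha * t)), (fun t => A * alpha * x1 (alpha * t)).
  split; [now apply osol_scale|]. split; [|split].
  - now apply (least_period_rescaled A alpha _ _ x).
  - intros t. now apply Rmult_lt_0_compat.
  - intros v v1 Hv Vl Vp.
    destruct (osol_unscale 1 q alpha v v1 Hq1 Ha Hv) as [y [y1 [Hy [E E1]]]]. fold A in E, E1.
    destruct (Xu y y1 Hy) as [tau Es].
    + now apply (least_period_rescaled A alpha _ v y).
    + intros t. rewrite (rescaled_inv A alpha t v y HA Ha E).
      apply Rmult_lt_0_compat; trivial. now apply Rinv_0_lt_compat.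
    + exists (tau / alpha). intros t. rewrite E, Es. do 2 f_equal. field. lra.
Qed.

Lemma alpha_pos_periods (eps q alpha : R) (w w1 : R -> R) : 0 < q -> q <> 1 ->
  eps = 1 \/ eps = -1 -> 0 < alpha -> alpha_osol eps q alpha w w1 ->
  (forall t, w (t + 2 * PI) = w t) -> (forall t, 0 < w t) -> ~ (forall s t, w s = w t) ->
  eps = 1 /\ q < 1 /\ exists k, setB q alpha k /\ least_period (2 * PI / INR k) w.
Proof.
  intros Hq Hq1 Heps Ha Hw Hper Hp Hnc.
  destruct (osol_unscale eps q alpha w w1 Hq1 Ha Hw) as [x [x1 [Hx [E E1]]]].
  assert (HA := unit_amp_gt0 q alpha Ha). set (A := unit_amp q alpha) in *.
  assert (Xper : periodic (alpha * (2 * PI)) x)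
    by now apply (periodic_rescaled A alpha _ w x), two_pi_periodic.
  assert (Xp : forall t, 0 < x t).
  { intros t. rewrite (rescaled_inv A alpha t w x HA Ha E).
    apply Rmult_lt_0_compat; trivial. now apply Rinv_0_lt_compat. }
  assert (Xnc := nonconstant_rescaled A alpha w x E Hnc).
  destruct (positive_nonconstant_case eps q _ x x1 Hq Hq1 Heps Hx Xper Xp Xnc) as [-> [Hlt _]].
  split; [trivial|split; [trivial|]].
  destruct (pos_periods q _ x x1 ltac:(lra) Hx Xper Xp Xnc) as [n [T [ET [HT HR]]]].
  exists (S n). assert (Hn : 0 < INR (S n)) by (apply lt_0_INR; lia).
  assert (EE : alpha * (2 * PI / INR (S n)) = T).
  { replace (alpha * (2 * PI / INR (S n))) with (alpha * (2 * PI) / INR (S n)) by (field; lra).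
    rewrite ET. field. lra. }
  split.
  - apply setB_iff; trivial; [lra|]. rewrite EE. now split.
  - apply (least_period_rescaled A alpha _ w x); trivial. now rewrite EE.
Qed.

(** A nonconstant solution through the origin runs along whole loops, so one period has room for a
    loop, and for two if both signs occur. *)
Lemma alpha_degenerate (eps q alpha p : R) (w w1 : R -> R) : 0 < q -> q <> 1 ->
  eps = 1 \/ eps = -1 -> 0 < alpha -> alpha_osol eps q alpha w w1 -> periodic p w ->
  ~ regular w w1 -> ~ (forall s t, w s = w t) ->
  eps = 1 /\ q < 1 /\ loop q <= alpha * p /\ (sign_changing_O w -> 2 * loop q <= alpha * p).
Proof.
  intros Hq Hq1 Heps Ha Hw Hper Hnr Hnc.
  destruct (osol_unscale eps q alpha w w1 Hq1 Ha Hw) as [x [x1 [Hx [E E1]]]].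
  assert (HA := unit_amp_gt0 q alpha Ha). set (A := unit_amp q alpha) in *.
  assert (HAa : 0 < A * alpha) by now apply Rmult_lt_0_compat.
  assert (Xper : periodic (alpha * p) x) by now apply (periodic_rescaled A alpha _ w x).
  assert (Xnc := nonconstant_rescaled A alpha w x E Hnc).
  assert (Xn : exists t0, x t0 = 0 /\ x1 t0 = 0).
  { apply Classical_Prop.NNPP. intros K. apply Hnr.
    apply (regular_rescaled A (A * alpha) alpha w w1 x x1); trivial.
    intros t Ht. apply K. now exists t. }
  destruct Xn as [t0 [Z0 Z1]].
  destruct (degenerate_case eps q _ x x1 t0 Hq Hq1 Heps Hx Xper Z0 Z1 Xnc) as [-> Hlt].
  split; [trivial|split; [trivial|split]].
  - apply (degenerate_period q _ x x1 t0); trivial; lra.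
  - intros Hsc. apply (degenerate_sc_period q _ x x1 t0); trivial; [lra|].
    now apply (sign_changing_rescaled A alpha w x).
Qed.

Lemma alpha_osol_opp (eps q alpha : R) (w w1 : R -> R) : alpha_osol eps q alpha w w1 ->
  alpha_osol eps q alpha (fun t => - w t) (fun t => - w1 t).
Proof.
  intros H t. destruct (H t) as [H0 H1]. split; [now apply is_derive_opp_R|].
  evar_last; [apply is_derive_opp_R; exact H1|]. eqR. rewrite spow_opp. ring.
Qed.

Lemma alpha_osol_shift (eps q alpha tau : R) (w w1 : R -> R) : alpha_osol eps q alpha w w1 ->
  alpha_osol eps q alpha (fun t => w (t + tau)) (fun t => w1 (t + tau)).
Proof.
  intros H t. destruct (H (t + tau)) as [H0 H1].
  split; now apply is_derive_shift.
Qed.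

Lemma alpha_osol_shift_sign (eps q alpha s tau : R) (w w1 : R -> R) : s = 1 \/ s = -1 ->
  alpha_osol eps q alpha w w1 ->
  alpha_osol eps q alpha (fun t => s * w (t + tau)) (fun t => s * w1 (t + tau)).
Proof.
  intros Hs H t. destruct (alpha_osol_shift eps q alpha tau w w1 H t) as [H0 H1].
  split; [now apply is_derive_scal_R|]. evar_last; [apply is_derive_scal_R; exact H1|]. eqR.
  destruct Hs as [-> | ->]; [rewrite !Rmult_1_l; ring|].
  replace (-1 * w (t + tau)) with (- w (t + tau)) by ring. rewrite spow_opp. ring.
Qed.

(** A zero of a solution that does not change sign is an extremum, hence a double zero. *)
Lemma regular_one_sign (w w1 : R -> R) (eps q alpha : R) : alpha_osol eps q alpha w w1 ->
  regular w w1 -> ~ sign_changing_O w -> (forall t, 0 < w t) \/ (forall t, 0 < - w t).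
Proof.
  intros Hw Hn Hns.
  assert (Nz : forall v v1, alpha_osol eps q alpha v v1 -> regular v v1 -> (forall t, 0 <= v t) ->
            forall t, 0 < v t).
  { intros v v1 Hv Hr Hge t. destruct (Hge t) as [H|H]; trivial. exfalso. apply (Hr t).
    split; [now symmetry|]. apply (min_derive_0 v t); [apply Hv|]. intros s. rewrite <- H. apply Hge. }
  destruct (Classical_Prop.classic (exists t, w t < 0)) as [Hn1|Hn1].
  - right. apply (Nz (fun t => - w t) (fun t => - w1 t)).
    + now apply alpha_osol_opp.
    + intros t [Z0 Z1]. apply (Hn t). split; lra.
    + intros t. apply Rnot_lt_le. intros K. apply Hns. split; trivial. exists t. lra.
  - left. apply (Nz w w1); trivial. intros t. apply Rnot_lt_le. intros K. apply Hn1. now exists t.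
Qed.

(** For [alpha <= 1] every kind of nonconstant solution is excluded: [setA] with [eps = 1] requires
    [alpha > 1], [setB] contains no integer because [alpha sqrt (1 - q) < 1], and a loop is longer
    than [2 PI]. *)
Lemma no_solution_small_alpha (q alpha : R) (w w1 : R -> R) : 0 < q -> q <> 1 ->
  0 < alpha <= 1 -> alpha_osol 1 q alpha w w1 -> (forall t, w (t + 2 * PI) = w t) ->
  forall s t, w s = w t.
Proof.
  intros Hq Hq1 Ha Hw Hper. apply Classical_Prop.NNPP. intros Hnc. assert (P := PI_RGT_0).
  assert (Kge : forall k, 0 < INR k -> 1 <= INR k).
  { intros k Hk. destruct k; simpl in Hk; [lra|]. rewrite S_INR. assert (J := pos_INR k). lra. }
  destruct (Classical_Prop.classic (regular w w1)) as [Hn|Hn].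
  - destruct (Classical_Prop.classic (sign_changing_O w)) as [Hs|Hs].
    + destruct (alpha_sc_periods 1 q alpha w w1 Hq Hq1 ltac:(now left) ltac:(lra) Hw Hper Hs Hn)
        as [k [[[He _]|[[_ [_ [H _]]]|[_ [_ [H _]]]]] _]]; lra.
    + assert (Pc : forall v v1, alpha_osol 1 q alpha v v1 -> (forall t, v (t + 2 * PI) = v t) ->
        (forall t, 0 < v t) -> ~ (forall s t, v s = v t) -> False).
      { intros v v1 Hv Vper Vp Vnc.
        destruct (alpha_pos_periods 1 q alpha v v1 Hq Hq1 ltac:(now left) ltac:(lra) Hv Vper Vp Vnc)
          as [_ [Hlt [k [[B1 B2] _]]]].
        assert (S1 : 0 < sqrt (1 - q)) by (apply sqrt_lt_R0; lra).
        assert (S2 : sqrt (1 - q) * sqrt (1 - q) = 1 - q) by (apply sqrt_sqrt; lra).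
        assert (Hk : 0 < INR k) by nra. specialize (Kge k Hk).
        assert (sqrt (1 - q) < 1) by nra. nra. }
      destruct (regular_one_sign w w1 1 q alpha Hw Hn Hs) as [Hp|Hp].
      * now apply (Pc w w1).
      * apply (Pc (fun t => - w t) (fun t => - w1 t)); trivial.
        -- now apply alpha_osol_opp.
        -- intros t. now rewrite Hper.
        -- intros K. apply Hnc. intros s t. specialize (K s t). simpl in K. lra.
  - destruct (alpha_degenerate 1 q alpha (2 * PI) w w1 Hq Hq1 ltac:(now left) ltac:(lra) Hw
      (two_pi_periodic w Hper) Hn Hnc) as [_ [Hlt [HL _]]].
    assert (J := loop_gt q ltac:(lra)). nra.
Qed.

(** * From (O) to (E) *)

Lemma ex_in_range (R1 : R) (R2 : Rbar) : Rbar_lt R1 R2 -> exists r, in_range R1 R2 r.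
Proof.
  intros H. unfold in_range. destruct R2 as [b| |]; simpl in *.
  - exists ((R1 + b) / 2). lra.
  - exists (R1 + 1). split; trivial. lra.
  - contradiction.
Qed.

Lemma annulus_polar_inv (R1 : R) (R2 : Rbar) (x y : R) : annulus R1 R2 x y ->
  exists r t, in_range R1 R2 r /\ x = r * cos t /\ y = r * sin t.
Proof.
  intros H. destruct (polar_exists x y) as [t [Ex Ey]]. now exists (norm2 x y), t.
Qed.

(** An angle is chosen at every point. Two angles of one point off the origin differ by a multiple
    of [2 PI], so the periodicity of [w] makes the choice immaterial. *)
Lemma polar_function (F w : R -> R) : (forall t, w (t + 2 * PI) = w t) ->
  exists u, forall R1 R2, 0 <= R1 -> polar_form R1 R2 u (fun r t => F r * w t).
Proof.
  intros Hper.
  destruct (IndefiniteDescription.functional_choice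
    (fun z t => fst z = norm2 (fst z) (snd z) * cos t /\ snd z = norm2 (fst z) (snd z) * sin t))
    as [angle Ha].
  { intros [x y]. apply polar_exists. }
  exists (fun x y => F (norm2 x y) * w (angle (x, y))). intros R1 R2 HR1 r t Hr.
  assert (r0 := in_range_pos _ _ _ HR1 Hr).
  rewrite norm2_polar by lra. f_equal.
  destruct (Ha (r * cos t, r * sin t)) as [E1 E2]. simpl in E1, E2.
  set (s := angle (r * cos t, r * sin t)) in *. rewrite norm2_polar in E1, E2 by lra.
  apply Rmult_eq_reg_l in E1; [|lra]. apply Rmult_eq_reg_l in E2; [|lra].
  assert (Z : sin ((s - t) / 2) = 0).
  { assert (C : cos (s - t) = 1).
    { rewrite cos_minus, <- E1, <- E2. assert (S := sin2_cos2 t). unfold Rsqr in S. lra. }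
    replace (s - t) with (2 * ((s - t) / 2)) in C by field. rewrite cos_2a_sin in C.
    assert (sin ((s - t) / 2) * sin ((s - t) / 2) = 0) by lra. nra. }
  destruct (sin_eq_0_0 _ Z) as [k Hk].
  replace s with (t + IZR k * (2 * PI)) by lra. now apply periodic_multZ.
Qed.

(** Links the Cartesian gradient, in which double zeros of [u] are expressed, to [w] and its
    derivative. *)
Lemma polar_gradient (R1 : R) (R2 : Rbar) (u : R -> R -> R) (F w : R -> R) (r t F' w' : R) :
  0 <= R1 -> (forall x y, annulus R1 R2 x y -> ex_diff_n u 2 x y) ->
  polar_form R1 R2 u (fun r t => F r * w t) -> in_range R1 R2 r ->
  is_derive F r F' -> is_derive w t w' ->
  let ux := Derive (fun z => u z (r * sin t)) (r * cos t) in
  let uy := Derive (fun z => u (r * cos t) z) (r * sin t) in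
  ux * cos t + uy * sin t = F' * w t /\ ux * (- (r * sin t)) + uy * (r * cos t) = F r * w'.
Proof.
  intros HR1 HC Hp Hr HF Hw ux uy.
  assert (L : locally_2d (fun x y => ex_diff_n u 1 x y) (r * cos t) (r * sin t)).
  { apply locally_2d_impl with (2 := locally_2d_annulus R1 R2 _ _ (annulus_polar R1 R2 r t HR1 Hr)).
    apply locally_2d_forall. intros a b H. apply (ex_diff_n_m 2 1); [lia|now apply HC]. }
  split.
  - apply (is_derive_loc_unique (fun r => u (r * cos t) (r * sin t)) (fun r => F r * w t) r).
    + apply (chain_2d u (fun r => r * cos t) (fun r => r * sin t)); trivial;
        (auto_derive; [trivial|ring]).
    + evar_last; [apply (is_derive_mult_R F (fun _ => w t)); [exact HF|apply (is_derive_const (w t))]|].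
      unfold zero; simpl; ring.
    + generalize (locally_in_range R1 R2 r Hr). apply filter_imp. intros z Hz. now apply Hp.
  - apply (is_derive_loc_unique (fun t => u (r * cos t) (r * sin t)) (fun t => F r * w t) t).
    + apply (chain_2d u (fun t => r * cos t) (fun t => r * sin t)); trivial;
        (auto_derive; [trivial|ring]).
    + now apply is_derive_scal_R.
    + apply filter_forall. intros z. now apply Hp.
Qed.

Lemma no_double_zero_iff (R1 : R) (R2 : Rbar) (eps q alpha M N : R) (u : R -> R -> R) (w w1 : R -> R) :
  0 <= R1 -> Rbar_lt R1 R2 -> 0 < q ->
  (forall r, in_range R1 R2 r -> 0 < weight alpha M N r) ->
  alpha_osol eps q alpha w w1 -> polar_form R1 R2 u (fun r t => weight alpha M N r * w t) ->
  no_double_zero R1 R2 u <-> regular w w1.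
Proof.
  intros HR1 HR2 Hq HW Hw Hp.
  assert (HC := polar_form_smooth R1 R2 eps q alpha M N u w w1 HR1 Hq Hw Hp).
  assert (G := fun r t Hr => polar_gradient R1 R2 u (weight alpha M N) w r t _ _ HR1 HC Hp Hr
    (is_derive_weight alpha M N r (in_range_pos R1 R2 r HR1 Hr)) (proj1 (Hw t))).
  simpl in G. split; intros H.
  - intros t [Z0 Z1]. destruct (ex_in_range R1 R2 HR2) as [r Hr].
    assert (r0 := in_range_pos _ _ _ HR1 Hr).
    apply (H _ _ (annulus_polar R1 R2 r t HR1 Hr)). destruct (G r t Hr) as [G1 G2].
    set (ux := Derive (fun z => u z (r * sin t)) (r * cos t)) in *.
    set (uy := Derive (fun z => u (r * cos t) z) (r * sin t)) in *.
    rewrite Z0, Rmult_0_r in G1. rewrite Z1, Rmult_0_r in G2.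
    assert (G3 : - ux * sin t + uy * cos t = 0).
    { apply Rmult_eq_reg_l with r; lra. }
    assert (S := sin2_cos2 t). unfold Rsqr in S.
    split; [rewrite Hp, Z0 by trivial; ring|]. split.
    + replace ux with (ux * (sin t * sin t + cos t * cos t)) by (rewrite S; ring).
      replace (ux * (sin t * sin t + cos t * cos t)) with
        ((ux * cos t + uy * sin t) * cos t - (- ux * sin t + uy * cos t) * sin t) by ring.
      rewrite G1, G3. ring.
    + replace uy with (uy * (sin t * sin t + cos t * cos t)) by (rewrite S; ring).
      replace (uy * (sin t * sin t + cos t * cos t)) with
        ((ux * cos t + uy * sin t) * sin t + (- ux * sin t + uy * cos t) * cos t) by ring.
      rewrite G1, G3. ring.
  - intros x y Hxy [Z0 [Zx Zy]]. destruct (annulus_polar_inv R1 R2 x y Hxy) as [r [t [Hr [-> ->]]]].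
    destruct (G r t Hr) as [_ G2]. rewrite Zx, Zy in G2. rewrite Hp in Z0 by trivial.
    assert (W0 := HW r Hr). apply (H t). split.
    + apply Rmult_eq_reg_l with (weight alpha M N r); lra.
    + apply Rmult_eq_reg_l with (weight alpha M N r); lra.
Qed.

Lemma radial_iff (R1 : R) (R2 : Rbar) (F : R -> R) (u : R -> R -> R) (w : R -> R) :
  Rbar_lt R1 R2 -> (forall r, in_range R1 R2 r -> 0 < F r) ->
  polar_form R1 R2 u (fun r t => F r * w t) -> radial R1 R2 u <-> forall s t, w s = w t.
Proof.
  intros HR2 HF Hp. split; intros H.
  - intros s t. destruct (ex_in_range R1 R2 HR2) as [r Hr]. assert (E := H r s t Hr).
    rewrite !Hp in E by trivial. apply Rmult_eq_reg_l in E; trivial.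
    assert (J := HF r Hr). lra.
  - intros r s t Hr. rewrite !Hp by trivial. now rewrite (H s t).
Qed.

(** [P] is invariant under positive factors, so the weight drops out; the property is instantiated
    with the sign conditions and with vanishing. *)
Lemma polar_form_exists_iff (R1 : R) (R2 : Rbar) (F : R -> R) (u : R -> R -> R) (w : R -> R)
  (P : R -> Prop) : 0 <= R1 -> Rbar_lt R1 R2 ->
  (forall r, in_range R1 R2 r -> 0 < F r) -> (forall a z, 0 < a -> P (a * z) <-> P z) ->
  polar_form R1 R2 u (fun r t => F r * w t) ->
  (exists x y, annulus R1 R2 x y /\ P (u x y)) <-> exists t, P (w t).
Proof.
  intros HR1 HR2 HF HP Hp. destruct (ex_in_range R1 R2 HR2) as [r0 Hr0]. split.
  - intros [x [y [Hxy H]]]. destruct (annulus_polar_inv R1 R2 x y Hxy) as [r [t [Hr [-> ->]]]].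
    exists t. rewrite Hp in H by trivial. exact (proj1 (HP _ _ (HF r Hr)) H).
  - intros [t H]. exists (r0 * cos t), (r0 * sin t). split; [now apply annulus_polar|].
    rewrite Hp by trivial. exact (proj2 (HP _ _ (HF r0 Hr0)) H).
Qed.

Lemma polar_form_forall_iff (R1 : R) (R2 : Rbar) (F : R -> R) (u : R -> R -> R) (w : R -> R)
  (P : R -> Prop) : 0 <= R1 -> Rbar_lt R1 R2 ->
  (forall r, in_range R1 R2 r -> 0 < F r) -> (forall a z, 0 < a -> P (a * z) <-> P z) ->
  polar_form R1 R2 u (fun r t => F r * w t) ->
  (forall x y, annulus R1 R2 x y -> P (u x y)) <-> forall t, P (w t).
Proof.
  intros HR1 HR2 HF HP Hp. destruct (ex_in_range R1 R2 HR2) as [r0 Hr0]. split.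
  - intros H t. apply (proj1 (HP _ (w t) (HF r0 Hr0))). rewrite <- (Hp r0 t Hr0). apply H.
    now apply annulus_polar.
  - intros H x y Hxy. destruct (annulus_polar_inv R1 R2 x y Hxy) as [r [t [Hr [-> ->]]]].
    rewrite Hp by trivial. exact (proj2 (HP _ _ (HF r Hr)) (H t)).
Qed.

Lemma scale_gt0 (a z : R) : 0 < a -> 0 < a * z <-> 0 < z.
Proof. intros Ha. split; intros H; [apply Rmult_lt_reg_l with a; lra|now apply Rmult_lt_0_compat]. Qed.

Lemma scale_lt0 (a z : R) : 0 < a -> a * z < 0 <-> z < 0.
Proof. intros Ha. split; intros H; nra. Qed.

Lemma scale_ge0 (a z : R) : 0 < a -> 0 <= a * z <-> 0 <= z.
Proof. intros Ha. split; intros H; [apply Rmult_le_reg_l with a; lra|apply Rmult_le_pos; lra]. Qed.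

Lemma scale_eq0 (a z : R) : 0 < a -> a * z = 0 <-> z = 0.
Proof. intros Ha. split; intros H; [apply Rmult_eq_reg_l with a; lra|rewrite H; ring]. Qed.

(** An interval of zeros of [w] spreads to a neighbourhood because the local angle is continuous;
    conversely, a neighbourhood contains an arc of the circle through its centre. *)
Lemma no_dead_core_iff (R1 : R) (R2 : Rbar) (F : R -> R) (u : R -> R -> R) (w : R -> R) :
  0 <= R1 -> Rbar_lt R1 R2 -> (forall r, in_range R1 R2 r -> 0 < F r) ->
  polar_form R1 R2 u (fun r t => F r * w t) ->
  no_dead_core R1 R2 u <-> forall a b, a < b -> exists t, a < t < b /\ w t <> 0.
Proof.
  intros HR1 HR2 HF Hp. split; intros H.
  - intros a b Hab. apply Classical_Prop.NNPP. intros K.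
    assert (Z : forall t, a < t < b -> w t = 0).
    { intros t Ht. apply Classical_Prop.NNPP. intros Nz. apply K. now exists t. }
    destruct (ex_in_range R1 R2 HR2) as [r Hr]. assert (r0 := in_range_pos _ _ _ HR1 Hr).
    set (t0 := (a + b) / 2). set (x0 := r * cos t0). set (y0 := r * sin t0).
    assert (Ha := annulus_polar R1 R2 r t0 HR1 Hr). fold x0 y0 in Ha.
    apply (H x0 y0 Ha).
    assert (Er : norm2 x0 y0 = r) by (apply norm2_polar; lra).
    assert (E0 := norm2_sq x0 y0). rewrite Er in E0.
    assert (D0 : 0 < x0 * x0 + y0 * y0) by nra.
    assert (LD := locally_2d_half_plane x0 y0 x0 y0 D0).
    assert (LA := locally_2d_annulus R1 R2 x0 y0 Ha).
    set (T := fun x y => t0 + atan ((x0 * y + - y0 * x) * / (x0 * x + y0 * y))).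
    assert (CT : continuity_2d_pt T x0 y0) by (apply (smooth_angle x0 y0 t0); exact D0).
    assert (ET : T x0 y0 = t0).
    { unfold T. replace ((x0 * y0 + - y0 * x0) * / (x0 * x0 + y0 * y0)) with 0 by (field; lra).
      rewrite atan_0. ring. }
    assert (LT : locally_2d (fun x y => a < T x y < b) x0 y0).
    { apply (locally_2d_of_continuity T (fun t => a < t < b)); trivial.
      rewrite ET. apply locally_R. exists ((b - a) / 2). split; [lra|].
      intros s Hs. apply Rabs_def2 in Hs. unfold t0 in Hs. lra. }
    assert (L := locally_2d_and _ _ _ _ (locally_2d_and _ _ _ _ LA LD) LT).
    apply locally_2d_impl with (2 := L). apply locally_2d_forall. intros x y [[Hxa Hd] HT].
    destruct (local_angle x0 y0 t0 x y) as [Px Py]; trivial.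
    + now rewrite Er.
    + now rewrite Er.
    + replace (t0 + atan ((x0 * y - y0 * x) * / (x0 * x + y0 * y))) with (T x y) in Px, Py
        by (unfold T; do 3 f_equal; ring).
      assert (Eu : u x y = u (norm2 x y * cos (T x y)) (norm2 x y * sin (T x y)))
        by now rewrite <- Px, <- Py.
      rewrite Eu, Hp by exact Hxa. rewrite Z by trivial. ring.
  - intros x y Hxy [d Hd]. destruct (annulus_polar_inv R1 R2 x y Hxy) as [r [t [Hr [-> ->]]]].
    assert (Cc : continuous (fun s => r * cos s) t).
    { apply (ex_derive_continuous (fun s => r * cos s)). now auto_derive. }
    assert (Cs : continuous (fun s => r * sin s) t).
    { apply (ex_derive_continuous (fun s => r * sin s)). now auto_derive. }
    assert (L := filter_and _ _ (locally_continuous_ball _ t _ Cc (cond_pos d))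
                   (locally_continuous_ball _ t _ Cs (cond_pos d))).
    apply locally_R in L. destruct L as [e [He L]].
    destruct (H (t - e) (t + e) ltac:(lra)) as [s [Hs Ns]].
    destruct (L s) as [B1 B2]; [apply Rabs_def1; lra|].
    assert (E := Hd _ _ B1 B2). rewrite Hp in E by trivial.
    apply Rmult_integral in E. assert (J := HF r Hr). destruct E as [E|E]; [lra|contradiction].
Qed.

Lemma least_period_two_pi (k : nat) (w : R -> R) : 0 < INR k -> periodic (2 * PI / INR k) w ->
  forall t, w (t + 2 * PI) = w t.
Proof.
  intros Hk [_ H] t. rewrite <- (periodic_mult _ w k H t). f_equal. f_equal. field. lra.
Qed.

(** * The homoclinic wave on the circle *)

Definition homoclinic_wave (q alpha t : R) : R := unit_amp q alpha * bump q (alpha * t).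

Lemma homoclinic_wave_osol (q alpha : R) : 0 < q < 1 -> 0 < alpha ->
  alpha_osol 1 q alpha (homoclinic_wave q alpha)
    (fun t => unit_amp q alpha * alpha * bump' q (alpha * t)).
Proof. intros Hq Ha. apply osol_scale; trivial; [lra|now apply osol_bump]. Qed.

Lemma homoclinic_wave_ge0 (q alpha t : R) : 0 < q < 1 -> 0 < alpha -> 0 <= homoclinic_wave q alpha t.
Proof.
  intros Hq Ha. apply Rmult_le_pos; [now apply Rlt_le, unit_amp_gt0|now apply bump_ge0].
Qed.

Lemma homoclinic_wave_orbit (q alpha t : R) : 0 < q < 1 -> 0 < alpha ->
  homoclinic_orbit q alpha (homoclinic_wave q alpha t) (Derive (homoclinic_wave q alpha) t).
Proof.
  intros Hq Ha. split; [now apply homoclinic_wave_ge0|].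
  rewrite (is_derive_unique _ t _ (proj1 (homoclinic_wave_osol q alpha Hq Ha t))).
  unfold homoclinic_wave. set (A := unit_amp q alpha). set (s := alpha * t).
  assert (E := energy_bump q s Hq). unfold energy in E.
  assert (EA : A ^ 2 * alpha ^ 2 = apow (1 + q) A).
  { unfold A. rewrite <- (apow_unit_amp q alpha) by (trivial; lra).
    rewrite <- apow_sq, <- apow_plus. f_equal; ring. }
  replace ((A * bump q s) ^ 2 * Rpower (Rabs (A * bump q s)) (q - 1)) with
    (apow (1 + q) (A * bump q s)) by (rewrite apow_S; unfold spow; ring).
  rewrite apow_mult, <- EA.
  replace ((A * alpha * bump' q s) ^ 2 + alpha ^ 2 * (A * bump q s) ^ 2) with
    (A ^ 2 * alpha ^ 2 * (bump' q s ^ 2 + bump q s ^ 2)) by ring.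
  replace (bump' q s ^ 2 + bump q s ^ 2) with (2 / (1 + q) * apow (1 + q) (bump q s)) by lra. ring.
Qed.

Lemma homoclinic_wave_once_vanishing (q alpha : R) : 0 < q < 1 -> 0 < alpha ->
  nonneg_once_vanishing_solution 1 q alpha (homoclinic_wave q alpha).
Proof.
  intros Hq Ha. assert (HA := unit_amp_gt0 q alpha Ha). assert (P := PI_RGT_0).
  assert (HL := loop_gt q Hq). split; [|split].
  - apply solution_O_iff. eexists. now apply homoclinic_wave_osol.
  - intros t. now apply homoclinic_wave_ge0.
  - exists (loop q / alpha). split.
    + split; [apply Rdiv_lt_0_compat; lra|]. intros t. unfold homoclinic_wave.
      replace (alpha * (t + loop q / alpha)) with (alpha * t + loop q) by (field; lra).
      now rewrite bump_periodic.
    + exists 0. split.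
      * split; [split; [lra|apply Rdiv_lt_0_compat; lra]|]. unfold homoclinic_wave.
        rewrite Rmult_0_r, bump_0. ring.
      * intros t [[Ht1 Ht2] E]. destruct Ht1 as [Ht1|Ht1]; trivial. exfalso.
        assert (B : 0 < bump q (alpha * t)).
        { apply bump_gt0; trivial. split; [nra|].
          apply (Rmult_lt_compat_l alpha) in Ht2; trivial.
          replace (alpha * (loop q / alpha)) with (loop q) in Ht2 by (field; lra). exact Ht2. }
        unfold homoclinic_wave in E. nra.
Qed.

Lemma once_vanishing_unique (q alpha : R) (w : R -> R) : 0 < q < 1 -> 0 < alpha ->
  nonneg_once_vanishing_solution 1 q alpha w -> translate_of (homoclinic_wave q alpha) w.
Proof.
  intros Hq Ha [Hs [Hnn [p [Hp [t0 [[Ht0 E0] Hun]]]]]]. apply solution_O_iff in Hs.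
  destruct Hs as [w1 Hw].
  destruct (osol_unscale 1 q alpha w w1 ltac:(lra) Ha Hw) as [x [x1 [Hx [E _]]]].
  assert (HA := unit_amp_gt0 q alpha Ha). set (A := unit_amp q alpha) in *.
  assert (HA' : 0 < / A) by now apply Rinv_0_lt_compat.
  destruct (once_vanishing_bump q (alpha * p) x x1 Hq Hx) as [tau Et].
  - intros t. rewrite (rescaled_inv A alpha t w x HA Ha E). apply Rmult_le_pos; [lra|apply Hnn].
  - now apply (periodic_rescaled A alpha p w x).
  - exists (alpha * t0). split.
    + split; [split; nra|]. rewrite E in E0. apply Rmult_integral in E0. destruct E0; lra.
    + intros s [Hs E1].
      assert (Es : t0 = s / alpha).
      { apply Hun. split.
        - split; [apply Rmult_le_reg_l with alpha|apply Rmult_lt_reg_l with alpha]; trivial;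
            replace (alpha * (s / alpha)) with s by (field; lra); lra.
        - rewrite E. replace (alpha * (s / alpha)) with s by (field; lra). rewrite E1. ring. }
      rewrite Es. field. lra.
  - exists (tau / alpha). intros t. rewrite E, Et. unfold homoclinic_wave. fold A.
    do 2 f_equal. field. lra.
Qed.

Lemma bump_nonzero_dense (q a b : R) : 0 < q < 1 -> a < b -> exists t, a < t < b /\ 0 < bump q t.
Proof.
  intros Hq Hab. assert (P := PI_RGT_0). assert (HL := loop_gt q Hq).
  set (m := (a + b) / 2).
  destruct (periodic_reduce (loop q) (bump q) m ltac:(lra) (fun t => bump_periodic q t Hq))
    as [r [Hr [_ [n En]]]].
  (* A step to the right of the midpoint, short enough to stay in the loop that contains it; it also
     leaves the zero if the midpoint is one. *)
  set (d := Rmin ((b - a) / 2) (loop q - r) / 2).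
  assert (D0 : 0 < Rmin ((b - a) / 2) (loop q - r)) by (apply Rmin_glb_lt; lra).
  assert (D1 : Rmin ((b - a) / 2) (loop q - r) <= (b - a) / 2) by apply Rmin_l.
  assert (D2 : Rmin ((b - a) / 2) (loop q - r) <= loop q - r) by apply Rmin_r.
  exists (m + d). split; [unfold m, d; lra|].
  rewrite <- (periodic_multZ (loop q) (bump q) n (fun t => bump_periodic q t Hq)).
  apply bump_gt0; trivial. replace (m + d + IZR n * loop q) with (r + d) by (rewrite En; ring).
  unfold d. lra.
Qed.

(** The condition on [n] says that [n] times the loop length is [2 PI alpha]: exactly [n] loops fit
    on the circle. *)
Lemma full_loops_wave (q alpha : R) (n : nat) (w w1 : R -> R) : 0 < q < 1 -> 0 < alpha ->
  (1 - q) * alpha = INR n -> alpha_osol 1 q alpha w w1 -> (forall t, w (t + 2 * PI) = w t) ->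
  (forall t, 0 <= w t) -> (exists t, w t = 0) -> ~ (forall s t, w s = w t) ->
  ((1 < n)%nat -> forall a b, a < b -> exists t, a < t < b /\ w t <> 0) ->
  exists tau, forall t, w t = homoclinic_wave q alpha (t + tau).
Proof.
  intros Hq Ha Hn Hw Hper Hnn [t0 E0] Hnc Hd. assert (P := PI_RGT_0).
  destruct (osol_unscale 1 q alpha w w1 ltac:(lra) Ha Hw) as [x [x1 [Hx [E _]]]].
  assert (HA := unit_amp_gt0 q alpha Ha). set (A := unit_amp q alpha) in *.
  assert (HA' : 0 < / A) by now apply Rinv_0_lt_compat.
  assert (Xnn : forall t, 0 <= x t).
  { intros t. rewrite (rescaled_inv A alpha t w x HA Ha E). apply Rmult_le_pos; [lra|apply Hnn]. }
  assert (EL : INR n * loop q = alpha * (2 * PI)) by (rewrite <- Hn; unfold loop; field; lra).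
  destruct (full_loops_bump q n x x1 (alpha * t0) Hq Hx Xnn) as [tau Et].
  - apply INR_lt. simpl. rewrite <- Hn. apply Rmult_lt_0_compat; lra.
  - rewrite EL. apply (periodic_rescaled A alpha _ w x HA Ha E). now apply two_pi_periodic.
  - rewrite E in E0. apply Rmult_integral in E0. destruct E0; lra.
  - exact (nonconstant_rescaled A alpha w x E Hnc).
  - intros H1 a b Hab. destruct (Hd H1 (a / alpha) (b / alpha)) as [t [Ht Nz]].
    { apply Rmult_lt_compat_r; trivial. now apply Rinv_0_lt_compat. }
    exists (alpha * t). split.
    + assert (Ea : a = alpha * (a / alpha)) by (field; lra).
      assert (Eb : b = alpha * (b / alpha)) by (field; lra).
      split; [rewrite Ea|rewrite Eb]; apply Rmult_lt_compat_l; lra.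
    + destruct (Xnn (alpha * t)) as [H|H]; trivial. exfalso. apply Nz. rewrite E, <- H. ring.
  - exists (tau / alpha). intros t. rewrite E, Et. unfold homoclinic_wave. fold A.
    do 2 f_equal. field. lra.
Qed.

Lemma setA_pos (eps q alpha : R) (k : nat) : 0 < q -> q <> 1 -> 0 < alpha ->
  setA eps q alpha k -> 0 < INR k.
Proof. intros Hq Hq1 Ha H. now apply setA_iff in H. Qed.

(** A sign changing solution through the origin needs two loops in one period, whereas the periods
    attached to [setA] stay strictly below two loops. *)
Lemma sc_periodic_regular (eps q alpha : R) (k : nat) (w w1 : R -> R) : 0 < q -> q <> 1 ->
  eps = 1 \/ eps = -1 -> 0 < alpha -> setA eps q alpha k -> alpha_osol eps q alpha w w1 ->
  least_period (2 * PI / INR k) w -> sign_changing_O w -> regular w w1.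
Proof.
  intros Hq Hq1 Heps Ha Hk Hw Hl Hs. apply Classical_Prop.NNPP. intros Hn.
  destruct (alpha_degenerate eps q alpha _ w w1 Hq Hq1 Heps Ha Hw (proj1 Hl) Hn
    (least_period_nonconstant _ _ Hl)) as [He [Hlt [_ H2]]].
  specialize (H2 Hs). apply setA_iff in Hk; trivial.
  destruct Hk as [_ [[He2 _]|[[_ [Hgt _]]|[_ [_ [_ H]]]]]]; [lra|lra|].
  unfold loop in H2. replace (4 * PI / (1 - q)) with (2 * (2 * PI / (1 - q))) in H by (field; lra). lra.
Qed.

Lemma polar_form_pseudo_radial (R1 : R) (R2 : Rbar) (F w : R -> R) (u : R -> R -> R) :
  (forall t, w (t + 2 * PI) = w t) -> polar_form R1 R2 u (fun r t => F r * w t) ->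
  pseudo_radial R1 R2 u.
Proof. intros H Hp. now exists F, w. Qed.

Lemma polar_form_ext (R1 : R) (R2 : Rbar) (u f g : R -> R -> R) :
  (forall r t, f r t = g r t) -> polar_form R1 R2 u f -> polar_form R1 R2 u g.
Proof. intros E H r t Hr. now rewrite <- E, H. Qed.

(** Selects one wave for every [k]. The uniqueness clause no longer speaks of regularity, which
    [sc_periodic_regular] supplies. *)
Lemma sc_waves (eps q alpha : R) : 0 < q -> q <> 1 -> eps = 1 \/ eps = -1 -> 0 < alpha ->
  exists w w1 : nat -> R -> R, forall k, setA eps q alpha k ->
    alpha_osol eps q alpha (w k) (w1 k) /\ least_period (2 * PI / INR k) (w k) /\
    sign_changing_O (w k) /\ regular (w k) (w1 k) /\
    forall v v1, alpha_osol eps q alpha v v1 -> least_period (2 * PI / INR k) v ->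
      sign_changing_O v -> exists s tau, (s = 1 \/ s = -1) /\ forall t, v t = s * w k (t + tau).
Proof.
  intros Hq Hq1 Heps Ha.
  destruct (IndefiniteDescription.functional_choice (fun k (p : (R -> R) * (R -> R)) =>
    setA eps q alpha k ->
    alpha_osol eps q alpha (fst p) (snd p) /\ least_period (2 * PI / INR k) (fst p) /\
    sign_changing_O (fst p) /\ regular (fst p) (snd p) /\
    forall v v1, alpha_osol eps q alpha v v1 -> least_period (2 * PI / INR k) v ->
      sign_changing_O v -> exists s tau, (s = 1 \/ s = -1) /\ forall t, v t = s * fst p (t + tau)))
    as [W HW].
  - intros k. destruct (Classical_Prop.classic (setA eps q alpha k)) as [Hk|Hk].
    + destruct (alpha_sc_family eps q alpha k Hq Hq1 Ha Hk) as [w [w1 [H1 [H2 [H3 [H4 H5]]]]]].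
      exists (w, w1). intros _. repeat (split; [assumption|]). intros v v1 Hv Vl Vs.
      apply (H5 v v1); trivial. now apply (sc_periodic_regular eps q alpha k).
    + exists (fun _ => 0, fun _ => 0). intros H. contradiction.
  - exists (fun k => fst (W k)), (fun k => snd (W k)). exact HW.
Qed.

Lemma pos_waves (q alpha : R) : 0 < q < 1 -> 0 < alpha ->
  exists w w1 : nat -> R -> R, forall k, setB q alpha k ->
    alpha_osol 1 q alpha (w k) (w1 k) /\ least_period (2 * PI / INR k) (w k) /\
    (forall t, 0 < w k t) /\
    forall v v1, alpha_osol 1 q alpha v v1 -> least_period (2 * PI / INR k) v ->
      (forall t, 0 < v t) -> exists tau, forall t, v t = w k (t + tau).
Proof.
  intros Hq Ha.
  destruct (IndefiniteDescription.functional_choice (fun k (p : (R -> R) * (R -> R)) =>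
    setB q alpha k ->
    alpha_osol 1 q alpha (fst p) (snd p) /\ least_period (2 * PI / INR k) (fst p) /\
    (forall t, 0 < fst p t) /\
    forall v v1, alpha_osol 1 q alpha v v1 -> least_period (2 * PI / INR k) v ->
      (forall t, 0 < v t) -> exists tau, forall t, v t = fst p (t + tau))) as [W HW].
  - intros k. destruct (Classical_Prop.classic (setB q alpha k)) as [Hk|Hk].
    + destruct (alpha_pos_family q alpha k Hq Ha Hk) as [w [w1 H]]. now exists (w, w1).
    + exists (fun _ => 0, fun _ => 0). intros H. contradiction.
  - exists (fun k => fst (W k)), (fun k => snd (W k)). exact HW.
Qed.

Theorem theorem3 (R1 : R) (R2 : Rbar) (eps q alpha M N : R)
  (hR1 : 0 <= R1) (hR2 : Rbar_lt R1 R2)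
  (heps : eps = 1 \/ eps = -1)
  (hq : 0 < q) (hq1 : q <> 1) (halpha : 0 < alpha)
  (hMN : forall r, in_range R1 R2 r -> 0 < weight alpha M N r) :
  (* 1 *)
  (eps = 1 -> alpha <= 1 ->
     forall u, solution_E R1 R2 eps q alpha M N u ->
       pseudo_radial R1 R2 u -> radial R1 R2 u)
  /\
  (* 2 *)
  (eps = -1 \/ 1 < alpha ->
     exists w : nat -> R -> R,
       (forall k, setA eps q alpha k ->
          sc_periodic_solution eps q alpha k (w k) /\
          forall w', sc_periodic_solution eps q alpha k w' ->
            translate_up_to_sign_of (w k) w') /\
       (forall u,
          (solution_E R1 R2 eps q alpha M N u /\
           pseudo_radial R1 R2 u /\ ~ radial R1 R2 u /\
           sign_changing_E R1 R2 u /\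
           (gluing_possible eps q alpha -> no_double_zero R1 R2 u))
          <->
          (exists (k : nat) (s tau : R),
             setA eps q alpha k /\ (s = 1 \/ s = -1) /\
             polar_form R1 R2 u
               (fun r theta => s * weight alpha M N r * w k (theta + tau)))))
  /\
  (* 3 *)
  (((exists u,
       solution_E R1 R2 eps q alpha M N u /\
       pseudo_radial R1 R2 u /\ ~ radial R1 R2 u /\ positive_E R1 R2 u)
    <-> (eps = 1 /\ q < 1 /\ exists k, setB q alpha k))
   /\
   (eps = 1 -> q < 1 ->
     exists v : nat -> R -> R,
       (forall k, setB q alpha k ->
          pos_periodic_solution eps q alpha k (v k) /\
          forall v', pos_periodic_solution eps q alpha k v' ->
            translate_of (v k) v') /\
       (forall u,
          (solution_E R1 R2 eps q alpha M N u /\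
           pseudo_radial R1 R2 u /\ ~ radial R1 R2 u /\ positive_E R1 R2 u)
          <->
          (exists (k : nat) (tau : R),
             setB q alpha k /\
             polar_form R1 R2 u
               (fun r theta => weight alpha M N r * v k (theta + tau))))))
  /\
  (* 4 *)
  (eps = 1 -> q < 1 -> (exists n : nat, (1 - q) * alpha = INR n) ->
     exists v : R -> R,
       (nonneg_once_vanishing_solution eps q alpha v /\
        (forall t, homoclinic_orbit q alpha (v t) (Derive v t)) /\
        forall v', nonneg_once_vanishing_solution eps q alpha v' ->
          translate_of v v') /\
       (forall u,
          (solution_E R1 R2 eps q alpha M N u /\
           pseudo_radial R1 R2 u /\ ~ radial R1 R2 u /\
           nonnegative_E R1 R2 u /\ vanishes_E R1 R2 u /\
           (gluing_possible eps q alpha -> no_dead_core R1 R2 u))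
          <->
          (exists tau : R,
             polar_form R1 R2 u
               (fun r theta => weight alpha M N r * v (theta + tau))))).
Proof.
  assert (HP := PI_RGT_0).
  assert (Red := fun u => reduction R1 R2 eps q alpha M N u hR1 heps hq hq1 hMN).
  split; [|split; [|split; [split|]]].
  - intros E Hle u Hs Hp. subst eps. apply Classical_Prop.NNPP. intros Hnr.
    destruct (Red u Hs Hp Hnr) as [w [w1 [Hper [Hw [Hnc _]]]]]. apply Hnc.
    apply (no_solution_small_alpha q alpha w w1); trivial. lra.
  - intros _. destruct (sc_waves eps q alpha hq hq1 heps halpha) as [w [w1 HW]].
    exists w. split.
    + intros k Hk. destruct (HW k Hk) as [Hw [Hl [Hs [_ Hu]]]]. split.
      * split; [|now split]. apply solution_O_iff. now exists (w1 k).
      * intros v [Hv [Vl Vs]]. apply solution_O_iff in Hv. destruct Hv as [v1 Hv].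
        destruct (Hu v v1 Hv Vl Vs) as [s [tau [[-> | ->] E]]]; [left|right]; exists tau;
          intros t; rewrite E; ring.
    + intros u. split.
      * intros [Hs [Hp [Hnr [Hsc Hg]]]].
        destruct (Red u Hs Hp Hnr) as [v [v1 [Hper [Hv [Hnc Hf]]]]].
        assert (Sv : sign_changing_O v).
        { destruct Hsc as [S1 S2]. split.
          - exact (proj1 (polar_form_exists_iff R1 R2 _ u v (fun z => 0 < z) hR1 hR2 hMN scale_gt0 Hf) S1).
          - exact (proj1 (polar_form_exists_iff R1 R2 _ u v (fun z => z < 0) hR1 hR2 hMN scale_lt0 Hf) S2). }
        (* If [v] met the phase origin, two loops would fit on the circle, that is
           [2 <= alpha (1 - q)]. This is the gluing case, in which double zeros are excluded by
           assumption. *)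
        assert (Rv : regular v v1).
        { apply Classical_Prop.NNPP. intros Hn.
          destruct (alpha_degenerate eps q alpha (2 * PI) v v1 hq hq1 heps halpha Hv
            (two_pi_periodic v Hper) Hn Hnc) as [He [Hlt [_ H2]]].
          apply Hn. apply (no_double_zero_iff R1 R2 eps q alpha M N u v v1); trivial.
          apply Hg. split; [trivial|split; [trivial|]].
          specialize (H2 Sv). apply (Rmult_le_compat_r ((1 - q) / (2 * PI))) in H2.
          - unfold loop in H2.
            replace (2 * (2 * PI / (1 - q)) * ((1 - q) / (2 * PI))) with 2 in H2 by (field; lra).
            replace (alpha * (2 * PI) * ((1 - q) / (2 * PI))) with (alpha * (1 - q)) in H2
              by (field; lra). exact H2.
          - apply Rlt_le, Rdiv_lt_0_compat; lra. }
        destruct (alpha_sc_periods eps q alpha v v1 hq hq1 heps halpha Hv Hper Sv Rv) as [k [Hk Vl]].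
        destruct (HW k Hk) as [_ [_ [_ [_ Hu]]]].
        destruct (Hu v v1 Hv Vl Sv) as [s [tau [Hs1 E]]].
        exists k, s, tau. split; [trivial|split; [trivial|]].
        apply (polar_form_ext R1 R2 u (fun r t => weight alpha M N r * v t)); trivial.
        intros r t. rewrite E. ring.
      * intros [k [s [tau [Hk [Hs Hf]]]]]. destruct (HW k Hk) as [Hw [Hl [Hsc [Hn _]]]].
        assert (s0 : s <> 0) by (destruct Hs as [-> | ->]; lra).
        assert (Kp := setA_pos eps q alpha k hq hq1 halpha Hk).
        set (v := fun t => s * w k (t + tau)). set (v1 := fun t => s * w1 k (t + tau)).
        assert (Hf' : polar_form R1 R2 u (fun r t => weight alpha M N r * v t)).
        { revert Hf. apply polar_form_ext. intros r t. unfold v. ring. }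
        assert (Hv : alpha_osol eps q alpha v v1) by now apply alpha_osol_shift_sign.
        assert (Vl : least_period (2 * PI / INR k) v) by now apply least_period_shift_sign.
        assert (Vper := least_period_two_pi k v Kp (proj1 Vl)).
        assert (Vn : regular v v1).
        { intros t [Z0 Z1]. apply (Hn (t + tau)).
          split; apply (Rmult_eq_reg_l s); trivial; rewrite Rmult_0_r; assumption. }
        split; [now apply (polar_form_solution R1 R2 eps q alpha M N u v v1)|].
        split; [now apply (polar_form_pseudo_radial R1 R2 (weight alpha M N) v)|].
        split; [|split].
        -- intros Hr. apply (least_period_nonconstant _ _ Vl).
           now apply (radial_iff R1 R2 (weight alpha M N) u v).
        -- destruct Hsc as [[a Ha] [b Hb]].
           assert (V1 : exists t, 0 < v t).
           { destruct Hs as [E|E]; [exists (a - tau)|exists (b - tau)]; unfold v; rewrite E.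
             - replace (a - tau + tau) with a by ring. lra.
             - replace (b - tau + tau) with b by ring. lra. }
           assert (V2 : exists t, v t < 0).
           { destruct Hs as [E|E]; [exists (b - tau)|exists (a - tau)]; unfold v; rewrite E.
             - replace (b - tau + tau) with b by ring. lra.
             - replace (a - tau + tau) with a by ring. lra. }
           split.
           ++ exact (proj2 (polar_form_exists_iff R1 R2 _ u v (fun z => 0 < z) hR1 hR2 hMN scale_gt0 Hf') V1).
           ++ exact (proj2 (polar_form_exists_iff R1 R2 _ u v (fun z => z < 0) hR1 hR2 hMN scale_lt0 Hf') V2).
        -- intros _. now apply (no_double_zero_iff R1 R2 eps q alpha M N u v v1).
  - split.
    + intros [u [Hs [Hp [Hnr Hpos]]]].
      destruct (Red u Hs Hp Hnr) as [v [v1 [Hper [Hv [Hnc Hf]]]]].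
      assert (Vp : forall t, 0 < v t).
      { exact (proj1 (polar_form_forall_iff R1 R2 _ u v (fun z => 0 < z) hR1 hR2 hMN scale_gt0 Hf) Hpos). }
      destruct (alpha_pos_periods eps q alpha v v1 hq hq1 heps halpha Hv Hper Vp Hnc)
        as [He [Hlt [k [Hk _]]]].
      split; [trivial|split; [trivial|now exists k]].
    + intros [He [Hlt [k Hk]]]. assert (Hq : 0 < q < 1) by lra. subst eps.
      destruct (alpha_pos_family q alpha k Hq halpha Hk) as [v [v1 [Hv [Vl [Vp _]]]]].
      assert (Kp : 0 < INR k) by now apply setB_iff in Hk.
      assert (Vper := least_period_two_pi k v Kp (proj1 Vl)).
      destruct (polar_function (weight alpha M N) v Vper) as [u Hu]. specialize (Hu R1 R2 hR1).
      exists u.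
      split; [now apply (polar_form_solution R1 R2 1 q alpha M N u v v1)|].
      split; [now apply (polar_form_pseudo_radial R1 R2 (weight alpha M N) v)|].
      split.
      * intros Hr. apply (least_period_nonconstant _ _ Vl).
        now apply (radial_iff R1 R2 (weight alpha M N) u v).
      * exact (proj2 (polar_form_forall_iff R1 R2 _ u v (fun z => 0 < z) hR1 hR2 hMN scale_gt0 Hu) Vp).
  - intros He Hlt. assert (Hq : 0 < q < 1) by lra. subst eps.
    destruct (pos_waves q alpha Hq halpha) as [w [w1 HW]]. exists w. split.
    + intros k Hk. destruct (HW k Hk) as [Hw [Hl [Hpos Hu]]]. split.
      * split; [|now split]. apply solution_O_iff. now exists (w1 k).
      * intros v [Hv [Vl Vp]]. apply solution_O_iff in Hv. destruct Hv as [v1 Hv].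
        exact (Hu v v1 Hv Vl Vp).
    + intros u. split.
      * intros [Hs [Hp [Hnr Hpos]]].
        destruct (Red u Hs Hp Hnr) as [v [v1 [Hper [Hv [Hnc Hf]]]]].
        assert (Vp : forall t, 0 < v t).
        { exact (proj1 (polar_form_forall_iff R1 R2 _ u v (fun z => 0 < z) hR1 hR2 hMN scale_gt0 Hf) Hpos). }
        destruct (alpha_pos_periods 1 q alpha v v1 hq hq1 heps halpha Hv Hper Vp Hnc)
          as [_ [_ [k [Hk Vl]]]].
        destruct (HW k Hk) as [_ [_ [_ Hu]]]. destruct (Hu v v1 Hv Vl Vp) as [tau E].
        exists k, tau. split; [trivial|].
        apply (polar_form_ext R1 R2 u (fun r t => weight alpha M N r * v t)); trivial.
        intros r t. now rewrite E.
      * intros [k [tau [Hk Hf]]]. destruct (HW k Hk) as [Hw [Hl [Hpos _]]].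
        set (v := fun t => w k (t + tau)). set (v1 := fun t => w1 k (t + tau)).
        assert (Kp : 0 < INR k) by now apply setB_iff in Hk.
        change (polar_form R1 R2 u (fun r t => weight alpha M N r * v t)) in Hf.
        assert (Hv : alpha_osol 1 q alpha v v1) by now apply alpha_osol_shift.
        assert (Vl : least_period (2 * PI / INR k) v) by now apply least_period_shift.
        assert (Vper := least_period_two_pi k v Kp (proj1 Vl)).
        split; [now apply (polar_form_solution R1 R2 1 q alpha M N u v v1)|].
        split; [now apply (polar_form_pseudo_radial R1 R2 (weight alpha M N) v)|].
        split.
        -- intros Hr. apply (least_period_nonconstant _ _ Vl).
           now apply (radial_iff R1 R2 (weight alpha M N) u v).
        -- refine (proj2 (polar_form_forall_iff R1 R2 _ u v (fun z => 0 < z) hR1 hR2 hMN scale_gt0 Hf) _).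
           intros t. apply Hpos.
  - intros He Hlt [n Hn]. assert (Hq : 0 < q < 1) by lra. subst eps.
    assert (n0 : 0 < INR n) by (rewrite <- Hn; apply Rmult_lt_0_compat; lra).
    exists (homoclinic_wave q alpha). split; [split; [|split]|].
    + now apply homoclinic_wave_once_vanishing.
    + intros t. now apply homoclinic_wave_orbit.
    + intros v Hv. now apply once_vanishing_unique.
    + intros u. split.
      * intros [Hs [Hp [Hnr [Hnn [Hz Hg]]]]].
        destruct (Red u Hs Hp Hnr) as [v [v1 [Hper [Hv [Hnc Hf]]]]].
        destruct (full_loops_wave q alpha n v v1 Hq halpha Hn Hv Hper) as [tau E]; trivial.
        -- exact (proj1 (polar_form_forall_iff R1 R2 _ u v (fun z => 0 <= z) hR1 hR2 hMN scale_ge0 Hf) Hnn).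
        -- exact (proj1 (polar_form_exists_iff R1 R2 _ u v (fun z => z = 0) hR1 hR2 hMN scale_eq0 Hf) Hz).
        (* With at least two loops on the circle gluing is possible, and the absence of dead cores
           makes the nonzero set of [v] dense. *)
        -- intros H1. apply (no_dead_core_iff R1 R2 (weight alpha M N) u v); trivial.
           apply Hg. split; [trivial|split; [trivial|]]. rewrite Rmult_comm, Hn.
           apply (le_INR 2). lia.
        -- exists tau.
           apply (polar_form_ext R1 R2 u (fun r t => weight alpha M N r * v t)); trivial.
           intros r t. now rewrite E.
      * intros [tau Hf]. set (v := fun t => homoclinic_wave q alpha (t + tau)).
        change (polar_form R1 R2 u (fun r t => weight alpha M N r * v t)) in Hf.
        assert (Hv := alpha_osol_shift 1 q alpha tau _ _ (homoclinic_wave_osol q alpha Hq halpha)).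
        assert (HA := unit_amp_gt0 q alpha halpha).
        (* After scaling by [alpha], the angle [2 PI] is [n] loop lengths; this is where the
           integrality of [(1 - q) alpha] enters. *)
        assert (Vper : forall t, v (t + 2 * PI) = v t).
        { intros t. unfold v, homoclinic_wave. f_equal.
          rewrite <- (periodic_mult (loop q) (bump q) n (fun s => bump_periodic q s Hq)
                       (alpha * (t + tau))).
          f_equal. rewrite <- Hn. unfold loop. field. lra. }
        assert (Vd : forall a b, a < b -> exists t, a < t < b /\ v t <> 0).
        { intros a b Hab.
          destruct (bump_nonzero_dense q (alpha * (a + tau)) (alpha * (b + tau)) Hq) as [s [Hs Ps]].
          - apply Rmult_lt_compat_l; lra.
          - exists (s / alpha - tau). split.
            + assert (Es : s = alpha * (s / alpha)) by (field; lra). rewrite Es in Hs.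
              destruct Hs as [S1 S2]. apply Rmult_lt_reg_l in S1; trivial.
              apply Rmult_lt_reg_l in S2; trivial. lra.
            + unfold v, homoclinic_wave.
              replace (alpha * (s / alpha - tau + tau)) with s by (field; lra). nra. }
        assert (V0 : v (- tau) = 0).
        { unfold v, homoclinic_wave. rewrite Rplus_opp_l, Rmult_0_r, bump_0. ring. }
        split; [exact (polar_form_solution R1 R2 1 q alpha M N u v _ hR1 hq hMN Hv Hf)|].
        split; [now apply (polar_form_pseudo_radial R1 R2 (weight alpha M N) v)|].
        split; [|split; [|split]].
        -- intros Hr.
           assert (Hc := proj1 (radial_iff R1 R2 (weight alpha M N) u v hR2 hMN Hf) Hr).
           destruct (Vd 0 1 Rlt_0_1) as [t [_ Nz]]. apply Nz. rewrite <- V0. apply Hc.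
        -- refine (proj2 (polar_form_forall_iff R1 R2 _ u v (fun z => 0 <= z) hR1 hR2 hMN scale_ge0 Hf) _).
           intros t. now apply homoclinic_wave_ge0.
        -- refine (proj2 (polar_form_exists_iff R1 R2 _ u v (fun z => z = 0) hR1 hR2 hMN scale_eq0 Hf) _).
           now exists (- tau).
        -- intros _. now apply (no_dead_core_iff R1 R2 (weight alpha M N) u v).
Qed.
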